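(* Let $n\ge 5$, let $M=\mathrm{Pic}(\overline{\mathcal M}_{0,n})$, let $N\subset M$ be the subgroup generated by the classes of the boundary divisors $D_I$ with $|I|,|I^c|\neq 2$, and let $Q=M/N$. (a) Let $G\subseteq\mathfrak{S}_n$ be a subgroup such that $Q$ is a stably permutation $G$-module. Then the $G$-action on $\overline{\mathcal M}_{0,n}$ is stably linearizable. (b) Let $X$ be a form of $\overline{\mathcal M}_{0,n}$ over a field $F$ such that the action of the absolute Galois group of $F$ on $Q$ gives rise to a stably permutation module. Then $X$ is stably rational over $F$.
   Context: $\overline{\mathcal M}_{0,n}$ is the moduli space of stable $n$-pointed curves of genus zero; $\mathfrak{S}_n$ acts on it by permuting the marked points. Its boundary divisors $D_I=D_{I^c}$ are indexed by partitions $\{1,\dots,n\}=I\sqcup I^c$ with $|I|,|I^c|\ge 2$, and $\mathfrak{S}_n$ permutes them via the indices; thus $M$, $N$, $Q$ are $\mathfrak{S}_n$-modules. Equivalently, $Q$ is the divisor class group $\mathrm{Cl}(X_n)$ of the $\mathfrak{S}_n$-symmetrically linearized GIT quotient $X_n=(\mathbb{P}^1)^n/\!/\mathrm{SL}_2$, and is isomorphic to the index-two submodule $\{\sum a_ig_i:\ \sum a_i\equiv 0 \bmod 2\}$ of the permutation module $\bigoplus_{i=1}^n\mathbb{Z}g_i$, with the class of $D_{ij}$ mapping to $g_i+g_j$. For $n\ge5$, $\mathrm{Aut}(\overline{\mathcal M}_{0,n})=\mathfrak{S}_n$; a form $X$ of $\overline{\mathcal M}_{0,n}$ over $F$ (an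 $F$-variety isomorphic to $\overline{\mathcal M}_{0,n}$ over an algebraic closure of $F$) is therefore a twist by a homomorphism from the absolute Galois group to $\mathfrak{S}_n$, through which the Galois group acts on $M$, $N$, $Q$. A $G$-module (free of finite rank over $\mathbb{Z}$) is a permutation module if it has a $\mathbb{Z}$-basis permuted by $G$; it is stably permutation if its direct sum with some permutation module is a permutation module. A generically free regular action of a finite group $G$ on a projective variety $X$ is linearizable if $X$ is $G$-equivariantly birational to $\mathbb{P}(V)$ for a linear representation $V$ of $G$; it is stably linearizable if $X\times\mathbb{P}^r$, with trivial action on the second factor, is linearizable for some $r$. *)

(* Defs.v *)
(* Classical projective geometry: a variety is the set of its points over an
   algebraically closed field, inside a product of projective spaces. *)
From HB Require Import structures.
From mathcomp Require Import all_boot all_order all_algebra all_fingroup.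
From mathcomp Require Import mxrepresentation separable.
From mathcomp Require Import boolp.
From mathcomp.multinomials Require Import freeg mpoly.

Set Implicit Arguments.
Unset Strict Implicit.
Unset Printing Implicit Defensive.

Import GRing.Theory.
Local Open Scope ring_scope.

(* MathComp's convention (s * t) x = t (s x) makes every action below a right
   action. *)
Section Modules.
Variable Gam : groupType.

Definition is_Gmodule (L : zmodType) (act : Gam -> L -> L) : Prop :=
  [/\ forall x, act 1%g x = x,
      forall g h x, act (g * h)%g x = act h (act g x) &
      forall g x y, act g (x + y) = act g x + act g y].

Definition is_permutation_module (L : zmodType) (act : Gam -> L -> L) : Prop :=
  is_Gmodule act /\
  exists (m : nat) (e : 'I_m -> L),
    (forall x, exists! c : {ffun 'I_m -> int}, x = \sum_i e i *~ c i) /\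
    (forall g i, exists j, act g (e i) = e j).

Definition dsum_act (L P : zmodType) (actL : Gam -> L -> L)
    (actP : Gam -> P -> P) (g : Gam) (x : L * P) : L * P :=
  (actL g x.1, actP g x.2).

Definition is_stably_permutation_module (L : zmodType) (act : Gam -> L -> L)
    : Prop :=
  exists (P : zmodType) (actP : Gam -> P -> P),
    is_permutation_module actP /\ is_permutation_module (dsum_act act actP).
End Modules.

Inductive subgroup_gen (A : zmodType) (S : A -> Prop) : A -> Prop :=
| Sgen0 : subgroup_gen S 0
| SgenI x : S x -> subgroup_gen S x
| SgenB x y : subgroup_gen S x -> subgroup_gen S y -> subgroup_gen S (x - y).

Section Quotient.
Variables (A : zmodType) (S : A -> Prop).

Definition qrel (x y : A) : bool := `[< subgroup_gen S (x - y) >].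

Lemma SgenN x : subgroup_gen S x -> subgroup_gen S (- x).
Proof. by move=> Sx; rewrite -sub0r; apply: SgenB => //; apply: Sgen0. Qed.

Lemma SgenD x y :
  subgroup_gen S x -> subgroup_gen S y -> subgroup_gen S (x + y).
Proof. by move=> Sx /SgenN Sy; rewrite -[y]opprK; apply: SgenB. Qed.

Lemma qrel_refl : reflexive qrel.
Proof. by move=> x; apply/asboolP; rewrite subrr; apply: Sgen0. Qed.

Lemma qrel_sym : ssrbool.symmetric qrel.
Proof.
by move=> x y; apply/idP/idP => /asboolP/SgenN; rewrite opprB => ?; apply/asboolP.
Qed.

Lemma qrel_trans : transitive qrel.
Proof.
move=> y x z /asboolP Sxy /asboolP Syz; apply/asboolP.
by rewrite -[x - z](subrKA y); apply: SgenD.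
Qed.

Canonical qrel_equiv := EquivRel qrel qrel_refl qrel_sym qrel_trans.

Definition zquot : Type := {eq_quot qrel_equiv}%qT.
HB.instance Definition _ := Choice.on zquot.
HB.instance Definition _ : EqQuotient A qrel_equiv zquot := EqQuotient.on zquot.

Definition zproj (x : A) : zquot := \pi_zquot%qT x.

Lemma zproj_eq x y : (zproj x = zproj y) <-> subgroup_gen S (x - y).
Proof.
split=> [/eqmodP /asboolP //|Sxy]; apply/eqmodP; exact/asboolP.
Qed.

Local Notation qrepr := generic_quotient.repr.

Lemma zprojK (q : zquot) : zproj (qrepr q) = q.
Proof. exact: reprK. Qed.

Definition zq_add (p q : zquot) : zquot := zproj (qrepr p + qrepr q).
Definition zq_opp (p : zquot) : zquot := zproj (- qrepr p).

Lemma repr_zproj x : subgroup_gen S (qrepr (zproj x) - x).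
Proof. by apply/zproj_eq; rewrite zprojK. Qed.

Lemma zq_addE x y : zq_add (zproj x) (zproj y) = zproj (x + y).
Proof.
by apply/zproj_eq; rewrite opprD addrACA; apply: SgenD; apply: repr_zproj.
Qed.

Lemma zq_oppE x : zq_opp (zproj x) = zproj (- x).
Proof. by apply/zproj_eq; rewrite -opprD; apply/SgenN/repr_zproj. Qed.

Lemma zq_addA : associative zq_add.
Proof.
by move=> p q r; rewrite -(zprojK p) -(zprojK q) -(zprojK r) !zq_addE addrA.
Qed.
Lemma zq_addC : commutative zq_add.
Proof. by move=> p q; rewrite -(zprojK p) -(zprojK q) !zq_addE addrC. Qed.
Lemma zq_add0 : left_id (zproj 0) zq_add.
Proof. by move=> p; rewrite -(zprojK p) zq_addE add0r. Qed.
Lemma zq_addN : left_inverse (zproj 0) zq_opp zq_add.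
Proof. by move=> p; rewrite -(zprojK p) zq_oppE zq_addE addNr. Qed.

HB.instance Definition _ :=
  GRing.isZmodule.Build zquot zq_addA zq_addC zq_add0 zq_addN.

(* Meaningful only when f is additive and preserves <S>. *)
Definition zquot_map (f : A -> A) (q : zquot) : zquot := zproj (f (qrepr q)).
End Quotient.

(* An ambient space is a product, over the finite type [mfac], of projective
   spaces; [mvar] is the set of all homogeneous coordinates, and [blk] sends a
   coordinate to the factor it belongs to. *)
Record mproj := MProj { mvar : finType; mfac : finType; blk : mvar -> mfac }.

Definition Pspace (d : nat) : mproj :=
  @MProj 'I_d unit (fun _ => tt).

Definition prodamb (A B : mproj) : mproj :=
  @MProj (mvar A + mvar B)%type (mfac A + mfac B)%type
    (fun v => match v with inl a => inl (blk a) | inr b => inr (blk b) end).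

Section Geometry.
Variable K : closedFieldType.

(* A point is given by a vector of homogeneous coordinates, vectors related by
   [same_pt] giving the same point.  Every subset considered is stable under
   [same_pt]. *)
Definition pts (A : mproj) := mvar A -> K.
Definition subpts (A : mproj) := pts A -> Prop.

Definition is_point (A : mproj) : subpts A :=
  fun x => forall i, exists v, blk v = i /\ x v != 0.

Definition rescale (A : mproj) (l : mfac A -> K) (x : pts A) : pts A :=
  fun v => l (blk v) * x v.

Definition same_pt (A : mproj) (x y : pts A) : Prop :=
  exists l : mfac A -> K, (forall i, l i != 0) /\ y = rescale l x.

Definition mpol (A : mproj) := {mpoly K[#|mvar A|]}.
Definition peval (A : mproj) (p : mpol A) (x : pts A) : K :=
  p.@[fun i => x (enum_val i)].

(* p is multihomogeneous of multidegree d; K being infinite, this can be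
   expressed through the values of p. *)
Definition multihomog (A : mproj) (d : mfac A -> nat) (p : mpol A) : Prop :=
  forall (l : mfac A -> K) (x : pts A),
    peval p (rescale l x) = (\prod_i l i ^+ d i) * peval p x.

Definition vanish (A : mproj) (Z : subpts A) (p : mpol A) : Prop :=
  forall x, Z x -> peval p x = 0.

Definition subpt (A : mproj) (Z Y : subpts A) : Prop := forall x, Z x -> Y x.

Definition closed_set (A : mproj) (Z : subpts A) : Prop :=
  exists E : mpol A -> Prop,
    (forall p, E p -> exists d, multihomog d p) /\
    (forall x, Z x <-> is_point x /\ forall p, E p -> peval p x = 0).

Definition irreducible_set (A : mproj) (Z : subpts A) : Prop :=
  (exists x, Z x) /\
  forall Y1 Y2 : subpts A, closed_set Y1 -> closed_set Y2 ->
    (forall x, Z x -> Y1 x \/ Y2 x) -> subpt Z Y1 \/ subpt Z Y2.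

Definition closed_variety (A : mproj) (X : subpts A) : Prop :=
  closed_set X /\ irreducible_set X.

Definition zclosure (A : mproj) (S : subpts A) : subpts A :=
  fun x => is_point x /\
    forall d p, multihomog d p -> vanish S p -> peval p x = 0.

Definition whole (d : nat) : subpts (Pspace d) := @is_point (Pspace d).

Definition prodset (A B : mproj) (X : subpts A) (Y : subpts B)
    : subpts (prodamb A B) :=
  fun z => X (fun v => z (inl v)) /\ Y (fun v => z (inr v)).

(* In the following, [C] is a set of allowed coefficients: a subfield of K. *)
Definition coefs_in (C : K -> Prop) (A : mproj) (p : mpol A) : Prop :=
  forall m, C p@_m.

Definition form_tuple (A B : mproj) := mvar B -> mpol A.

Definition is_form_tuple (C : K -> Prop) (A B : mproj) (q : form_tuple A B)
    : Prop :=
  (forall w, coefs_in C (q w)) /\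
  (forall j, exists d, forall w, blk w = j -> multihomog d (q w)).

Definition teval (A B : mproj) (q : form_tuple A B) (x : pts A) : pts B :=
  fun w => peval (q w) x.

Definition is_morphism (C : K -> Prop) (A B : mproj) (X : subpts A)
    (Y : subpts B) (f : pts A -> pts B) : Prop :=
  (forall x, X x -> Y (f x)) /\
  (forall x, X x -> exists q : form_tuple A B,
     [/\ is_form_tuple C q, is_point (teval q x) &
         forall y, X y -> is_point (teval q y) -> same_pt (teval q y) (f y)]).

Definition is_isomorphism (C : K -> Prop) (A B : mproj) (X : subpts A)
    (Y : subpts B) (f : pts A -> pts B) : Prop :=
  is_morphism C X Y f /\
  exists g : pts B -> pts A,
    [/\ is_morphism C Y X g,
        forall x, X x -> same_pt (g (f x)) x &
        forall y, Y y -> same_pt (f (g y)) y].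

(* The nonempty open subset of X where the form h does not vanish is mapped
   isomorphically by q onto the one of Y where h' does not vanish, with
   inverse q'.  On irreducible X and Y a rational map is given by a single
   tuple of forms, and any isomorphism between nonempty open subsets restricts
   to one of this shape. *)
Definition is_birational_map (C : K -> Prop) (A B : mproj) (X : subpts A)
    (Y : subpts B) (q : form_tuple A B) (h : mpol A)
    (q' : form_tuple B A) (h' : mpol B) : Prop :=
  [/\ is_form_tuple C q /\ is_form_tuple C q',
      [/\ coefs_in C h, exists d, multihomog d h & ~ vanish X h],
      [/\ coefs_in C h', exists d, multihomog d h' & ~ vanish Y h'],
      forall x, X x -> peval h x != 0 ->
        [/\ Y (teval q x), peval h' (teval q x) != 0 &
            same_pt (teval q' (teval q x)) x] &
      forall y, Y y -> peval h' y != 0 ->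
        [/\ X (teval q' y), peval h (teval q' y) != 0 &
            same_pt (teval q (teval q' y)) y]].

Definition is_birational (C : K -> Prop) (A B : mproj) (X : subpts A)
    (Y : subpts B) : Prop :=
  exists q h q' h', is_birational_map C X Y q h q' h'.

Definition rep_act (gT : finGroupType) (G : {group gT}) (d : nat)
    (rV : mx_representation K G d) (g : gT) (x : pts (Pspace d))
    : pts (Pspace d) :=
  fun j => ((\row_i x i) *m rV g) 0 j.

Definition linearizable (gT : finGroupType) (G : {group gT}) (A : mproj)
    (X : subpts A) (act : gT -> pts A -> pts A) : Prop :=
  exists (d : nat) (rV : mx_representation K G d) (q : form_tuple A (Pspace d))
         (h : mpol A) (q' : form_tuple (Pspace d) A) (h' : mpol (Pspace d)),
    is_birational_map (fun _ => True) X (@whole d) q h q' h' /\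
    forall g x, g \in G -> X x -> peval h x != 0 -> peval h (act g x) != 0 ->
      same_pt (teval q (act g x)) (rep_act rV g (teval q x)).

Definition act_left (A B : mproj) (f : pts A -> pts A) (z : pts (prodamb A B))
    : pts (prodamb A B) :=
  fun w => match w with
           | inl v => f (fun v' => z (inl v')) v
           | inr v => z (inr v)
           end.

Definition stably_linearizable (gT : finGroupType) (G : {group gT})
    (A : mproj) (X : subpts A) (act : gT -> pts A -> pts A) : Prop :=
  exists r : nat,
    linearizable G (prodset X (@whole r.+1))
      (fun g => @act_left A (Pspace r.+1) (act g)).

Definition prime_divisor (A : mproj) (X Z : subpts A) : Prop :=
  [/\ closed_variety Z, subpt Z X, ~ subpt X Z &
      forall Y : subpts A, closed_variety Y -> subpt Z Y -> subpt Y X ->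
        subpt Y Z \/ subpt X Y].

Definition prime_div (A : mproj) (X : subpts A) :=
  {classic {Z : subpts A | prime_divisor X Z}}.

Definition Div (A : mproj) (X : subpts A) := {freeg prime_div X}.

(* a / b lies in the local ring of X along the prime divisor Z. *)
Definition in_local_ring (A : mproj) (Z : subpts A) (a b : mpol A) : Prop :=
  (exists d, multihomog d a /\ multihomog d b) /\ ~ vanish Z b.

(* a / b generates the maximal ideal of the local ring of X along Z. *)
Definition uniformizer (A : mproj) (X Z : subpts A) (a b : mpol A) : Prop :=
  [/\ in_local_ring Z a b, vanish Z a &
      forall a' b', in_local_ring Z a' b' -> vanish Z a' ->
        exists c e, in_local_ring Z c e /\
          vanish X (a' * b * e - a * c * b')].

(* The rational function p / q on X has order m along Z, that is
   p / q = (a / b) ^ m * (c / e) with a / b a uniformizer and c / e a unit. *)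
Definition has_order (A : mproj) (X Z : subpts A) (p q : mpol A) (m : int)
    : Prop :=
  exists a b c e (i j : nat),
    [/\ uniformizer X Z a b, in_local_ring Z c e /\ ~ vanish Z c,
        m = i%:Z - j%:Z &
        vanish X (p * b ^+ i * a ^+ j * e - q * a ^+ i * b ^+ j * c)].

Definition principal (A : mproj) (X : subpts A) (D : Div X) : Prop :=
  exists p q : mpol A,
    [/\ exists d, multihomog d p /\ multihomog d q, ~ vanish X p, ~ vanish X q &
        forall Z : prime_div X, has_order X (sval Z) p q (coeff Z D)].

Definition Cl (A : mproj) (X : subpts A) : zmodType :=
  zquot (@principal A X).

Definition cl (A : mproj) (X : subpts A) (D : Div X) : Cl X :=
  zproj (@principal A X) D.

Definition reindex (A : mproj) (pi : mvar A -> mvar A) (x : pts A) : pts A :=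
  fun v => x (pi v).

Section Reindex.
Variables (A : mproj) (pi pi' : mvar A -> mvar A) (pf pf' : mfac A -> mfac A).
Hypothesis piK : cancel pi pi'.
Hypothesis pi'K : cancel pi' pi.
Hypothesis pfK : cancel pf pf'.
Hypothesis blk_pi : forall v, blk (pi v) = pf (blk v).

Lemma reindexK : cancel (@reindex A pi) (reindex pi').
Proof. by move=> x; apply/funext => v; rewrite /reindex pi'K. Qed.

Lemma reindex_multihomog (d : mfac A -> nat) (p : mpol A) : multihomog d p ->
  exists d' p', multihomog d' p' /\ forall x, peval p' x = peval p (reindex pi x).
Proof.
move=> hp.
pose p' : mpol A :=
  p \mPo [tuple 'X_(enum_rank (pi (enum_val i))) | i < #|mvar A|].
have p'E x : peval p' x = peval p (reindex pi x).
  rewrite /peval comp_mpoly_meval; apply: meval_eq => i /=.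
  by rewrite tnth_mktuple mevalXU enum_rankK.
exists (fun j => d (pf' j)), p'; split=> // l x; rewrite !p'E.
have -> : reindex pi (rescale l x) =
          rescale (fun i => l (pf i)) (reindex pi x).
  by apply/funext => v; rewrite /reindex /rescale blk_pi.
rewrite hp; congr (_ * _).
rewrite [RHS](reindex_inj (can_inj pfK)).
by apply: eq_bigr => i _; rewrite pfK.
Qed.

Lemma reindex_is_point (x : pts A) : is_point x <-> is_point (reindex pi x).
Proof.
split=> hx i.
  have [v [bv xv]] := hx (pf i); exists (pi' v).
  rewrite /reindex pi'K; split=> //; apply: (can_inj pfK).
  by rewrite -blk_pi pi'K.
have pf_bij : bijective pf by apply: injF_bij; apply: can_inj pfK.
have [g _ gK] := pf_bij.
have [v [bv xv]] := hx (g i); exists (pi v); split=> //.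
by rewrite blk_pi bv gK.
Qed.

Lemma reindex_closed (Z : subpts A) :
  closed_set Z -> closed_set (fun x => Z (reindex pi x)).
Proof.
case=> E [hE EZ].
exists (fun p' => (exists d, multihomog d p') /\
  exists2 p, E p & forall x, peval p' x = peval p (reindex pi x)).
split=> [p' [] //|x]; rewrite EZ -reindex_is_point; split=> -[xpt hx]; split=> //.
  by move=> p' [_ [p Ep ->]]; apply: hx.
move=> p Ep; have [d hp] := hE p Ep.
have [d' [p' [hp' p'E]]] := reindex_multihomog hp.
by rewrite -p'E; apply: hx; split; [exists d' | exists p].
Qed.
End Reindex.

Section ReindexPrime.
Variables (A : mproj) (pi pi' : mvar A -> mvar A) (pf pf' : mfac A -> mfac A).
Hypothesis piK : cancel pi pi'.
Hypothesis pi'K : cancel pi' pi.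
Hypothesis pfK : cancel pf pf'.
Hypothesis pf'K : cancel pf' pf.
Hypothesis blk_pi : forall v, blk (pi v) = pf (blk v).

Let blk_pi' v : blk (pi' v) = pf' (blk v).
Proof. by rewrite -[in RHS](pi'K v) blk_pi pfK. Qed.

Let reK : cancel (@reindex A pi) (reindex pi') := reindexK pi'K.
Let re'K : cancel (@reindex A pi') (reindex pi) := reindexK piK.

Lemma reindex_variety (Z : subpts A) :
  closed_variety Z -> closed_variety (fun x => Z (reindex pi x)).
Proof.
case=> clZ [[z Zz] irrZ]; split; first exact: (reindex_closed pi'K pfK blk_pi).
split=> [|Y1 Y2 clY1 clY2 sub]; first by exists (reindex pi' z); rewrite re'K.
have cl' Y : closed_set Y -> closed_set (fun x => Y (reindex pi' x)).
  exact: (reindex_closed piK pf'K blk_pi').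
have [x Zx|sY|sY] := irrZ _ _ (cl' _ clY1) (cl' _ clY2).
- by apply: sub; rewrite re'K.
- by left=> x /sY; rewrite reK.
- by right=> x /sY; rewrite reK.
Qed.
End ReindexPrime.

Lemma reindex_prime_divisor (A : mproj) (pi pi' : mvar A -> mvar A)
    (pf pf' : mfac A -> mfac A) (X Z : subpts A) :
  cancel pi pi' -> cancel pi' pi -> cancel pf pf' -> cancel pf' pf ->
  (forall v, blk (pi v) = pf (blk v)) ->
  (forall x, X x <-> X (reindex pi x)) ->
  prime_divisor X Z -> prime_divisor X (fun x => Z (reindex pi x)).
Proof.
move=> piK pi'K pfK pf'K blk_pi XE [vZ sZX nXZ maxZ].
have reK : cancel (@reindex A pi) (reindex pi') := reindexK pi'K.
have re'K : cancel (@reindex A pi') (reindex pi) := reindexK piK.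
have blk_pi' v : blk (pi' v) = pf' (blk v).
  by rewrite -[in RHS](pi'K v) blk_pi pfK.
split=> [|x /sZX xX|sXZ|Y vY sZY sYX].
- exact: (reindex_variety piK pi'K pfK pf'K blk_pi).
- exact/XE.
- by apply: nXZ => x Xx; rewrite -[x]re'K; apply/sXZ/XE; rewrite re'K.
pose Y' : subpts A := fun x => Y (reindex pi' x).
have vY' : closed_variety Y' := reindex_variety pi'K piK pf'K pfK blk_pi' vY.
have sZY' : subpt Z Y' by move=> z Zz; apply: sZY; rewrite re'K.
have sY'X : subpt Y' X by move=> x /sYX /(XE _).1; rewrite re'K.
have [sY|sX] := maxZ Y' vY' sZY' sY'X; [left|right] => x.
- by move=> Yx; apply: sY; rewrite /Y' reK.
- by move=> /(XE x).1/sX; rewrite /Y' reK.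
Qed.
End Geometry.

Section Moduli.
Variable n : nat.

Definition quad := {t : 4.-tuple 'I_n | uniq t}.
Definition lab (t : quad) (a : 'I_4) : 'I_n := tnth (val t) a.

Lemma quad_perm_subproof (s : 'S_n) (t : quad) :
  uniq [tuple of map s (val t)].
Proof. by have := valP t; rewrite (map_inj_uniq (@perm_inj _ s)). Qed.
Definition quad_perm (s : 'S_n) (t : quad) : quad :=
  Sub [tuple of map s (val t)] (quad_perm_subproof s t).

Lemma lab_perm s t a : lab (quad_perm s t) a = s (lab t a).
Proof. by rewrite /lab /= tnth_map. Qed.

Lemma quad_permM (s u : 'S_n) t :
  quad_perm (s * u)%g t = quad_perm u (quad_perm s t).
Proof.
by apply/val_inj/eq_from_tnth => a; rewrite /= !tnth_map permM.
Qed.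
Lemma quad_perm1 t : quad_perm 1%g t = t.
Proof. by apply/val_inj/eq_from_tnth => a; rewrite /= tnth_map perm1. Qed.

(* One copy of P^1, with coordinates (t, false) : (t, true), for each ordered
   quadruple t of distinct labels. *)
Definition quadP1 : mproj := @MProj (quad * bool)%type quad (fun v => v.1).

Section Points.
Variable K : closedFieldType.

Definition bracket (u v : 'I_n -> K) (i j : 'I_n) : K := u i * v j - u j * v i.

(* The cross-ratios of the n points [u i : v i] of P^1: for t = (i, j, k, l)
   the coordinate in the factor t is [ij][kl] : [ik][jl], the image of the
   curve under the forgetful map to M_{0,{i,j,k,l}} = P^1 - {0, 1, oo}. *)
Definition cross_ratios (u v : 'I_n -> K) : pts K quadP1 :=
  fun w => let: (t, b) := w in
    let i := lab t ord0 in let j := lab t 1%R in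
    let k := lab t 2%:R in let l := lab t 3%:R in
    if b then bracket u v i k * bracket u v j l
    else bracket u v i j * bracket u v k l.

Definition M0n : subpts K quadP1 := fun x =>
  exists u v, (forall i j, i != j -> bracket u v i j != 0) /\
              x = cross_ratios u v.

(* The product of all the forgetful maps to the Mbar_{0,{i,j,k,l}} = P^1 is a
   closed embedding of Mbar_{0,n} (Gerritzen, Herrlich and van der Put; Keel),
   so that Mbar_{0,n} is the closure of the image of M_{0,n}. *)
Definition Mbar : subpts K quadP1 := zclosure M0n.

(* D_I consists of the stable curves with a node separating the points marked
   by I from the others, that is of those which the forgetful map to
   Mbar_{0,{i,j,k,l}} sends to the boundary point ij|kl, which is 0 in the
   above coordinate, for all i, j in I and k, l outside I. *)
Definition boundary (I : {set 'I_n}) : subpts K quadP1 := fun x =>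
  Mbar x /\ forall t : quad,
    lab t ord0 \in I -> lab t 1%R \in I ->
    lab t 2%:R \notin I -> lab t 3%:R \notin I -> x (t, false) = 0.

(* The marked point i becomes the marked point s i. *)
Definition Sn_act (s : 'S_n) (x : pts K quadP1) : pts K quadP1 :=
  reindex (fun w : mvar quadP1 => (quad_perm s^-1%g w.1, w.2)) x.

Lemma Sn_actM (s u : 'S_n) x : Sn_act (s * u)%g x = Sn_act u (Sn_act s x).
Proof.
by apply/funext => -[t b]; rewrite /Sn_act /reindex /= invMg quad_permM.
Qed.
Lemma Sn_act1 x : Sn_act 1%g x = x.
Proof. by apply/funext => -[t b]; rewrite /Sn_act /reindex /= invg1 quad_perm1. Qed.

Let qf (s : 'S_n) (w : mvar quadP1) : mvar quadP1 := (quad_perm s w.1, w.2).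

Let quad_permK s : cancel (quad_perm s) (quad_perm s^-1%g).
Proof. by move=> t; rewrite -quad_permM mulgV quad_perm1. Qed.
Let quad_permVK s : cancel (quad_perm s^-1%g) (quad_perm s).
Proof. by move=> t; rewrite -quad_permM mulVg quad_perm1. Qed.
Let qfK s : cancel (qf s) (qf s^-1%g).
Proof. by case=> t b; rewrite /qf /= quad_permK. Qed.
Let qfVK s : cancel (qf s^-1%g) (qf s).
Proof. by case=> t b; rewrite /qf /= quad_permVK. Qed.

Lemma Sn_act_M0n s x : M0n x -> M0n (Sn_act s x).
Proof.
case=> u [v [uv ->]]; exists (fun i => u (s^-1%g i)), (fun i => v (s^-1%g i)).
split=> [i j ij|]; first by apply: uv; rewrite (inj_eq perm_inj).
by apply/funext => -[t b]; rewrite /Sn_act /reindex /= !lab_perm.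
Qed.

Lemma Sn_act_Mbar s x : Mbar x -> Mbar (Sn_act s x).
Proof.
case=> xpt hx; split.
  by apply/(@reindex_is_point K quadP1 (qf s^-1%g) (qf s) (quad_perm s^-1%g)
             (quad_perm s) (qfK s) (quad_permVK s) (fun=> erefl) x).
move=> d p hp vp.
have [d' [p' [hp' p'E]]] := @reindex_multihomog K quadP1 (qf s^-1%g)
  (quad_perm s^-1%g) (quad_perm s) (quad_permVK s) (fun=> erefl) d p hp.
have := hx d' p' hp'; rewrite p'E; apply=> y /(Sn_act_M0n s) My.
by rewrite p'E; apply: vp.
Qed.

Lemma Sn_prime_subproof (s : 'S_n) (Z : {Z | prime_divisor Mbar Z}) :
  prime_divisor Mbar (fun x => sval Z (Sn_act s^-1%g x)).
Proof.
apply: (@reindex_prime_divisor K quadP1 (qf s^-1%g^-1%g) (qf s^-1%g)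
          (quad_perm s^-1%g^-1%g) (quad_perm s^-1%g) _ _
          (@qfVK s^-1%g) (@qfK s^-1%g) (@quad_permVK s^-1%g) (@quad_permK s^-1%g) (fun=> erefl)).
  move=> x; split; first exact: (@Sn_act_Mbar s^-1%g).
  move/(Sn_act_Mbar s); rewrite -[reindex _ x]/(Sn_act s^-1%g x).
  by rewrite -Sn_actM mulVg Sn_act1.
exact: svalP.
Qed.

Definition Sn_prime (s : 'S_n) (Z : prime_div Mbar) : prime_div Mbar :=
  exist _ _ (Sn_prime_subproof s Z).

Definition Sn_Div (s : 'S_n) (D : Div Mbar) : Div Mbar :=
  \sum_(Z <- dom D) << coeff Z D *g Sn_prime s Z >>.

(* Mbar_{0,n} being smooth, its Picard group is its divisor class group. *)
Definition PicMbar : zmodType := Cl Mbar.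

Definition PicMbar_act (s : 'S_n) : PicMbar -> PicMbar :=
  zquot_map (Sn_Div s).

(* |I|, |I^c| >= 2 for every boundary divisor, so that the condition that both
   differ from 2 amounts to |I|, |I^c| >= 3. *)
Definition boundary_class_gt2 (c : PicMbar) : Prop :=
  exists (I : {set 'I_n}) (Z : prime_div Mbar),
    [/\ (2 < #|I|)%N, (2 < #|~: I|)%N,
        forall x, sval Z x <-> boundary I x &
        c = cl << Z >>].

Definition Qmod : zmodType := zquot boundary_class_gt2.

Definition Qmod_act (s : 'S_n) : Qmod -> Qmod := zquot_map (PicMbar_act s).
End Points.
End Moduli.

Section Galois.
Variables (F : fieldType) (K : closedFieldType) (iota : {rmorphism F -> K}).

Definition is_algebraic_closure : Prop := forall a : K, algebraicOver iota a.

Definition in_base (a : K) : Prop := exists b, a = iota b.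

Definition separable_over_base (a : K) : Prop :=
  exists2 p : {poly F}, separable_poly p & root (map_poly iota p) a.

(* Automorphisms of K over F, each given together with its inverse; K being an
   algebraic closure of F, they form the absolute Galois group of F. *)
Definition is_galois (s : (K -> K) * (K -> K)) : Prop :=
  [/\ {morph s.1 : a b / a + b}, {morph s.1 : a b / a * b},
      forall b, s.1 (iota b) = iota b, cancel s.1 s.2 & cancel s.2 s.1].

Definition absGal := {s : {classic (K -> K) * (K -> K)} | `[< is_galois s >]}.

HB.instance Definition _ := Choice.on absGal.

Definition mk_gal (s : (K -> K) * (K -> K)) (gal_s : `[< is_galois s >]) : absGal :=
  exist (fun u : {classic (K -> K) * (K -> K)} => is_true `[< is_galois u >])
        s gal_s.

Definition galact (s : absGal) : K -> K := (val s).1.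

Lemma galoisP (s : absGal) : is_galois (val s).
Proof. exact/asboolP/(valP s). Qed.

Lemma galois_one : `[< is_galois (id, id) >].
Proof. by apply/asboolP; split. Qed.

Lemma galois_inv (s : absGal) : `[< is_galois ((val s).2, (val s).1) >].
Proof.
have [sD sM sF sK s'K] := galoisP s; apply/asboolP; split=> //= [a b|a b|b].
- by rewrite -{1}(s'K a) -{1}(s'K b) -sD sK.
- by rewrite -{1}(s'K a) -{1}(s'K b) -sM sK.
- by rewrite -{1}sF sK.
Qed.

Lemma galois_mul (s t : absGal) :
  `[< is_galois ((val t).1 \o (val s).1, (val s).2 \o (val t).2) >].
Proof.
have [sD sM sF sK s'K] := galoisP s; have [tD tM tF tK t'K] := galoisP t.
apply/asboolP; split=> /= [a b|a b|b|a|a] /=.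
- by rewrite sD tD.
- by rewrite sM tM.
- by rewrite sF tF.
- by rewrite tK sK.
- by rewrite s'K t'K.
Qed.

(* As for permutations, s * t is s followed by t. *)
Definition gal_one : absGal := mk_gal galois_one.
Definition gal_inv (s : absGal) : absGal := mk_gal (galois_inv s).
Definition gal_mul (s t : absGal) : absGal :=
  mk_gal (galois_mul s t).

Lemma gal_mulA : associative gal_mul.
Proof. by move=> s t u; apply: val_inj. Qed.
Lemma gal_mul1 : left_id gal_one gal_mul.
Proof. by move=> s; apply: val_inj => /=; case: (val s). Qed.
Lemma gal_1mul : right_id gal_one gal_mul.
Proof. by move=> s; apply: val_inj => /=; case: (val s). Qed.
Lemma gal_mulV : left_inverse gal_one gal_inv gal_mul.
Proof.
move=> s; have [_ _ _ sK s'K] := galoisP s; apply: val_inj => /=.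
by congr pair; apply/funext => a /=; rewrite s'K.
Qed.
Lemma gal_Vmul : right_inverse gal_one gal_inv gal_mul.
Proof.
move=> s; have [_ _ _ sK s'K] := galoisP s; apply: val_inj => /=.
by congr pair; apply/funext => a /=; rewrite sK.
Qed.

HB.instance Definition _ :=
  isGroup.Build absGal gal_mulA gal_mul1 gal_1mul gal_mulV gal_Vmul.

Definition gal_pt (A : mproj) (s : absGal) (x : pts K A) : pts K A :=
  fun v => galact s (x v).

(* The ideal of X is generated by polynomials over F; over an imperfect F this
   is more than X being cut out by such polynomials. *)
Definition defined_over_base (A : mproj) (X : subpts K A) : Prop :=
  forall p : mpol K A, vanish X p ->
    exists (k : nat) (c : 'I_k -> K) (g : 'I_k -> mpol K A),
      (forall i, coefs_in in_base (g i) /\ vanish X (g i)) /\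
      p = \sum_i c i *: g i.

(* A geometrically integral projective F-variety, given by its points over the
   algebraic closure K. *)
Definition projective_variety_over_base (A : mproj) (X : subpts K A) : Prop :=
  closed_variety X /\ defined_over_base X.

Definition stably_rational (A : mproj) (X : subpts K A) : Prop :=
  exists r m : nat,
    is_birational in_base (prodset X (@whole K r.+1)) (@whole K m.+1).

(* X is the form of Mbar_{0,n} obtained by twisting by rho.  The automorphism
   group scheme of Mbar_{0,n}, n >= 5, is the constant group S_n, hence an
   isomorphism X -> Mbar_{0,n} over K is defined over the separable closure of F
   in K, and determines rho by the relation below. *)
Definition is_twist (n : nat) (rho : absGal -> 'S_n) (A : mproj)
    (X : subpts K A) : Prop :=
  exists2 psi : pts K A -> pts K (quadP1 n),
    is_isomorphism separable_over_base X (@Mbar n K) psi &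
    forall (s : absGal) x, X x ->
      same_pt (psi (gal_pt s x)) (Sn_act (rho s) (gal_pt s (psi x))).
End Galois.

(* Main.v *)
(* A divisor on Mbar_{0,n} other than the boundary divisors D_I with |I|, |I^c| >= 3 is cut out by
   a form f on (P^1)^n; the multidegree of f defines a map phi from Q to Z^n with values of even
   sum.  If e_ij is the class of the divisor [ij] = 0, then d_ab = e_ak - e_bk does not depend on k,
   and s |-> d_{s o, o} is a cocycle with values in Q, which becomes a coboundary after
   multiplication by an integer, hence is one, s q - q, if Q is stably permutation.  Then the o-th
   basis vector minus phi(q) is an invariant vector of odd sum, and the labels at which it is odd
   form a stable set O with |O| odd.
   Given such an O, there is a 2 x 2 matrix tau of forms in n vectors of K^2, generically
   invertible, covariant under GL_2 and invariant under the permutations preserving O.  It reduces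
   the structure group of the configurations above M_{0,n} to scalars:
   (x, g) |-> g tau(m)^-1 m, where m is a configuration representing x, is a birational map from
   Mbar_{0,n} x P^3 to P^n, equivariant if P^n is the compactification of the affine space of
   configurations of n points of the affine line, on which the group acts by permuting coordinates.  This
   is (a).  For (b), the map defined over the separable closure becomes Galois equivariant after
   a change of coordinates trivialising the twisted permutation module (Dedekind's independence of
   automorphisms), and an equivariant birational map descends to F. *)
Require Import Defs.
From HB Require Import structures.
From mathcomp Require Import all_boot all_order all_algebra all_fingroup.
From mathcomp Require Import mxrepresentation.
From mathcomp Require Import separable boolp ring zify.
From mathcomp Require classical_sets.
From mathcomp.multinomials Require Import freeg mpoly.

Set Implicit Arguments.
Unset Strict Implicit.
Unset Printing Implicit Defensive.

Import GRing.Theory.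
Local Open Scope ring_scope.

(** * Unique factorization in polynomial rings *)

(** Divisors and orders are reached through factorial polynomial rings. A form on the product of
    lines pulls back to a polynomial in n vectors of K^2, semi-invariant under GL_2 and scalings;
    its prime factors inherit this, and each defines a prime divisor along which orders are
    multiplicities. Semi-invariant forms have even total degree, hence the values of phi have even
    sum; dually, brackets use up the labels of an odd set in pairs and leave one vector over, from
    which tau is built.

    The D_I with |I|, |I^c| >= 3 are invisible to these factors, yet the independence of d_ab from k
    needs the order of a cross-ratio along each of them. A curve crossing D_I transversally gives
    that order once a uniformizer is known. Uniformizers come from the existence of some principal
    divisor: otherwise infinitely many prime divisors would be independent in Q; and by definition a
    principal divisor has an order, hence a uniformizer, along every prime divisor.

    The dimensions match as (n - 3) + 3 = n, where P^3 is the projective space of 2 x 2 matrices. *)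

Section Factorial.
Variable R : idomainType.
Implicit Types (p a b : R) (s : seq R).

Definition divides p a := exists c, a = c * p.

Definition prime_elt p :=
  [/\ p != 0, p \isn't a GRing.unit &
      forall a b, divides p (a * b) -> divides p a \/ divides p b].

(** The factors are required to be prime, not just irreducible, so that uniqueness is automatic. *)
Definition has_fact a := exists u s,
  [/\ u \is a GRing.unit, forall p, p \in s -> prime_elt p & a = u * \prod_(p <- s) p].

Lemma dividesM p a b : divides p a -> divides p (a * b).
Proof. by case=> c ->; exists (c * b); rewrite mulrAC. Qed.

Lemma dividesMr p a b : divides p b -> divides p (a * b).
Proof. by rewrite mulrC; apply: dividesM. Qed.

Lemma dividesD p a b : divides p a -> divides p b -> divides p (a + b).
Proof. by case=> c -> [d ->]; exists (c + d); rewrite mulrDl. Qed.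

Lemma dividesB p a b : divides p a -> divides p b -> divides p (a - b).
Proof. by case=> c -> [d ->]; exists (c - d); rewrite mulrBl. Qed.

Lemma divides0 p : divides p 0.
Proof. by exists 0; rewrite mul0r. Qed.

Lemma divides_prod p (I : Type) (r : seq I) (P : pred I) (F : I -> R) : prime_elt p ->
  divides p (\prod_(i <- r | P i) F i) -> exists2 i, P i & divides p (F i).
Proof.
move=> [_ pU pP]; elim: r => [|i r IHr]; rewrite ?big_nil ?big_cons.
  by case=> c /esym c1; case/negP: pU; apply/unitrPr; exists c; rewrite mulrC c1.
by case: ifP => Pi // /pP[|//]; exists i.
Qed.

Lemma prime_divides_exp p a k : prime_elt p -> divides p (a ^+ k) -> divides p a.
Proof.
move=> pp; elim: k => [|k IHk]; rewrite ?expr0 ?exprS.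
  by case: pp => _ pU _ [c c1]; case/negP: pU; apply/unitrPr; exists c; rewrite mulrC -c1.
by case: (pp) => _ _ /[apply] -[].
Qed.

Lemma has_factM a b : has_fact a -> has_fact b -> has_fact (a * b).
Proof.
case=> u [s [uU sP ->]] [v [t [vU tP ->]]]; exists (u * v), (s ++ t).
split; first by rewrite unitrM uU.
  by move=> p; rewrite mem_cat => /orP[/sP|/tP].
by rewrite big_cat mulrACA.
Qed.

(* A prime dividing a prime is associate to it, so it can be cancelled. *)
Lemma fact_cancel p a u s : prime_elt p -> u \is a GRing.unit ->
  (forall q, q \in s -> prime_elt q) -> p * a = u * \prod_(q <- s) q ->
  exists v t, [/\ v \is a GRing.unit, forall q, q \in t -> prime_elt q,
     a = v * \prod_(q <- t) q & (size t < size s)%N].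
Proof.
move=> pp uU sP paE.
have [i /andP[si _] [c qE]] : exists2 q, (q \in s) && true & divides p q.
  have : divides p (u * \prod_(q <- s) q) by exists a; rewrite -paE mulrC.
  case: (pp) => _ pU pP /pP[[c uE]|].
    by case/negP: pU; move: uU; rewrite uE unitrM => /andP[].
  rewrite big_seq => /(divides_prod pp)[q sq dq]; exists q => //.
  by rewrite sq.
have [i0 iU iP] := sP _ si.
have [p0 pU _] := pp.
have cU : c \is a GRing.unit.
  have : divides i (c * p) by exists 1; rewrite mul1r qE.
  case/iP=> [[d cE]|[d pE]].
    case/negP: pU; apply/unitrPr; exists d.
    have : i * (p * d) = i * 1 by rewrite mulr1 [RHS]qE cE; ring.
    by move/(mulfI i0).
  apply/unitrPr; exists d.
  have : p * (c * d) = p * 1 by rewrite mulr1 [RHS]pE qE; ring.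
  by move/(mulfI p0).
exists (u * c), (rem i s); split.
- by rewrite unitrM uU.
- by move=> q /mem_rem /sP.
- apply: (mulfI p0); rewrite paE (perm_big _ (perm_to_rem si)) big_cons /= qE.
  by ring.
- by rewrite size_rem //; case: (s) si.
Qed.

End Factorial.

Definition factorial_ring (R : idomainType) := forall a : R, a != 0 -> has_fact a.

Section FactorialPoly.
Variable R : idomainType.
Hypothesis factR : factorial_ring R.
Implicit Types f g h k : {poly R}.

Lemma divides_polyC (p : R) f : divides p%:P f <-> forall i, divides p f`_i.
Proof.
split=> [[c ->] i|dp]; first by exists c`_i; rewrite coefMC.
have /choice[c cE] : forall i, exists c, f`_i = c * p by [].
exists (\poly_(i < size f) c i); apply/polyP => i.
rewrite coefMC coef_poly; case: ltnP => [_|/(nth_default 0) ->]; first exact: cE.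
by rewrite mul0r.
Qed.

(** Gauss's lemma. If p divides neither f nor g, let i and j be the least indices of coefficients it
    does not divide; in the coefficient of index i + j of f * g every term but f_i * g_j is
    divisible by p. *)
Lemma prime_polyC (p : R) : prime_elt p -> prime_elt p%:P.
Proof.
move=> pp; have [p0 pU pP] := pp; split; first by rewrite polyC_eq0.
  by rewrite poly_unitE coefC /= negb_and pU orbT.
move=> f g /divides_polyC dfg; apply/or_asboolP.
apply/negP => /negP; rewrite negb_or => /andP[/asboolP nf /asboolP ng].
have ex h : ~ divides p%:P h -> exists i, `[< ~ divides p h`_i >].
  move=> nh; apply/not_existsP => H; apply: nh; apply/divides_polyC => i.
  by apply: contrapT => Hi; apply: (H i); apply/asboolP.
have [i /asboolP ni mi] := ex_minnP (ex _ nf).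
have [j /asboolP nj mj] := ex_minnP (ex _ ng).
have := dfg (i + j)%N; rewrite coefM.
have ltij : (i < (i + j).+1)%N by rewrite ltnS leq_addr.
rewrite (bigD1 (Ordinal ltij)) //= addKn => dS.
suff d2 : divides p (\sum_(k < (i + j).+1 | k != Ordinal ltij) f`_k * g`_(i + j - k)).
  by have := dividesB dS d2; rewrite addrK => /pP[].
elim/big_ind: _ => [|x y|k ki]; [exact: divides0 | exact: dividesD|].
have [ltk|gtk|ek] := ltngtP k i.
- apply: dividesM; apply: contrapT => nk; have := mi k.
  by rewrite leqNgt ltk => H; apply: notF; apply: H; apply/asboolP.
- apply: dividesMr; apply: contrapT => nk; have := mj (i + j - k)%N.
  have lek : (k <= i + j)%N by rewrite -ltnS.
  rewrite leqNgt ltn_subLR // ltn_add2r gtk => H; apply: notF; apply: H.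
  by apply/asboolP.
- by case/eqP: ki; apply: val_inj.
Qed.

Definition primitive f := forall p, prime_elt p -> ~ divides p%:P f.

(** The prime factors of c are removed one by one: each divides k * f, hence k, since f is
    primitive. *)
Lemma primitive_cancel c f g k : primitive f -> c != 0 -> c *: g = k * f ->
  divides f g.
Proof.
move=> fP /factR[u [s [uU]]]; elim: s k c => [|p s IHs] k c sP ->.
  rewrite big_nil mulr1 => E; exists (u^-1 *: k).
  by rewrite -scalerAl -E scalerA mulVr // scale1r.
rewrite big_cons mulrCA -scalerA => E.
have pp : prime_elt p by apply: sP; rewrite mem_head.
have [_ _ pP] := prime_polyC pp.
have [|[k' kE]|/(fP _ pp)//] := pP k f.
  by exists (u * \prod_(q <- s) q *: g); rewrite -E -mul_polyC mulrC.
apply: (IHs k' _ _ erefl) => [q sq|]; first by apply: sP; rewrite inE sq orbT.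
have p0 : p%:P != 0 by rewrite polyC_eq0; case: pp.
by apply: (mulfI p0); rewrite mul_polyC E kE mulrA [p%:P * _]mulrC.
Qed.

(** A factorization up to the scalar c, that is over the fraction field, becomes one over R of the
    same degrees: each prime factor of c divides g or h and is taken out of it. *)
Lemma reducible_cancel c f g h : c != 0 -> c *: f = g * h ->
  exists g' h', [/\ f = g' * h', size g' = size g & size h' = size h].
Proof.
move=> /factR[u [s [uU]]]; elim: s g h c => [|p s IHs] g h c sP ->.
  rewrite big_nil mulr1 => E; exists (u^-1 *: g), h; split=> //.
    by rewrite -scalerAl -E scalerA mulVr // scale1r.
  by rewrite size_scale // invr_eq0; apply: contraTneq uU => ->; rewrite unitr0.
rewrite big_cons mulrCA -scalerA => E.
have pp : prime_elt p by apply: sP; rewrite mem_head.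
have sP' q : q \in s -> prime_elt q by move=> sq; apply: sP; rewrite inE sq orbT.
have [_ _ pP] := prime_polyC pp.
have p0 : p != 0 by case: pp.
have [|[k kE]|[k kE]] := pP g h.
- by exists (u * \prod_(q <- s) q *: f); rewrite -E -mul_polyC mulrC.
- have [|g' [h' [fE sg' sh']]] := IHs k h _ sP' erefl.
    apply: (@mulfI _ p%:P); first by rewrite polyC_eq0.
    by rewrite mul_polyC E kE; ring.
  by exists g', h'; rewrite fE sg' sh' kE [k * _]mulrC mul_polyC size_scale.
- have [|g' [h' [fE sg' sh']]] := IHs g k _ sP' erefl.
    apply: (@mulfI _ p%:P); first by rewrite polyC_eq0.
    by rewrite mul_polyC E kE; ring.
  by exists g', h'; rewrite fE sg' sh' kE [k * _]mulrC mul_polyC size_scale.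
Qed.

Lemma has_fact_polyC (c : R) : has_fact c -> has_fact c%:P.
Proof.
case=> u [s [uU sP ->]]; exists u%:P, [seq p%:P | p <- s]; split.
- by rewrite poly_unitE coefC /= size_polyC uU andbT (_ : u != 0) //; apply: contraTneq uU => ->; rewrite unitr0.
- by move=> _ /mapP[p /sP pp ->]; apply: prime_polyC.
- by rewrite rmorphM rmorph_prod big_map.
Qed.

(** Extracting a prime from f shortens the factorization of its leading coefficient, so the process
    stops. *)
Lemma primitive_part f : f != 0 -> exists c g, [/\ has_fact c, primitive g & f = c%:P * g].
Proof.
move=> f0; have : lead_coef f != 0 by rewrite lead_coef_eq0.
case/factR => u [s [uU sP lfE]].
have [m] := ubnP (size s); elim: m f f0 u s uU sP lfE => // m IHm f f0 u s uU sP lfE.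
rewrite ltnS => sm.
have [fP|] := pselect (primitive f).
  exists 1, f; split=> //; last by rewrite mul1r.
  by exists 1, [::]; rewrite unitr1 big_nil mulr1.
move/existsNP=> [p /not_implyP[pp /contrapT[g fE]]].
have g0 : g != 0 by apply: contraNneq f0 => g0; rewrite fE g0 mul0r.
have [|v [t [vU tP gE ltts]]] := @fact_cancel _ p (lead_coef g) u s pp uU sP.
  by rewrite -lfE fE lead_coefM lead_coefC mulrC.
have [|c [h [cP hP hE]]] := IHm g g0 v t vU tP gE; first exact: leq_trans sm.
exists (p * c), h; split=> //; last by rewrite fE hE polyCM mulrC mulrA.
apply: has_factM => //; exists 1, [:: p]; rewrite unitr1; split=> //.
  by move=> q; rewrite inE => /eqP ->.
by rewrite big_seq1 mul1r.
Qed.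

(** Divisibility [%|] over a domain is divisibility over the fraction field. A primitive polynomial
    irreducible in that sense is prime by [primitive_cancel]; a reducible one splits into factors of
    smaller degree by [reducible_cancel]. *)
Lemma factorial_poly : factorial_ring {poly R}.
Proof.
move=> f; have [m] := ubnP (size f); elim: m f => // m IHm f /ltnSE sfm f0.
have [c [g [cF gP fE]]] := primitive_part f0.
rewrite fE; apply: has_factM; first exact: has_fact_polyC.
have [c0 g0] : c%:P != 0 /\ g != 0.
  by apply/andP; rewrite -negb_or -mulf_eq0 -fE.
have sg : size g = size f.
  rewrite fE mul_polyC size_scale //; by rewrite polyC_eq0 in c0.
have [sg1|sg1] := leqP (size g) 1.
  rewrite (size1_polyC sg1); apply/has_fact_polyC/factR.
  by rewrite -polyC_eq0 -size1_polyC.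
have [gI|] := pselect (irreducible_poly g).
  exists 1, [:: g]; rewrite unitr1; split=> //; last by rewrite big_seq1 mul1r.
  move=> q; rewrite inE => /eqP ->; split=> //.
    by rewrite poly_unitE negb_and neq_ltn sg1 orbT.
  move=> a b [k kE].
  have gab : g %| a * b by rewrite kE dvdp_mull.
  have toF x : g %| x -> divides g x.
    by move/Pdiv.Idomain.dvdpP => [[d k'] /= d0 dE]; apply: (primitive_cancel gP d0 dE).
  have [ga|nga] := boolP (g %| a); first by left; apply: toF.
  right; apply: toF; move: gab; rewrite Gauss_dvdpr //.
  by rewrite qpoly.irreducible_poly_coprime.
move=> nI; have [q sq /andP[qg nqg]] : exists2 q : {poly R}, size q != 1%N & (q %| g) && ~~ (q %= g).
  apply: contrapT => H; apply: nI; split=> // q sq qg.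
  by apply: contrapT => nqg; apply: H; exists q => //; rewrite qg; apply/negP.
have [[d k] /= d0 dE] := Pdiv.Idomain.dvdpP _ _ qg.
have [g' [h' [gE sg' sh']]] := reducible_cancel d0 dE.
have k0 : k != 0.
  apply/negP => /eqP k0; move: dE; rewrite k0 mul0r -mul_polyC => /eqP.
  by rewrite mulf_eq0 (negPf g0) polyC_eq0 (negPf d0).
have q0 : q != 0 by apply: dvdpN0 qg g0.
have sq1 : (1 < size q)%N by rewrite ltn_neqAle eq_sym sq lt0n size_poly_eq0.
have sqg : (size q < size g)%N.
  rewrite ltn_neqAle dvdp_leq // andbT; apply: contra nqg => e.
  by rewrite -dvdp_size_eqp.
have sE : (size k + size q = (size g).+1)%N.
  by rewrite -(size_scale g d0) dE size_mul // prednK // addn_gt0 size_poly_gt0 k0.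
rewrite gE; apply: has_factM; apply: IHm.
- by rewrite sg' ; apply: leq_trans sfm; rewrite -sg; lia.
- by rewrite -size_poly_eq0 sg' size_poly_eq0.
- by rewrite sh'; apply: leq_trans sfm; rewrite -sg.
- by rewrite -size_poly_eq0 sh' size_poly_eq0.
Qed.

End FactorialPoly.

Section IsoFact.
Variables (R S : idomainType) (h : R -> S) (h' : S -> R).
Hypotheses (hK : cancel h h') (h'K : cancel h' h).
Hypotheses (h0 : h 0 = 0) (h1 : h 1 = 1) (hM : {morph h : x y / x * y}).

Let h'M x y : h' (x * y) = h' x * h' y.
Proof. by apply: (can_inj hK); rewrite hM !h'K. Qed.

Lemma iso_divides a b : divides (h a) (h b) <-> divides a b.
Proof.
split=> [[c E]|[c ->]]; last by exists (h c); rewrite hM.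
by exists (h' c); apply: (can_inj hK); rewrite E hM h'K.
Qed.

Lemma iso_unit a : (h a \is a GRing.unit) = (a \is a GRing.unit).
Proof.
apply/idP/idP => /unitrPr[b E]; apply/unitrPr; last by exists (h b); rewrite -hM E.
by exists (h' b); apply: (can_inj hK); rewrite hM h'K E h1.
Qed.

Lemma iso_prime p : prime_elt (h p) -> prime_elt p.
Proof.
move=> [p0 pU pP]; split.
- by apply: contraNneq p0 => ->; rewrite h0.
- by rewrite -iso_unit.
- by move=> a b /iso_divides; rewrite hM => /pP[] /iso_divides; [left|right].
Qed.

Lemma iso_prime_inv p : prime_elt p -> prime_elt (h p).
Proof.
move=> [p0 pU pP]; split.
- by apply: contraNneq p0 => /(congr1 h'); rewrite hK -h0 hK => ->.
- by rewrite iso_unit.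
- move=> a b; rewrite -(h'K a) -(h'K b) -hM => /iso_divides /pP.
  by case=> /iso_divides; [left|right].
Qed.

Lemma iso_factorial : factorial_ring S -> factorial_ring R.
Proof.
move=> fS a a0; have : h a != 0.
  by apply: contraNneq a0 => /(congr1 h'); rewrite hK -h0 hK => ->.
case/fS=> u [s [uU sP E]]; exists (h' u), [seq h' p | p <- s]; split.
- by rewrite -iso_unit h'K.
- by move=> _ /mapP[p /sP pp ->]; apply: iso_prime; rewrite h'K.
- apply: (can_inj hK); rewrite E hM h'K (big_morph h hM h1) big_map; congr (_ * _).
  by apply: eq_bigr => i _; rewrite h'K.
Qed.
End IsoFact.

Section MPolyUFD.
Variable K : fieldType.

Section Muni.
Variable n : nat.
Implicit Types (p : {mpoly K[n.+1]}) (q : {poly {mpoly K[n]}}).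

(** Inverse of [muni], which regards a polynomial in n + 1 variables as one in the last variable;
    factoriality is transported along it. *)
Definition muni_inv q : {mpoly K[n.+1]} := (map_poly (@mwiden n K) q).['X_ord_max].

Lemma muni_invD : {morph muni_inv : x y / x + y}.
Proof. by move=> x y; rewrite /muni_inv rmorphD hornerD. Qed.

Lemma muni_invM : {morph muni_inv : x y / x * y}.
Proof. by move=> x y; rewrite /muni_inv rmorphM hornerM. Qed.

Lemma muniXE (m : 'X_{1..n.+1}) : muni 'X_[K, m] =
  'X_[[multinom (m (widen_ord (leqnSn n) i)) | i < n]] *: 'X^(m ord_max).
Proof. by rewrite muniE msuppX big_seq1 mcoeffX eqxx scale1r. Qed.

Lemma muni_mwiden (p : {mpoly K[n]}) : muni (mwiden p) = p%:P.
Proof.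
elim/mpolyind: p => [|c m p _ _ IH]; first by rewrite mwiden0 muni0.
rewrite mwidenD muniD IH mwidenZ muniZ polyCD; congr (_ + _).
rewrite mwidenX muniXE -!mul_polyC -mul_mpolyC rmorphM /=; congr (_ * _).
rewrite mnmwiden_ordmax expr0 mulr1; congr ('X_[_])%:P.
by apply/mnmP => i; rewrite mnmE mnmwiden_widen.
Qed.

Lemma muniXmax : muni 'X_(ord_max : 'I_n.+1) = 'X :> {poly {mpoly K[n]}}.
Proof.
rewrite muniXE mnm1E eqxx expr1 (_ : [multinom _ | i < n] = 0%MM) ?mpolyX0 ?scale1r //.
by apply/mnmP => i; rewrite mnmE mnm1E mnm0E -val_eqE /= gtn_eqF.
Qed.

Lemma muni_invK : cancel muni_inv (@muni n K).
Proof.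
elim/poly_ind => [|q c IH]; first by rewrite /muni_inv rmorph0 horner0 muni0.
rewrite muni_invD muni_invM muniD muniM IH; congr (_ * _ + _).
  by rewrite /muni_inv map_polyX hornerX muniXmax.
by rewrite /muni_inv map_polyC hornerC muni_mwiden.
Qed.

Lemma muniK : cancel (@muni n K) muni_inv.
Proof.
elim/mpolyind => [|c m p _ _ IH]; first by rewrite muni0 /muni_inv rmorph0 horner0.
rewrite muniD muni_invD [X in _ + X]IH; congr (_ + _).
rewrite muniZ -mul_polyC muni_invM muniXE -mul_polyC muni_invM /muni_inv.
rewrite !map_polyC !hornerC rmorphXn /= map_polyX hornerXn mwidenC -mul_mpolyC.
congr (_ * _); rewrite mwidenX mpolyXn -mpolyXD; congr 'X_[_].
apply/mnmP => i; rewrite mnmDE mulmnE mnm1E.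
case: (unliftP ord_max i) => [j ->|->].
  have -> : fintype.lift ord_max j = widen_ord (leqnSn n) j by apply: val_inj; rewrite /= /bump leqNgt ltn_ord.
  by rewrite mnmwiden_widen mnmE -val_eqE /= gtn_eqF ?muln0 ?addn0 //=.
by rewrite mnmwiden_ordmax eqxx mul1n.
Qed.

Lemma meval_mwiden (v : 'I_n.+1 -> K) (p : {mpoly K[n]}) :
  (mwiden p).@[v] = p.@[fun i => v (widen_ord (leqnSn n) i)].
Proof.
elim/mpolyind: p => [|c m p _ _ IH]; first by rewrite mwiden0 !meval0.
rewrite mwidenD !mevalD IH mwidenZ !mevalZ mwidenX !mevalX; congr (_ * _ + _).
rewrite big_ord_recr /= mnmwiden_ordmax expr0 mulr1.
by apply: eq_bigr => i _; rewrite mnmwiden_widen.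
Qed.

Lemma meval_muni (v : 'I_n.+1 -> K) p :
  p.@[v] = (map_poly (meval (fun i => v (widen_ord (leqnSn n) i))) (muni p)).[v ord_max].
Proof.
rewrite -{1}(muniK p); elim/poly_ind: (muni p) => [|q c IH].
  by rewrite /muni_inv !rmorph0 !horner0 meval0.
rewrite muni_invD muni_invM mevalD mevalM IH rmorphD rmorphM /=.
rewrite map_polyX map_polyC hornerD hornerM hornerX hornerC; congr (_ * _ + _).
  by rewrite /muni_inv map_polyX hornerX mevalXU.
by rewrite /muni_inv map_polyC hornerC meval_mwiden.
Qed.

Definition ext_pt (v : 'I_n -> K) (x : K) (i : 'I_n.+1) : K :=
  if unlift ord_max i is Some j then v j else x.

Lemma ext_ptW v x i : ext_pt v x (widen_ord (leqnSn n) i) = v i.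
Proof.
have -> : widen_ord (leqnSn n) i = fintype.lift ord_max i.
  by apply: val_inj; rewrite /= /bump leqNgt ltn_ord.
by rewrite /ext_pt liftK.
Qed.

Lemma meval_ext v x p : p.@[ext_pt v x] = (map_poly (meval v) (muni p)).[x].
Proof.
rewrite meval_muni {2}/ext_pt unlift_none; congr (_.[_]).
by apply: eq_map_poly => c; apply: meval_eq => i; rewrite ext_ptW.
Qed.
End Muni.

Lemma mpoly0_unit (p : {mpoly K[0]}) : p != 0 -> p \is a GRing.unit.
Proof.
have E (q : {mpoly K[0]}) : q = (q@_0)%:MP.
  by apply/mpolyP => m; rewrite (_ : m = 0%MM) ?mcoeffC ?eqxx ?mulr1 //; apply/mnmP => -[].
rewrite (E p) mpolyC_eq0 -unitfE => /unitrPr[b bE]; apply/unitrPr; exists b%:MP.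
by rewrite -mpolyCM bE.
Qed.

Lemma factorial_mpoly n : factorial_ring {mpoly K[n]}.
Proof.
elim: n => [p p0|n IHn].
  by exists p, [::]; rewrite mpoly0_unit // big_nil mulr1.
exact: (iso_factorial (@muniK n) (@muni_invK n) (@muni0 _ _) (@muni1 _ _) (@muniM _ _) (factorial_poly IHn)).
Qed.
End MPolyUFD.

(** * Zeros of a prime polynomial *)

Section Hypersurface.
Variable K : closedFieldType.

Lemma mpoly_nonroot n (p : {mpoly K[n]}) : p != 0 -> exists v, p.@[v] != 0.
Proof.
elim: n p => [|n IHn] p p0.
  exists (fun=> 0); have /mpoly0_unit/unitrPr[q pq] := p0.
  by apply: contra_neq (oner_neq0 K) => pv; rewrite -(@meval1 0 K (fun=> 0)) -pq mevalM pv mul0r.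
have : muni p != 0 by apply: contraNneq p0 => e; rewrite -(muniK p) e /muni_inv rmorph0 horner0.
rewrite -lead_coef_eq0 => /IHn[v lv].
have /closed_nonrootP[x px] : map_poly (meval v) (muni p) != 0.
  by rewrite -lead_coef_eq0 lead_coef_map_eq.
by exists (ext_pt v x); rewrite meval_ext.
Qed.

Lemma mpoly_eq_fun n (p q : {mpoly K[n]}) : (forall v, p.@[v] = q.@[v]) -> p = q.
Proof.
move=> pq; apply/eqP; rewrite -subr_eq0; apply/negP => /negP/mpoly_nonroot[v].
by rewrite mevalB pq subrr eqxx.
Qed.

Lemma prime_polyC_inv (R : idomainType) (c : R) : prime_elt c%:P -> prime_elt c.
Proof.
have dE a : divides c a <-> divides c%:P a%:P.
  by rewrite divides_polyC; split=> [ca [|i]|/(_ 0%N)]; rewrite coefC //=; apply: divides0.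
move=> [c0 cU cP]; split; first by rewrite polyC_eq0 in c0.
  apply: contra cU => /unitrPr[b bE]; apply/unitrPr; exists b%:P.
  by rewrite -polyCM bE.
by move=> a b /dE; rewrite polyCM => /cP[] /dE; [left|right].
Qed.

(** Coprimality is over the fraction field. Writing c F = h * gcd, the prime F divides h, and then
    the gcd is constant, or it divides the gcd, hence a scalar multiple of G, hence G. *)
Lemma prime_poly_coprime (R : idomainType) (F G : {poly R}) : (1 < size F)%N ->
  prime_elt F -> ~ divides F G -> coprimep F G.
Proof.
move=> sF [F0 _ FP] nFG; rewrite coprimep_def; apply/contraT => sg.
have [[c h] /= c0 cE] := Pdiv.Idomain.dvdpP _ _ (dvdp_gcdl F G).
have [[d l] /= d0 dE] := Pdiv.Idomain.dvdpP _ _ (dvdp_gcdr F G).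
have [|[k kE]|[k kE]] := FP h (gcdp F G).
- by exists c%:P; rewrite -cE mul_polyC.
- have E : c%:P = k * gcdp F G.
    by apply: (mulIf F0); rewrite mul_polyC cE kE; ring.
  have : size c%:P = 1%N by rewrite size_polyC c0.
  rewrite E => /eqP; rewrite -dvdp1 => H.
  by case/negP: sg; rewrite -dvdp1; apply: dvdp_trans H; apply: dvdp_mull.
- have [|[e eE]|//] := FP d%:P G.
    by exists (l * k); rewrite mul_polyC dE kE; ring.
  have : size d%:P = 1%N by rewrite size_polyC d0.
  rewrite eE => /eqP; rewrite -dvdp1 => H; have : size F == 1%N.
    by rewrite -dvdp1; apply: dvdp_trans H; apply: dvdp_mull.
  by move/eqP => sF1; rewrite sF1 in sF.
Qed.

(** The Nullstellensatz for a principal prime ideal. If f involves the last variable, a combination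
    of f and P is a nonzero polynomial d in the other variables; at a point where neither d nor the
    leading coefficient of f vanishes, a root of f in the last variable is not a root of P.
    Otherwise f fails to divide some coefficient of P and induction applies. *)
Lemma hypersurface_null n (f P : {mpoly K[n]}) : prime_elt f -> ~ divides f P ->
  exists w, f.@[w] = 0 /\ P.@[w] != 0.
Proof.
elim: n f P => [|n IHn] f P fp nfP.
  by case: fp => f0; rewrite mpoly0_unit.
have Fp := iso_prime_inv (@muniK _ n) (@muni_invK _ n) (@muni0 _ _) (@muni1 _ _) (@muniM _ _) fp.
have nFG : ~ divides (muni f) (muni P).
  exact: (fun H => nfP ((iso_divides (@muniK _ n) (@muni_invK _ n) (@muniM _ _) f P).1 H)).
have [sF|sF] := leqP (size (muni f)) 1.
  have FE := size1_polyC sF; have Fp' := Fp; rewrite FE in Fp' nFG.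
  have : ~ forall i, divides (muni f)`_0 (muni P)`_i by move/divides_polyC.
  move/existsNP => [i ni].
  have [w [fw Pw]] := IHn _ _ (prime_polyC_inv Fp') ni.
  have /closed_nonrootP[x px] : map_poly (meval w) (muni P) != 0.
    by apply: contraNneq Pw => e; rewrite -(coef_map (meval w)) e coef0.
  exists (ext_pt w x); rewrite !meval_ext; split=> //.
  by rewrite FE map_polyC hornerC.
have /Bezout_coprimepP[[u v] /=] := prime_poly_coprime sF Fp nFG.
rewrite -size_poly_eq1 => /eqP sE.
have E := size1_polyC (eq_leq sE); set d := _`_0 in E.
have d0 : d != 0.
  by apply/negP => /eqP d0; rewrite E d0 size_poly0 in sE.
have l0 : lead_coef (muni f) != 0 by rewrite lead_coef_eq0; case: Fp.
have /mpoly_nonroot[w] := mulf_neq0 d0 l0.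
rewrite mevalM mulf_eq0 negb_or => /andP[dw lw].
have /closed_rootP[x fx] : size (map_poly (meval w) (muni f)) != 1%N.
  by rewrite size_map_poly_id0 // neq_ltn sF orbT.
exists (ext_pt w x); rewrite !meval_ext; split; first exact/eqP.
apply: contra dw => /eqP Px.
move/(congr1 (fun q => (map_poly (meval w) q).[x])): E.
move/rootP: fx Px; move: (muni f) (muni P) => F G Fx Gx.
rewrite rmorphD [X in (X + _).[_]]rmorphM [X in (_ + X).[_]]rmorphM hornerD hornerM hornerM.
by rewrite [X in _ * X + _]Fx [X in _ + _ * X]Gx map_polyC hornerC !mulr0 addr0 => <-.
Qed.
End Hypersurface.

(** * Forms on products of projective spaces *)

Section Mproj.
Variable K : closedFieldType.
Implicit Types A B : mproj.

Definition var A (v : mvar A) : mpol K A := 'X_(enum_rank v).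
Definition cst A (c : K) : mpol K A := c%:MP.

Section PevalE.
Variables (A : mproj) (x : pts K A).
Implicit Types p q : mpol K A.

Lemma pevalD p q : peval (p + q) x = peval p x + peval q x.
Proof. exact: mevalD. Qed.
Lemma pevalN p : peval (- p) x = - peval p x.
Proof. exact: mevalN. Qed.
Lemma pevalB p q : peval (p - q) x = peval p x - peval q x.
Proof. exact: mevalB. Qed.
Lemma pevalM p q : peval (p * q) x = peval p x * peval q x.
Proof. exact: mevalM. Qed.
Lemma pevalX p k : peval (p ^+ k) x = peval p x ^+ k.
Proof. by rewrite /peval rmorphXn. Qed.
Lemma pevalZ c p : peval (c *: p) x = c * peval p x.
Proof. exact: mevalZ. Qed.
Lemma pevalC c : peval (cst A c) x = c.
Proof. exact: mevalC. Qed.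
Lemma peval1 : peval (1 : mpol K A) x = 1.
Proof. exact: meval1. Qed.
Lemma peval0 : peval (0 : mpol K A) x = 0.
Proof. exact: meval0. Qed.
Lemma pevalV v : peval (@var A v) x = x v.
Proof. by rewrite /peval mevalXU enum_rankK. Qed.
End PevalE.

Definition pevalE := (pevalB, pevalD, pevalN, pevalM, pevalX, pevalZ, pevalC, peval1, peval0, pevalV).

Lemma peval_prod A (I : Type) (r : seq I) (P : pred I) (F : I -> mpol K A) x :
  peval (\prod_(i <- r | P i) F i) x = \prod_(i <- r | P i) peval (F i) x.
Proof. by rewrite /peval rmorph_prod. Qed.

Lemma peval_sum A (I : Type) (r : seq I) (P : pred I) (F : I -> mpol K A) x :
  peval (\sum_(i <- r | P i) F i) x = \sum_(i <- r | P i) peval (F i) x.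
Proof. by rewrite /peval raddf_sum. Qed.

Lemma peval_ext A (p : mpol K A) (x y : pts K A) : x =1 y -> peval p x = peval p y.
Proof. by move=> xy; apply: meval_eq => i; apply: xy. Qed.

Definition of_vec A (v : 'I_#|mvar A| -> K) : pts K A := fun a => v (enum_rank a).

Lemma peval_of_vec A (p : mpol K A) v : peval p (of_vec v) = p.@[v].
Proof. by apply: meval_eq => i; rewrite /of_vec enum_valK. Qed.

Lemma peval_inj A (p q : mpol K A) : (forall x, peval p x = peval q x) -> p = q.
Proof. by move=> pq; apply: mpoly_eq_fun => v; rewrite -!peval_of_vec. Qed.

Lemma peval_nonroot A (p : mpol K A) : p != 0 -> exists x, peval p x != 0.
Proof. by move/mpoly_nonroot => [v pv]; exists (of_vec v); rewrite peval_of_vec. Qed.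

Lemma peval_null A (f P : mpol K A) : prime_elt f -> ~ divides f P ->
  exists x, peval f x = 0 /\ peval P x != 0.
Proof.
move=> fp /(hypersurface_null fp)[v [fv Pv]].
by exists (of_vec v); rewrite !peval_of_vec.
Qed.

Lemma mpol_factorial A : factorial_ring (mpol K A).
Proof. exact: factorial_mpoly. Qed.

Lemma divides_peval A (f P : mpol K A) x : divides f P -> peval f x = 0 -> peval P x = 0.
Proof. by case=> c ->; rewrite pevalE => ->; rewrite mulr0. Qed.

Definition subst A B (q : form_tuple K A B) (p : mpol K B) : mpol K A :=
  p \mPo [tuple q (enum_val i) | i < #|mvar B|].

Lemma peval_subst A B (q : form_tuple K A B) (p : mpol K B) x :
  peval (subst q p) x = peval p (teval q x).
Proof.
by rewrite /peval comp_mpoly_meval; apply: meval_eq => i; rewrite tnth_mktuple.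
Qed.

Lemma substM A B (q : form_tuple K A B) p1 p2 : subst q (p1 * p2) = subst q p1 * subst q p2.
Proof. by apply: peval_inj => x; rewrite pevalE !peval_subst pevalE. Qed.

Lemma substX A B (q : form_tuple K A B) p k : subst q (p ^+ k) = subst q p ^+ k.
Proof. by apply: peval_inj => x; rewrite pevalE !peval_subst pevalE. Qed.

Lemma substB A B (q : form_tuple K A B) p1 p2 : subst q (p1 - p2) = subst q p1 - subst q p2.
Proof. by apply: peval_inj => x; rewrite pevalE !peval_subst pevalE. Qed.

Definition curve A (r : mvar A -> {poly K}) (p : mpol K A) : {poly K} :=
  mmap polyC (fun i => r (enum_val i)) p.

Lemma curveE A r (p : mpol K A) s : (curve r p).[s] = peval p (fun v => (r v).[s]).
Proof.
rewrite /curve /peval; elim/mpolyind: p => [|c m p _ _ IH].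
  by rewrite mmap0 meval0 horner0.
rewrite mmapD mevalD hornerD IH mmapZ mevalZ hornerM hornerC mmapX mevalX.
by rewrite /mmap1 horner_prod; under eq_bigr do rewrite horner_exp.
Qed.

Lemma poly_eq_fun (p q : {poly K}) (r : {poly K}) : r != 0 ->
  (forall s, r.[s] != 0 -> p.[s] = q.[s]) -> p = q.
Proof.
move=> r0 pq; apply/eqP; rewrite -subr_eq0; apply/negPn/negP => pq0.
have /closed_nonrootP[s] : (p - q) * r != 0 by rewrite mulf_neq0.
rewrite /root hornerM mulf_eq0 negb_or hornerD hornerN => /andP[ne /pq e].
by rewrite e subrr eqxx in ne.
Qed.

Lemma expr_fun_inj i j : (forall s : K, s ^+ i = s ^+ j) -> i = j.
Proof.
move=> E; have : 'X^i = 'X^j :> {poly K}.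
  by apply: (@poly_eq_fun _ _ 1) => [|s _]; rewrite ?oner_eq0 // !hornerXn.
by move/(congr1 (fun p : {poly K} => size p)); rewrite !size_polyXn => -[].
Qed.

Lemma multihomogM A d e (p q : mpol K A) :
  multihomog d p -> multihomog e q -> multihomog (fun i => d i + e i)%N (p * q).
Proof.
move=> hp hq l x; rewrite !pevalE hp hq mulrACA; congr (_ * _).
by rewrite -big_split; apply: eq_bigr => i _; rewrite exprD.
Qed.

Lemma multihomog_ext A d e (p : mpol K A) : d =1 e -> multihomog d p -> multihomog e p.
Proof. by move=> de hp l x; rewrite hp; congr (_ * _); apply: eq_bigr => i _; rewrite de. Qed.

Lemma multihomog_cst A c : multihomog (fun=> 0%N) (@cst A c).
Proof. by move=> l x; rewrite !pevalE big1 ?mul1r // => i _; rewrite expr0. Qed.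

Lemma multihomog1 A : multihomog (fun=> 0%N) (1 : mpol K A).
Proof. exact: multihomog_cst. Qed.

Lemma multihomog_prod A (I : eqType) (r : seq I) (d : I -> mfac A -> nat) (F : I -> mpol K A) :
  (forall i, i \in r -> multihomog (d i) (F i)) ->
  multihomog (fun j => \sum_(i <- r) d i j)%N (\prod_(i <- r) F i).
Proof.
elim: r => [|i r IHr] H.
  rewrite big_nil; apply: multihomog_ext (@multihomog1 A) => j; by rewrite big_nil.
rewrite big_cons; have Hi := H i (mem_head _ _).
apply: multihomog_ext (multihomogM Hi (IHr _)) => [j|k kr]; first by rewrite big_cons.
by apply: H; rewrite inE kr orbT.
Qed.

Lemma multihomogX A d (p : mpol K A) k : multihomog d p -> multihomog (fun i => d i * k)%N (p ^+ k).
Proof.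
move=> hp l x; rewrite !pevalE hp exprMn -prodrXl; congr (_ * _).
by apply: eq_bigr => i _; rewrite exprM.
Qed.

Lemma multihomogD A d (p q : mpol K A) : multihomog d p -> multihomog d q -> multihomog d (p + q).
Proof. by move=> hp hq l x; rewrite !pevalE hp hq mulrDr. Qed.

Lemma multihomogZ A d c (p : mpol K A) : multihomog d p -> multihomog d (c *: p).
Proof. by move=> hp l x; rewrite !pevalE hp mulrCA. Qed.

Lemma multihomogB A d (p q : mpol K A) : multihomog d p -> multihomog d q -> multihomog d (p - q).
Proof. by move=> hp hq l x; rewrite !pevalE hp hq mulrBr. Qed.

Lemma multihomog_sum A d (I : eqType) (r : seq I) (F : I -> mpol K A) :
  (forall i, i \in r -> multihomog d (F i)) -> multihomog d (\sum_(i <- r) F i).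
Proof.
elim: r => [|i r IHr] H; first by rewrite big_nil => l x; rewrite !pevalE mulr0.
rewrite big_cons; apply: multihomogD; first by apply: H; rewrite mem_head.
by apply: IHr => j jr; apply: H; rewrite inE jr orbT.
Qed.

Lemma prod_delta (I : finType) (i : I) (l : I -> K) : \prod_j l j ^+ (j == i) = l i.
Proof.
rewrite (bigD1 i) //= eqxx expr1 big1 ?mulr1 // => j /negPf ->; exact: expr0.
Qed.

Lemma multihomog_var A v : multihomog (fun i => (i == blk v) : nat) (@var A v).
Proof. by move=> l x; rewrite !pevalE prod_delta. Qed.

Lemma rescale_comp A (l l' : mfac A -> K) x :
  rescale l (rescale l' x) = rescale (fun i => l i * l' i) x.
Proof. by apply/funext => v; rewrite /rescale mulrA. Qed.

Lemma rescale1 A (x : pts K A) : rescale (fun=> 1) x = x.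
Proof. by apply/funext => v; rewrite /rescale mul1r. Qed.

Lemma same_ptxx A (x : pts K A) : same_pt x x.
Proof. by exists (fun=> 1); rewrite rescale1; split=> // i; rewrite oner_eq0. Qed.

Lemma same_pt_sym A (x y : pts K A) : same_pt x y -> same_pt y x.
Proof.
case=> l [l0 ->]; exists (fun i => (l i)^-1); split=> [i|]; first by rewrite invr_eq0.
rewrite rescale_comp -[LHS]rescale1; congr (rescale _ _).
by apply/funext => i; rewrite mulVf.
Qed.

Lemma same_pt_trans A (x y z : pts K A) : same_pt x y -> same_pt y z -> same_pt x z.
Proof.
case=> l [l0 ->] [k [k0 ->]]; exists (fun i => k i * l i).
by rewrite rescale_comp; split=> // i; rewrite mulf_neq0.
Qed.

Lemma prodX_neq0 (I : finType) (l : I -> K) (d : I -> nat) :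
  (forall i, l i != 0) -> \prod_i l i ^+ d i != 0.
Proof. by move=> l0; apply/prodf_neq0 => i _; rewrite expf_neq0. Qed.

Lemma multihomog_same A d (p : mpol K A) x y : multihomog d p -> same_pt x y ->
  (peval p y == 0) = (peval p x == 0).
Proof. by move=> hp [l [l0 ->]]; rewrite hp mulf_eq0 (negPf (prodX_neq0 _ l0)). Qed.

Lemma is_point_rescale A (l : mfac A -> K) (x : pts K A) : (forall i, l i != 0) ->
  is_point x -> is_point (rescale l x).
Proof.
move=> l0 xp i; have [v [<- xv]] := xp i; exists v.
by rewrite /rescale mulf_neq0.
Qed.

Lemma same_pt_is_point A (x y : pts K A) : same_pt x y -> is_point x -> is_point y.
Proof. by case=> l [l0 ->]; apply: is_point_rescale. Qed.

Lemma zclosure_vanish A (S : subpts K A) d p : multihomog d p ->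
  (forall x, S x -> is_point x) -> (vanish (zclosure S) p <-> vanish S p).
Proof.
move=> hp Sp; split=> [H x Sx|H x [_ /(_ d p hp H)] //].
by apply: H; split=> [|e q hq]; [exact: Sp|apply].
Qed.

Lemma zclosure_closed A (S : subpts K A) : closed_set (zclosure S).
Proof.
exists (fun p => (exists d, multihomog d p) /\ vanish S p).
split=> [p []//|x]; split=> -[xp H]; split=> //.
  by move=> p [[d hp] vp]; apply: (H d).
by move=> d p hp vp; apply: H; split=> //; exists d.
Qed.

Lemma closed_point A (Y : subpts K A) x : closed_set Y -> Y x -> is_point x.
Proof. by case=> E [_ YE] /YE[]. Qed.

Lemma closed_same A (Y : subpts K A) x y : closed_set Y -> same_pt x y -> Y x -> Y y.
Proof.
case=> E [Eh YE] xy /YE[xp xE]; apply/YE; split; first exact: same_pt_is_point xy xp.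
move=> p Ep; have [d hp] := Eh p Ep.
by apply/eqP; rewrite (multihomog_same hp xy) xE.
Qed.

Lemma form_closed A d (p : mpol K A) : multihomog d p ->
  closed_set (fun x => is_point x /\ peval p x = 0).
Proof.
move=> hp; exists (eq^~ p); split=> [q ->|x]; first by exists d.
by split=> -[xp H]; split=> //; [move=> q -> | apply: H].
Qed.

Lemma irreducible_vanishM A (Y : subpts K A) d e p q : irreducible_set Y ->
  (forall x, Y x -> is_point x) -> multihomog d p -> multihomog e q ->
  vanish Y (p * q) -> vanish Y p \/ vanish Y q.
Proof.
move=> [_ irr] Yp hp hq H.
have [x Yx|Y1|Y2] := irr _ _ (form_closed hp) (form_closed hq).
- have /eqP := H x Yx; rewrite pevalE mulf_eq0 => /orP[]/eqP E; [left|right]; split=> //; exact: Yp.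
- by left=> x /Y1[].
- by right=> x /Y2[].
Qed.

Lemma irreducible_vanishX A (Y : subpts K A) d p k : irreducible_set Y ->
  (forall x, Y x -> is_point x) -> multihomog d p -> vanish Y (p ^+ k) -> vanish Y p.
Proof.
move=> iY Yp hp; elim: k => [|k IHk] H.
  by have [[x Yx] _] := iY; have := H x Yx; rewrite expr0 peval1 => /eqP; rewrite oner_eq0.
have [|//|//] := irreducible_vanishM iY Yp hp (multihomogX k hp).
by rewrite -exprS.
Qed.

(** A closed set not containing the closure lies in the zeros of a form that does not vanish on S.
    If two such sets covered the closure, the product of their forms would vanish on S. *)
Lemma vanish_prime_irreducible A (S : subpts K A) : (exists x, S x) -> (forall x, S x -> is_point x) ->
  (forall d e p q, multihomog d p -> multihomog e q -> vanish S (p * q) -> vanish S p \/ vanish S q) ->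
  irreducible_set (zclosure S).
Proof.
move=> [x Sx] Sp SP; split=> [|Y1 Y2 c1 c2 H].
  by exists x; split=> [|d p _ /(_ _ Sx)]; first exact: Sp.
apply: contrapT => /not_orP[n1 n2].
have ex Y : closed_set Y -> ~ subpt (zclosure S) Y -> exists d p, multihomog d p /\
    vanish Y p /\ ~ vanish S p.
  move=> [E [Eh YE]] nY; apply: contrapT => nE; apply: nY => y [yp yH]; apply/YE; split=> // p Ep.
  have [d hp] := Eh p Ep; apply: (yH d) => //; apply: contrapT => np; apply: nE.
  by exists d, p; split=> //; split=> // z /YE[_ /(_ p Ep)].
have [d [p [hp [vp np]]]] := ex _ c1 n1; have [e [q [hq [vq nq]]]] := ex _ c2 n2.
have [|//|//] := SP d e p q hp hq => y Sy.
have zy : zclosure S y by split=> [|d' p' _ /(_ _ Sy)]; first exact: Sp.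
by rewrite pevalE; have [/vp->|/vq->] := H y zy; rewrite ?mul0r ?mulr0.
Qed.

End Mproj.

(** * Multiplicity of a prime in a factorial ring *)

Section Multiplicity.
Variables (R : idomainType).
Hypothesis factR : factorial_ring R.
Implicit Types f P Q : R.

Definition mult_is f P m := exists2 h, P = f ^+ m * h & ~ divides f h.

Lemma mult_isM f P Q m k : prime_elt f -> mult_is f P m -> mult_is f Q k ->
  mult_is f (P * Q) (m + k)%N.
Proof.
move=> [_ _ fP] [h -> nh] [g -> ng]; exists (h * g); first by rewrite exprD mulrACA.
by case/fP.
Qed.

Lemma mult_isX f P m k : prime_elt f -> mult_is f P m -> mult_is f (P ^+ k) (m * k)%N.
Proof.
move=> fp fP; elim: k => [|k IHk]; last by rewrite exprS mulnS; apply: mult_isM.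
exists 1; rewrite ?muln0 ?mulr1 // => -[c c1]; have [_ fU _] := fp.
by case/negP: fU; apply/unitrPr; exists c; rewrite mulrC -c1.
Qed.

Lemma mult_is0 f P : mult_is f P 0 <-> ~ divides f P.
Proof.
split=> [[h -> nh]|nP]; first by rewrite expr0 mul1r.
by exists P; rewrite ?expr0 ?mul1r.
Qed.

Lemma mult_is_uniq f P m k : prime_elt f -> mult_is f P m -> mult_is f P k -> m = k.
Proof.
move=> [f0 _ _]; wlog lemk : m k / (m <= k)%N => [W|] Pm Pk.
  by have [/W->|/ltnW/W->] := leqP m k.
case: Pm Pk => h -> nh [g]; rewrite -(subnKC lemk) exprD -mulrA => /(mulfI (expf_neq0 _ f0)) E _.
case: (k - m)%N E => [|j] E; first by rewrite addn0.
by case: nh; exists (f ^+ j * g); rewrite E exprS; ring.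
Qed.

Lemma mult_is_ex f P : prime_elt f -> P != 0 -> exists m, mult_is f P m.
Proof.
move=> fp /factR[u [s [uU]]]; elim: s P => [|p s IHs] P sP ->.
  exists 0%N; apply/mult_is0; rewrite big_nil mulr1 => -[c uE].
  by have [_ fU _] := fp; move: uU; rewrite uE unitrM (negPf fU) andbF.
rewrite big_cons mulrCA; have [|m mE] := IHs _ _ erefl.
  by move=> q qs; apply: sP; rewrite inE qs orbT.
have pp : prime_elt p by apply: sP; rewrite mem_head.
have [[c pE]|np] := pselect (divides f p); last first.
  by exists (0 + m)%N; apply: mult_isM => //; apply/mult_is0.
exists (1 + m)%N; apply: mult_isM => //; exists c; first by rewrite expr1 mulrC.
case=> d cE; have [p0 _ pP] := pp; have [f0 fU _] := fp.
have fne : f * f * d = p by rewrite pE cE; ring.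
have [|[e eE]|[e eE]] := pP f (f * d); first by exists 1; rewrite mulrA fne mul1r.
  case/negP: fU; apply/unitrPr; exists (e * d); apply: (mulfI f0).
  by rewrite mulr1 [RHS]eE -fne; ring.
have fd0 : f * d != 0 by apply: contraNneq p0; rewrite -fne -mulrA => ->; rewrite mulr0.
case/negP: fU; apply/unitrPr; exists e; apply: (mulfI fd0).
by rewrite mulr1 [RHS]eE -fne; ring.
Qed.

End Multiplicity.

(** * Semi-invariant forms and prime divisors of the moduli space *)

Section SemiInvariants.
Variable K : closedFieldType.

(** The factor c, as a function of s, is a polynomial C with C(st) = C(s)C(t). Writing C = D X^k
    with D(0) nonzero, D is again multiplicative, and evaluation at t = 0 gives D(s) = 1. *)
Lemma one_parameter A (act : K -> pts K A -> pts K A) (f : mpol K A) :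
  (forall x v, exists r : {poly K}, forall s, act s x v = r.[s]) ->
  (forall s s' x, act s (act s' x) = act (s * s') x) -> (forall x, act 1 x = x) -> f != 0 ->
  (forall s, s != 0 -> exists c, forall x, peval f (act s x) = c * peval f x) ->
  exists k, forall s x, peval f (act s x) = s ^+ k * peval f x.
Proof.
move=> actP actM act1 /peval_nonroot[x0 fx0] semi.
have exR x : exists R : {poly K}, forall s, peval f (act s x) = R.[s].
  have /choice[r rE] := actP x; exists (curve r f) => s; rewrite curveE.
  by apply: peval_ext => v; apply: rE.
have [R0 R0E] := exR x0.
pose C := (peval f x0)^-1 *: R0.
have CE s : C.[s] = (peval f x0)^-1 * peval f (act s x0) by rewrite hornerZ R0E.
have fC s x : peval f (act s x) = C.[s] * peval f x.
  have [R RE] := exR x; rewrite RE; suff -> : R = peval f x *: C by rewrite hornerZ mulrC.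
  apply: (@poly_eq_fun _ _ _ 'X) => [|a]; first by rewrite polyX_eq0.
  rewrite hornerX => a0; have [c cE] := semi a a0.
  by rewrite -RE hornerZ CE !cE; field.
have C1 : C.[1] = 1 by rewrite CE act1 mulVf.
have CM s s' : C.[s * s'] = C.[s] * C.[s'].
  by apply: (mulIf fx0); rewrite -fC -actM !fC mulrA.
have [k [D D0 CDE]] := multiplicity_XsubC C 0.
have C0 : C != 0 by apply/eqP => C0; move: C1; rewrite C0 horner0 => /esym/eqP; rewrite oner_eq0.
have CD : C = D * 'X^k by rewrite CDE polyC0 subr0.
have D0' : D.[0] != 0 by move: D0; rewrite C0.
have DM s : s != 0 -> D.[s] = 1.
  move=> s0; have : D \Po (s *: 'X) = D.[s] *: D.
    apply: (@poly_eq_fun _ _ _ 'X) => [|a]; first by rewrite polyX_eq0.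
    rewrite hornerX => a0; rewrite horner_comp !hornerZ hornerX.
    have := CM s a; rewrite CD !hornerM !hornerXn exprMn.
    have sk : s ^+ k * a ^+ k != 0 by rewrite mulf_neq0 ?expf_neq0.
    move=> E; apply: (mulIf sk); rewrite E; ring.
  move/(congr1 (fun p => p.[0])); rewrite horner_comp !hornerZ hornerX mulr0.
  by rewrite -{1}[D.[0]]mul1r => /(mulIf D0') <-.
exists k => s x; rewrite fC CD hornerM hornerXn.
have [->|s0] := eqVneq s 0; last by rewrite DM ?mul1r.
suff : D = 1 by move=> ->; rewrite hornerC mul1r.
apply: (@poly_eq_fun _ _ _ 'X) => [|a]; first by rewrite polyX_eq0.
by rewrite hornerX => a0; rewrite DM // hornerC.
Qed.

Lemma semi_multihomog A (f : mpol K A) : f != 0 ->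
  (forall l : mfac A -> K, (forall i, l i != 0) ->
     exists c, forall x, peval f (rescale l x) = c * peval f x) ->
  exists d, multihomog d f.
Proof.
move=> f0 semi.
have /choice[d dE] : forall i, exists k, forall s x,
    peval f (rescale (fun j => if j == i then s else 1) x) = s ^+ k * peval f x.
  move=> i; apply: one_parameter => // [x v|s s' x|x|s s0].
  - rewrite /rescale; case: eqP => _; last by exists (x v)%:P => s; rewrite hornerC mul1r.
    by exists (x v *: 'X) => s; rewrite hornerZ hornerX mulrC.
  - rewrite rescale_comp; congr rescale; apply/funext => j.
    by case: eqP; rewrite ?mulr1.
  - rewrite -[RHS]rescale1; congr rescale; apply/funext => j; by case: eqP.
  - by apply: semi => j; case: (j == i) => //; apply: oner_neq0.
exists d => l x.
have H (r : seq (mfac A)) : uniq r -> peval f (rescale (fun j => if j \in r then l j else 1) x)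
    = \prod_(i <- r) l i ^+ d i * peval f x.
  elim: r => [_|i r IHr /= /andP[ir ur]].
    by rewrite big_nil mul1r (_ : (fun j => _) = fun=> 1) ?rescale1.
  rewrite big_cons -mulrA -(IHr ur) -dE rescale_comp; congr (peval f (rescale _ x)).
  apply/funext => j; rewrite inE; case: eqVneq => [->|_] /=; last by rewrite mul1r.
  by rewrite (negPf ir) mulr1.
rewrite -(H _ (index_enum_uniq _)); congr (peval f (rescale _ x)).
by apply/funext => j; rewrite mem_index_enum.
Qed.

Lemma multihomog_uniq A d e (f : mpol K A) : f != 0 -> multihomog d f -> multihomog e f -> d =1 e.
Proof.
move=> /peval_nonroot[x fx] hd he i; apply: expr_fun_inj => s.
have := hd (fun j => if j == i then s else 1) x; rewrite he => /(mulIf fx).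
have E (k : mfac A -> nat) : \prod_j (if j == i then s else 1) ^+ k j = s ^+ k i.
  rewrite (bigD1 i) //= eqxx big1 ?mulr1 // => j /negPf ->; exact: expr1n.
by rewrite !E => ->.
Qed.

Lemma multihomog_const A (f : mpol K A) : multihomog (fun=> 0%N) f -> exists c, f = cst A c.
Proof.
move=> hf; exists (peval f (fun=> 0)); apply: peval_inj => x; rewrite pevalC.
have := hf (fun=> 0) x; rewrite big1 => [|i _]; last by rewrite expr0.
by rewrite mul1r => <-; apply: peval_ext => v; rewrite /rescale mul0r.
Qed.

Lemma cst_unit A c : c != 0 -> (cst A c : mpol K A) \is a GRing.unit.
Proof.
by move=> c0; apply/unitrPr; exists (cst A c^-1); apply: peval_inj => x; rewrite !pevalE divff.
Qed.

(** On the line from x to a rescaled point, u restricts to an invertible polynomial in one variable,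
    hence to a constant; so u is a form of degree 0. *)
Lemma mpol_unitE A (u : mpol K A) : u \is a GRing.unit -> exists2 c, c != 0 & u = cst A c.
Proof.
move=> /unitrPr[v uv].
have nz x : peval u x != 0.
  apply/eqP => ux; have := congr1 (fun q => peval q x) uv.
  by rewrite pevalM ux mul0r peval1 => /esym/eqP; rewrite oner_eq0.
suff H : multihomog (fun=> 0%N) u.
  have [c uE] := multihomog_const H; exists c => //.
  by have := nz (fun=> 0); rewrite uE pevalC.
move=> l x; rewrite big1 ?mul1r => [|i _]; last by rewrite expr0.
pose r v : {poly K} := (x v)%:P + (l (blk v) * x v - x v) *: 'X.
have : size (curve r u) = 1%N.
  have : curve r u * curve r v = 1.
    apply: (@poly_eq_fun _ _ _ 1) => [|s _]; first exact: oner_neq0.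
    by rewrite hornerM !curveE -pevalM uv peval1 hornerC.
  by move=> E; apply/eqP; rewrite -dvdp1 -E dvdp_mulr.
move/eqP/size_poly1P=> [c _ E].
have ev s : peval u (fun w => (r w).[s]) = c by rewrite -curveE E hornerC.
have H0 := ev 0; have H1 := ev 1; rewrite -{}H1 in H0.
transitivity (peval u (fun w => (r w).[1])); last rewrite -H0.
  by apply: peval_ext => w; rewrite /r hornerD hornerC hornerZ hornerX /rescale; ring.
by apply: peval_ext => w; rewrite /r hornerD hornerC hornerZ hornerX mulr0 addr0.
Qed.

End SemiInvariants.

(** * Pull-back of forms to n vectors of the plane K^2 *)

Section Pull.
Variables (K : closedFieldType) (n : nat).

Definition P1n : mproj := @MProj ('I_n * bool)%type 'I_n (fun v => v.1).
Implicit Types (w : pts K P1n) (i j : 'I_n) (f P : mpol K P1n) (p : mpol K (quadP1 n)).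

Definition br w i j : K := w (i, false) * w (j, true) - w (j, false) * w (i, true).
Definition brp i j : mpol K P1n :=
  @var K P1n (i, false) * @var K P1n (j, true) - @var K P1n (j, false) * @var K P1n (i, true).
Definition cr w : pts K (quadP1 n) := cross_ratios (fun i => w (i, false)) (fun i => w (i, true)).

Definition l0 (t : quad n) := lab t ord0.
Definition l1 (t : quad n) := lab t 1%R.
Definition l2 (t : quad n) := lab t 2%:R.
Definition l3 (t : quad n) := lab t 3%:R.

Lemma crE w t b : cr w (t, b) = if b then br w (l0 t) (l2 t) * br w (l1 t) (l3 t)
                                else br w (l0 t) (l1 t) * br w (l2 t) (l3 t).
Proof. by []. Qed.

Definition crp : form_tuple K P1n (quadP1 n) := fun v =>
  if v.2 then brp (l0 v.1) (l2 v.1) * brp (l1 v.1) (l3 v.1)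
  else brp (l0 v.1) (l1 v.1) * brp (l2 v.1) (l3 v.1).

Lemma brpE i j w : peval (brp i j) w = br w i j.
Proof. by rewrite !pevalE. Qed.

Lemma br_ii w i : br w i i = 0.
Proof. by rewrite /br; ring. Qed.

Lemma crpE v w : peval (crp v) w = cr w v.
Proof. by case: v => t b; rewrite /crp crE; case: b; rewrite /= pevalM !brpE. Qed.

Definition pull p : mpol K P1n := subst crp p.

Lemma pullE p w : peval (pull p) w = peval p (cr w).
Proof. by rewrite peval_subst; apply: peval_ext => v; rewrite /teval crpE. Qed.

Lemma pullM p q : pull (p * q) = pull p * pull q. Proof. exact: substM. Qed.
Lemma pullX p k : pull (p ^+ k) = pull p ^+ k. Proof. exact: substX. Qed.
Lemma pullB p q : pull (p - q) = pull p - pull q. Proof. exact: substB. Qed.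

(* GL_2 x (K^* )^n acting on configurations of n vectors of K^2. *)
Definition lin (g : bool -> bool -> K) (t : 'I_n -> K) w : pts K P1n :=
  fun v => t v.1 * (g v.2 false * w (v.1, false) + g v.2 true * w (v.1, true)).
Definition det2 (g : bool -> bool -> K) := g false false * g true true - g false true * g true false.
Definition inv2 (g : bool -> bool -> K) (a b : bool) : K :=
  (det2 g)^-1 * (if a == b then g (~~ a) (~~ b) else - g a b).
Definition id2 (a b : bool) : K := (a == b)%:R.

Lemma lin_id t w : lin id2 t w = @rescale K P1n t w.
Proof.
apply/funext => -[i b]; rewrite /lin /rescale /id2 /=.
by case: b; rewrite /= !(mul1r, mul0r, addr0, add0r).
Qed.

Lemma lin_inv g t w : det2 g != 0 -> (forall i, t i != 0) ->
  lin (inv2 g) (fun i => (t i)^-1) (lin g t w) = w.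
Proof.
move=> g0 t0; apply/funext => -[i b]; rewrite /lin /inv2 /=; have ti := t0 i.
transitivity ((t i)^-1 * t i * ((det2 g)^-1 * det2 g) * w (i, b)).
  by move: (det2 g)^-1 => Di; rewrite /det2; case: b; rewrite /=; ring.
by rewrite !mulVf // !mul1r.
Qed.

Lemma det2_invE g : det2 g != 0 -> det2 (inv2 g) = (det2 g)^-1.
Proof.
move=> g0; apply: (mulfI g0); rewrite divff //.
transitivity (det2 g * ((det2 g)^-1 * (det2 g)^-1 * det2 g)); last by field.
by rewrite /inv2; move: (det2 g)^-1 => Di; rewrite /det2 /=; ring.
Qed.

Lemma det2_inv g : det2 g != 0 -> det2 (inv2 g) != 0.
Proof.
by move=> g0; rewrite det2_invE // invr_eq0.
Qed.

Lemma br_lin g t w i j : br (lin g t w) i j = t i * t j * det2 g * br w i j.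
Proof. by rewrite /br /lin /det2 /=; ring. Qed.

(** The factor c is not named: the property has to be inherited by prime factors ([semi_factor]),
    where no formula for it is at hand. *)
Definition semi f := forall g t, det2 g != 0 -> (forall i, t i != 0) ->
  exists c, forall w, peval f (lin g t w) = c * peval f w.

Lemma semi_br i j : semi (brp i j).
Proof.
by move=> g t _ _; exists (t i * t j * det2 g) => w; rewrite !brpE br_lin.
Qed.

Lemma cr_lin g t w : cr (lin g t w) =
  @rescale K (quadP1 n) (fun q => det2 g ^+ 2 * (t (l0 q) * t (l1 q) * t (l2 q) * t (l3 q))) (cr w).
Proof. by apply/funext => -[q b]; rewrite /rescale !crE !br_lin; case: b => /=; ring. Qed.

Lemma semi_pull d p : multihomog d p -> semi (pull p).
Proof.
move=> hp g t _ _; rewrite /=.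
exists (\prod_q (det2 g ^+ 2 * (t (l0 q) * t (l1 q) * t (l2 q) * t (l3 q))) ^+ d q) => w.
by rewrite !pullE cr_lin hp.
Qed.

Definition linp g t : form_tuple K P1n P1n := fun v =>
  (t v.1 * g v.2 false) *: @var K P1n (v.1, false) + (t v.1 * g v.2 true) *: @var K P1n (v.1, true).

Lemma linpE f g t w : peval (subst (linp g t) f) w = peval f (lin g t w).
Proof.
rewrite peval_subst; apply: peval_ext => v.
by rewrite /teval /linp /lin !pevalE; ring.
Qed.

Lemma semi_neq0 f g t c : f != 0 -> det2 g != 0 -> (forall i, t i != 0) ->
  (forall w, peval f (lin g t w) = c * peval f w) -> c != 0.
Proof.
move=> /peval_nonroot[w fw] g0 t0 E; apply: contraNneq fw => c0.
have ti i : (t i)^-1 != 0 by rewrite invr_eq0.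
have gi := det2_inv g0.
rewrite -(lin_inv w g0 t0).
have : lin g t (lin (inv2 g) (fun i => (t i)^-1) w) = w.
  rewrite -[RHS](lin_inv w gi ti); congr (lin _ _ _); last first.
    by apply/funext => i; rewrite invrK.
  apply/funext => a; apply/funext => b; rewrite {1}/inv2 det2_invE //.
  by rewrite invrK /inv2; case: a b => -[] /=; rewrite ?mulrN mulrA divff // mul1r ?opprK.
by move=> H; rewrite lin_inv // -H E c0 mul0r.
Qed.

End Pull.

Section Factors.
Variables (K : closedFieldType) (n : nat).
Local Notation P1n := (P1n n).
Implicit Types (w : pts K P1n) (i j : 'I_n) (f P Q : mpol K P1n).

Lemma fact_divisor (R : idomainType) (f P u : R) s : prime_elt f -> u \is a GRing.unit ->
  P = u * \prod_(q <- s) q -> divides f P -> exists2 q, q \in s & divides f q.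
Proof.
move=> fp uU -> ; have [_ fU fP] := fp.
case/fP => [[c uE]|]; first by move: uU; rewrite uE unitrM (negPf fU) andbF.
rewrite big_seq => /(divides_prod fp)[q]; by exists q.
Qed.

Lemma prime_assoc (R : idomainType) (f q : R) : prime_elt f -> prime_elt q -> divides f q ->
  exists2 c, c \is a GRing.unit & q = c * f.
Proof.
move=> [f0 fU _] [q0 qU qP] [c qE]; exists c => //.
have [|[d dE]|[d dE]] := qP c f; first by exists 1; rewrite mul1r.
  case/negP: fU; apply/unitrPr; exists d.
  have cd0 : c != 0 by apply: contraNneq q0 => c0; rewrite qE c0 mul0r.
  by apply: (mulfI cd0); rewrite mulr1 [RHS]dE qE; ring.
by apply/unitrPr; exists d; apply: (mulfI f0); rewrite mulr1 [RHS]dE qE; ring.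
Qed.

Lemma lin_prime f g t : det2 g != 0 -> (forall i, t i != 0) -> prime_elt f ->
  prime_elt (subst (linp g t) f).
Proof.
move=> g0 t0; have ti i : (t i)^-1 != 0 by rewrite invr_eq0.
have gi := det2_inv g0.
have lin_inv' w : lin g t (lin (inv2 g) (fun i => (t i)^-1) w) = w.
  rewrite -[RHS](lin_inv w gi ti); congr (lin _ _ _); last first.
    by apply/funext => i; rewrite invrK.
  apply/funext => a; apply/funext => b; rewrite {1}/inv2 det2_invE // invrK /inv2.
  by case: a b => -[] /=; rewrite ?mulrN mulrA divff // mul1r ?opprK.
apply: (@iso_prime_inv _ _ _ (subst (linp (inv2 g) (fun i => (t i)^-1)))).
- by move=> p; apply: peval_inj => w; rewrite !linpE lin_inv'.
- by move=> p; apply: peval_inj => w; rewrite !linpE lin_inv.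
- by apply: peval_inj => w; rewrite linpE !peval0.
- by apply: peval_inj => w; rewrite linpE !peval1.
- by move=> p q; rewrite substM.
Qed.

(* The line through 1 and h in the group meets finitely many prime factors of P up
   to units, so f composed with any element of that line stays proportional to f. *)
Lemma semi_factor f P : prime_elt f -> P != 0 -> semi P -> divides f P -> semi f.
Proof.
move=> fp P0 sP fP g t g0 t0.
have [u [s [uU sprime PE]]] := mpol_factorial P0.
pose gs (x : K) a b : K := (1 - x) * id2 K a b + x * g a b.
pose ts (x : K) i : K := (1 - x) + x * t i.
pose cur w (v : mvar P1n) : {poly K} :=
  let T i : {poly K} := (1 - 'X) + t i *: 'X in
  let G a b : {poly K} := id2 K a b *: (1 - 'X) + g a b *: 'X in
  T v.1 * (G v.2 false * (w (v.1, false))%:P + G v.2 true * (w (v.1, true))%:P).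
have curE w v x : (cur w v).[x] = lin (gs x) (ts x) w v.
  by rewrite /cur /lin /gs /ts !(hornerD, hornerM, hornerZ, hornerC, hornerX, hornerN); ring.
pose F w := curve (cur w) f.
have FE w x : (F w).[x] = peval f (lin (gs x) (ts x) w).
  by rewrite curveE; apply: peval_ext => v; rewrite curE.
have gs1 : gs 1 = g.
  by apply/funext => a; apply/funext => b; rewrite /gs; ring.
have ts1 : ts 1 = t by apply/funext => i; rewrite /ts; ring.
have lin0 w : lin (gs 0) (ts 0) w = w.
  have -> : gs 0 = @id2 K by apply/funext => a; apply/funext => b; rewrite /gs; ring.
  have -> : ts 0 = fun=> 1 by apply/funext => i; rewrite /ts; ring.
  by rewrite lin_id rescale1.
pose G a b : {poly K} := id2 K a b *: (1 - 'X) + g a b *: 'X.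
pose good : {poly K} := (G false false * G true true - G false true * G true false) *
  \prod_i ((1 - 'X) + t i *: 'X).
have goodE x : good.[x] = det2 (gs x) * \prod_i ts x i.
  rewrite /good hornerM horner_prod; congr (_ * _).
    by rewrite /det2 /gs /G !(hornerD, hornerM, hornerZ, hornerC, hornerX, hornerN); ring.
  by apply: eq_bigr => i _; rewrite /ts !(hornerD, hornerZ, hornerC, hornerX, hornerN); ring.
have good0 : good != 0.
  have : good.[1] != 0.
    by rewrite goodE gs1 ts1 mulf_neq0 //; apply/prodf_neq0 => i _.
  by apply: contraNneq => ->; rewrite horner0.
(* [D q w w'] vanishes identically when, along the line, f composed with the group element is
   proportional to q as far as w and w' can tell. If every factor q of P had a nonzero [D], some
   invertible element of the line would avoid the zeros of all of them. *)
pose D q w w' := F w * (peval q w')%:P - F w' * (peval q w)%:P.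
have [q qs Dq] : exists2 q, q \in s & forall w w', D q w w' = 0.
  apply: contrapT => H.
  have /choice[W WE] : forall q, exists ww, q \in s -> D q ww.1 ww.2 != 0.
    move=> q; have [qs|_] := boolP (q \in s); last by exists (fun=> 0, fun=> 0).
    apply: contrapT => nW; apply: H; exists q => // w w'; apply/eqP/negPn/negP => ne.
    by apply: nW; exists (w, w').
  have /closed_nonrootP[x] : good * \prod_(q <- s) D q (W q).1 (W q).2 != 0.
    by rewrite mulf_neq0 // prodf_seq_neq0; apply/allP => q /WE.
  rewrite /root hornerM mulf_eq0 negb_or goodE mulf_eq0 negb_or => /andP[/andP[gx tx] Dx].
  have tx' i : ts x i != 0 by move/prodf_neq0: tx; apply.
  have [c cE] := sP _ _ gx tx'.
  have c0 := semi_neq0 P0 gx tx' cE.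
  have fxp := lin_prime gx tx' fp.
  have dfx : divides (subst (linp (gs x) (ts x)) f) P.
    case: fP => h hE; exists (cst P1n c^-1 * subst (linp (gs x) (ts x)) h).
    apply: peval_inj => w; rewrite !pevalE !linpE; apply: (mulfI c0).
    by rewrite -cE hE !pevalE; field.
  have [q qs dq] := fact_divisor fxp uU PE dfx.
  have [e eU qE] := prime_assoc fxp (sprime q qs) dq.
  have [k k0 kE] := mpol_unitE eU.
  move: Dx; rewrite horner_prod prodf_seq_neq0 => /allP/(_ q qs).
  rewrite /D !hornerE !FE qE kE !pevalE !linpE => /eqP; apply; ring.
have [w0 fw0] := peval_nonroot (let: And3 f0 _ _ := fp in f0).
have q0 : q != 0 by case: (sprime q qs).
have [w1 qw1] := peval_nonroot q0.
have D0 w w' : peval f w * peval q w' = peval f w' * peval q w.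
  have /(congr1 (fun p => p.[0])) := Dq w w'.
  by rewrite /D !hornerE !FE !lin0 => /eqP; rewrite subr_eq0 => /eqP.
have D1 w w' : peval f (lin g t w) * peval q w' = peval f (lin g t w') * peval q w.
  have /(congr1 (fun p => p.[1])) := Dq w w'.
  by rewrite /D !hornerE !FE !gs1 !ts1 => /eqP; rewrite subr_eq0 => /eqP.
have qw0 : peval q w0 != 0.
  by apply: contraNneq qw1 => e; have := D0 w0 w1; rewrite e mulr0 => /eqP; rewrite mulf_eq0 (negPf fw0).
exists (peval f (lin g t w0) / peval f w0) => w.
have E1 := D1 w w0; have E0 := D0 w w0.
by apply: (mulIf qw0); rewrite E1 -[RHS]mulrA E0; field.
Qed.

Lemma semi_quot f h : f != 0 -> h != 0 -> semi f -> semi (f * h) -> semi h.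
Proof.
move=> f0 h0 sf sfh g t g0 t0.
have [c cE] := sf g t g0 t0; have [d dE] := sfh g t g0 t0.
have c0 := semi_neq0 f0 g0 t0 cE.
exists (c^-1 * d) => w; have : f * (cst P1n c * subst (linp g t) h - cst P1n d * h) = 0.
  apply: peval_inj => x; rewrite !pevalE linpE.
  by have := dE x; rewrite !pevalE cE => E; rewrite mulrBr !mulrA [_ * c]mulrC E; ring.
move/eqP; rewrite mulf_eq0 (negPf f0) subr_eq0 => /eqP /(congr1 (fun q => peval q w)).
by rewrite !pevalE linpE -mulrA => <-; rewrite mulKf.
Qed.

Lemma semi_homog f : f != 0 -> semi f -> exists d, multihomog d f.
Proof.
move=> f0 sf; apply: semi_multihomog => // l l0.
have d0 : det2 (@id2 K) != 0.
  by rewrite /det2 /id2 /= mulr1 mulr0 subr0 oner_neq0.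
by have [c cE] := sf (@id2 K) l d0 l0; exists c => x; rewrite -cE lin_id.
Qed.

(** The matrices diag(s, 1) and diag(1, s) multiply f by s^k0 and s^k1; exchanging the two
    coordinates shows k0 = k1, and the product of these matrices, the scalar s, acts by s to the
    total degree. *)
Lemma semi_even f d : f != 0 -> semi f -> multihomog d f -> ~~ odd (\sum_i d i).
Proof.
move=> f0 sf hd.
pose gd a s (x y : bool) : K := if x == y then (if x == a then s else 1) else 0.
have one_ne : forall i : 'I_n, (1 : K) != 0 by move=> _; apply: oner_neq0.
have gdE a s : det2 (gd a s) = s.
  by rewrite /det2 /gd; case: a => /=; ring.
have ex a : exists k, forall s x, peval f (lin (gd a s) (fun=> 1) x) = s ^+ k * peval f x.
  apply: one_parameter => // [x [i b]|s s' x|x|s s0].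
  - rewrite /lin /gd /=; case: b; case: a => /=;
      [exists (x (i, true) *: 'X)|exists (x (i, true))%:P|exists (x (i, false))%:P|exists (x (i, false) *: 'X)];
      by move=> s; rewrite ?hornerZ ?hornerX ?hornerC; ring.
  - by apply/funext => -[i b]; rewrite /lin /gd; case: a b => -[] /=; ring.
  - by apply/funext => -[i b]; rewrite /lin /gd; case: a b => -[] /=; ring.
  - by apply: sf => //; rewrite gdE.
have [k0 k0E] := ex false; have [k1 k1E] := ex true.
have kd : (k0 + k1 = \sum_i d i)%N.
  have [x fx] := peval_nonroot f0; apply: (@expr_fun_inj K) => s; apply: (mulIf fx).
  rewrite exprD -mulrA -k1E -k0E -prodrXr -(hd (fun=> s)); apply: peval_ext => -[i b].
  by rewrite /lin /gd /rescale; case: b => /=; ring.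
pose sw (x y : bool) : K := (x != y)%:R.
have sw0 : det2 sw != 0 by rewrite /det2 /sw /= mulr0 mulr1 sub0r oppr_eq0 oner_neq0.
have [c cE] := sf sw (fun=> 1) sw0 one_ne.
have c0 := semi_neq0 f0 sw0 one_ne cE.
have k01 : k0 = k1.
  have [x fx] := peval_nonroot f0; apply: (@expr_fun_inj K) => s.
  apply: (mulIf fx); apply: (mulfI c0); rewrite mulrCA -cE -k0E -k1E -cE.
  by apply: peval_ext => -[i b]; rewrite /lin /gd /sw; case: b => /=; ring.
by rewrite -kd k01 addnn odd_double.
Qed.

Lemma brp_neq0 i j : i != j -> brp K i j != 0.
Proof.
move=> ij; suff : peval (brp K i j) (fun v => (v == (i, false))%:R + (v == (j, true))%:R) != 0.
  by apply: contraNneq => ->; rewrite peval0.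
have ji : (j == i) = false by rewrite eq_sym (negPf ij).
rewrite brpE /br !xpair_eqE !eqxx ji (negPf ij) /=.
by rewrite !(addr0, add0r, mul0r, mulr0, subr0, mulr1) oner_neq0.
Qed.

Definition deg2 i j : mfac P1n -> nat := fun k => ((k == i) + (k == j))%N.

Lemma brp_multihomog i j : multihomog (deg2 i j) (brp K i j).
Proof.
apply: multihomogB; first exact: (multihomogM (@multihomog_var K P1n (i, false)) (@multihomog_var K P1n (j, true))).
apply: (multihomog_ext (d := deg2 j i)); first by move=> k; rewrite /deg2 addnC.
exact: (multihomogM (@multihomog_var K P1n (j, false)) (@multihomog_var K P1n (i, true))).
Qed.

(** Being semi-invariant, f has even total degree, while its degree is at most 1 in each of i, j and
    0 elsewhere; so it is the degree of [ij] or 0, and the latter would make f a unit. *)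
Lemma prime_brp_homog f i j : i != j -> prime_elt f -> divides f (brp K i j) ->
  multihomog (deg2 i j) f.
Proof.
move=> ij fp fij; have [f0 fU _] := fp.
have b0 := brp_neq0 ij.
have sf := semi_factor fp b0 (@semi_br K n i j) fij.
have [h hE] := fij; have h0 : h != 0 by apply: contraNneq b0 => h0; rewrite hE h0 mul0r.
have sh : semi h by apply: (@semi_quot f) => //; rewrite mulrC -hE; apply: semi_br.
have [d hd] := semi_homog f0 sf; have [e he] := semi_homog h0 sh.
have E k : (d k + e k = deg2 i j k)%N.
  have H : multihomog (fun k => d k + e k)%N (brp K i j) by rewrite hE mulrC; apply: multihomogM.
  exact: (multihomog_uniq b0 H (@brp_multihomog i j)).
have dle k : (d k <= deg2 i j k)%N by rewrite -E leq_addr.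
have dif : d i = d j.
  have := semi_even f0 sf hd; rewrite (bigD1 i) //= (bigD1 j) 1?eq_sym //= big1; last first.
    move=> k /andP[ki kj]; apply/eqP.
    by have := dle k; rewrite /deg2 (negPf ki) (negPf kj) leqn0.
  have := dle i; have := dle j; rewrite /deg2 !eqxx (negPf ij) eq_sym (negPf ij).
  by case: (d i) (d j) => [|[|]] // [|[|]].
have := dle i; rewrite {1}/deg2 eqxx (negPf ij) addn0 leq_eqVlt ltnS leqn0 => /orP[|] /eqP di.
  apply: multihomog_ext hd => k; apply/eqP; rewrite eqn_leq dle /deg2.
  have [->|ki] := eqVneq k i; first by rewrite di (negPf ij).
  by have [->|kj] := eqVneq k j; rewrite // -dif di.
suff /multihomog_const[c fE] : multihomog (fun=> 0%N) f.
  by case/negP: fU; rewrite fE cst_unit //; apply: contraNneq f0 => c0; rewrite fE c0 /cst mpolyC0.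
apply: multihomog_ext hd => k; have [->//|ki] := eqVneq k i.
have [->|kj] := eqVneq k j; first by rewrite -dif.
by apply/eqP; have := dle k; rewrite /deg2 (negPf ki) (negPf kj) leqn0.
Qed.

Lemma prime_brp_uniq f i j k l : i != j -> k != l -> prime_elt f ->
  divides f (brp K i j) -> divides f (brp K k l) -> [set i; j] = [set k; l].
Proof.
move=> ij kl fp fij fkl; have [f0 _ _] := fp.
have E := multihomog_uniq f0 (prime_brp_homog ij fp fij) (prime_brp_homog kl fp fkl).
apply/setP => x; rewrite !inE; have := E x; rewrite /deg2.
by do 4!case: eqP => //= _.
Qed.

(** Each prime factor already has the multidegree of [ij], so its cofactor is a constant. *)
Lemma brp_prime i j : i != j -> prime_elt (brp K i j).
Proof.
move=> ij; have b0 := brp_neq0 ij.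
have [u [[|f s] [uU sP bE]]] := mpol_factorial b0.
  have [c c0 cE] := mpol_unitE uU.
  have := multihomog_uniq b0 (@brp_multihomog i j) _ i; rewrite /deg2 eqxx => /(_ (fun=> 0%N)) H.
  suff /H : multihomog (fun=> 0%N) (brp K i j) by [].
  by rewrite bE big_nil mulr1 cE; apply: multihomog_cst.
have fp : prime_elt f by apply: sP; rewrite mem_head.
have fij : divides f (brp K i j).
  by rewrite bE big_cons; exists (u * \prod_(q <- s) q); ring.
have hf := prime_brp_homog ij fp fij; have [f0 _ _] := fp.
have [h hE] := fij; have h0 : h != 0 by apply: contraNneq b0 => h0; rewrite hE h0 mul0r.
have sf := semi_factor fp b0 (@semi_br K n i j) fij.
have sh : semi h by apply: (@semi_quot f) => //; rewrite mulrC -hE; apply: semi_br.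
have [e he] := semi_homog h0 sh.
have E k : (e k + deg2 i j k = deg2 i j k)%N.
  have H : multihomog (fun k => e k + deg2 i j k)%N (brp K i j) by rewrite hE; apply: multihomogM.
  exact: (multihomog_uniq b0 H (@brp_multihomog i j)).
have [|c cE] := @multihomog_const _ _ h.
  by apply: multihomog_ext he => k; apply/eqP; rewrite -(eqn_add2r (deg2 i j k)) E.
have c0 : c != 0 by apply: contraNneq h0 => c0; rewrite cE c0 /cst mpolyC0.
have cU := cst_unit P1n c0; rewrite hE cE; have [_ fU fP] := fp; split.
- by rewrite mulf_neq0 // -cE.
- by rewrite unitrM (negPf fU) andbF.
- have dc a : divides f a -> divides (cst P1n c * f) a.
    by case=> d ->; exists (d * (cst P1n c)^-1); rewrite mulrA divrK.
  move=> a b [d dE]; have : divides f (a * b) by exists (d * cst P1n c); rewrite dE; ring.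
  by case/fP => /dc; [left|right].
Qed.

End Factors.

Lemma ndiv_prod (R : idomainType) (f : R) (I : Type) (r : seq I) (P : pred I) (F : I -> R) : prime_elt f ->
  (forall i, P i -> ~ divides f (F i)) -> ~ divides f (\prod_(i <- r | P i) F i).
Proof. by move=> fp H /(divides_prod fp)[i Pi]; apply: H. Qed.

Lemma ndivM (R : idomainType) (f a b : R) : prime_elt f -> ~ divides f a -> ~ divides f b -> ~ divides f (a * b).
Proof. by move=> [_ _ fP] na nb /fP[]. Qed.

(** * Prime divisors attached to prime factors *)

Section Zf.
Variables (K : closedFieldType) (n : nat).
Hypothesis n_ge5 : (5 <= n)%N.
Local Notation P1n := (P1n n).
Local Notation Q := (quadP1 n).
Implicit Types (w : pts K P1n) (i j a b c : 'I_n) (f P : mpol K P1n) (p : mpol K Q).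

Lemma fresh (s : seq 'I_n) : (size s < n)%N -> exists c, c \notin s.
Proof.
move=> ss; apply/existsP; apply: contraLR ss; rewrite negb_exists -leqNgt => /forallP H.
have /uniq_leq_size : uniq (enum 'I_n) by apply: enum_uniq.
rewrite size_enum_ord; apply => i _; have := H i; by rewrite negbK.
Qed.

(** The cross-ratio of (a, i, b, c) is the coordinate of the point i when a, b, c sit at 0, 1, oo;
    [None] for the labels a, b, c themselves, whose positions are given by [m00]. *)
Definition qd a b c i : option (quad n) := insub [tuple a; i; b; c].

Lemma qdP a b c i t : qd a b c i = Some t -> [/\ l0 t = a, l1 t = i, l2 t = b & l3 t = c].
Proof. by rewrite /qd; case: insubP => // u _ uE [<-]; rewrite /l0 /l1 /l2 /l3 /lab uE. Qed.

Lemma quad_uniq (t : quad n) :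
  [/\ l0 t != l1 t, l0 t != l2 t & l0 t != l3 t] /\ [/\ l1 t != l2 t, l1 t != l3 t & l2 t != l3 t].
Proof.
have := valP t; rewrite /l0 /l1 /l2 /l3 /lab; case: (val t) => -[|x0 [|x1 [|x2 [|x3 [|]]]]] // sz.
rewrite !(tnth_nth x0) /= !inE !negb_or.
by case/and4P=> /and3P[? ? ?] /andP[? ?] ? _; split.
Qed.

Lemma qd_none a b c i : a != b -> a != c -> b != c -> qd a b c i = None -> i \in [:: a; b; c].
Proof.
move=> ab ac bc; rewrite /qd; case: insubP => // ; rewrite /= !inE !negb_or ab ac bc !andbT.
by rewrite !negb_and !negbK (eq_sym a).
Qed.

Definition m00 a b (v : 'I_n * bool) : K :=
  if v.1 == a then v.2%:R else if v.1 == b then 1 else (~~ v.2)%:R.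

(* The points of P^1 normalised so that a, b, c are 0, 1, oo. *)
Definition m0 a b c (x : pts K Q) : pts K P1n := fun v =>
  if qd a b c v.1 is Some t then x (t, v.2) else m00 a b v.

Definition m0p a b c : form_tuple K Q P1n := fun v =>
  if qd a b c v.1 is Some t then @var K Q (t, v.2) else cst Q (m00 a b v).

Lemma m0E a b c x : teval (m0p a b c) x = m0 a b c x.
Proof.
apply/funext => v; rewrite /teval /m0p /m0; case: qd => [t|]; by rewrite pevalE.
Qed.

Definition m0_deg a b c (d : mfac P1n -> nat) : mfac Q -> nat :=
  fun t => (\sum_(i | qd a b c i == Some t) d i)%N.

Lemma m0_homog a b c d P : multihomog d P -> multihomog (m0_deg a b c d) (subst (m0p a b c) P).
Proof.
move=> hP l x.
rewrite !peval_subst !m0E.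
pose l' i := if qd a b c i is Some t then l t else 1.
have -> : m0 a b c (rescale l x) = @rescale K P1n l' (m0 a b c x).
  by apply/funext => v; rewrite /m0 /rescale /l' /=; case: qd => //; rewrite mul1r.
rewrite hP; congr (_ * _).
under [RHS]eq_bigr do rewrite -prodrXr.
rewrite (exchange_big_dep predT) //=; apply: eq_bigr => i _; rewrite /l'.
case: qd => [t|]; last by rewrite big_pred0 // expr1n.
by rewrite (big_pred1 t) // => u; rewrite /= (inj_eq Some_inj) eq_sym.
Qed.

(** The matrix taking the points a, b, c of w to 0, 1, oo: its rows are the linear forms [bc][a -]
    and [ab][- c]; [tT] then scales the vectors a, b, c to their normal forms. *)
Definition gT a b c w (x y : bool) : K :=
  if x then br w a b * (if y then - w (c, false) else w (c, true))
  else br w b c * (if y then w (a, false) else - w (a, true)).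

Definition tT a b c w i : K :=
  if i == a then (br w a b * br w a c)^-1 else
  if i == b then (br w a b * br w b c)^-1 else
  if i == c then (br w a c * br w b c)^-1 else 1.

Definition N3 a b c w := br w a b * br w a c * br w b c.
Definition N3p a b c := brp K a b * brp K a c * brp K b c.

Lemma N3E a b c w : peval (N3p a b c) w = N3 a b c w.
Proof. by rewrite /N3p !pevalM !brpE. Qed.

Lemma gT_det a b c w : det2 (gT a b c w) = - N3 a b c w.
Proof. by rewrite /det2 /gT /N3 /br /=; ring. Qed.

Lemma N3_neq a b c w : N3 a b c w != 0 -> [/\ br w a b != 0, br w a c != 0 & br w b c != 0].
Proof. by rewrite /N3 !mulf_eq0 !negb_or => /andP[/andP[]]. Qed.

Lemma br_neq w i j : br w i j != 0 -> i != j.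
Proof. by apply: contraNneq => ->; rewrite br_ii. Qed.

Lemma tT_neq0 a b c w i : N3 a b c w != 0 -> tT a b c w i != 0.
Proof.
move/N3_neq => [x y z]; rewrite /tT.
case: (i == a); first by rewrite invr_eq0 mulf_neq0.
case: (i == b); first by rewrite invr_eq0 mulf_neq0.
by case: (i == c); rewrite ?invr_eq0 ?mulf_neq0 ?oner_neq0.
Qed.

Lemma m0_cr a b c w : N3 a b c w != 0 ->
  m0 a b c (cr w) = lin (gT a b c w) (tT a b c w) w.
Proof.
move=> /N3_neq [x y z]; have [[ab ac] bc] := (br_neq x, br_neq y, br_neq z).
apply/funext => -[i e]; rewrite /m0 /=; case qE: qd => [t|].
  have [E0 E1 E2 E3] := qdP qE; have [[n1 n2 n3] [n4 n5 n6]] := quad_uniq t.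
  rewrite E0 E1 E2 E3 in n1 n2 n3 n4 n5 n6.
  rewrite -[LHS]/(cr w (t, e)) crE E0 E1 E2 E3 /lin /tT eq_sym (negPf n1) (negPf n4) (negPf n5) /= mul1r /gT.
  by case: e; rewrite /br /=; ring.
have := qd_none ab ac bc qE; rewrite /m00 /lin /tT /gT /= !inE => /or3P[] /eqP ->.
- rewrite !eqxx; case: e => /=.
    apply: (mulfI (mulf_neq0 x y)); rewrite mulVKf ?mulf_neq0 //.
    by rewrite mulr1 /br; ring.
  by rewrite /br; ring.
- rewrite eq_sym (negPf ab) !eqxx; apply: (mulfI (mulf_neq0 x z)); rewrite mulVKf ?mulf_neq0 //.
  by case: e; rewrite /br /=; ring.
- rewrite eq_sym (negPf ac) eq_sym (negPf bc) !eqxx; case: e => /=; first by rewrite /br; ring.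
  apply: (mulfI (mulf_neq0 y z)); rewrite mulVKf ?mulf_neq0 //.
  by rewrite mulr1 /br; ring.
Qed.

Definition discp : mpol K P1n := \prod_(ij : 'I_n * 'I_n | ij.1 != ij.2) brp K ij.1 ij.2.

Lemma discE w : (peval discp w != 0) <-> (forall i j, i != j -> br w i j != 0).
Proof.
rewrite /discp peval_prod; split=> [/prodf_neq0 H i j ij|H].
  by have := H (i, j) ij; rewrite brpE.
by apply/prodf_neq0 => -[i j] /= ij; rewrite brpE H.
Qed.

Lemma discp_neq0 : discp != 0.
Proof. by apply/prodf_neq0 => -[i j] /= ij; apply: brp_neq0. Qed.

Lemma cr_point w : (forall i j, i != j -> br w i j != 0) -> forall v, cr w v != 0.
Proof.
move=> H [t b]; have [[n1 n2 n3] [n4 n5 n6]] := quad_uniq t.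
by rewrite crE; case: b; rewrite mulf_neq0 // H.
Qed.

Lemma M0n_crP x : M0n x <-> exists w, (forall i j, i != j -> br w i j != 0) /\ x = cr w.
Proof.
split=> [[u [v [H ->]]]|[w [H ->]]]; last by exists (fun i => w (i, false)), (fun i => w (i, true)).
by exists (fun k => if k.2 then v k.1 else u k.1).
Qed.

Lemma M0n_point (x : pts K Q) : M0n x -> is_point x.
Proof. by move/M0n_crP => [w [H ->]] t; exists (t, false); split=> //; apply: cr_point. Qed.

Lemma vanish_M0n p : vanish (@M0n n K) p <-> pull p = 0.
Proof.
split=> [H|p0 x /M0n_crP[w [_ ->]]]; last by rewrite -pullE p0 peval0.
apply/eqP; have := discp_neq0; apply: contraNT => pp0; apply/eqP; apply: peval_inj => w.
have : pull p * discp = 0.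
  apply: peval_inj => w'; rewrite pevalM peval0 pullE.
  have [d0|d0] := eqVneq (peval discp w') 0; first by rewrite d0 mulr0.
  by rewrite H ?mul0r //; apply/M0n_crP; exists w'; split=> //; apply/discE.
by move/eqP; rewrite mulf_eq0 (negPf pp0) => /eqP ->.
Qed.

Lemma vanish_Mbar d p : multihomog d p -> (vanish (@Mbar n K) p <-> pull p = 0).
Proof. by move=> hp; rewrite -vanish_M0n; apply: zclosure_vanish hp M0n_point. Qed.

Lemma cr_Mbar w : is_point (cr w) -> Mbar (cr w).
Proof. by move=> wp; split=> // d p hp /vanish_M0n p0; rewrite -pullE p0 peval0. Qed.

Lemma Mbar_point (x : pts K Q) : Mbar x -> is_point x.
Proof. by case. Qed.

Lemma closed_Mbar : closed_set (@Mbar n K).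
Proof. exact: zclosure_closed. Qed.

(** The brackets in the two coordinates of a cross-ratio belong to different pairs of labels, and a
    prime divides the bracket of one pair only. *)
Lemma crp_ndiv f (t : quad n) : prime_elt f -> exists e, ~ divides f (crp K (t, e)).
Proof.
move=> fp; apply: contrapT => H.
have {}H e : divides f (crp K (t, e)) by apply: contrapT => nd; apply: H; exists e.
have [[n1 n2 n3] [n4 n5 n6]] := quad_uniq t; have [_ _ fP] := fp.
have := H true; have := H false; rewrite /crp /=.
have F i j k l : i != j -> k != l -> i \notin [:: k; l] -> divides f (brp K i j) ->
    ~ divides f (brp K k l).
  move=> ij kl ikl d1 d2; have := prime_brp_uniq ij kl fp d1 d2 => /setP/(_ i).
  by rewrite !inE eqxx /=; move: ikl; rewrite !inE negb_or => /andP[/negPf-> /negPf->].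
have F' i j k l : i != j -> k != l -> j \notin [:: k; l] -> divides f (brp K i j) ->
    ~ divides f (brp K k l).
  move=> ij kl ikl d1 d2; have := prime_brp_uniq ij kl fp d1 d2 => /setP/(_ j).
  by rewrite !inE eqxx orbT /=; move: ikl; rewrite !inE negb_or => /andP[/negPf-> /negPf->].
move=> /fP[] d1 /fP[] d2.
- by apply: (F' _ _ _ _ _ _ _ d1 d2); rewrite // !inE negb_or eq_sym n1 n4.
- by apply: (F _ _ _ _ _ _ _ d1 d2); rewrite // !inE negb_or n1 n3.
- by apply: (F' _ _ _ _ _ _ _ d1 d2); rewrite // !inE negb_or eq_sym n3 eq_sym n6.
- by apply: (F _ _ _ _ _ _ _ d1 d2); rewrite // !inE negb_or eq_sym n4 n6.
Qed.

(** A prime divides at most one coordinate of each cross-ratio; adding the other one to the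
    polynomials to be avoided keeps all cross-ratios of w defined. *)
Lemma generic_pt f P : prime_elt f -> ~ divides f P ->
  exists w, [/\ peval f w = 0, peval P w != 0 & is_point (cr w)].
Proof.
move=> fp nP; have /choice[bt btP] : forall t, exists e, ~ divides f (crp K (t, e)).
  by move=> t; apply: crp_ndiv.
have nQ : ~ divides f (P * \prod_t crp K (t, bt t)).
  by apply: ndivM => //; apply: ndiv_prod => // i _.
have [w [fw]] := peval_null fp nQ; rewrite pevalM mulf_eq0 negb_or peval_prod => /andP[Pw /prodf_neq0 H].
exists w; split=> // t; exists (t, bt t); split=> //.
by have := H t isT; rewrite crpE.
Qed.

(** A prime divides the bracket of a single pair at most, and avoiding one label of that pair avoids
    it. Two primes exclude two labels, and n >= 5 leaves three. *)
Lemma triple f f' : prime_elt f -> prime_elt f' ->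
  exists a b c, ~ divides f (N3p a b c) /\ ~ divides f' (N3p a b c).
Proof.
move=> fp fp'; have [x0 _] := @fresh [::] (leq_trans (isT : 0 < 5)%N n_ge5).
have one g : prime_elt g -> exists i, forall a b, a != b -> a != i -> b != i -> ~ divides g (brp K a b).
  move=> gp; have [[i [j [ij gij]]]|H] := pselect (exists i j, i != j /\ divides g (brp K i j)).
    exists i => a b ab ai bi gab; have := prime_brp_uniq ij ab gp gij gab => /setP/(_ i).
    by rewrite !inE eqxx /= ![i == _]eq_sym (negPf ai) (negPf bi).
  by exists x0 => a b ab _ _ gab; apply: H; exists a, b.
have [i iP] := one f fp; have [k kP] := one f' fp'.
have [a] := @fresh [:: i; k] (leq_trans (isT : 2 < 5)%N n_ge5).
have [b] := @fresh [:: i; k; a] (leq_trans (isT : 3 < 5)%N n_ge5).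
have [c] := @fresh [:: i; k; a; b] n_ge5.
rewrite !inE !negb_or => /and4P[ci ck ca cb] /and3P[bi bk ba] /andP[ai ak].
exists a, b, c; split; (do 2?apply: ndivM => //); first [apply: iP | apply: kP] => //;
  by rewrite eq_sym.
Qed.

Definition Sf f : subpts K Q := fun x => exists w, [/\ peval f w = 0, is_point (cr w) & x = cr w].
(** The closure of the image of those zeros of f at which all cross-ratios are defined. For f = [ij]
    it turns out to be D_ij ([bzE]). *)
Definition Zf f : subpts K Q := zclosure (Sf f).

Lemma Sf_point f x : Sf f x -> is_point x.
Proof. by case=> w [_ wp ->]. Qed.

Lemma vanish_Zf f d p : prime_elt f -> multihomog d p -> (vanish (Zf f) p <-> divides f (pull p)).
Proof.
move=> fp hp; rewrite (zclosure_vanish hp (@Sf_point f)); split=> [H|fP x [w [fw wp ->]]].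
  apply: contrapT => /(generic_pt fp)[w [fw pw wp]].
  by case/eqP: pw; rewrite pullE; apply: H; exists w.
by rewrite -pullE; apply: divides_peval fP fw.
Qed.

Definition pfactor f := prime_elt f /\ exists d p, [/\ multihomog d p, pull p != 0 & divides f (pull p)].

Lemma pfactor_semi f : pfactor f -> semi f.
Proof. by case=> fp [d [p [hp p0 fP]]]; apply: semi_factor fp p0 (semi_pull hp) fP. Qed.

Definition dq (t : quad n) : mfac P1n -> nat :=
  fun i => ((i == l0 t) + (i == l1 t) + (i == l2 t) + (i == l3 t))%N.

Lemma crp_homog t e : multihomog (dq t) (crp K (t, e)).
Proof.
have H a b c d : multihomog (fun i : mfac P1n => (i == a) + (i == b) + (i == c) + (i == d))%N (brp K a b * brp K c d).
  apply: multihomog_ext (multihomogM (@brp_multihomog K n a b) (@brp_multihomog K n c d)).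
  by move=> i; rewrite /deg2 addnA.
case: e; rewrite /crp /=; last exact: H.
by apply: multihomog_ext (H (l0 t) (l2 t) (l1 t) (l3 t)) => i; rewrite /dq; congr addn; rewrite addnAC.
Qed.

Lemma prime_pull_N3 a b c : a != b -> a != c -> b != c -> N3p a b c != 0.
Proof. by move=> ab ac bc; rewrite !mulf_neq0 // brp_neq0. Qed.

(** On M_{0,n} the point x is the class of its normalised configuration; the proportionality,
    written without denominators, extends to the closure. The factor [mu] vanishes at quadruples
    whose cross-ratio is undefined on the normalised configuration. *)
Lemma cr_m0_rel a b c x : a != b -> a != c -> b != c -> Mbar x ->
  exists mu, cr (m0 a b c x) = @rescale K Q mu x.
Proof.
move=> ab ac bc Mx; have xp := Mbar_point Mx.
pose G v : mpol K Q := subst (m0p a b c) (crp K v).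
have GE v y : peval (G v) y = cr (m0 a b c y) v by rewrite peval_subst m0E crpE.
have rel t : cr (m0 a b c x) (t, false) * x (t, true) = cr (m0 a b c x) (t, true) * x (t, false).
  have hG e : multihomog (m0_deg a b c (dq t)) (G (t, e)) by apply: m0_homog; apply: crp_homog.
  have hv e : multihomog (fun i : mfac Q => (i == t) : nat) (@var K Q (t, e)).
    exact: (@multihomog_var K Q (t, e)).
  have [_ H] := Mx.
  have := H _ _ (multihomogB (multihomogM (hG false) (hv true)) (multihomogM (hG true) (hv false))).
  rewrite pevalB !pevalM !GE !pevalV => E; apply/eqP; rewrite -subr_eq0; apply/eqP/E.
  apply/vanish_M0n; have N0 := prime_pull_N3 ab ac bc; apply/eqP; apply: contraT => p0.
  have /peval_nonroot[w] := mulf_neq0 p0 N0.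
  rewrite pevalM N3E mulf_eq0 negb_or pullE => /andP[+ Nw].
  by rewrite pevalB !pevalM !GE !pevalV (m0_cr Nw) cr_lin /rescale /=; move/eqP; case; ring.
have /choice[mu muE] t : exists m, forall e, cr (m0 a b c x) (t, e) = m * x (t, e).
  have [[u e] /= [ut xe]] := xp t; rewrite ut in xe; have R := rel t.
  exists (cr (m0 a b c x) (t, e) / x (t, e)) => e'.
  have [->|ne] := eqVneq e' e; first by rewrite divfK.
  apply: (mulIf xe); rewrite mulrAC divfK //.
  by case: e e' ne xe R => -[] //= _ _; rewrite ?(mulrC (x _)) => ->.
by exists mu; apply/funext => -[t e]; rewrite muE.
Qed.

Lemma Zf_closed f : closed_set (Zf f).
Proof. exact: zclosure_closed. Qed.

Lemma Zf_irreducible f : prime_elt f -> irreducible_set (Zf f).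
Proof.
move=> fp; apply: vanish_prime_irreducible.
- have [_ fU _] := fp.
  have n1 : ~ divides f 1.
    by case=> c c1; case/negP: fU; apply/unitrPr; exists c; rewrite mulrC -c1.
  by have [w [fw _ wp]] := generic_pt fp n1; exists (cr w), w.
- exact: Sf_point.
- move=> d e p q hp hq /(zclosure_vanish (multihomogM hp hq) (@Sf_point f)).
  move/(vanish_Zf fp (multihomogM hp hq)); rewrite pullM; have [_ _ fP] := fp.
  by case/fP => H; [left|right]; apply/(zclosure_vanish _ (@Sf_point f)); eauto; apply/vanish_Zf; eauto.
Qed.

Lemma Zf_Mbar f : subpt (Zf f) (@Mbar n K).
Proof.
move=> x [xp H]; split=> // d p hp /vanish_M0n p0; apply: (H d) => // y [w [_ _ ->]].
by rewrite -pullE p0 peval0.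
Qed.

Lemma pull_m0 f a b c w : semi f -> N3 a b c w != 0 ->
  exists2 k, k != 0 & peval f (m0 a b c (cr w)) = k * peval f w.
Proof.
move=> sf Nw; have g0 : det2 (gT a b c w) != 0 by rewrite gT_det oppr_eq0.
have t0 i := tT_neq0 i Nw; have [k kE] := sf _ _ g0 t0.
have [->|f0] := eqVneq f 0; first by exists 1; rewrite ?oner_neq0 // !peval0 mulr0.
by exists k; [apply: semi_neq0 f0 g0 t0 kE | rewrite m0_cr].
Qed.

Lemma triple_neq f a b c : ~ divides f (N3p a b c) -> [/\ a != b, a != c & b != c].
Proof.
have z i : brp K i i = 0 by apply: peval_inj => w; rewrite brpE br_ii peval0.
move=> H; split; apply: contra_notN H => /eqP->; rewrite /N3p z ?mul0r ?mulr0 ?mul0r;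
  exact: divides0.
Qed.

(** Maximality: a form vanishing on Y but not on Mbar pulls back to f^k * h with f not dividing h.
    Brought back to Mbar by the normalisation [m0], h does not vanish on Y, which contains [Zf f];
    so f does, and with it every form vanishing on [Zf f]. *)
Lemma Zf_prime_divisor f : pfactor f -> prime_divisor (@Mbar n K) (Zf f).
Proof.
move=> pf; have [fp [d [p [hp p0 fP]]]] := pf; have sf := pfactor_semi pf.
have [f0 fU _] := fp; have [df hf] := semi_homog f0 sf.
have [a [b [c [nN _]]]] := triple fp fp; have [ab ac bc] := triple_neq nN.
split=> [||H|Y [cY iY] sZY sYM].
- by split; [exact: Zf_closed | exact: Zf_irreducible].
- exact: Zf_Mbar.
- have vp : vanish (Zf f) p by apply/(vanish_Zf fp hp).
  by case/eqP: p0; apply/(vanish_Mbar hp) => x /H/vp.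
have Yp x : Y x -> is_point x by move/sYM/Mbar_point.
have [MY|nMY] := pselect (subpt (@Mbar n K) Y); [by right|left].
have [E [Eh YE]] := cY.
have [q Eq nq] : exists2 q, E q & ~ vanish (@Mbar n K) q.
  apply: contrapT => H; apply: nMY => x Mx; apply/YE; split; first exact: Mbar_point.
  by move=> q Eq; apply: contrapT => qx; apply: H; exists q => // vq; apply/qx/vq.
have [e hq] := Eh q Eq; have vq : vanish Y q by move=> x /YE[_]; apply.
have q0 : pull q != 0 by apply/eqP => q0; apply/nq/(vanish_Mbar hq).
have [k [h qE nh]] := mult_is_ex (@mpol_factorial _ _) fp q0.
have fk0 : f ^+ k != 0 by rewrite expf_neq0.
have h0 : h != 0 by apply: contraNneq q0 => h0; rewrite qE h0 mulr0.
have sh : semi h.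
  apply: (semi_quot fk0 h0); last by rewrite -qE; apply: semi_pull hq.
  move=> g t g0 t0; have [m mE] := sf g t g0 t0; exists (m ^+ k) => w.
  by rewrite !pevalX mE exprMn.
have [dh hh] := semi_homog h0 sh.
pose A := subst (m0p a b c) f; pose B := subst (m0p a b c) h.
have hA := m0_homog a b c hf; have hB := m0_homog a b c hh.
have vAB : vanish Y (A ^+ k * B).
  move=> x Yx; have [mu muE] := cr_m0_rel ab ac bc (sYM x Yx).
  rewrite pevalM pevalX !peval_subst m0E -pevalX -pevalM -qE pullE muE hq.
  by rewrite vq // mulr0.
have nB : ~ vanish Y B.
  move=> vB; have := ndivM fp nh nN => /(generic_pt fp)[w [fw]].
  rewrite pevalM N3E mulf_eq0 negb_or => /andP[hw Nw] wp.
  have [m m0' mE] := pull_m0 sh Nw.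
  have : peval B (cr w) = 0 by apply/vB/sZY; split=> // d' p' _; apply; exists w.
  by rewrite peval_subst m0E mE => /eqP; rewrite mulf_eq0 (negPf m0') (negPf hw).
have vA : vanish Y A.
  have [vAk|//] := irreducible_vanishM iY Yp (multihomogX k hA) hB vAB.
  exact: irreducible_vanishX iY Yp hA vAk.
have /choice[bt btP] : forall t, exists e, ~ divides f (crp K (t, e)).
  by move=> t; apply: crp_ndiv.
(* Where [S] is not zero, the factors of [cr_m0_rel] are invertible, so that vanishing at the
   normalised configuration means vanishing at the point. *)
pose S := \prod_t subst (m0p a b c) (crp K (t, bt t)).
have hS : multihomog (fun u => \sum_t m0_deg a b c (dq t) u)%N S.
  by apply: multihomog_prod => t _; apply: m0_homog; apply: crp_homog.
have nS : ~ vanish Y S.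
  move=> vS; have nP : ~ divides f (\prod_t crp K (t, bt t)) by apply: ndiv_prod.
  have := ndivM fp nP nN => /(generic_pt fp)[w [fw]].
  rewrite pevalM N3E mulf_eq0 negb_or peval_prod => /andP[/prodf_neq0 hw Nw] wp.
  have : peval S (cr w) = 0 by apply/vS/sZY; split=> // d' p' _; apply; exists w.
  rewrite peval_prod => /eqP; rewrite prodf_seq_eq0 => /hasP[t _ /=].
  rewrite peval_subst m0E crpE (m0_cr Nw) cr_lin /rescale mulf_eq0 -crpE (negPf (hw t isT)) orbF.
  have D0 : det2 (gT a b c w) != 0 by rewrite gT_det oppr_eq0.
  have T0 i := tT_neq0 i Nw; apply/negP.
  exact: (mulf_neq0 (expf_neq0 _ D0) (mulf_neq0 (mulf_neq0 (mulf_neq0 (T0 _) (T0 _)) (T0 _)) (T0 _))).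
move=> x Yx; split; first exact: Yp.
move=> dr r hr /(zclosure_vanish hr (@Sf_point f))/(vanish_Zf fp hr)[R RE].
suff : vanish Y (r * S).
  case/(irreducible_vanishM iY Yp hr hS) => [/(_ x Yx)//|/nS//].
move=> y Yy; rewrite pevalM; have [mu muE] := cr_m0_rel ab ac bc (sYM y Yy).
have : peval (pull r) (m0 a b c y) = 0.
  by rewrite RE pevalM; have := vA y Yy; rewrite peval_subst m0E => ->; rewrite mulr0.
rewrite pullE muE hr => /eqP; rewrite mulf_eq0 => /orP[|/eqP->]; last by rewrite mul0r.
rewrite prodf_seq_eq0 => /hasP[t _ /=]; rewrite expf_eq0 => /andP[_ /eqP mt].
rewrite /S peval_prod (bigD1 t) //= peval_subst m0E crpE muE /rescale /= mt mul0r.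
by rewrite mul0r mulr0.
Qed.

End Zf.

Lemma mul3_neq0 (R : idomainType) (a b c : R) : a * b * c != 0 -> a != 0 /\ b != 0.
Proof. by rewrite !mulf_eq0 !negb_or => /andP[/andP[]]. Qed.

(** * Orders of functions along these divisors *)

Section Orders.
Variables (K : closedFieldType) (n : nat).
Hypothesis n_ge5 : (5 <= n)%N.
Local Notation P1n := (P1n n).
Local Notation Q := (quadP1 n).
Local Notation Mbar := (@Mbar n K).
Implicit Types (w : pts K P1n) (i j a b c : 'I_n) (f P : mpol K P1n) (p : mpol K Q).

Lemma vanish_Mbar_pull p : vanish Mbar p -> pull p = 0.
Proof.
move=> H; apply/vanish_M0n => x Mx; apply: H; split; first exact: M0n_point.
by move=> d q _; apply.
Qed.

(** The normalisation multiplies f by a factor depending on w. Up to a constant and a power of [N3p]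
    this factor is the polynomial W, obtained by applying the normalising matrix of w to a fixed
    [w0] with f(w0) nonzero; it has no zero where the points a, b, c are distinct. *)
Lemma pull_m0_poly f d a b c : N3p K a b c != 0 -> f != 0 -> semi f -> multihomog d f ->
  exists W D k, [/\ k != 0, W * f = cst P1n k * N3p K a b c ^+ D * pull (subst (m0p K a b c) f) &
    forall w, N3 a b c w != 0 -> peval W w != 0].
Proof.
move=> N0 f0 sf hd; have [w0 fw0] := peval_nonroot f0.
pose tp i := if i == a then brp K b c else if i == b then brp K a c else
             if i == c then brp K a b else N3p K a b c.
pose gp (x y : bool) : mpol K P1n :=
  if x then brp K a b * (if y then - @var K P1n (c, false) else @var K P1n (c, true))
  else brp K b c * (if y then @var K P1n (a, false) else - @var K P1n (a, true)).
pose W := subst (fun v : mvar P1n => tp v.1 * (gp v.2 false * cst P1n (w0 (v.1, false)) + gp v.2 true * cst P1n (w0 (v.1, true)))) f.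
pose D := (\sum_i d i)%N.
have tpE w i : N3 a b c w != 0 -> peval (tp i) w = N3 a b c w * tT a b c w i.
  move=> Nw; have [x y z] := N3_neq Nw; rewrite /tp /tT /N3.
  case: (i == a); first by rewrite brpE; field; rewrite ?x ?y ?z.
  case: (i == b); first by rewrite brpE; field; rewrite ?x ?y ?z.
  case: (i == c); first by rewrite brpE; field; rewrite ?x ?y ?z.
  by rewrite N3E mulr1.
have gpE w x y : peval (gp x y) w = gT a b c w x y.
  by rewrite /gp /gT; case: x y => -[]; rewrite pevalM brpE ?pevalN pevalV.
have WE w : N3 a b c w != 0 ->
    peval W w = peval f (lin (gT a b c w) (fun i => N3 a b c w * tT a b c w i) w0).
  move=> Nw; rewrite peval_subst; apply: peval_ext => -[i e].
  by rewrite /teval /lin pevalM tpE // !pevalD !pevalM !pevalC !gpE.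
have chi w : N3 a b c w != 0 -> exists2 k, k != 0 &
    forall w', peval f (lin (gT a b c w) (fun i => N3 a b c w * tT a b c w i) w') = k * peval f w'.
  move=> Nw; have g0 : det2 (gT a b c w) != 0 by rewrite gT_det oppr_eq0.
  have t0 i : N3 a b c w * tT a b c w i != 0 by rewrite mulf_neq0 // tT_neq0.
  by have [k kE] := sf _ _ g0 t0; exists k => //; apply: semi_neq0 f0 g0 t0 kE.
exists W, D, (peval f w0); split=> //.
- apply/eqP; rewrite -subr_eq0; apply: contraT => ne.
  have /peval_nonroot[w] := mulf_neq0 ne N0.
  rewrite pevalM N3E mulf_eq0 negb_or => /andP[+ Nw]; rewrite pevalB !pevalM pevalC pevalX N3E.
  have [k k0 kE] := chi w Nw; rewrite WE // kE pullE peval_subst m0E m0_cr //.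
  have := kE w; rewrite -[X in peval f X](_ : @rescale K P1n (fun=> N3 a b c w) (lin (gT a b c w) (tT a b c w) w) = _).
    rewrite hd prodrXr -/D => E /eqP; case; rewrite -[X in _ - X]mulrA E; ring.
  by apply/funext => -[i e]; rewrite /rescale /lin /= mulrA.
- by move=> w Nw; have [k k0 kE] := chi w Nw; rewrite WE // kE mulf_neq0.
Qed.

Lemma mult_pull_m0 f d a b c : pfactor f -> multihomog d f -> ~ divides f (N3p K a b c) ->
  mult_is f (pull (subst (m0p K a b c) f)) 1.
Proof.
move=> pf hd nN; have [fp _] := pf; have sf := pfactor_semi pf; have [f0 fU fP] := fp.
have N0 : N3p K a b c != 0 by apply/eqP => N0; apply: nN; rewrite N0; apply: divides0.
have [W [D [k [k0 WE Wn]]]] := pull_m0_poly N0 f0 sf hd.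
have nW : ~ divides f W.
  move=> fW; have [w [fw Nw _]] := generic_pt fp nN.
  by rewrite N3E in Nw; case/eqP: (Wn w Nw); apply: divides_peval fW fw.
have fdiv : divides f (pull (subst (m0p K a b c) f)).
  have : divides f (cst P1n k * N3p K a b c ^+ D * pull (subst (m0p K a b c) f)) by exists W.
  case/fP => // /fP[|/(prime_divides_exp fp)//]; case=> h hE; case/negP: fU.
  by have := cst_unit P1n k0; rewrite hE unitrM => /andP[].
case: fdiv => h hE; exists h; first by rewrite expr1 mulrC.
move=> [g gE]; apply: nW; exists (cst P1n k * N3p K a b c ^+ D * g).
by apply: (mulIf f0); rewrite WE hE gE; ring.
Qed.

(** f is not itself a form on the product of lines, but its composite with the normalisation is one,
    of order 1 along the divisor; a monomial in coordinates that f does not divide serves as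
    denominator of the same multidegree. *)
Lemma base_form f : pfactor f -> exists d (a0 b0 : mpol K Q),
  [/\ multihomog d a0, multihomog d b0, mult_is f (pull a0) 1 & ~ divides f (pull b0)].
Proof.
move=> pf; have [fp _] := pf; have sf := pfactor_semi pf; have [f0 _ _] := fp.
have [d hd] := semi_homog f0 sf; have [a [b [c [nN _]]]] := triple n_ge5 fp fp.
have /choice[bt btP] : forall t, exists e, ~ divides f (crp K (t, e)).
  by move=> t; apply: crp_ndiv.
pose d0 := m0_deg a b c d.
exists d0, (subst (m0p K a b c) f), (\prod_t @var K Q (t, bt t) ^+ d0 t); split.
- exact: m0_homog.
- move=> l x; rewrite !peval_prod -big_split; apply: eq_bigr => t _.
  by rewrite !pevalX !pevalV exprMn.
- exact: mult_pull_m0 pf hd nN.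
- suff -> : pull (\prod_t @var K Q (t, bt t) ^+ d0 t) = \prod_t crp K (t, bt t) ^+ d0 t.
    by apply: ndiv_prod => // t _ dt; apply: (btP t); apply: prime_divides_exp fp dt.
  apply: peval_inj => w; rewrite pullE !peval_prod; apply: eq_bigr => t _.
  by rewrite !pevalX pevalV crpE.
Qed.

Lemma in_local_Zf f p q : prime_elt f -> in_local_ring (Zf f) p q ->
  ~ divides f (pull q) /\ (~ vanish (Zf f) p <-> ~ divides f (pull p)).
Proof.
by move=> fp [[d [hp hq]] nq]; split; [move/(vanish_Zf fp hq) | rewrite (vanish_Zf fp hp)].
Qed.

(** The quotient provided by [base_form] has order 1 and is a multiple of p / q in the local ring,
    so the order of p / q is at most 1; it is at least 1 since p vanishes on the divisor. *)
Lemma uniformizer_Zf f p q : pfactor f -> uniformizer Mbar (Zf f) p q ->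
  mult_is f (pull p) 1 /\ ~ divides f (pull q).
Proof.
move=> pf [lpq vp uP]; have [fp _] := pf; have [nq _] := in_local_Zf fp lpq.
have [d [a0 [b0 [ha hb ma nb]]]] := base_form pf; split=> //.
have vfp : divides f (pull p) by have [[e [hp _]] _] := lpq; apply/(vanish_Zf fp hp).
have l0 : in_local_ring (Zf f) a0 b0.
  by split; [exists d | move/(vanish_Zf fp hb)].
have v0 : vanish (Zf f) a0.
  by apply/(vanish_Zf fp ha); case: ma => h -> _; exists h; rewrite expr1 mulrC.
have [c [e [lce]]] := uP _ _ l0 v0; have [ne _] := in_local_Zf fp lce.
move/vanish_Mbar_pull; rewrite pullB !pullM => /eqP; rewrite subr_eq0 => /eqP E.
have m1 : mult_is f (pull a0 * pull q * pull e) (1 + 0 + 0)%N.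
  exact: (mult_isM fp (mult_isM fp ma ((mult_is0 _ _).2 nq)) ((mult_is0 _ _).2 ne)).
have nz : pull p * pull c * pull b0 != 0.
  have nz0 (x : mpol K P1n) : ~ divides f x -> x != 0.
    by move=> nx; apply/eqP => z; apply: nx; rewrite z; apply: divides0.
  rewrite -E; case: ma => h -> nh; have [f0 _ _] := fp.
  exact: (mulf_neq0 (mulf_neq0 (mulf_neq0 (expf_neq0 1 f0) (nz0 _ nh)) (nz0 _ nq)) (nz0 _ ne)).
have [p0 c0] := mul3_neq0 nz.
have [m mp] := mult_is_ex (@mpol_factorial _ _) fp p0.
have [k mc] := mult_is_ex (@mpol_factorial _ _) fp c0.
have mb : mult_is f (pull b0) 0 by apply/mult_is0.
have m2 := mult_isM fp (mult_isM fp mp mc) mb; rewrite -E in m2.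
have H := mult_is_uniq fp m1 m2; case: m mp {m2} H => [|[|m]] mp H //.
by case/mult_is0: mp.
Qed.

(** Compares the multiplicities of f on both sides of the relation that defines the order; the
    existence of an order is an assumption here. *)
Lemma order_Zf f p q m mp mq : pfactor f -> has_order Mbar (Zf f) p q m ->
  mult_is f (pull p) mp -> mult_is f (pull q) mq -> m = mp%:Z - mq%:Z.
Proof.
move=> pf [a [b [c [e [i [j [uab [lce nc] -> v]]]]]]] hp hq; have [fp _] := pf.
have [ma nb] := uniformizer_Zf pf uab; have [ne /iffLR/(_ nc) nc'] := in_local_Zf fp lce.
have M0 x : ~ divides f x -> mult_is f x 0 := (mult_is0 f x).2.
move/vanish_Mbar_pull: v; rewrite pullB !pullM !pullX => /eqP; rewrite subr_eq0 => /eqP E.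
have L := mult_isM fp (mult_isM fp (mult_isM fp hp (mult_isX i fp (M0 _ nb))) (mult_isX j fp ma)) (M0 _ ne).
have R := mult_isM fp (mult_isM fp (mult_isM fp hq (mult_isX i fp ma)) (mult_isX j fp (M0 _ nb))) (M0 _ nc').
by rewrite E in L; have := mult_is_uniq fp L R; lia.
Qed.

(** The normalised form of f' vanishes on [Zf f], so f divides its pull-back, which is f' up to a
    factor invertible at a generic zero of f. *)
Lemma Zf_inj f f' : pfactor f -> pfactor f' -> (forall x, Zf f x -> Zf f' x) -> divides f f'.
Proof.
move=> pf pf' ZE; have [[fp _] [fp' _]] := (pf, pf').
have [f0 _ _] := fp'; have [d hd] := semi_homog f0 (pfactor_semi pf').
have [a [b [c [nN nN']]]] := triple n_ge5 fp fp'.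
have hB := m0_homog a b c hd.
have [h hE _] := mult_pull_m0 pf' hd nN'.
have : vanish (Zf f) (subst (m0p K a b c) f').
  by move=> x /ZE; move: x; apply/(vanish_Zf fp' hB); exists h; rewrite hE expr1 mulrC.
move/(vanish_Zf fp hB) => fB; apply: contrapT => nf.
have [w [fw + _]] := generic_pt fp (ndivM fp nf nN).
rewrite pevalM N3E mulf_eq0 negb_or => /andP[fw' Nw].
have [k k0 kE] := pull_m0 (pfactor_semi pf') Nw.
have := divides_peval fB fw; rewrite pullE peval_subst m0E kE => /eqP.
by rewrite mulf_eq0 (negPf k0) (negPf fw').
Qed.

Lemma pfactor_factor f d p : prime_elt f -> multihomog d p -> pull p != 0 ->
  divides f (pull p) -> pfactor f.
Proof. by move=> fp hp p0 fP; split=> //; exists d, p. Qed.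

End Orders.

(** * Additive extension from prime divisors to divisors *)

Section Lift.
Variables (T : choiceType) (V : zmodType).
Implicit Types (h : T -> V) (D : {freeg T / int}).

Definition zlift h D : V := \sum_(Z <- dom D) h Z *~ coeff Z D.

Lemma zlift_sub h D (s : seq T) : uniq s -> (forall Z, Z \in dom D -> Z \notin s -> h Z = 0) ->
  zlift h D = \sum_(Z <- s) h Z *~ coeff Z D.
Proof.
move=> us ds; rewrite /zlift (bigID (fun Z => Z \in s)) /= [X in _ + X]big1_seq; last first.
  by move=> Z /andP[Zs ZD]; rewrite ds // mul0rz.
rewrite addr0 [RHS](bigID (fun Z => Z \in dom D)) /= [X in _ = _ + X]big1 ?addr0; last first.
  by move=> Z /coeff_outdom ->; rewrite mulr0z.
rewrite -big_filter -[RHS]big_filter; apply: perm_big; apply: uniq_perm.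
- by rewrite filter_uniq ?uniq_dom.
- by rewrite filter_uniq.
- by move=> Z; rewrite !mem_filter andbC.
Qed.

Lemma zliftB h D1 D2 : zlift h (D1 - D2) = zlift h D1 - zlift h D2.
Proof.
pose s := undup (dom D1 ++ dom D2).
have us : uniq s := undup_uniq _.
have E D : {subset dom D <= s} -> zlift h D = \sum_(Z <- s) h Z *~ coeff Z D.
  by move=> Ds; apply: zlift_sub => // Z /Ds ->.
rewrite !E => [|Z ZD|Z ZD|Z ZD]; last 3 first.
- by rewrite mem_undup mem_cat ZD orbT.
- by rewrite mem_undup mem_cat ZD.
- by rewrite mem_undup; apply: domB ZD.
by rewrite -sumrB; apply: eq_bigr => Z _; rewrite raddfB /= mulrzBr.
Qed.

Lemma zlift0 h : zlift h 0 = 0.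
Proof. by rewrite /zlift dom0 big_nil. Qed.

Lemma zliftN h D : zlift h (- D) = - zlift h D.
Proof. by have := zliftB h 0 D; rewrite !sub0r zlift0 sub0r. Qed.

Lemma zliftD h D1 D2 : zlift h (D1 + D2) = zlift h D1 + zlift h D2.
Proof. by rewrite -[D2]opprK zliftB zliftN !opprK. Qed.

Lemma zliftU h Z : zlift h << Z >> = h Z.
Proof. by rewrite /zlift domU1 big_seq1 coeffU eqxx mulr1. Qed.

Lemma zlift_sum h (I : Type) (r : seq I) (P : pred I) (F : I -> {freeg T / int}) :
  zlift h (\sum_(i <- r | P i) F i) = \sum_(i <- r | P i) zlift h (F i).
Proof. by apply: (big_morph _ (zliftD h) (zlift0 h)). Qed.

Lemma zliftMz h D k : zlift h (D *~ k) = zlift h D *~ k.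
Proof.
have M m : zlift h (D *+ m) = zlift h D *+ m.
  by elim: m => [|m IH]; rewrite ?zlift0 // !mulrS zliftD IH.
by case: k => m; rewrite ?NegzE ?mulrNz ?zliftN -!pmulrn M.
Qed.
End Lift.

(** L holds one representative up to units of each prime that may divide P, so that one list serves
    for both the numerator and the denominator of a function. *)
Lemma factor_along (R : idomainType) (L : seq R) (P : R) : uniq L ->
  (forall f, f \in L -> prime_elt f) ->
  (forall f g, f \in L -> g \in L -> divides f g -> f = g) ->
  has_fact P -> (forall f, prime_elt f -> divides f P -> exists2 g, g \in L & divides g f) ->
  exists m u, [/\ u \is a GRing.unit, P = u * \prod_(f <- L) f ^+ m f &
     forall f, f \in L -> mult_is f P (m f)].
Proof.
move=> uL Lp Ldist [u [s [uU sp ->]]].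
have E (f0 : R) : f0 \in L -> forall m : R -> nat, \prod_(f <- L) f ^+ (m f + (f == f0))%N =
     f0 * \prod_(f <- L) f ^+ m f.
  move=> f0L m; rewrite !(bigD1_seq f0) //= eqxx addn1 exprS mulrA; congr (_ * _).
  by apply: eq_bigr => f /negPf ->; rewrite addn0.
elim: s sp => [|q s IHs] sp H.
  exists (fun=> 0%N), u; split=> //; first by congr (_ * _); rewrite big_nil big1 // => f _; rewrite expr0.
  move=> f /Lp fp; apply/mult_is0; rewrite big_nil mulr1 => -[c uE].
  by have [_ fU _] := fp; move: uU; rewrite uE unitrM (negPf fU) andbF.
rewrite big_cons mulrCA; have qp : prime_elt q by apply: sp; rewrite mem_head.
have [|f fp [c E2]|m [v [vU PE mP]]] := IHs.
- by move=> g gs; apply: sp; rewrite inE gs orbT.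
- by apply: H => //; exists (c * q); rewrite big_cons mulrCA E2; ring.
have [|f0 f0L f0q] := H q qp; first by exists (u * \prod_(j <- s) j); rewrite big_cons; ring.
have f0p := Lp _ f0L; have [c cU qE] := prime_assoc f0p qp f0q.
exists (fun f => m f + (f == f0))%N, (c * v); split.
- by rewrite unitrM cU.
- by rewrite PE E // qE; ring.
- move=> f fL; have fp := Lp _ fL; rewrite addnC; apply: mult_isM => //; last exact: mP.
  have [->|ne] := eqVneq f f0.
    exists c; first by rewrite expr1 mulrC.
    by case=> d dE; have [_ fU _] := f0p; move: cU; rewrite dE unitrM (negPf fU) andbF.
  apply/mult_is0 => fq; case/eqP: ne; apply: Ldist => //.
  move: fq; rewrite qE; have [_ fU fP] := fp; case/fP => // -[d dE].
  by move: cU; rewrite dE unitrM (negPf fU) andbF.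
Qed.

Lemma multihomog_cstM (K : closedFieldType) A d k (p : mpol K A) : multihomog d p -> multihomog d (cst A k * p).
Proof. by move=> hp l x; rewrite !pevalM !pevalC hp mulrCA. Qed.

Lemma ffunMz (I : finType) (v : {ffun I -> int}) k i : (v *~ k) i = v i * k.
Proof.
have M m : (v *+ m) i = v i *+ m.
  by elim: m => [|m IH]; rewrite ?ffunE // !mulrS ffunE IH.
case: k => m; first by rewrite -pmulrn M -mulr_natr natz.
by rewrite NegzE mulrNz ffunE -pmulrn M mulrN -mulr_natr natz.
Qed.

(** * The multidegree of a divisor class *)

Section Phi.
Variables (K : closedFieldType) (n : nat).
Hypothesis n_ge5 : (5 <= n)%N.
Local Notation P1n := (P1n n).
Local Notation Q := (quadP1 n).
Local Notation Mbar := (@Mbar n K).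
Local Notation V := {ffun 'I_n -> int}.
Implicit Types (w : pts K P1n) (i j a b c : 'I_n) (f P : mpol K P1n) (p : mpol K Q).
Implicit Types (Z : prime_div Mbar) (D : Div Mbar).

Definition is_deg Z (d : 'I_n -> nat) := exists f,
  [/\ pfactor f, @multihomog K P1n d f & forall x, sval Z x <-> Zf f x].

Lemma is_deg_uniq Z d e : is_deg Z d -> is_deg Z e -> d =1 e.
Proof.
move=> [f [pf hd fE]] [g [pg he gE]].
have fg : divides f g by apply: (Zf_inj n_ge5 pf pg) => x /fE/gE.
have [[fp _] [gp _]] := (pf, pg); have [c /mpol_unitE[k k0 kE] gfE] := prime_assoc fp gp fg.
have [f0 _ _] := fp; have [g0 _ _] := gp.
apply: (@multihomog_uniq K P1n _ _ g) => //.
by rewrite gfE kE; apply: (@multihomog_cstM K P1n).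
Qed.

(** Zero on the prime divisors that come from no prime factor; those include the boundary divisors
    generating N ([phiZ_boundary]), so that the extension descends to Q. *)
Definition phiZ Z : V :=
  if pselect (exists d, is_deg Z d) is left H then [ffun i => (projT1 (cid H) i)%:Z] else 0.

Lemma phiZE Z d : is_deg Z d -> phiZ Z = [ffun i => (d i)%:Z].
Proof.
move=> Zd; rewrite /phiZ; case: pselect => [H|[]]; last by exists d.
by apply/ffunP => i; rewrite !ffunE (is_deg_uniq (projT2 (cid H)) Zd).
Qed.

Lemma phiZ0 Z : ~ (exists d, is_deg Z d) -> phiZ Z = 0.
Proof. by rewrite /phiZ; case: pselect. Qed.

Lemma phiZ_type Z : phiZ Z != 0 -> exists d, is_deg Z d.
Proof. by move=> H; apply: contrapT => /phiZ0 E; rewrite E eqxx in H. Qed.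

Definition phiD D : V := zlift phiZ D.

Lemma phiZ_even Z : (2 %| (\sum_i phiZ Z i)%R)%Z.
Proof.
have [[d dZ]|/phiZ0->] := pselect (exists d, is_deg Z d); last first.
  by rewrite big1 ?dvdz0 // => i _; rewrite ffunE.
rewrite (phiZE dZ); under eq_bigr do rewrite ffunE.
rewrite -(big_morph Posz PoszD (erefl : Posz 0 = 0)) dvdzE /= dvdn2.
by have [f [pf hd _]] := dZ; have [[f0 _ _] _] := pf; apply: semi_even f0 (pfactor_semi pf) hd.
Qed.

Lemma phiD_even D : (2 %| (\sum_i phiD D i)%R)%Z.
Proof.
have E : \sum_i phiD D i = \sum_(Z <- dom D) (\sum_i phiZ Z i) * coeff Z D.
  rewrite /phiD /zlift; under eq_bigr do rewrite sum_ffunE.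
  rewrite exchange_big; apply: eq_bigr => Z _; rewrite mulr_suml; apply: eq_bigr => i _.
  exact: ffunMz.
by rewrite E; apply: rpred_sum => Z _; apply: dvdz_mulr; apply: phiZ_even.
Qed.

Lemma same_sval Z1 Z2 : (forall x, sval Z1 x <-> sval Z2 x) -> Z1 = Z2.
Proof.
case: Z1 Z2 => [z1 h1] [z2 h2] /= E; have Ez : z1 = z2 by apply/funext => x; apply/propext.
by subst z2; congr exist; apply: Prop_irrelevance.
Qed.

Definition mkZ f (pf : pfactor f) : prime_div Mbar :=
  exist (fun Y : subpts K Q => prime_divisor Mbar Y) (Zf f) (Zf_prime_divisor n_ge5 pf).

Definition pull_deg (d : mfac Q -> nat) : 'I_n -> nat := fun i => (\sum_t d t * dq t i)%N.

Lemma pull_homog d p : multihomog d p -> @multihomog K P1n (pull_deg d) (pull p).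
Proof.
move=> hp l w; rewrite !pullE.
have -> : cr (rescale l w) = @rescale K Q (fun t => l (l0 t) * l (l1 t) * l (l2 t) * l (l3 t)) (cr w).
  by apply/funext => -[t b]; rewrite /rescale !crE /br /=; case: b; ring.
rewrite hp; congr (_ * _); rewrite /pull_deg.
under [RHS]eq_bigr do rewrite -prodrXr.
rewrite exchange_big /=; apply: eq_bigr => t _.
under eq_bigr do rewrite mulnC exprM; rewrite prodrXl; congr (_ ^+ _); rewrite /dq.
under eq_bigr do rewrite !exprD.
by rewrite !big_split /= !prod_delta.
Qed.

(** Numerator and denominator have the same multidegree, hence so do their pull-backs; factoring
    these along one list of primes turns the equality of multidegrees into the vanishing of the
    sum. *)
Lemma phiD_principal D : principal D -> phiD D = 0.
Proof.
move=> [p [q [[d [hp hq]] np nq ord]]].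
have p0 : pull p != 0 by apply/eqP => /(vanish_Mbar hp).
have q0 : pull q != 0 by apply/eqP => /(vanish_Mbar hq).
have [u [s [uU sp PE]]] := mpol_factorial (mulf_neq0 p0 q0).
have pfac f : prime_elt f -> divides f (pull p * pull q) -> pfactor f.
  move=> fp; have [_ _ fP] := fp.
  by case/fP => fd; [apply: pfactor_factor fp hp p0 fd|apply: pfactor_factor fp hq q0 fd].
have ds f : f \in s -> divides f (pull p * pull q).
  move=> fs; rewrite PE (big_rem f) //=; exists (u * \prod_(y <- rem f s) y); ring.
pose zz f : seq (prime_div Mbar) := if pselect (pfactor f) is left pf then [:: mkZ pf] else [::].
pose Zs := undup (flatten [seq zz f | f <- s]).
have /choice[fZ fZP] : forall Z, exists f, Z \in Zs -> [/\ pfactor f, f \in s & forall x, sval Z x <-> Zf f x].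
  move=> Z; have [|_] := boolP (Z \in Zs); last by exists 0.
  rewrite mem_undup => /flattenP[_ /mapP[f fs ->]]; rewrite /zz; case: pselect => // pf.
  by rewrite inE => /eqP ->; exists f.
have Zs_mem f : pfactor f -> divides f (pull p * pull q) -> exists2 Z, Z \in Zs & forall x, sval Z x <-> Zf f x.
  move=> pf fd; have [fp _] := pf; have [g gs fg] := fact_divisor fp uU PE fd.
  have gp := sp g gs; have pg := pfac g gp (ds g gs).
  have [c /mpol_unitE[k k0 kE] gE] := prime_assoc fp gp fg.
  exists (mkZ pg) => [|x].
    rewrite mem_undup; apply/flattenP; exists (zz g); first exact: map_f.
    rewrite /zz; case: pselect => // pg'; rewrite inE; apply/eqP; apply: same_sval => //.
  have gz w : (peval g w = 0) <-> (peval f w = 0).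
    by rewrite gE kE pevalM pevalC; split=> [/eqP|->]; rewrite ?mulr0 // mulf_eq0 (negPf k0) => /eqP.
  have SE : Sf g = Sf f.
    by apply/funext => y; apply/propext; split=> -[w [/gz fw wp ->]]; exists w.
  by rewrite /= /Zf SE.
pose L := [seq fZ Z | Z <- Zs].
have uZ : uniq Zs := undup_uniq _.
have inj : {in Zs &, injective fZ}.
  move=> Z1 Z2 h1 h2 E; have [_ _ E1] := fZP _ h1; have [_ _ E2] := fZP _ h2.
  by apply: same_sval => x; rewrite E1 E E2.
have uL : uniq L by rewrite map_inj_in_uniq.
have LP f : f \in L -> exists2 Z, Z \in Zs & f = fZ Z by case/mapP => Z; exists Z.
have Lp f : f \in L -> prime_elt f by case/LP => Z /fZP[[fp _] _ _] ->.
have Ldist f g : f \in L -> g \in L -> divides f g -> f = g.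
  case/LP=> Z1 h1 -> /LP[Z2 h2 ->] dfg; have [pf1 _ E1] := fZP _ h1; have [pf2 _ E2] := fZP _ h2.
  have [[fp1 _] [fp2 _]] := (pf1, pf2); have [c /mpol_unitE[k k0 kE] gE] := prime_assoc fp1 fp2 dfg.
  congr fZ; apply: same_sval => x; rewrite E1 E2 /Zf (_ : Sf (fZ Z1) = Sf (fZ Z2)) //.
  apply/funext => y; apply/propext; split=> -[w [fw wp ->]]; exists w; split=> //.
    by rewrite gE kE pevalM fw mulr0.
  by move: fw; rewrite gE kE pevalM pevalC => /eqP; rewrite mulf_eq0 (negPf k0) => /eqP.
have Lfac f : prime_elt f -> divides f (pull p * pull q) -> exists2 g, g \in L & divides g f.
  move=> fp fd; have pf := pfac f fp fd; have [Z Zin ZE] := Zs_mem f pf fd.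
  exists (fZ Z); first exact: map_f.
  by have [pfz _ E] := fZP _ Zin; apply: (Zf_inj n_ge5 pfz pf) => x /E/ZE.
have [mp [up [upU pE mpP]]] := factor_along uL Lp Ldist (@mpol_factorial _ _ _ p0)
   (fun f fp fd => Lfac f fp (dividesM _ fd)).
have [mq [uq [uqU qE mqP]]] := factor_along uL Lp Ldist (@mpol_factorial _ _ _ q0)
   (fun f fp fd => Lfac f fp (dividesMr _ fd)).
have /choice[dg dgP] : forall f, exists e, f \in L -> @multihomog K P1n e f.
  move=> f; have [fL|_] := boolP (f \in L); last by exists (fun=> 0%N).
  have [Z /fZP[pf _ _] fE] := LP f fL; have [[f0 _ _] _] := pf.
  by have [e he] := semi_homog f0 (pfactor_semi pf); exists e; rewrite fE.
have degE (P : mpol K P1n) (m : mpol K P1n -> nat) v e : v \is a GRing.unit -> P != 0 ->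
    @multihomog K P1n e P -> P = v * \prod_(f <- L) f ^+ m f ->
    forall i, e i = (\sum_(f <- L) dg f i * m f)%N.
  move=> vU P0 hP PEq; have [k k0 kE] := mpol_unitE vU.
  apply: (multihomog_uniq P0 hP); rewrite PEq kE.
  have hpr : multihomog (fun i : mfac P1n => \sum_(f <- L) dg f i * m f)%N (\prod_(f <- L) f ^+ m f).
    by apply: multihomog_prod => f fL; apply: multihomogX; apply: dgP.
  exact: multihomog_cstM hpr.
have Ep := degE _ mp _ _ upU p0 (pull_homog hp) pE.
have Eq := degE _ mq _ _ uqU q0 (pull_homog hq) qE.
(* A divisor outside [Zs] contributes nothing: it comes from no prime factor, or from one dividing
   neither pull-back, and then its coefficient is 0. *)
rewrite /phiD (zlift_sub (s := Zs)) // => [|Z ZD ZnZs]; last first.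
  apply/eqP; apply: contraT => /phiZ_type[e [f [pf hf ZE]]].
  have [fp _] := pf; have nd : ~ divides f (pull p * pull q).
    move=> fd; have [Z' Z'in E'] := Zs_mem f pf fd; case/negP: ZnZs.
    by rewrite (_ : Z = Z') //; apply: same_sval => x; rewrite ZE E'.
  have := ord Z; rewrite (_ : sval Z = Zf f); last by apply/funext => x; apply/propext/ZE.
  have [n1 n2] : ~ divides f (pull p) /\ ~ divides f (pull q).
    by split=> h; apply: nd; [apply: dividesM|apply: dividesMr].
  move/(order_Zf n_ge5 pf)/(_ ((mult_is0 _ _).2 n1) ((mult_is0 _ _).2 n2)).
  by rewrite subrr => cZ; move: ZD; rewrite mem_dom cZ eqxx.
apply/ffunP => i; rewrite sum_ffunE ffunE.
transitivity (\sum_(Z <- Zs) ((dg (fZ Z) i)%:Z * (mp (fZ Z))%:Z - (dg (fZ Z) i)%:Z * (mq (fZ Z))%:Z)).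
  apply: eq_big_seq => Z Zin; have [pf _ ZE] := fZP Z Zin; have fL : fZ Z \in L by apply: map_f.
  have Zd : is_deg Z (dg (fZ Z)) by exists (fZ Z); split=> //; apply: dgP.
  have := ord Z; rewrite (_ : sval Z = Zf (fZ Z)); last by apply/funext => x; apply/propext/ZE.
  move/(order_Zf n_ge5 pf)/(_ (mpP _ fL) (mqP _ fL)) => ->.
  rewrite -mulrBr (phiZE Zd); move: (_ - _) => m.
  by rewrite ffunMz ffunE.
rewrite sumrB; apply/eqP; rewrite subr_eq0; apply/eqP.
have H (m : mpol K P1n -> nat) : \sum_(Z <- Zs) (dg (fZ Z) i)%:Z * (m (fZ Z))%:Z = (\sum_(f <- L) dg f i * m f)%N%:Z.
  rewrite (big_morph Posz PoszD (erefl : Posz 0 = 0)) big_map; apply: eq_bigr => Z _.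
  by rewrite PoszM.
by rewrite !H -Ep -Eq.
Qed.

End Phi.

(** * Homomorphisms out of a quotient group *)

Section ZquotMap.
Variables (A : zmodType) (S : A -> Prop).

Lemma subgroup_gen_kills (B : zmodType) (f : A -> B) :
  (forall x y, f (x - y) = f x - f y) -> (forall x, S x -> f x = 0) ->
  forall x, subgroup_gen S x -> f x = 0.
Proof.
move=> fB fS x; elim=> [|y /fS //|y z _ fy _ fz]; last by rewrite fB fy fz subrr.
by rewrite -(subrr 0) fB subrr.
Qed.

Definition zquot_lift (B : zmodType) (f : A -> B) (q : zquot S) : B :=
  f (generic_quotient.repr q).

Lemma zquot_liftE (B : zmodType) (f : A -> B) :
  (forall x y, f (x - y) = f x - f y) -> (forall x, S x -> f x = 0) ->
  forall x, zquot_lift f (zproj S x) = f x.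
Proof.
move=> fB fS x; apply/eqP; rewrite -subr_eq0 -fB; apply/eqP.
by apply: subgroup_gen_kills => //; apply: repr_zproj.
Qed.

Lemma zprojD x y : zproj S (x + y) = zproj S x + zproj S y.
Proof. by rewrite [RHS]zq_addE. Qed.

Lemma zprojN x : zproj S (- x) = - zproj S x.
Proof. by rewrite [RHS]zq_oppE. Qed.

Lemma zprojB x y : zproj S (x - y) = zproj S x - zproj S y.
Proof. by rewrite zprojD zprojN. Qed.

Lemma zproj_eq0 x : S x -> zproj S x = 0.
Proof. by move=> Sx; apply/zproj_eq; rewrite subr0; apply: SgenI. Qed.

Lemma zproj_surj (q : zquot S) : exists x, q = zproj S x.
Proof. by exists (generic_quotient.repr q); rewrite zprojK. Qed.

Lemma zquot_mapE (f : A -> A) : (forall x y, f (x - y) = f x - f y) ->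
  (forall x, S x -> subgroup_gen S (f x)) ->
  forall x, zquot_map f (zproj S x) = zproj S (f x).
Proof.
move=> fB fS x; apply/zproj_eq; rewrite -fB.
elim: (repr_zproj S x) => [|y /fS //|y z _ fy _ fz]; last by rewrite fB; apply: SgenB.
by rewrite -(subrr 0) fB subrr; apply: Sgen0.
Qed.

Lemma zquot_mapB (f : A -> A) : (forall x y, f (x - y) = f x - f y) ->
  (forall x, S x -> subgroup_gen S (f x)) ->
  forall p q : zquot S, zquot_map f (p - q) = zquot_map f p - zquot_map f q.
Proof.
move=> fB fS p q; have [[x ->] [y ->]] := (zproj_surj p, zproj_surj q).
by rewrite -zprojB !zquot_mapE // fB zprojB.
Qed.
End ZquotMap.

(** * Permutations of the labels and the map phi *)

Section Equivariance.
Variables (K : closedFieldType) (n : nat).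
Hypothesis n_ge5 : (5 <= n)%N.
Local Notation P1n := (P1n n).
Local Notation Q := (quadP1 n).
Local Notation Mbar := (@Mbar n K).
Local Notation V := {ffun 'I_n -> int}.
Implicit Types (w : pts K P1n) (i j a b c : 'I_n) (f P : mpol K P1n) (p : mpol K Q).
Implicit Types (Z : prime_div Mbar) (D : Div Mbar) (s : 'S_n).

Definition relab s w : pts K P1n := fun v => w (s v.1, v.2).

Lemma Sn_actE s x (t : quad n) e : Sn_act s^-1%g x (t, e) = x (quad_perm s t, e) :> K.
Proof. by rewrite /Sn_act /reindex /= invgK. Qed.

Lemma cr_relab s w : cr (relab s w) = Sn_act s^-1%g (cr w).
Proof.
apply/funext => -[t e]; rewrite Sn_actE !crE /relab /br /l0 /l1 /l2 /l3 !lab_perm.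
by [].
Qed.

Definition polyT s p : mpol K Q := subst (fun v : mvar Q => @var K Q (quad_perm s v.1, v.2)) p.

Lemma polyTE s p x : peval (polyT s p) x = peval p (Sn_act s^-1%g x).
Proof.
by rewrite peval_subst; apply: peval_ext => -[t e]; rewrite /teval pevalV Sn_actE.
Qed.

Lemma Sn_act_rescale s (l : mfac Q -> K) x :
  Sn_act s^-1%g (rescale l x) = @rescale K Q (fun t => l (quad_perm s t)) (Sn_act s^-1%g x).
Proof. by apply/funext => -[t e]; rewrite Sn_actE /rescale Sn_actE. Qed.

Lemma quad_permK s : cancel (quad_perm s) (@quad_perm n s^-1%g).
Proof. by move=> t; rewrite -quad_permM mulgV quad_perm1. Qed.

Lemma polyT_homog s d p : multihomog d p -> multihomog (fun t : mfac Q => d (quad_perm s^-1%g t)) (polyT s p).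
Proof.
move=> hp l x; rewrite !polyTE Sn_act_rescale hp; congr (_ * _).
rewrite [RHS](reindex_inj (can_inj (quad_permK s))) /=.
by apply: eq_bigr => t _; rewrite quad_permK.
Qed.

Lemma is_point_Sn s (x : pts K Q) : is_point x -> is_point (Sn_act s^-1%g x).
Proof.
move=> xp t; have [[t' e] [/= tE xt]] := xp (quad_perm s t).
by exists (t, e); split=> //; rewrite Sn_actE -tE.
Qed.

Lemma Sn_actK s x : Sn_act s^-1%g (Sn_act s x) = x :> pts K Q.
Proof. by rewrite -Sn_actM mulgV Sn_act1. Qed.

Lemma Sn_actVK s x : Sn_act s (Sn_act s^-1%g x) = x :> pts K Q.
Proof. by rewrite -Sn_actM mulVg Sn_act1. Qed.

Lemma vanish_polyT s (Y : subpts K Q) p :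
  vanish (fun x => Y (Sn_act s^-1%g x)) (polyT s p) <-> vanish Y p.
Proof.
split=> H x Yx; last by rewrite polyTE H.
by rewrite -(Sn_actK s x) -polyTE H // Sn_actK.
Qed.

Lemma vanish_Mbar_polyT s p : vanish Mbar (polyT s p) <-> vanish Mbar p.
Proof.
split=> H x Mx; last by rewrite polyTE H //; apply: Sn_act_Mbar.
by rewrite -(Sn_actK s x) -polyTE H //; apply: Sn_act_Mbar.
Qed.

Lemma polyTM s p q : polyT s (p * q) = polyT s p * polyT s q.
Proof. exact: substM. Qed.
Lemma polyTB s p q : polyT s (p - q) = polyT s p - polyT s q.
Proof. exact: substB. Qed.
Lemma polyTX s p k : polyT s (p ^+ k) = polyT s p ^+ k.
Proof. exact: substX. Qed.

Lemma polyTK s p : polyT s (polyT s^-1%g p) = p.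
Proof. by apply: peval_inj => x; rewrite !polyTE invgK Sn_actVK. Qed.

Lemma in_local_polyT s (Z : subpts K Q) p q : in_local_ring Z p q ->
  in_local_ring (fun x => Z (Sn_act s^-1%g x)) (polyT s p) (polyT s q).
Proof.
move=> [[d [hp hq]] nq]; split; last by rewrite vanish_polyT.
by exists (fun t => d (quad_perm s^-1%g t)); split; apply: polyT_homog.
Qed.

Lemma has_order_polyT s (Z : subpts K Q) p q m : has_order Mbar Z p q m ->
  has_order Mbar (fun x => Z (Sn_act s^-1%g x)) (polyT s p) (polyT s q) m.
Proof.
move=> [a [b [c [e [i [j [[lab va uP] [lce nc] -> v]]]]]]].
exists (polyT s a), (polyT s b), (polyT s c), (polyT s e), i, j; split=> //.
- split; [exact: in_local_polyT|by rewrite vanish_polyT|].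
  move=> a' b' lab' va'.
  have lab2 : in_local_ring Z (polyT s^-1%g a') (polyT s^-1%g b').
    have := in_local_polyT s^-1%g lab'; rewrite invgK.
    by rewrite (_ : (fun x => _) = Z) //; apply/funext => x; rewrite Sn_actK.
  have va2 : vanish Z (polyT s^-1%g a').
    move=> x Zx; rewrite polyTE invgK; apply: va'; by rewrite Sn_actK.
  have [c' [e' [l v']]] := uP _ _ lab2 va2.
  exists (polyT s c'), (polyT s e'); split; first exact: in_local_polyT.
  by move/(vanish_Mbar_polyT s): v'; rewrite polyTB !polyTM !polyTK.
- by split; [exact: in_local_polyT | rewrite vanish_polyT].
- by move/(vanish_Mbar_polyT s): v; rewrite polyTB !polyTM !polyTX.
Qed.

Lemma Sn_primeK s Z : Sn_prime s (Sn_prime s^-1%g Z) = Z.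
Proof. by apply: same_sval => x /=; rewrite invgK Sn_actVK. Qed.

Lemma Sn_primeVK s Z : Sn_prime s^-1%g (Sn_prime s Z) = Z.
Proof. by apply: same_sval => x /=; rewrite invgK Sn_actK. Qed.

Lemma Sn_DivE s D : Sn_Div s D = zlift (fun Z => << Sn_prime s Z >>) D.
Proof. by apply: eq_bigr => Z _; rewrite freegU_mulz intz. Qed.

Lemma Sn_DivB s D1 D2 : Sn_Div s (D1 - D2) = Sn_Div s D1 - Sn_Div s D2.
Proof. by rewrite !Sn_DivE zliftB. Qed.

Lemma Sn_DivU s Z : Sn_Div s << Z >> = << Sn_prime s Z >>.
Proof. by rewrite Sn_DivE zliftU. Qed.

Lemma coeff_Sn_Div s D Z : coeff Z (Sn_Div s D) = coeff (Sn_prime s^-1%g Z) D.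
Proof.
rewrite /Sn_Div raddf_sum /=.
rewrite -[in RHS](freeg_sumE D) [RHS]raddf_sum /=; apply: eq_bigr => Y _; rewrite !coeffU; congr (_ * _%:R); congr nat_of_bool.
by apply/idP/idP => /eqP E; apply/eqP; rewrite ?E ?Sn_primeK // -E Sn_primeVK.
Qed.

Lemma principal_Sn s D : principal D -> principal (Sn_Div s D).
Proof.
move=> [p [q [[d [hp hq]] np nq ord]]]; exists (polyT s p), (polyT s q); split.
- by exists (fun t => d (quad_perm s^-1%g t)); split; apply: polyT_homog.
- by rewrite vanish_Mbar_polyT.
- by rewrite vanish_Mbar_polyT.
- move=> Z; rewrite coeff_Sn_Div; have := has_order_polyT s (ord (Sn_prime s^-1%g Z)).
  by rewrite (_ : (fun x => _) = sval Z) //; apply/funext => x /=; rewrite invgK Sn_actVK.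
Qed.

Lemma PicMbar_actE s D : PicMbar_act s (cl D) = cl (Sn_Div s D).
Proof.
rewrite /PicMbar_act zquot_mapE // => [|D' pD]; first exact: Sn_DivB.
exact/SgenI/principal_Sn.
Qed.

Lemma PicMbar_actB s (x y : PicMbar n K) : PicMbar_act s (x - y) = PicMbar_act s x - PicMbar_act s y.
Proof.
apply: zquot_mapB => [|D pD]; first exact: Sn_DivB.
exact/SgenI/principal_Sn.
Qed.

Lemma boundary_Sn s (I : {set 'I_n}) (x : pts K Q) :
  boundary I (Sn_act s^-1%g x) <-> boundary [set s i | i in I] x.
Proof.
split=> -[Mx H].
  split; first by rewrite -(Sn_actVK s x); apply: Sn_act_Mbar.
  move=> t; rewrite -[t](quad_permK s^-1%g) invgK -Sn_actE => h0 h1 h2 h3.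
  apply: H; move: h0 h1 h2 h3; rewrite !lab_perm !(mem_imset _ _ perm_inj) //.
split; first exact: Sn_act_Mbar.
move=> t h0 h1 h2 h3; rewrite Sn_actE; apply: H; rewrite !lab_perm !(mem_imset _ _ perm_inj) //.
Qed.

Lemma boundary_gt2_Sn s (y : PicMbar n K) :
  boundary_class_gt2 y -> boundary_class_gt2 (PicMbar_act s y).
Proof.
move=> [I [Z [h1 h2 ZE ->]]]; exists [set s i | i in I], (Sn_prime s Z); split.
- by rewrite card_imset //; apply: perm_inj.
- have -> : ~: [set s i | i in I] = [set s i | i in ~: I].
    apply/setP => i; rewrite inE -[i](permKV s) !(mem_imset _ _ perm_inj) inE //.
  by rewrite card_imset //; apply: perm_inj.
- by move=> x; rewrite -boundary_Sn /= ZE.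
- by rewrite PicMbar_actE Sn_DivU.
Qed.

Definition qcl D : Qmod n K := zproj (@boundary_class_gt2 n K) (cl D).

Lemma qcl_surj (q : Qmod n K) : exists D, q = qcl D.
Proof. by have [c ->] := zproj_surj q; have [D ->] := zproj_surj c; exists D. Qed.

Lemma qclB D1 D2 : qcl (D1 - D2) = qcl D1 - qcl D2.
Proof. by rewrite /qcl /cl !zprojB. Qed.

Lemma qclD D1 D2 : qcl (D1 + D2) = qcl D1 + qcl D2.
Proof. by rewrite /qcl /cl !zprojD. Qed.

Lemma qcl_principal D : principal D -> qcl D = 0.
Proof.
move=> pD; rewrite /qcl (_ : cl D = 0); last exact: zproj_eq0.
by have := zprojB (@boundary_class_gt2 n K) 0 0; rewrite !subrr.
Qed.

Lemma qcl_boundary (I : {set 'I_n}) Z : (2 < #|I|)%N -> (2 < #|~: I|)%N ->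
  (forall x, sval Z x <-> boundary I x) -> qcl << Z >> = 0.
Proof. by move=> h1 h2 ZE; apply: zproj_eq0; exists I, Z. Qed.

Lemma Qmod_actE s D : Qmod_act s (qcl D) = qcl (Sn_Div s D).
Proof.
rewrite /Qmod_act zquot_mapE ?PicMbar_actE // => [|c cP]; first exact: PicMbar_actB.
exact/SgenI/boundary_gt2_Sn.
Qed.

Definition relabp s f : mpol K P1n := subst (fun v : mvar P1n => @var K P1n (s v.1, v.2)) f.

Lemma relabpE s f w : peval (relabp s f) w = peval f (relab s w).
Proof. by rewrite peval_subst; apply: peval_ext => v; rewrite /teval pevalV. Qed.

Lemma relabK s w : relab s (relab s^-1%g w) = w.
Proof. by apply/funext => -[i e]; rewrite /relab /= permK. Qed.

Lemma relabVK s w : relab s^-1%g (relab s w) = w.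
Proof. by apply/funext => -[i e]; rewrite /relab /= permKV. Qed.

Lemma pull_polyT s p : pull (polyT s p) = relabp s (pull p).
Proof. by apply: peval_inj => w; rewrite pullE polyTE relabpE pullE cr_relab. Qed.

Lemma relabp_pfactor s f : pfactor f -> pfactor (relabp s f).
Proof.
have inv0 : relabp s 0 = 0 by apply: peval_inj => w; rewrite relabpE !peval0.
move=> [fp [d [p [hp p0 [h hE]]]]]; split.
  apply: (@iso_prime_inv _ _ _ (relabp s^-1%g)) fp => //.
  - by move=> g; apply: peval_inj => w; rewrite !relabpE relabK.
  - by move=> g; apply: peval_inj => w; rewrite !relabpE relabVK.
  - by apply: peval_inj => w; rewrite relabpE !peval1.
  - by move=> g h'; apply: substM.
exists (fun t => d (quad_perm s^-1%g t)), (polyT s p); split; first exact: polyT_homog.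
  rewrite pull_polyT; apply: contraNneq p0 => E; apply/eqP; apply: peval_inj => w.
  by rewrite -(relabK s w) -relabpE E !peval0.
by exists (relabp s h); rewrite pull_polyT hE; apply: substM.
Qed.

Lemma Zf_relabp s f x : Zf (relabp s f) x <-> Zf f (Sn_act s^-1%g x).
Proof.
have sub u g y : Zf (relabp u g) y -> Zf g (Sn_act u^-1%g y).
  move=> [yp H]; split; first exact: is_point_Sn.
  move=> d p hp vp; rewrite -polyTE; apply: (H _ _ (polyT_homog u hp)) => z [w [fw wp ->]].
  rewrite polyTE -cr_relab; apply: vp; exists (relab u w); split=> //; first by rewrite -relabpE.
  by rewrite cr_relab; apply: is_point_Sn.
split; first exact: sub.
move=> H; have := @sub s^-1%g (relabp s f) (Sn_act s^-1%g x).
rewrite invgK Sn_actVK; apply; rewrite (_ : relabp _ _ = f) //.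
by apply: peval_inj => w; rewrite !relabpE relabK.
Qed.

Lemma relabp_homog s (d : 'I_n -> nat) f : @multihomog K P1n d f ->
  @multihomog K P1n (fun i => d (s^-1%g i)) (relabp s f).
Proof.
move=> hf l w; rewrite !relabpE.
have -> : relab s (rescale l w) = @rescale K P1n (fun i => l (s i)) (relab s w) by [].
rewrite hf; congr (_ * _); rewrite [RHS](reindex_inj (@perm_inj _ s)) /=.
by apply: eq_bigr => i _; rewrite permK.
Qed.

Lemma is_deg_Sn s Z d : is_deg Z d -> is_deg (Sn_prime s Z) (fun i => d (s^-1%g i)).
Proof.
move=> [f [pf hf ZE]]; exists (relabp s f); split; first exact: relabp_pfactor.
  exact: relabp_homog.
by move=> x; rewrite Zf_relabp -ZE.
Qed.

Lemma phiZ_Sn s Z i : phiZ (Sn_prime s Z) i = phiZ Z (s^-1%g i).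
Proof.
have [[d dZ]|nd] := pselect (exists d, is_deg Z d).
  by rewrite (phiZE n_ge5 dZ) (phiZE n_ge5 (is_deg_Sn s dZ)) !ffunE.
rewrite !phiZ0 ?ffunE // => -[d /(is_deg_Sn s^-1%g)]; rewrite Sn_primeVK => H.
by apply: nd; exists (fun i => d (s^-1%g^-1%g i)).
Qed.

Lemma phiD_Sn s D i : phiD (Sn_Div s D) i = phiD D (s^-1%g i).
Proof.
rewrite Sn_DivE {1}/zlift /phiD zlift_sum sum_ffunE /zlift sum_ffunE.
by apply: eq_bigr => Z _; rewrite -/(zlift _ _) zliftMz zliftU !ffunMz phiZ_Sn.
Qed.

(** Suppose D_I = [Zf f]. After discarding one label of the pair whose bracket f may divide, a, b
    are taken in I and c, e outside; this is where both sides need three elements. A generic zero of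
    f has [ab] and [ce] nonzero, whereas their product is a coordinate vanishing on D_I. *)
Lemma phiZ_boundary (I : {set 'I_n}) Z : (2 < #|I|)%N -> (2 < #|~: I|)%N ->
  (forall x, sval Z x <-> boundary I x) -> phiZ Z = 0.
Proof.
move=> hI hJ ZE; apply: phiZ0 => -[d [f [pf hf Zf_E]]]; have [fp _] := pf.
have two (A : {set 'I_n}) x : (2 < #|A|)%N -> exists a b, [/\ a \in A, b \in A, a != b, a != x & b != x].
  move=> hA; have /card_gt1P[a [b [aA bA ab]]] : (1 < #|A :\ x|)%N.
    by have := cardsD1 x A; move: hA; case: (x \in A) => /=; rewrite ?add1n ?add0n => h1 h2; move: h1; rewrite h2 // => /ltnW.
  by move: aA bA; rewrite !inE => /andP[ax aA] /andP[bx bA]; exists a, b.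
have [x xP] : exists x, forall a b, a != b -> a != x -> b != x -> ~ divides f (brp K a b).
  have [x0 _] := @fresh n [::] (leq_trans (isT : 0 < 5)%N n_ge5).
  have [[i [j [ij gij]]]|H] := pselect (exists i j, i != j /\ divides f (brp K i j)).
    exists i => a b ab ai bi gab; have := prime_brp_uniq ij ab fp gij gab => /setP/(_ i).
    by rewrite !inE eqxx /= ![i == _]eq_sym (negPf ai) (negPf bi).
  by exists x0 => a b ab _ _ gab; apply: H; exists a, b.
have [a [b [aI bI ab ax bx]]] := two I x hI.
have [c [e [cI eI ce cx ex]]] := two (~: I) x hJ.
rewrite !inE in cI eI.
have [w [fw + wp]] := generic_pt fp (ndivM fp (xP a b ab ax bx) (xP c e ce cx ex)).
rewrite pevalM !brpE => /eqP; case.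
have Zw : boundary I (cr w) by apply/ZE/Zf_E; split=> // d' p _; apply; exists w.
have u : uniq [tuple a; b; c; e].
  have ne x' y' : x' \in I -> y' \notin I -> x' != y' by move=> h; apply: contraNneq => <-.
  by rewrite /= !inE !negb_or ab ce !ne.
pose t : quad n := exist (fun t : 4.-tuple 'I_n => uniq t) [tuple a; b; c; e] u.
by have [_ /(_ t aI bI cI eI)] := Zw; rewrite -[LHS]/(br w a b * br w c e).
Qed.

Definition phiQ : Qmod n K -> V := zquot_lift (zquot_lift (@phiD K n)).

Lemma phiQE D : phiQ (qcl D) = phiD D.
Proof.
have E D' : zquot_lift (@phiD K n) (cl D') = phiD D'.
  by apply: zquot_liftE => [|D'' /(phiD_principal n_ge5)//]; apply: zliftB.
rewrite /phiQ zquot_liftE ?E // => [x y|c [I [Z [h1 h2 ZE ->]]]]; last first.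
  by rewrite E /phiD zliftU (phiZ_boundary h1 h2 ZE).
have [[D1 ->] [D2 ->]] := (zproj_surj x, zproj_surj y).
by rewrite -zprojB !E; apply: zliftB.
Qed.

Lemma phiQB x y : phiQ (x - y) = phiQ x - phiQ y.
Proof.
have [[D1 ->] [D2 ->]] := (qcl_surj x, qcl_surj y).
by rewrite -qclB !phiQE; apply: zliftB.
Qed.

Lemma phiQ_Sn s q i : phiQ (Qmod_act s q) i = phiQ q (s^-1%g i).
Proof. by have [D ->] := qcl_surj q; rewrite Qmod_actE !phiQE phiD_Sn. Qed.

Lemma phiQ_even q : (2 %| (\sum_i phiQ q i)%R)%Z.
Proof. by have [D ->] := qcl_surj q; rewrite phiQE phiD_even. Qed.

End Equivariance.

(** * Boundary divisors *)

Section Incidence.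
Variables (K : closedFieldType) (n : nat).
Hypothesis n_ge5 : (5 <= n)%N.
Local Notation P1n := (P1n n).
Local Notation Q := (quadP1 n).
Local Notation Mbar := (@Mbar n K).
Implicit Types (w : pts K P1n) (i j a b c d : 'I_n) (x y : pts K Q) (t : quad n).

Lemma pointQ x t : is_point x -> x (t, false) != 0 \/ x (t, true) != 0.
Proof. by move=> /(_ t)[[t' [|]] [/= <- H]]; [right|left]. Qed.

Lemma same_pt_cross x y : is_point x -> is_point y ->
  (forall t, x (t, false) * y (t, true) = x (t, true) * y (t, false)) -> same_pt x y.
Proof.
move=> xp yp H.
exists (fun t => if x (t, false) != 0 then y (t, false) / x (t, false) else y (t, true) / x (t, true)).
have alt t : if x (t, false) != 0 then is_true (y (t, false) != 0)
             else [/\ x (t, false) = 0, x (t, true) != 0, y (t, false) = 0 & y (t, true) != 0].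
  have Ht := H t; have [x0|x0] := eqVneq (x (t, false)) 0 => /=.
    have [|xt] := pointQ t xp; first by rewrite x0 eqxx.
    move: Ht; rewrite x0 mul0r => /esym/eqP; rewrite mulf_eq0 (negPf xt) => /eqP y0.
    by have [|yt] := pointQ t yp; first by rewrite y0 eqxx.
  apply: contraPneq Ht => y0; rewrite y0 mulr0 => /eqP; rewrite mulf_eq0 (negPf x0) => /eqP y1.
  by have [|] := pointQ t yp; rewrite ?y0 ?y1 eqxx.
split=> [t|]; first by have := alt t; case: ifP => [x0 y0|_ [_ x1 _ y1]]; rewrite mulf_neq0 ?invr_eq0.
apply/funext => -[t e]; rewrite /rescale /=; have := alt t; have Ht := H t.
case: ifP => [x0 _|_ [x0 x1 y0 y1]]; case: e; rewrite ?divfK // ?y0 ?x0 ?mulr0 //.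
by apply: (mulfI x0); rewrite Ht; field.
Qed.

Definition lbl t a b c d := [/\ l0 t = a, l1 t = b, l2 t = c & l3 t = d].

Lemma lbl_ex a b c d : uniq [:: a; b; c; d] -> exists t, lbl t a b c d.
Proof.
move=> u; exists (exist (fun t : 4.-tuple 'I_n => uniq t) [tuple a; b; c; d] u).
by split.
Qed.

Lemma lbl_self t : lbl t (l0 t) (l1 t) (l2 t) (l3 t).
Proof. by []. Qed.

Lemma lbl_uniq t a b c d : lbl t a b c d -> uniq [:: a; b; c; d].
Proof.
case=> <- <- <- <-; have [[n1 n2 n3] [n4 n5 n6]] := quad_uniq t.
by rewrite /= !inE !negb_or n1 n2 n3 n4 n5 n6.
Qed.

Lemma lbl_inj t t' a b c d : lbl t a b c d -> lbl t' a b c d -> t = t'.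
Proof.
case=> h0 h1 h2 h3 [k0 k1 k2 k3]; apply/val_inj/eq_from_tnth => k.
have E (u : quad n) : tnth (val u) k = nth (l0 u) [:: l0 u; l1 u; l2 u; l3 u] k.
  case: k => [[|[|[|[|]]]] kP] //=; congr tnth; exact: val_inj.
by rewrite !E h0 h1 h2 h3 k0 k1 k2 k3.
Qed.

Definition tri (C : bool -> bool -> bool -> K) t1 t2 t3 x :=
  \sum_(e1 : bool) \sum_(e2 : bool) \sum_(e3 : bool)
     C e1 e2 e3 * (x (t1, e1) * x (t2, e2) * x (t3, e3)).

(** A trilinear relation that is an identity between brackets extends from configurations to the
    closure. The relations below are the classical ones between cross-ratios with permuted or
    replaced labels. *)
Lemma tri_Mbar C t1 t2 t3 x : Mbar x -> (forall w, tri C t1 t2 t3 (cr w) = 0) -> tri C t1 t2 t3 x = 0.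
Proof.
move=> Mx H.
pose q : mpol K Q := \sum_(e1 : bool) \sum_(e2 : bool) \sum_(e3 : bool)
  C e1 e2 e3 *: (@var K Q (t1, e1) * @var K Q (t2, e2) * @var K Q (t3, e3)).
have qE y : peval q y = tri C t1 t2 t3 y.
  rewrite /q peval_sum; apply: eq_bigr => e1 _; rewrite peval_sum; apply: eq_bigr => e2 _.
  by rewrite peval_sum; apply: eq_bigr => e3 _; rewrite pevalZ !pevalM !pevalV.
have hq : multihomog (fun t : mfac Q => (t == t1) + (t == t2) + (t == t3))%N q.
  do 3 (apply: multihomog_sum => ? _); apply: multihomogZ.
  by apply: multihomogM; [apply: multihomogM|]; apply: multihomog_var.
have /(vanish_Mbar hq) vq : pull q = 0 by apply: peval_inj => w; rewrite pullE qE H peval0.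
by rewrite -qE; apply: vq.
Qed.

Definition bi (C : bool -> bool -> K) t1 t2 x :=
  \sum_(e1 : bool) \sum_(e2 : bool) C e1 e2 * (x (t1, e1) * x (t2, e2)).

Lemma bi_Mbar C t1 t2 x : Mbar x -> (forall w, bi C t1 t2 (cr w) = 0) -> bi C t1 t2 x = 0.
Proof.
move=> Mx H.
pose q : mpol K Q := \sum_(e1 : bool) \sum_(e2 : bool)
  C e1 e2 *: (@var K Q (t1, e1) * @var K Q (t2, e2)).
have qE y : peval q y = bi C t1 t2 y.
  rewrite /q peval_sum; apply: eq_bigr => e1 _; rewrite peval_sum; apply: eq_bigr => e2 _.
  by rewrite pevalZ !pevalM !pevalV.
have hq : multihomog (fun t : mfac Q => (t == t1) + (t == t2))%N q.
  do 2 (apply: multihomog_sum => ? _); apply: multihomogZ.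
  by apply: multihomogM; apply: multihomog_var.
have /(vanish_Mbar hq) vq : pull q = 0 by apply: peval_inj => w; rewrite pullE qE H peval0.
by rewrite -qE; apply: vq.
Qed.

Lemma rel_flip t t' a b c d x : Mbar x -> lbl t a b c d -> lbl t' b a c d ->
  x (t', false) * (x (t, true) - x (t, false)) = - (x (t, false) * x (t', true)).
Proof.
move=> Mx [h0 h1 h2 h3] [k0 k1 k2 k3].
have := @bi_Mbar (fun e e' => match e, e' with
  | false, true => 1 | true, false => 1 | false, false => -1 | _, _ => 0 end) t t' x Mx.
rewrite /bi => H; apply/eqP; rewrite -subr_eq0 -{}H; first by rewrite !big_bool /=; apply/eqP; ring.
by move=> w; rewrite !big_bool !crE /= h0 h1 h2 h3 k0 k1 k2 k3 /br; ring.
Qed.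

Lemma rel_half t t' a b c d x : Mbar x -> lbl t a b c d -> lbl t' c d a b ->
  x (t', false) * x (t, true) = x (t, false) * x (t', true).
Proof.
move=> Mx [h0 h1 h2 h3] [k0 k1 k2 k3].
have := @bi_Mbar (fun e e' => match e, e' with
  | true, false => 1 | false, true => -1 | _, _ => 0 end) t t' x Mx.
rewrite /bi => H; apply/eqP; rewrite -subr_eq0 -{}H; first by rewrite !big_bool /=; apply/eqP; ring.
by move=> w; rewrite !big_bool !crE /= h0 h1 h2 h3 k0 k1 k2 k3 /br; ring.
Qed.

Lemma rel_swap t t' a b c d x : Mbar x -> lbl t a b c d -> lbl t' a c b d ->
  x (t, false) * x (t', false) = x (t, true) * x (t', true).
Proof.
move=> Mx [h0 h1 h2 h3] [k0 k1 k2 k3].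
have := @bi_Mbar (fun e e' => match e, e' with
  | false, false => 1 | true, true => -1 | _, _ => 0 end) t t' x Mx.
rewrite /bi => H; apply/eqP; rewrite -subr_eq0 -{}H; first by rewrite !big_bool /=; apply/eqP; ring.
by move=> w; rewrite !big_bool !crE /= h0 h1 h2 h3 k0 k1 k2 k3 /br; ring.
Qed.

Lemma rel_cycle t t' a b c d x : Mbar x -> lbl t a b c d -> lbl t' a d b c ->
  (x (t, true) - x (t, false)) * x (t', true) = - (x (t, false) * x (t', false)).
Proof.
move=> Mx [h0 h1 h2 h3] [k0 k1 k2 k3].
have := @bi_Mbar (fun e e' => match e, e' with
  | true, true => 1 | false, true => -1 | false, false => 1 | _, _ => 0 end) t t' x Mx.
rewrite /bi => H; apply/eqP; rewrite -subr_eq0 -{}H; first by rewrite !big_bool /=; apply/eqP; ring.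
by move=> w; rewrite !big_bool !crE /= h0 h1 h2 h3 k0 k1 k2 k3 /br; ring.
Qed.

(** For the ratio lambda of the first coordinate to the second, lambda(a,b,e,d) lambda(a,e,c,d) =
    lambda(a,b,c,d). *)
Lemma rel_ins t t1 t2 a b c d (e : 'I_n) x : Mbar x -> lbl t a b c d -> lbl t1 a b e d -> lbl t2 a e c d ->
  x (t1, false) * x (t2, false) * x (t, true) = x (t1, true) * x (t2, true) * x (t, false).
Proof.
move=> Mx [h0 h1 h2 h3] [k0 k1 k2 k3] [m0 m1 m2 m3].
have := @tri_Mbar (fun e e' e'' => match e, e', e'' with
  | false, false, true => 1 | true, true, false => -1 | _, _, _ => 0 end) t1 t2 t x Mx.
rewrite /tri => H; apply/eqP; rewrite -subr_eq0 -{}H; first by rewrite !big_bool /=; apply/eqP; ring.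
by move=> w; rewrite !big_bool !crE /= h0 h1 h2 h3 k0 k1 k2 k3 m0 m1 m2 m3 /br; ring.
Qed.

(* The cocycle relation between the cross-ratios of four of the labels a, b, c, d, e. *)
Lemma rel_repl3 t t' t'' a b c d (e : 'I_n) x : Mbar x -> lbl t a b c d -> lbl t' a b c e -> lbl t'' b c d e ->
  x (t, false) * x (t', true) * x (t'', true) =
  x (t, true) * x (t', false) * (x (t'', true) - x (t'', false)).
Proof.
move=> Mx [h0 h1 h2 h3] [k0 k1 k2 k3] [m0 m1 m2 m3].
have := @tri_Mbar (fun e e' e'' => match e, e', e'' with
  | false, true, true => 1 | true, false, true => -1 | true, false, false => 1 | _, _, _ => 0 end) t t' t'' x Mx.
rewrite /tri => H; apply/eqP; rewrite -subr_eq0 -{}H; first by rewrite !big_bool /=; apply/eqP; ring.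
by move=> w; rewrite !big_bool !crE /= h0 h1 h2 h3 k0 k1 k2 k3 m0 m1 m2 m3 /br; ring.
Qed.

Lemma rel_repl0 t t' t'' a b c d (e : 'I_n) x : Mbar x -> lbl t d a b c -> lbl t' e a b c -> lbl t'' a b d e ->
  x (t, false) * x (t', true) * (x (t'', true) - x (t'', false)) =
  x (t, true) * x (t', false) * x (t'', true).
Proof.
move=> Mx [h0 h1 h2 h3] [k0 k1 k2 k3] [m0 m1 m2 m3].
have := @tri_Mbar (fun e e' e'' => match e, e', e'' with
  | false, true, true => 1 | true, false, true => -1 | false, true, false => -1 | _, _, _ => 0 end) t t' t'' x Mx.
rewrite /tri => H; apply/eqP; rewrite -subr_eq0 -{}H; first by rewrite !big_bool /=; apply/eqP; ring.
by move=> w; rewrite !big_bool !crE /= h0 h1 h2 h3 k0 k1 k2 k3 m0 m1 m2 m3 /br; ring.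
Qed.

Lemma rel_repl1 t t' t'' a b c d (e : 'I_n) x : Mbar x -> lbl t a d b c -> lbl t' a e b c -> lbl t'' a c d e ->
  x (t, false) * x (t', true) * (x (t'', true) - x (t'', false)) =
  x (t, true) * x (t', false) * x (t'', true).
Proof.
move=> Mx [h0 h1 h2 h3] [k0 k1 k2 k3] [m0 m1 m2 m3].
have := @tri_Mbar (fun e e' e'' => match e, e', e'' with
  | false, true, true => 1 | true, false, true => -1 | false, true, false => -1 | _, _, _ => 0 end) t t' t'' x Mx.
rewrite /tri => H; apply/eqP; rewrite -subr_eq0 -{}H; first by rewrite !big_bool /=; apply/eqP; ring.
by move=> w; rewrite !big_bool !crE /= h0 h1 h2 h3 k0 k1 k2 k3 m0 m1 m2 m3 /br; ring.
Qed.

Lemma rel_repl2 t t' t'' a b c d (e : 'I_n) x : Mbar x -> lbl t a b d c -> lbl t' a b e c -> lbl t'' a c d e ->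
  x (t, false) * x (t', true) * x (t'', true) =
  x (t, true) * x (t', false) * (x (t'', true) - x (t'', false)).
Proof.
move=> Mx [h0 h1 h2 h3] [k0 k1 k2 k3] [m0 m1 m2 m3].
have := @tri_Mbar (fun e e' e'' => match e, e', e'' with
  | false, true, true => 1 | true, false, true => -1 | true, false, false => 1 | _, _, _ => 0 end) t t' t'' x Mx.
rewrite /tri => H; apply/eqP; rewrite -subr_eq0 -{}H; first by rewrite !big_bool /=; apply/eqP; ring.
by move=> w; rewrite !big_bool !crE /= h0 h1 h2 h3 k0 k1 k2 k3 m0 m1 m2 m3 /br; ring.
Qed.

Lemma f0_t x t : is_point x -> x (t, false) = 0 -> x (t, true) != 0.
Proof. by move=> /(pointQ t)[]// /eqP. Qed.

Variable Z : subpts K Q.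
Hypotheses (irrZ : irreducible_set Z) (ZM : subpt Z Mbar).

Let Zp x : Z x -> is_point x.
Proof. by move/ZM/Mbar_point. Qed.

(** All of Z lies over the boundary point ab|cd of the line Mbar_{0,{a,b,c,d}}. *)
Definition v4 a b c d := exists t, lbl t a b c d /\ vanish Z (@var K Q (t, false)).

Lemma v4P t a b c d : lbl t a b c d -> v4 a b c d <-> (forall x, Z x -> x (t, false) = 0).
Proof.
move=> tl; split=> [[t' [tl' H]] x Zx|H]; last by exists t; split=> // x Zx; rewrite pevalV H.
by rewrite -(lbl_inj tl' tl); have := H x Zx; rewrite pevalV.
Qed.

Lemma v4_uniq a b c d : v4 a b c d -> uniq [:: a; b; c; d].
Proof. by case=> t [/lbl_uniq]. Qed.

Lemma v4_flip a b c d : v4 a b c d -> v4 b a c d.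
Proof.
move=> v; have u := v4_uniq v; have [t tl] := lbl_ex u.
have [|t' tl'] := @lbl_ex b a c d.
  by move: u; rewrite /= !inE !negb_or (eq_sym a b) => /and4P[/and3P[-> -> ->] /andP[-> ->] -> _].
apply/(v4P tl') => x Zx; have x0 := (v4P tl).1 v x Zx.
have := rel_flip (ZM Zx) tl tl'; rewrite x0 subr0 mul0r oppr0 => /eqP.
by rewrite mulf_eq0 (negPf (f0_t (Zp Zx) x0)) orbF => /eqP.
Qed.

Lemma v4_half a b c d : v4 a b c d -> v4 c d a b.
Proof.
move=> v; have u := v4_uniq v; have [t tl] := lbl_ex u.
have [|t' tl'] := @lbl_ex c d a b.
  by rewrite (_ : [:: c; d; a; b] = rot 2 [:: a; b; c; d]) // rot_uniq.
apply/(v4P tl') => x Zx; have x0 := (v4P tl).1 v x Zx.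
have := rel_half (ZM Zx) tl tl'; rewrite x0 mul0r => /eqP.
by rewrite mulf_eq0 (negPf (f0_t (Zp Zx) x0)) orbF => /eqP.
Qed.

Lemma v4_flip2 a b c d : v4 a b c d -> v4 a b d c.
Proof. by move/v4_half/v4_flip/v4_half. Qed.

Lemma v4_excl a b c d : v4 a b c d -> v4 a c b d -> False.
Proof.
move=> v v'; have [[t tl] [t' tl']] := (lbl_ex (v4_uniq v), lbl_ex (v4_uniq v')).
have [[x Zx] _] := irrZ; have [x0 x0'] := ((v4P tl).1 v x Zx, (v4P tl').1 v' x Zx).
have := rel_swap (ZM Zx) tl tl'; rewrite x0 mul0r => /esym/eqP.
by rewrite mulf_eq0 (negPf (f0_t (Zp Zx) x0)) (negPf (f0_t (Zp Zx) x0')).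
Qed.

(** By [rel_ins] the product of two coordinates vanishes on Z, and Z is irreducible. *)
Lemma v4_ins a b c d (e : 'I_n) : v4 a b c d -> e \notin [:: a; b; c; d] -> v4 a b e d \/ v4 a e c d.
Proof.
move=> v; have u := v4_uniq v; rewrite !inE !negb_or => /and4P[ea eb ec ed].
have [t tl] := lbl_ex u.
move: (u); rewrite /= !inE !negb_or => /and4P[/and3P[ab ac ad] /andP[bc bd] cd _].
have [|t1 tl1] := @lbl_ex a b e d.
  by rewrite /= !inE !negb_or ab ad bd ed !(eq_sym _ e) ea eb.
have [|t2 tl2] := @lbl_ex a e c d.
  by rewrite /= !inE !negb_or ac ad cd ed ec !(eq_sym _ e) ea.
have [|H|H] := @irreducible_vanishM _ _ Z _ _ (@var K Q (t1, false)) (@var K Q (t2, false)) irrZ Zp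
   (multihomog_var _) (multihomog_var _).
- move=> x Zx; have x0 := (v4P tl).1 v x Zx.
  have := rel_ins (ZM Zx) tl tl1 tl2; rewrite x0 mulr0 => /eqP.
  by rewrite mulf_eq0 (negPf (f0_t (Zp Zx) x0)) orbF pevalM !pevalV => /eqP.
- by left; exists t1.
- by right; exists t2.
Qed.

(** The candidate for I when Z lies over ij|kl, the labels k and l being on the far side. *)
Definition side i k l : {set 'I_n} := [set e | [&& e != k, e != l & (e == i) || `[< v4 i e k l >]]].

(** Labels are inserted one at a time, until any two labels of I are known to be separated along Z
    from any two labels outside; this is what places Z inside D_I. *)
Lemma v4_side i j k l : v4 i j k l ->
  [/\ i \in side i k l, j \in side i k l, k \notin side i k l, l \notin side i k l &
     forall a b c d, a \in side i k l -> b \in side i k l -> c \notin side i k l -> d \notin side i k l ->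
       a != b -> c != d -> v4 a b c d].
Proof.
move=> v0; have u := v4_uniq v0; rewrite /= !inE !negb_or in u.
have /and4P[/and3P[ij ik il] /andP[jk jl] kl _] := u.
set I := side i k l.
have iI : i \in I by rewrite inE ik il eqxx.
have jI : j \in I by rewrite inE jk jl; apply/orP; right; apply/asboolP.
have kI : k \notin I by rewrite inE eqxx.
have lI : l \notin I by rewrite inE eqxx andbF.
have ne a c : a \in I -> c \notin I -> a != c by move=> aI; apply: contraNneq => <-.
have inI a : a \in I -> a != i -> v4 i a k l.
  by rewrite inE => /and3P[_ _ /orP[/eqP->|/asboolP //]]; rewrite eqxx.
have notI c : c \notin I -> v4 i c k l -> False.
  move=> cI v; have := v4_uniq v; rewrite /= !inE !negb_or => /and4P[/and3P[_ _ _] /andP[ck cl] _ _].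
  by case/negP: cI; rewrite inE ck cl; apply/orP; right; apply/asboolP.
have S1 a c : a \in I -> a != i -> c \notin I -> c != l -> v4 i a c l.
  move=> aI ai cI cl; have va := inI a aI ai.
  have [->//|ck] := eqVneq c k.
  have [|//|/notI H] := @v4_ins _ _ _ _ c va; last by case: H.
  by rewrite !inE !negb_or ck cl ![c == _]eq_sym !ne.
have S1' a c : a \in I -> a != i -> c \notin I -> c != k -> v4 i a c k.
  move=> aI ai cI ck; have va := v4_flip2 (inI a aI ai).
  have [->//|cl] := eqVneq c l.
  have [|//|/v4_flip2/notI H] := @v4_ins _ _ _ _ c va; last by case: H.
  by rewrite !inE !negb_or ck cl ![c == _]eq_sym !ne.
have S2 a c d : a \in I -> a != i -> c \notin I -> d \notin I -> c != d -> v4 i a c d.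
  move=> aI ai cI dI cd.
  have [dl|dl] := eqVneq d l; first by rewrite dl; apply: S1 => //; rewrite -dl.
  have [cl|cl] := eqVneq c l; first by apply: v4_flip2; rewrite cl; apply: S1.
  have [dk|dk] := eqVneq d k; first by rewrite dk; apply: S1' => //; rewrite -dk.
  have [ck|ck] := eqVneq c k; first by apply: v4_flip2; rewrite ck; apply: S1'.
  (* If neither of the two insertions gives ia|cd, then Z lies over id|lc and over ic|ld, two
     different boundary points. *)
  have E1 : v4 i a d c \/ v4 i d l c.
    apply: (@v4_ins i a l c d); first exact/v4_flip2/S1.
    by rewrite !inE !negb_or dl (eq_sym d c) cd ![d == _]eq_sym !ne.
  have E2 : v4 i a c d \/ v4 i c l d.
    apply: (@v4_ins i a l d c); first exact/v4_flip2/S1.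
    by rewrite !inE !negb_or cl cd ![c == _]eq_sym !ne.
  case: E1 => [/v4_flip2//|h1]; case: E2 => // h2; exfalso.
  by apply: (@v4_excl i d c l) => //; apply: v4_flip2.
split=> // a b c d aI bI cI dI ab cd.
have [ai|ai] := eqVneq a i; first by rewrite ai; apply: S2 => //; rewrite eq_sym -ai.
have [bi|bi] := eqVneq b i; first by rewrite bi; apply/v4_flip/S2.
have va := v4_flip (S2 a c d aI ai cI dI cd); have vb := v4_flip (S2 b c d bI bi cI dI cd).
have [|h1|//] := @v4_ins _ _ _ _ b va; first by rewrite !inE !negb_or bi eq_sym ab !ne.
have [|h2|/v4_flip//] := @v4_ins _ _ _ _ a vb; first by rewrite !inE !negb_or ai ab !ne.
exfalso; apply: (@v4_excl i a b d); first exact: v4_flip.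
exact: v4_flip.
Qed.
End Incidence.

Lemma subst_homog (K : closedFieldType) (A B : mproj) (q : form_tuple K A B)
    (o : mfac B -> option (mfac A)) d (p : mpol K B) :
  (forall l x, teval q (rescale l x) = rescale (fun j => oapp l 1 (o j)) (teval q x)) ->
  multihomog d p -> exists d', multihomog d' (subst q p).
Proof.
move=> H hp; exists (fun i => \sum_(j | o j == Some i) d j)%N => l x.
rewrite !peval_subst H hp; congr (_ * _).
under [RHS]eq_bigr do rewrite -prodrXr.
rewrite (exchange_big_dep predT) //=; apply: eq_bigr => j _.
case: (o j) => [i|]; last by rewrite big_pred0 // expr1n.
by rewrite (big_pred1 i) // => u; rewrite /= (inj_eq Some_inj) eq_sym.
Qed.

Lemma curve_var (K : closedFieldType) (A : mproj) (r : mvar A -> {poly K}) v : curve r (@var K A v) = r v.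
Proof. by rewrite /curve /var mmapX mmap1U enum_rankK. Qed.

(** * Gluing and transverse curves at a boundary divisor *)

Section Chart.
Variables (K : closedFieldType) (n : nat).
Hypothesis n_ge5 : (5 <= n)%N.
Local Notation P1n := (P1n n).
Local Notation Q := (quadP1 n).
Local Notation Mbar := (@Mbar n K).
Implicit Types (w : pts K P1n) (i j a b c d : 'I_n) (x y : pts K Q) (t : quad n) (I : {set 'I_n}).

Definition cnt I t : nat := ((l0 t \in I) + (l1 t \in I) + (l2 t \in I) + (l3 t \in I))%N.

Definition toward I j : 'I_n -> 'I_n := fun e => if e \in I then e else j.

(** Only used when r keeps the four labels distinct; [insubd] returns t otherwise. *)
Definition qmap (r : 'I_n -> 'I_n) t : quad n := insubd t [tuple of map r (val t)].

Lemma qmap_lab r t : uniq [:: r (l0 t); r (l1 t); r (l2 t); r (l3 t)] ->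
  lbl (qmap r t) (r (l0 t)) (r (l1 t)) (r (l2 t)) (r (l3 t)).
Proof.
move=> u; have E : val (qmap r t) = [tuple of map r (val t)].
  rewrite /qmap insubdK //; move: u; rewrite /l0 /l1 /l2 /l3 /lab /in_mem /=.
  by case: (val t) => -[|x0 [|x1 [|x2 [|x3 [|]]]]].
by rewrite /lbl {1}/l0 {1}/l1 {1}/l2 {1}/l3 /lab E !tnth_map.
Qed.

Lemma toward_lab I j t : j \notin I -> (2 < cnt I t)%N ->
  lbl (qmap (toward I j) t) (toward I j (l0 t)) (toward I j (l1 t)) (toward I j (l2 t)) (toward I j (l3 t)).
Proof.
move=> jI; have ne a : a \in I -> (a != j) * (j != a).
  by move=> aI; rewrite (eq_sym j); have -> : a != j by apply: contraNneq jI => <-.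
have [[n1 n2 n3] [n4 n5 n6]] := quad_uniq t.
rewrite /cnt => H; apply: qmap_lab; move: H; rewrite /toward /= !inE !negb_or.
case e0: (l0 t \in I); case e1: (l1 t \in I); case e2: (l2 t \in I); case e3: (l3 t \in I) => //= _;
  by rewrite ?n1 ?n2 ?n3 ?n4 ?n5 ?n6 ?(ne _ e0) ?(ne _ e1) ?(ne _ e2) ?(ne _ e3).
Qed.

Lemma cntC I t : (cnt (~: I) t + cnt I t = 4)%N.
Proof. by rewrite /cnt !inE; do 4 case: (_ \in I). Qed.

Lemma boundaryC I x : boundary I x -> boundary (~: I) x.
Proof.
move=> [Mx H]; split=> // t; rewrite !inE !negbK => h0 h1 h2 h3.
have [|t' tl] := @lbl_ex n (l2 t) (l3 t) (l0 t) (l1 t).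
  have := lbl_uniq (lbl_self t).
  by rewrite (_ : [:: l2 t; l3 t; l0 t; l1 t] = rot 2 [:: l0 t; l1 t; l2 t; l3 t]) // rot_uniq.
have [e0 e1 e2 e3] := tl.
have x0 : x (t', false) = 0.
  by apply: H; rewrite -/(l0 _) -/(l1 _) -/(l2 _) -/(l3 _) ?e0 ?e1 ?e2 ?e3.
have := rel_half Mx tl (lbl_self t); rewrite x0 mul0r => /eqP.
by rewrite mulf_eq0 (negPf (f0_t (Mbar_point Mx) x0)) orbF => /eqP.
Qed.

Lemma boundary0 I x t a b c d : boundary I x -> lbl t a b c d ->
  a \in I -> b \in I -> c \notin I -> d \notin I -> x (t, false) = 0 /\ x (t, true) != 0.
Proof.
move=> [Mx H] [<- <- <- <-] h0 h1 h2 h3; have x0 := H t h0 h1 h2 h3; split=> //.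
exact: f0_t (Mbar_point Mx) x0.
Qed.

(* On D_I, the labels outside I all look the same from the component carrying I. *)
Lemma boundary_toward I j x t : boundary I x -> j \notin I -> (2 < cnt I t)%N ->
  x (t, false) * x (qmap (toward I j) t, true) = x (t, true) * x (qmap (toward I j) t, false).
Proof.
move=> Bx jI tI; have Mx : Mbar x by case: Bx.
have tl := toward_lab jI tI; have tt := lbl_self t.
have triv : toward I j (l0 t) = l0 t -> toward I j (l1 t) = l1 t -> toward I j (l2 t) = l2 t ->
    toward I j (l3 t) = l3 t -> x (t, false) * x (qmap (toward I j) t, true) = x (t, true) * x (qmap (toward I j) t, false).
  by move=> h0 h1 h2 h3; rewrite h0 h1 h2 h3 in tl; rewrite (lbl_inj tl tt) mulrC.
have ne a : a \in I -> (a != j) * (j != a).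
  by move=> aI; rewrite (eq_sym j); have -> : a != j by apply: contraNneq jI => <-.
have ex a b c : a \in I -> b \in I -> c \notin I -> a != b -> c != j ->
    exists t', [/\ lbl t' a b c j, x (t', false) = 0 & x (t', true) != 0].
  move=> aI bI cI ab cj; have nec e : e \in I -> e != c by move=> eI; apply: contraNneq cI => <-.
  have [|t' tl'] := @lbl_ex n a b c j; first by rewrite /= !inE !negb_or ab cj !nec // !ne.
  by exists t'; have [] := boundary0 Bx tl' aI bI cI jI.
have [[n1 n2 n3] [n4 n5 n6]] := quad_uniq t.
move: tI tl triv; rewrite /cnt /toward.
case e0: (l0 t \in I); case e1: (l1 t \in I); case e2: (l2 t \in I); case e3: (l3 t \in I) => //= _ tl triv;
  first exact: triv.
- have [E|l3j] := eqVneq (l3 t) j; first by apply: triv.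
  have [t' [tl' x0 x1]] := ex _ _ _ e1 e2 (negbT e3) n4 l3j.
  have := rel_repl3 Mx tt tl tl'; rewrite x0 subr0; exact: mulIf.
- have [E|l2j] := eqVneq (l2 t) j; first by apply: triv.
  have [t' [tl' x0 x1]] := ex _ _ _ e0 e3 (negbT e2) n3 l2j.
  have := rel_repl2 Mx tt tl tl'; rewrite x0 subr0; exact: mulIf.
- have [E|l1j] := eqVneq (l1 t) j; first by apply: triv.
  have [t' [tl' x0 x1]] := ex _ _ _ e0 e3 (negbT e1) n3 l1j.
  have := rel_repl1 Mx tt tl tl'; rewrite x0 subr0; exact: mulIf.
- have [E|l0j] := eqVneq (l0 t) j; first by apply: triv.
  have [t' [tl' x0 x1]] := ex _ _ _ e1 e2 (negbT e0) n4 l0j.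
  have := rel_repl0 Mx tt tl tl'; rewrite x0 subr0; exact: mulIf.
Qed.

Variables (I : {set 'I_n}) (i0 j0 : 'I_n).
Hypotheses (i0I : i0 \in I) (j0I : j0 \notin I).

(** For s nonzero [wI s w] and [wJ s w] differ by diag(s, 1) and scalings, so they have the same
    cross-ratios. At s = 0 the first sends all points outside I to (1 : 0), the second all points in
    I to (0 : 1). *)
Definition wI (s : K) w : pts K P1n := fun v => if (v.1 \notin I) && v.2 then w v * s else w v.
Definition wJ (s : K) w : pts K P1n := fun v => if (v.1 \in I) && ~~ v.2 then w v * s else w v.

Definition crR (R : comNzRingType) (m : 'I_n * bool -> R) (v : quad n * bool) : R :=
  let B a b := m (a, false) * m (b, true) - m (b, false) * m (a, true) in
  let t := v.1 in
  if v.2 then B (l0 t) (l2 t) * B (l1 t) (l3 t) else B (l0 t) (l1 t) * B (l2 t) (l3 t).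

Definition wIX w : 'I_n * bool -> {poly K} :=
  fun v => if (v.1 \notin I) && v.2 then (w v)%:P * 'X else (w v)%:P.
Definition wJX w : 'I_n * bool -> {poly K} :=
  fun v => if (v.1 \in I) && ~~ v.2 then (w v)%:P * 'X else (w v)%:P.

(* The curve contracts the points labelled by I (seen from them: the other
   points) and meets D_I at s = 0. *)
Definition gam w (v : mvar Q) : {poly K} := crR (if (1 < cnt I v.1)%N then wIX w else wJX w) v.

Lemma gamE w v s : (gam w v).[s] = cr (if (1 < cnt I v.1)%N then wI s w else wJ s w) v.
Proof.
case: v => t e; rewrite crE /gam /crR /br /wIX /wJX /wI /wJ /=.
have E (C : bool) (c : K) : (if C then c%:P * 'X else c%:P).[s] = if C then c * s else c.
  by case: C; rewrite !hornerE.
by case: e; case: (1 < _)%N; rewrite /= hornerM !hornerD !hornerN !hornerM !E.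
Qed.

(** The limit of the curve. A quadruple with at least two labels in I is read off [wI], the others
    off [wJ], so that at most two of its points are brought together and its cross-ratio stays
    defined. *)
Definition G w : pts K Q := fun v => (gam w v).[0].

Definition Gp : form_tuple K P1n Q := fun v =>
  crR (fun u : 'I_n * bool => if (if (1 < cnt I v.1)%N then (u.1 \notin I) && u.2 else (u.1 \in I) && ~~ u.2) then 0
              else @var K P1n u) v.

Lemma GpE w : teval Gp w = G w.
Proof.
apply/funext => -[t e]; rewrite /teval /G gamE crE /Gp /crR /br /wI /wJ /=.
have E (C : bool) (u : 'I_n * bool) : peval (if C then 0 else @var K P1n u) w = if C then w u * 0 else w u.
  by case: C; rewrite pevalE ?mulr0.
by case: e; case: (1 < _)%N; rewrite /= pevalM !pevalB !pevalM !E.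
Qed.

Definition good w := [/\ forall a, a \in I -> w (a, true) != 0, forall a, a \notin I -> w (a, false) != 0 &
  forall a b, a != b -> (a \in I) = (b \in I) -> br w a b != 0].

Lemma br_wI w a b : br (wI 0 w) a b =
  if a \in I then if b \in I then br w a b else - (w (b, false) * w (a, true))
  else if b \in I then w (a, false) * w (b, true) else 0.
Proof. by rewrite /br /wI /=; case: (a \in I); case: (b \in I) => /=; ring. Qed.

Lemma br_wJ w a b : br (wJ 0 w) a b =
  if a \in I then if b \in I then 0 else - (w (b, false) * w (a, true))
  else if b \in I then w (a, false) * w (b, true) else br w a b.
Proof. by rewrite /br /wJ /=; case: (a \in I); case: (b \in I) => /=; ring. Qed.

Lemma G_point w : good w -> is_point (G w).
Proof.
move=> [h1 h2 h3] t.
have bI a b : a != b -> (a \in I) || (b \in I) -> br (wI 0 w) a b != 0.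
  rewrite br_wI => ab; case e0: (a \in I); case e1: (b \in I) => //= _; first by apply: h3; rewrite ?e0.
    by rewrite oppr_eq0 mulf_neq0 ?h1 ?h2 ?e1.
  by rewrite mulf_neq0 ?h1 ?h2 ?e0.
have bJ a b : a != b -> (a \notin I) || (b \notin I) -> br (wJ 0 w) a b != 0.
  rewrite br_wJ => ab; case e0: (a \in I); case e1: (b \in I) => //= _; last by apply: h3; rewrite ?e0.
    by rewrite oppr_eq0 mulf_neq0 ?h1 ?h2 ?e1.
  by rewrite mulf_neq0 ?h1 ?h2 ?e0.
have [[n1 n2 n3] [n4 n5 n6]] := quad_uniq t.
suff : (G w (t, false) != 0) || (G w (t, true) != 0) by case/orP; [exists (t, false)|exists (t, true)].
rewrite /G !gamE !crE /=; case: ifP => [|/negbT]; rewrite /cnt => H.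
  have : ((l0 t \in I) || (l1 t \in I)) && ((l2 t \in I) || (l3 t \in I)) ||
         ((l0 t \in I) || (l2 t \in I)) && ((l1 t \in I) || (l3 t \in I)).
    by move: H; do 4 case: (_ \in I).
  by case/orP=> /andP[p1 p2]; apply/orP; [left|right]; rewrite mulf_neq0 ?bI.
have : ((l0 t \notin I) || (l1 t \notin I)) && ((l2 t \notin I) || (l3 t \notin I)) ||
       ((l0 t \notin I) || (l2 t \notin I)) && ((l1 t \notin I) || (l3 t \notin I)).
  by move: H; do 4 case: (_ \in I).
by case/orP=> /andP[p1 p2]; apply/orP; [left|right]; rewrite mulf_neq0 ?bJ.
Qed.

Lemma gam_Mbar (d : mfac Q -> nat) (p : mpol K Q) w : multihomog d p -> pull p = 0 -> curve (gam w) p = 0.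
Proof.
move=> hp p0; apply: (@poly_eq_fun _ _ _ 'X) => [|s]; first by rewrite polyX_eq0.
rewrite hornerX => s0; rewrite curveE horner0.
pose g (x y : bool) : K := if x == y then (if x then 1 else s) else 0.
pose tau i : K := if i \in I then 1 else s^-1.
have E : wJ s w = lin g tau (wI s w).
  apply/funext => -[i e]; rewrite /wJ /lin /wI /g /tau /=.
  by case: (i \in I); case: e => /=; field.
set mu := (fun q => det2 g ^+ 2 * (tau (l0 q) * tau (l1 q) * tau (l2 q) * tau (l3 q))).
have -> : (fun v => (gam w v).[s]) =
    @rescale K Q (fun t => if (1 < cnt I t)%N then 1 else mu t) (cr (wI s w)).
  apply/funext => v; rewrite gamE /rescale -[blk v]/(v.1); case: ifP; rewrite ?mul1r // => _.
  by rewrite E cr_lin.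
by rewrite hp -pullE p0 peval0 mulr0.
Qed.

Lemma G_Mbar w : good w -> Mbar (G w).
Proof.
move=> gw; split; first exact: G_point.
move=> d p hp /vanish_M0n p0; have := gam_Mbar w hp p0.
by move/(congr1 (fun P : {poly K} => P.[0])); rewrite curveE horner0.
Qed.

Lemma G_boundary w : good w -> boundary I (G w).
Proof.
move=> gw; split=> [|t]; first exact: G_Mbar.
rewrite -/(l0 _) -/(l1 _) -/(l2 _) -/(l3 _) => h0 h1 /negPf h2 /negPf h3.
by rewrite /G gamE crE /cnt /= h0 h1 h2 h3 /= !br_wI h2 h3 mulr0.
Qed.

(** Both configurations are moved so that [i0] is at (0 : 1) and [j0] at (1 : 0), the limit
    positions of I under [wJ] and of its complement under [wI]; labels in I are then taken from w,
    the others from w'. *)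
Definition mix w w' : pts K P1n := fun v =>
  br (if v.1 \in I then w else w') v.1 (if v.2 then j0 else i0).

Definition all_br w := forall i j, i != j -> br w i j != 0.

Lemma mix_good w w' : all_br w -> all_br w' -> good (mix w w').
Proof.
have ij : i0 != j0 by apply: contraNneq j0I => <-.
move=> hw hw'; split=> [a aI|a aI|a b ab].
- by rewrite /mix /= aI hw //; apply: contraNneq j0I => <-.
- by rewrite /mix /= (negPf aI) hw' //; apply: contraNneq aI => ->.
- move=> E; have -> : br (mix w w') a b = (let u := if a \in I then w else w' in br u a b * br u i0 j0).
    by rewrite {1}/br /mix /= -E; case: (a \in I); rewrite /br /=; ring.
  by case: (a \in I) => /=; rewrite mulf_neq0 ?hw ?hw'.
Qed.

(** The value 0, oo or 1 of the cross-ratio of a quadruple with two labels on each side of the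
    node. *)
Definition mid t (e : bool) : K :=
  if (l0 t \in I) == (l1 t \in I) then e%:R
  else if (l0 t \in I) == (l2 t \in I) then (~~ e)%:R else 1.

(** In cross-ratio coordinates, the gluing map onto D_I from the product of the moduli spaces for I
    + {j0} and I^c + {i0}; the extra label marks the node. *)
Definition Phi x y : pts K Q := fun v =>
  if (2 < cnt I v.1)%N then x (qmap (toward I j0) v.1, v.2)
  else if (2 < cnt (~: I) v.1)%N then y (qmap (toward (~: I) i0) v.1, v.2)
  else mid v.1 v.2.

Lemma Phi1 x y t e : (2 < cnt I t)%N -> Phi x y (t, e) = x (qmap (toward I j0) t, e).
Proof. by rewrite /Phi /= => ->. Qed.

Lemma Phi2 x y t e : (2 < cnt (~: I) t)%N -> Phi x y (t, e) = y (qmap (toward (~: I) i0) t, e).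
Proof. by move=> h; rewrite /Phi /= h; have := cntC I t; case: ifP => //; lia. Qed.

Lemma Phi3 x y t e : ~~ (2 < cnt I t)%N -> ~~ (2 < cnt (~: I) t)%N -> Phi x y (t, e) = mid t e.
Proof. by rewrite /Phi /= => /negPf -> /negPf ->. Qed.

Let i0C : i0 \notin ~: I. Proof. by rewrite inE i0I. Qed.

Lemma mid_pt t : mid t false != 0 \/ mid t true != 0.
Proof. by rewrite /mid; case: ifP => _; [|case: ifP => _]; rewrite ?oner_eq0; auto. Qed.

Lemma Phi_point x y : is_point x -> is_point y -> is_point (Phi x y).
Proof.
move=> xp yp t.
suff : Phi x y (t, false) != 0 \/ Phi x y (t, true) != 0 by case; [exists (t, false)|exists (t, true)].
by rewrite /Phi /=; case: ifP => _; [exact: pointQ | case: ifP => _; [exact: pointQ|exact: mid_pt]].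
Qed.

Lemma mid_cross t (f g : K) : ~~ (2 < cnt I t)%N -> ~~ (2 < cnt (~: I) t)%N ->
  ((l0 t \in I) = (l1 t \in I) -> f = 0) -> ((l0 t \in I) = (l2 t \in I) -> g = 0) ->
  ((l0 t \in I) = (l3 t \in I) -> f = g) -> f * mid t true = g * mid t false.
Proof.
rewrite /mid /cnt !inE; case: (l0 t \in I); case: (l1 t \in I); case: (l2 t \in I); case: (l3 t \in I) => //= _ _ h1 h2 h3.
all: first [by rewrite h1 // mul0r mulr0 | by rewrite h2 // mul0r mulr0 | by rewrite h3].
Qed.

(** Seen from I, the limit only depends on w, with every outside label at the place of [j0]; seen
    from the complement, only on w', with the labels of I at the place of [i0]. The two sides differ
    by the scalars c in [E1] and [E2]. *)
Lemma Phi_mix w w' : all_br w -> all_br w' -> same_pt (G (mix w w')) (Phi (cr w) (cr w')).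
Proof.
move=> hw hw'; apply: same_pt_cross.
- exact/G_point/mix_good.
- have pt u : all_br u -> is_point (cr u).
    by move=> hu t; exists (t, true); split=> //; apply: cr_point.
  by apply: Phi_point; apply: pt.
have ij : i0 != j0 by apply: contraNneq j0I => <-.
have dw := hw i0 j0 ij; have dw' := hw' i0 j0 ij.
have E1 a b : br (wI 0 (mix w w')) a b =
    (let c e := if e \in I then 1 else - br w' e i0 / br w i0 j0 in
     br w i0 j0 * (c a * c b) * br w (toward I j0 a) (toward I j0 b)).
  rewrite br_wI /mix /toward /=; case e0: (a \in I); case e1: (b \in I) => /=.
  - by rewrite {1}/br /= e0 e1 /br; ring.
  - by move: dw; rewrite /br => dw; field.
  - by move: dw; rewrite /br => dw; field.
  - by rewrite br_ii mulr0.
have E2 a b : br (wJ 0 (mix w w')) a b =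
    (let c e := if e \in I then br w e j0 / br w' i0 j0 else 1 in
     br w' i0 j0 * (c a * c b) * br w' (toward (~: I) i0 a) (toward (~: I) i0 b)).
  rewrite br_wJ /mix /toward /= !inE; case e0: (a \in I); case e1: (b \in I) => /=.
  - by rewrite br_ii mulr0.
  - by move: dw'; rewrite /br => dw'; field.
  - by move: dw'; rewrite /br => dw'; field.
  - by rewrite {1}/br /= e0 e1 /br; ring.
move=> t; have [h|h] := boolP (2 < cnt I t)%N.
  have [q0 q1 q2 q3] := toward_lab j0I h.
  by rewrite !Phi1 // /G !gamE !crE /= (ltnW h) q0 q1 q2 q3 !E1 /=; ring.
have [h'|h'] := boolP (2 < cnt (~: I) t)%N.
  have [q0 q1 q2 q3] := toward_lab i0C h'.
  have /negPf h2 : ~~ (1 < cnt I t)%N by have := cntC I t; lia.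
  by rewrite !Phi2 // /G !gamE !crE /= h2 q0 q1 q2 q3 !E2 /=; ring.
have h2 : (1 < cnt I t)%N by have := cntC I t; lia.
rewrite !Phi3 // /G !gamE !crE /= h2 /=; apply: mid_cross => //; move: h h'; rewrite /cnt !inE !br_wI.
all: case: (l0 t \in I); case: (l1 t \in I); case: (l2 t \in I); case: (l3 t \in I) => //= _ _ _; ring.
Qed.

Lemma Phi_diag x : boundary I x -> same_pt (Phi x x) x.
Proof.
move=> Bx; have Mx : Mbar x by case: Bx.
have xp := Mbar_point Mx; apply: same_pt_sym; apply: same_pt_cross => // [|t]; first exact: Phi_point.
rewrite /Phi /=; case: ifP => [h|/negbT h]; first exact: boundary_toward.
case: ifP => [h'|/negbT h']; first by apply: boundary_toward => //; apply: boundaryC.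
have tt := lbl_self t; have u := lbl_uniq tt; move: (u).
rewrite /= !inE !negb_or => /and4P[/and3P[n1 n2 n3] /andP[n4 n5] n6 _].
have BC := boundaryC Bx.
have zero t' a b c d : lbl t' a b c d -> (a \in I) = (b \in I) -> (c \in I) = (d \in I) ->
    (a \in I) != (c \in I) -> x (t', false) = 0 /\ x (t', true) != 0.
  move=> tl E1 E2 NE; have [aI|aI] := boolP (a \in I).
    by apply: (boundary0 Bx tl); rewrite -?E1 -?E2 //; move: NE; rewrite aI; case: (c \in I).
  by apply: (boundary0 BC tl); rewrite inE -?E1 -?E2 //; move: NE; rewrite (negPf aI); case: (c \in I).
have two : [\/ [/\ (l0 t \in I) = (l1 t \in I), (l2 t \in I) = (l3 t \in I) & (l0 t \in I) != (l2 t \in I)],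
               [/\ (l0 t \in I) = (l2 t \in I), (l1 t \in I) = (l3 t \in I) & (l0 t \in I) != (l1 t \in I)] |
               [/\ (l0 t \in I) = (l3 t \in I), (l1 t \in I) = (l2 t \in I) & (l0 t \in I) != (l1 t \in I)]].
  move: h h'; rewrite /cnt !inE; case: (l0 t \in I); case: (l1 t \in I); case: (l2 t \in I); case: (l3 t \in I) => //= _ _;
    first [by constructor 1 | by constructor 2 | by constructor 3].
case: two => -[E1 E2 NE].
- have [x0 _] := zero _ _ _ _ _ tt E1 E2 NE.
  by rewrite /mid -E1 eqxx x0 mul0r mulr0.
- have [|t' tl] := @lbl_ex n (l0 t) (l2 t) (l1 t) (l3 t).
    by rewrite /= !inE !negb_or n1 n2 n3 n6 n5 eq_sym n4.
  have [x0 x1] := zero _ _ _ _ _ tl E1 E2 NE.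
  have := rel_swap Mx tt tl; rewrite x0 mulr0 => /esym/eqP; rewrite mulf_eq0 (negPf x1) orbF => /eqP xt.
  by rewrite /mid (negPf NE) -E1 eqxx xt mul0r mulr0.
- have [|t' tl] := @lbl_ex n (l0 t) (l3 t) (l1 t) (l2 t).
    by rewrite /= !inE !negb_or n1 n2 n3 n4 ![l3 t == _]eq_sym n5 n6.
  have [x0 x1] := zero _ _ _ _ _ tl E1 E2 NE.
  have := rel_cycle Mx tt tl; rewrite x0 mulr0 oppr0 => /eqP; rewrite mulf_eq0 (negPf x1) orbF subr_eq0 => /eqP xt.
  by rewrite /mid (negPf NE) -E2 (negPf NE) !mulr1.
Qed.

Definition PhiL y : form_tuple K Q Q := fun v =>
  if (2 < cnt I v.1)%N then @var K Q (qmap (toward I j0) v.1, v.2)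
  else if (2 < cnt (~: I) v.1)%N then cst Q (y (qmap (toward (~: I) i0) v.1, v.2))
  else cst Q (mid v.1 v.2).

Definition PhiR x : form_tuple K Q Q := fun v =>
  if (2 < cnt I v.1)%N then cst Q (x (qmap (toward I j0) v.1, v.2))
  else if (2 < cnt (~: I) v.1)%N then @var K Q (qmap (toward (~: I) i0) v.1, v.2)
  else cst Q (mid v.1 v.2).

Lemma PhiLE y x : teval (PhiL y) x = Phi x y.
Proof. by apply/funext => v; rewrite /teval /PhiL /Phi; case: ifP => _; [|case: ifP => _]; rewrite pevalE. Qed.

Lemma PhiRE x y : teval (PhiR x) y = Phi x y.
Proof. by apply/funext => v; rewrite /teval /PhiR /Phi; case: ifP => _; [|case: ifP => _]; rewrite pevalE. Qed.

(** A form vanishing at the limits vanishes at the gluings of two points of M_{0,n} ([Phi_mix]);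
    with one argument fixed it is a form in the other, so the points can be moved to the closure in
    turn; and a point of D_I is the gluing of itself with itself ([Phi_diag]). *)
Lemma G_dense (d : mfac Q -> nat) (p : mpol K Q) : multihomog d p -> (forall w, good w -> peval p (G w) = 0) -> vanish (boundary I) p.
Proof.
move=> hp H x Bx; have Mx : Mbar x by case: Bx.
have S1 w w' : all_br w -> all_br w' -> peval p (Phi (cr w) (cr w')) = 0.
  move=> hw hw'; apply/eqP; rewrite (multihomog_same hp (Phi_mix hw hw')) H //; exact: mix_good.
have S2 w' : all_br w' -> peval p (Phi x (cr w')) = 0.
  move=> hw'; rewrite -PhiLE -peval_subst.
  have [|d' hd'] := @subst_homog K Q Q (PhiL (cr w')) (fun t => if (2 < cnt I t)%N then Some (qmap (toward I j0) t) else None) d p _ hp.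
    move=> l y; rewrite !PhiLE; apply/funext => -[t e]; rewrite /Phi /rescale /=.
    by case: ifP => //= _; rewrite mul1r.
  case: Mx => _; apply; first exact: hd'.
  by move=> _ /M0n_crP[w [hw ->]]; rewrite peval_subst PhiLE S1.
apply/eqP; rewrite -(multihomog_same hp (same_pt_sym (Phi_diag Bx))); apply/eqP.
rewrite -PhiRE -peval_subst.
have [|d' hd'] := @subst_homog K Q Q (PhiR x) (fun t => if (2 < cnt I t)%N then None else
    if (2 < cnt (~: I) t)%N then Some (qmap (toward (~: I) i0) t) else None) d p _ hp.
  move=> l y; rewrite !PhiRE; apply/funext => -[t e]; rewrite /Phi /rescale /=.
  by case: ifP => /= _; rewrite ?mul1r //; case: ifP => //= _; rewrite mul1r.
case: Mx => _; apply; first exact: hd'.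
by move=> _ /M0n_crP[w [hw ->]]; rewrite peval_subst PhiRE S2.
Qed.

Definition goodp : mpol K P1n := discp K n * \prod_(v : mvar P1n) @var K P1n v.

Lemma goodp_neq0 : goodp != 0.
Proof.
rewrite mulf_neq0 ?discp_neq0 //; apply/prodf_neq0 => v _.
apply/eqP => /(congr1 (fun P : mpol K P1n => peval P (fun=> 1))).
by rewrite pevalV peval0 => /eqP; rewrite oner_eq0.
Qed.

Lemma goodpP w : peval goodp w != 0 -> good w.
Proof.
rewrite pevalM mulf_eq0 negb_or => /andP[/discE h1]; rewrite peval_prod => /prodf_neq0 h2.
have nz v : w v != 0 by have := h2 v isT; rewrite pevalV.
by split=> // a b ab _; apply: h1.
Qed.

Lemma G_zero (p : mpol K Q) : (forall w, good w -> peval p (G w) = 0) -> subst Gp p = 0.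
Proof.
move=> H; apply/eqP; have /eqP : subst Gp p * goodp = 0.
  apply: peval_inj => w; rewrite pevalM peval0 peval_subst GpE.
  by have [->|/goodpP/H->] := eqVneq (peval goodp w) 0; rewrite ?mulr0 ?mul0r.
by rewrite mulf_eq0 (negPf goodp_neq0) orbF.
Qed.

(** D_I is the closure of the image under [G] of a nonempty open set of configurations, and a
    product of two nonzero polynomials in the coordinates of w is nonzero. *)
Lemma boundary_variety : closed_variety (@boundary n K I).
Proof.
pose S : subpts K Q := fun x => exists2 w, good w & x = G w.
have Sp x : S x -> is_point x by case=> w gw ->; apply: G_point.
have E : @boundary n K I = zclosure S.
  apply/funext => x; apply/propext; split=> [Bx|[xp H]].
    split=> [|d p hp vp]; first by apply: Mbar_point; case: Bx.
    by apply: (G_dense hp) Bx => w gw; apply: vp; exists w.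
  split=> [|t h0 h1 h2 h3].
    split=> // d p hp vp; apply: (H d p hp) => _ [w gw ->].
    by have [_] := G_Mbar gw; apply; first exact: hp.
  have := H _ _ (@multihomog_var K Q (t, false)); rewrite pevalV; apply=> _ [w gw ->].
  by rewrite pevalV; have [_] := G_boundary gw; apply.
rewrite E; split; first exact: zclosure_closed.
apply: vanish_prime_irreducible => // [|d e p q hp hq vpq].
  by have [w /goodpP gw] := peval_nonroot goodp_neq0; exists (G w), w.
have : subst Gp p * subst Gp q = 0.
  by rewrite -substM; apply: G_zero => w gw; apply: vpq; exists w.
have van P : subst Gp P = 0 -> vanish S P.
  by move=> P0 _ [w _ ->]; rewrite -GpE -peval_subst P0 peval0.
by move/eqP; rewrite mulf_eq0 => /orP[]/eqP/van; [left|right].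
Qed.

(** Write p / q = (a / b)(c / e) with a / b a uniformizer. On a curve where p vanishes to order
    exactly 1 at s = 0, the vanishing of both a and c there would give order at least 2; so c / e is
    a unit. *)
Lemma order_one (Z : subpts K Q) (p q : mpol K Q) (d : mfac Q -> nat) (a b : mpol K Q) : (forall x, Z x <-> boundary I x) ->
  uniformizer Mbar Z a b -> multihomog d p -> multihomog d q -> vanish Z p -> ~ vanish Z q ->
  (forall w, good w -> exists2 r, curve (gam w) p = 'X * r & r.[0] != 0) -> has_order Mbar Z p q 1.
Proof.
move=> ZE [lab va uP] hp hq vp nq H.
have lpq : in_local_ring Z p q by split=> //; exists d.
have [c [e [lce v]]] := uP p q lpq vp.
exists a, b, c, e, 1%N, 0%N; split=> //; last first.
  by move=> x Mx; have := v x Mx; rewrite !expr1 !expr0 !mulr1 !pevalE => <-; ring.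
split=> // vc.
have [[d1 [ha hb]] nb] := lab; have [[d2 [hc he]] ne] := lce.
have nz (P : mpol K Q) (d' : mfac Q -> nat) : multihomog d' P -> ~ vanish Z P -> subst Gp P != 0.
  move=> hP nP; apply/eqP => P0; apply: nP => x /ZE Bx; apply: (G_dense hP) Bx => w _.
  by rewrite -GpE -peval_subst P0 peval0.
have [w] := peval_nonroot (mulf_neq0 (mulf_neq0 (nz b d1 hb nb) (nz e d2 he ne)) goodp_neq0).
rewrite pevalM mulf_eq0 negb_or => /andP[+ /goodpP gw].
rewrite pevalM !peval_subst !GpE mulf_eq0 negb_or => /andP[bw ew].
have [r pE r0] := H w gw.
have at0 P : (curve (gam w) P).[0] = peval P (G w) by rewrite curveE.
have BG : Z (G w) by apply/ZE/G_boundary.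
have root0 P : vanish Z P -> exists r', curve (gam w) P = r' * 'X.
  move=> vP; have : root (curve (gam w) P) 0 by rewrite /root at0 vP.
  by case/factor_theorem => r'; rewrite subr0 => E; exists r'.
have [[ra aE] [rc cE]] := (root0 a va, root0 c vc).
have hh : multihomog (fun i : mfac Q => d i + d1 i + d2 i)%N (p * b * e - a * c * q).
  apply: multihomogB; first by apply: multihomogM => //; apply: multihomogM.
  by apply: multihomog_ext (multihomogM (multihomogM ha hc) hq) => i; lia.
have := gam_Mbar w hh (vanish_Mbar_pull v).
have cB (P1 P2 : mpol K Q) : curve (gam w) (P1 - P2) = curve (gam w) P1 - curve (gam w) P2 by exact: raddfB.
have cM (P1 P2 : mpol K Q) : curve (gam w) (P1 * P2) = curve (gam w) P1 * curve (gam w) P2.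
  by apply: (@poly_eq_fun _ _ _ 1) => [|s _]; rewrite ?oner_eq0 // hornerM !curveE pevalM.
rewrite cB !cM pE aE cE => /eqP; rewrite subr_eq0 => /eqP E.
have : 'X * (r * curve (gam w) b * curve (gam w) e) = 'X * (ra * rc * 'X * curve (gam w) q).
  by rewrite !mulrA in E *; rewrite E; ring.
move/(mulfI _) => /(_ (negbT (polyX_eq0 _))) /(congr1 (fun P : {poly K} => P.[0])).
rewrite !hornerM !at0 hornerX mulr0 mul0r => /eqP.
by rewrite !mulf_eq0 (negPf r0) (negPf bw) (negPf ew).
Qed.

Lemma gam_br t (e : bool) w : good w ->
  l0 t \in I -> (if e then l2 t else l1 t) \in I -> (if e then l1 t else l2 t) \notin I -> l3 t \notin I ->
  exists2 r, curve (gam w) (@var K Q (t, e)) = 'X * r & r.[0] != 0.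
Proof.
have [[n1 n2 n3] [n4 n5 n6]] := quad_uniq t.
move=> [_ _ h] m0 m1 m2 m3; rewrite curve_var /gam /cnt.
exists (br w (l0 t) (if e then l2 t else l1 t) * br w (if e then l1 t else l2 t) (l3 t))%:P; last first.
  rewrite hornerC mulf_neq0 ?h ?m0 ?m1 ?(negPf m2) ?(negPf m3) //; first by case: ifP.
  by case: ifP.
case: e m1 m2 => /= m1 m2; rewrite m0 m1 (negPf m2) (negPf m3) /crR /wIX /= m0 m1 m2 m3 /=;
  by rewrite /br !(polyCM, polyCB); ring.
Qed.

Lemma order_zero (Z : subpts K Q) (p q : mpol K Q) (d : mfac Q -> nat) (a b : mpol K Q) : uniformizer Mbar Z a b ->
  multihomog d p -> multihomog d q -> ~ vanish Z p -> ~ vanish Z q -> has_order Mbar Z p q 0.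
Proof.
move=> u hp hq np nq; exists a, b, p, q, 0%N, 0%N; split=> //.
  by split=> //; split=> //; exists d.
by move=> x _; rewrite !expr0 !mulr1 mulrC subrr peval0.
Qed.

Lemma order_opp (Z : subpts K Q) (p q : mpol K Q) : has_order Mbar Z p q 1 -> has_order Mbar Z q p (-1).
Proof.
move=> [a [b [c [e [i [j [u [lce nc] ij v]]]]]]].
exists a, b, e, c, j, i; split=> //.
- by case: lce => [[d [hc he]] ne]; split=> //; split=> //; exists d.
- by rewrite -[RHS]opprB -ij.
- move=> x Mx; have := v x Mx; rewrite !pevalE => /eqP; rewrite subr_eq0 => /eqP E.
  transitivity (peval q x * peval a x ^+ i * peval b x ^+ j * peval c x -
    peval p x * peval b x ^+ i * peval a x ^+ j * peval e x); first by ring.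
  by rewrite E subrr.
Qed.
End Chart.

Lemma divides_refl (R : idomainType) (a : R) : divides a a.
Proof. by exists 1; rewrite mul1r. Qed.

Lemma closed_fresh (K : closedFieldType) (s : seq K) : exists c, c \notin s.
Proof.
have p0 : \prod_(a <- s) ('X - a%:P) != 0 by apply: monic_neq0; apply: monic_prod_XsubC.
by have /closed_nonrootP[c cP] := p0; exists c; rewrite -root_prod_XsubC.
Qed.

Lemma closed_uniq (K : closedFieldType) m : exists c : 'I_m -> K, injective c.
Proof.
suff [s [us ss]] : exists s : seq K, uniq s /\ size s = m.
  exists (fun i => s`_i) => i j /eqP; rewrite nth_uniq ?ss // => /eqP; exact: val_inj.
elim: m => [|m [s [us ss]]]; first by exists [::].
by have [c cs] := closed_fresh s; exists (c :: s); rewrite /= cs us ss.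
Qed.

Lemma sum_mod2 (W : zmodType) m (e : 'I_m -> W) (a b k : 'I_m -> int) :
  (forall l, a l = b l + k l *+ 2) ->
  \sum_l e l *~ a l = \sum_l e l *~ b l + (\sum_l e l *~ k l) *+ 2.
Proof.
move=> H; rewrite -sumrMnl -big_split; apply: eq_bigr => l _.
by rewrite H mulrzDr mulr2n mulrzDr -mulr2n.
Qed.

(* Reduce coordinates modulo 2: a stably permutation module of infinite rank would not embed. *)
Lemma no_independent (Gam : groupType) (L : zmodType) (act : Gam -> L -> L) :
  is_stably_permutation_module act ->
  exists M : nat, forall (x : 'I_M -> L) (chi : 'I_M -> L -> int),
    (forall i a b, chi i (a + b) = chi i a + chi i b) ->
    ~ (forall i j, chi i (x j) = (i == j)%:Z).
Proof.
move=> [P [actP [_ [_ [m [e [eB _]]]]]]].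
have /choice[co coP] : forall z : L * P, exists c : {ffun 'I_m -> int}, z = \sum_i e i *~ c i.
  by move=> z; have [c [zE _]] := eB z; exists c.
exists m.+1 => x chi chiD H.
have chi0 i : chi i 0 = 0 by have := chiD i 0 0; rewrite addr0 => /eqP; rewrite -{1}[chi i 0]addr0 (inj_eq (addrI _)) => /eqP.
have chi_sum i (A : {set 'I_m.+1}) : chi i (\sum_(j in A) x j) = (i \in A)%:Z.
  rewrite (big_morph _ (chiD i) (chi0 i)); under eq_bigr do rewrite H.
  have [iA|iA] := boolP (i \in A).
    by rewrite (bigD1 i) //= eqxx big1 ?addr0 // => j /andP[_ /negPf]; rewrite eq_sym => ->.
  by rewrite big1 // => j jA; case: eqP => // E; rewrite E jA in iA.
pose S (A : {set 'I_m.+1}) : L := \sum_(j in A) x j.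
(* There are 2^(m+1) subsets and 2^m vectors of parities, so two different subsets have sums
   congruent modulo 2. *)
pose c2 (A : {set 'I_m.+1}) : {ffun 'I_m -> bool} := [ffun k => odd `|(co (S A, 0) k)%R|%N].
have /injectivePn[A [B AB cE]] : ~~ injectiveb c2.
  apply/negP => /injectiveP/leq_card; rewrite card_ffun card_bool card_ord.
  by rewrite -cardsT -powersetT card_powerset cardsT card_ord leq_exp2l // ltnn.
have [d dE] : exists d : L * P, (S A, 0 : P) = (S B, 0) + d *+ 2.
  have /choice[k kP] : forall l, exists k, co (S A, 0) l = co (S B, 0) l + k *+ 2.
    move=> l; have /ffunP/(_ l) := cE; rewrite !ffunE.
    move: (co _ l) (co _ l) => u v E; exists ((v - u) %/ 2)%Z.
    by rewrite -mulr_natr; lia.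
  exists (\sum_l e l *~ k l); rewrite {1}(coP (S A, 0)) {1}(coP (S B, 0)).
  exact: sum_mod2.
have {}dE : S A = S B + d.1 *+ 2 by rewrite -[LHS]/((_, 0 : P).1) dE.
case/eqP: AB; apply/setP => i; have := congr1 (chi i) dE.
rewrite mulr2n !chiD /S !chi_sum; case: (i \in A); case: (i \in B) => //=; lia.
Qed.

(** * Divisors of cross-ratios *)

Section Relation.
Variables (K : closedFieldType) (n : nat).
Hypothesis n_ge5 : (5 <= n)%N.
Local Notation P1n := (P1n n).
Local Notation Q := (quadP1 n).
Local Notation Mbar := (@Mbar n K).
Implicit Types (w : pts K P1n) (i j k l a b c : 'I_n) (x : pts K Q) (t : quad n) (I : {set 'I_n}).
Implicit Types (Z : prime_div Mbar) (D : Div Mbar) (s : 'S_n).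

Lemma quad_through i j : i != j -> exists k l t, lbl t i j k l.
Proof.
move=> ij; have [k] := @fresh n [:: i; j] (leq_trans (isT : 2 < 5)%N n_ge5).
have [l] := @fresh n [:: i; j; k] (leq_trans (isT : 3 < 5)%N n_ge5).
rewrite !inE !negb_or => /and3P[li lj lk] /andP[ki kj].
have [|t tl] := @lbl_ex n i j k l; last by exists k, l, t.
by rewrite /= !inE !negb_or ij ![_ == k]eq_sym ![_ == l]eq_sym ki kj li lj lk.
Qed.

Lemma pull_var t (e : bool) : pull (@var K Q (t, e)) =
  if e then brp K (l0 t) (l2 t) * brp K (l1 t) (l3 t) else brp K (l0 t) (l1 t) * brp K (l2 t) (l3 t).
Proof.
by apply: peval_inj => w; rewrite pullE pevalV crE; case: e; rewrite pevalM !brpE.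
Qed.

Lemma pull_var_neq0 t (e : bool) : pull (@var K Q (t, e)) != 0.
Proof.
have [[n1 n2 n3] [n4 n5 n6]] := quad_uniq t.
by rewrite pull_var; case: e; rewrite mulf_neq0 ?brp_neq0.
Qed.

Lemma brp_pfactor i j : i != j -> pfactor (brp K i j).
Proof.
move=> ij; have [k [l [t [h0 h1 h2 h3]]]] := quad_through ij.
split; first exact: brp_prime.
exists (fun u : mfac Q => (u == t) : nat), (@var K Q (t, false)); split; [exact: (@multihomog_var K Q)|exact: pull_var_neq0|].
by rewrite pull_var h0 h1; exists (brp K (l2 t) (l3 t)); rewrite mulrC.
Qed.

(** The fibres of one cross-ratio over varying c provide infinitely many prime divisors. *)
Lemma pencil (t : quad n) (c : K) :
  exists2 f, pfactor f & divides f (pull (@var K Q (t, false) - cst Q c * @var K Q (t, true))).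
Proof.
set p := _ - _.
have hp : multihomog (fun u : mfac Q => (u == t) : nat) p.
  by apply: multihomogB; [|apply: multihomog_cstM]; apply: (@multihomog_var K Q (t, _)).
have [[n1 n2 n3] [n4 n5 n6]] := quad_uniq t.
have p0 : pull p != 0.
  (* [l0 t] and [l2 t] are put at the same point, so the second coordinate of t is 0 while the first
     is 1. *)
  pose w : pts K P1n := fun v => if v.1 \in [:: l0 t; l2 t] then (~~ v.2)%:R
                                 else if v.1 == l1 t then v.2%:R else 1.
  apply: contraTneq (oner_neq0 K) => /(congr1 (fun P => peval P w)).
  rewrite peval0 pullE /p !pevalB pevalM pevalC !pevalV !crE /br /w /= !inE !eqxx /= !orbT.
  rewrite ?(eq_sym (l1 t) (l0 t)) ?(eq_sym (l3 t) (l0 t)) ?(eq_sym (l3 t) (l2 t)) ?(eq_sym (l3 t) (l1 t)).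
  rewrite (negPf n1) (negPf n4) (negPf n3) (negPf n6) (negPf n5) /=.
  by rewrite !(mulr1, mul1r, mulr0, mul0r, subr0, sub0r, subrr) => /eqP; rewrite (negPf (oner_neq0 K)).
have [u [s [uU sp pE]]] := mpol_factorial p0.
have [f fs] : exists f, f \in s.
  case: s sp pE => [|f s] _ pE; last by exists f; rewrite mem_head.
  exfalso; move: pE; rewrite big_nil mulr1 => pE.
  have [k k0 kE] := mpol_unitE uU.
  move: pE => /(congr1 (fun P => peval P (fun=> 0))); rewrite kE pevalC pullE /p !pevalB pevalM pevalC !pevalV.
  by rewrite !crE /br /= !mulr0 !subrr mul0r mulr0 subr0 => /esym/eqP; rewrite (negPf k0).
have fd : divides f (pull p) by rewrite pE (big_rem f) //=; exists (u * \prod_(y <- rem f s) y); ring.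
by exists f => //; apply: pfactor_factor (sp f fs) hp p0 fd.
Qed.

Lemma bracket_conflict (t : quad n) f : prime_elt f -> ~ (divides f (pull (@var K Q (t, false))) /\ divides f (pull (@var K Q (t, true)))).
Proof.
move=> fp []; rewrite !pull_var; have [_ _ fP] := fp; have [[n1 n2 n3] [n4 n5 n6]] := quad_uniq t.
have H a b c (d : 'I_n) : a != b -> c != d -> a != c -> a != d -> divides f (brp K a b) -> divides f (brp K c d) -> False.
  move=> ab cd ac ad f1 f2; have := prime_brp_uniq ab cd fp f1 f2 => /setP/(_ a).
  by rewrite !inE eqxx (negPf ac) (negPf ad).
have H' a b c (d : 'I_n) : a != b -> c != d -> b != c -> b != d -> divides f (brp K a b) -> divides f (brp K c d) -> False.
  move=> ab cd bc bd f1 f2; have := prime_brp_uniq ab cd fp f1 f2 => /setP/(_ b).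
  by rewrite !inE eqxx (negPf bc) (negPf bd) orbT.
have [n1' n3' n4' n6'] : [/\ l1 t != l0 t, l3 t != l0 t, l2 t != l1 t & l3 t != l2 t].
  by split; rewrite eq_sym.
case/fP=> f1 /fP[] f2.
- exact: (H' _ _ _ _ n1 n2 n1' n4 f1 f2).
- exact: (H _ _ _ _ n1 n5 n1 n3 f1 f2).
- exact: (H' _ _ _ _ n6 n2 n3' n6' f1 f2).
- exact: (H _ _ _ _ n6 n5 n4' n6 f1 f2).
Qed.

Definition coefQ Z : Qmod n K -> int := zquot_lift (zquot_lift (coeff Z)).

Lemma coeffZB Z D1 D2 : coeff Z (D1 - D2) = coeff Z D1 - coeff Z D2.
Proof. exact: raddfB. Qed.

Lemma coefQE Z D : (forall D, ~ @principal K Q Mbar D) -> phiZ Z != 0 -> coefQ Z (qcl D) = coeff Z D.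
Proof.
move=> np Z0.
have E D' : zquot_lift (coeff Z) (cl D') = coeff Z D'.
  by apply: zquot_liftE => [|D'' /np//]; apply: coeffZB.
rewrite /coefQ zquot_liftE ?E // => [x y|y [I [Z' [h1 h2 ZE ->]]]]; last first.
  rewrite E coeffU; case: eqP => [E'|]; rewrite ?mulr0 //.
  by move: Z0; rewrite -E' (phiZ_boundary n_ge5 h1 h2 ZE) eqxx.
have [[D1 ->] [D2 ->]] := (zproj_surj x, zproj_surj y).
by rewrite -zprojB !E; apply: coeffZB.
Qed.

Lemma phiZ_pfactor Z f : pfactor f -> (forall x, sval Z x <-> Zf f x) -> phiZ Z != 0.
Proof.
move=> pf ZE; have [[f0 fU _] _] := pf; have [d hd] := semi_homog f0 (pfactor_semi pf).
have dZ : is_deg Z d by exists f.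
rewrite (phiZE n_ge5 dZ); apply/eqP => /ffunP E.
have d0 : d =1 (fun=> 0%N) by move=> i; have := E i; rewrite !ffunE => -[].
have [c fE] := multihomog_const (multihomog_ext d0 hd).
case/negP: fU; rewrite fE; apply: cst_unit; apply: contraNneq f0 => c0.
by rewrite fE c0 /cst mpolyC0.
Qed.

(** Without principal divisors the class group would be free on the prime divisors, and the members
    of a pencil would remain independent in Q, contrary to [no_independent]. The use of a principal
    divisor is that it carries a uniformizer along every prime divisor. *)
Lemma principal_exists (Gam : groupType) (act : Gam -> Qmod n K -> Qmod n K) :
  is_stably_permutation_module act -> exists D, @principal K Q Mbar D.
Proof.
move=> /no_independent[M indep]; apply: contrapT => /forallNP np.
have [i _] := @fresh n [::] (leq_trans (isT : 0 < 5)%N n_ge5).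
have [j] := @fresh n [:: i] (leq_trans (isT : 1 < 5)%N n_ge5); rewrite inE eq_sym => ij.
have [_ [_ [t _]]] := quad_through ij.
have [c c_inj] := closed_uniq K M.
have /choice[f fP] : forall e, exists f, pfactor f /\
    divides f (pull (@var K Q (t, false) - cst Q (c e) * @var K Q (t, true))).
  by move=> e; have [f] := pencil t (c e); exists f.
pose Z e : prime_div Mbar := mkZ n_ge5 (fP e).1.
have Z0 e : phiZ (Z e) != 0 by apply: (phiZ_pfactor (fP e).1).
have Zinj : injective Z.
  move=> e e' E; apply/eqP; apply: contraT => ne.
  have fd : divides (f e) (f e').
    by apply: (Zf_inj n_ge5 (fP e).1 (fP e').1) => x; rewrite -[Zf (f e) x]/(sval (Z e) x) E.
  have [fp _] := (fP e).1; have d1 := (fP e).2; have [g gE] := (fP e').2; have [h hE] := fd.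
  have d2 : divides (f e) (pull (@var K Q (t, false) - cst Q (c e') * @var K Q (t, true))).
    by exists (h * g); rewrite gE hE; ring.
  have pc u : pull (@var K Q (t, false) - cst Q u * @var K Q (t, true)) =
      pull (@var K Q (t, false)) - cst P1n u * pull (@var K Q (t, true)).
    by apply: peval_inj => w; rewrite !(pullE, pevalE).
  rewrite !pc in d1 d2; have ne0 : c e - c e' != 0 by rewrite subr_eq0 (inj_eq c_inj).
  have dt : divides (f e) (pull (@var K Q (t, true))).
    have [g1 E1] := d1; have [g2 E2] := d2.
    exists (cst P1n (c e - c e')^-1 * (g2 - g1)).
    have -> : cst P1n (c e - c e')^-1 * (g2 - g1) * f e = cst P1n (c e - c e')^-1 * (g2 * f e - g1 * f e) by ring.
    rewrite -E1 -E2; apply: peval_inj => w; rewrite !(pullE, pevalE).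
    by field.
  case: (@bracket_conflict t (f e) fp); split=> //.
  have [g1 E1] := d1; have [g2 E2] := dt; exists (g1 + cst P1n (c e) * g2).
  by rewrite mulrDl -E1 -mulrA -E2; ring.
apply: (indep (fun e => qcl << Z e >>) (fun e => coefQ (Z e))) => [e u v|e e'].
  have [[D1 ->] [D2 ->]] := (qcl_surj u, qcl_surj v).
  by rewrite -qclD !coefQE //; exact: raddfD.
by rewrite coefQE // coeffU mul1r (inj_eq Zinj) eq_sym; case: eqP.
Qed.

(** Z lies in the variety D_I by [v4_side], and D_I is not all of Mbar, so the maximality of the
    prime divisor Z makes them equal. *)
Lemma v4_boundary Z i j k l : v4 (sval Z) i j k l ->
  [/\ i \in side (sval Z) i k l, j \in side (sval Z) i k l, k \notin side (sval Z) i k l,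
     l \notin side (sval Z) i k l & forall x, sval Z x <-> boundary (side (sval Z) i k l) x].
Proof.
have [[_ irrZ] ZM nMZ maxZ] := svalP Z.
move=> v; have [iI jI kI lI H] := v4_side irrZ ZM v; split=> //.
have vB := boundary_variety K n_ge5 iI kI.
have ZB : subpt (sval Z) (boundary (side (sval Z) i k l)).
  move=> x Zx; split=> [|t h0 h1 h2 h3]; first exact: ZM.
  have [[n1 n2 n3] [n4 n5 n6]] := quad_uniq t.
  by have /(v4P _ (lbl_self t)) := H _ _ _ _ h0 h1 h2 h3 n1 n6; apply.
have [|BZ|MB] := maxZ _ vB ZB; first by move=> x [].
  by move=> x; split; [exact: ZB|exact: BZ].
exfalso; have [t [[h0 h1 h2 h3] _]] := v.
case/eqP: (pull_var_neq0 t false); apply: vanish_Mbar_pull => x /MB[_].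
by rewrite pevalV; apply; rewrite -/(l0 _) -/(l1 _) -/(l2 _) -/(l3 _) ?h0 ?h1 ?h2 ?h3.
Qed.

Definition bz i j (ij : i != j) : prime_div Mbar := mkZ n_ge5 (brp_pfactor ij).

Lemma v4_bz i j k l (ij : i != j) t : lbl t i j k l -> v4 (sval (bz ij)) i j k l.
Proof.
move=> tl; exists t; split=> //; apply/(vanish_Zf (brp_prime K ij) (@multihomog_var K Q _)).
by have [h0 h1 _ _] := tl; rewrite pull_var h0 h1; exists (brp K (l2 t) (l3 t)); rewrite mulrC.
Qed.

(** A third label e on the side of i would make [ij] divide [ie] or [kl]. *)
Lemma bzE i j (ij : i != j) x : sval (bz ij) x <-> boundary [set i; j] x.
Proof.
have [k [l [t tl]]] := quad_through ij.
have [iI jI kI lI ->] := v4_boundary (v4_bz ij tl).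
rewrite (_ : side _ _ _ _ = [set i; j]) //; apply/setP => e; apply/idP/idP; last first.
  by rewrite !inE => /orP[]/eqP->; [move: iI|move: jI]; rewrite inE.
rewrite !inE => /and3P[ek el /orP[->//|/asboolP[t' [tl' v]]]].
have [h0 h1 h2 h3] := tl'; have [[n1 n2 n3] [n4 n5 n6]] := quad_uniq t'.
rewrite h0 h1 h2 h3 in n1 n2 n3 n4 n5 n6.
have fp := brp_prime K ij; have [_ _ fP] := fp.
move/(vanish_Zf fp (@multihomog_var K Q _)): v; rewrite pull_var h0 h1 h2 h3 => /fP[] fd.
  have fd0 := divides_refl (brp K i j).
  have := prime_brp_uniq ij n1 fp fd0 fd => /setP/(_ e).
  by rewrite !inE eqxx orbT => ->.
have fd0 := divides_refl (brp K i j).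
have := prime_brp_uniq ij n6 fp fd0 fd => /setP/(_ i).
by rewrite !inE eqxx (negPf n2) (negPf n3).
Qed.

Lemma bz_eq i j k l (ij : i != j) (kl : k != l) : [set i; j] = [set k; l] -> bz ij = bz kl.
Proof. by move=> E; apply: same_sval => x; rewrite !bzE E. Qed.

Definition ecl i j : Qmod n K := if boolP (i != j) is AltTrue h then qcl << bz h >> else 0.

Lemma eclE i j (ij : i != j) : ecl i j = qcl << bz ij >>.
Proof. by rewrite /ecl; case: {-}_ / boolP => [h|/negP//]; rewrite (bz_eq h ij). Qed.

Lemma ecl_sym i j : ecl i j = ecl j i.
Proof.
have [->//|ij] := eqVneq i j; have ji : j != i by rewrite eq_sym.
by rewrite (eclE ij) (eclE ji); congr (qcl << _ >>); apply: bz_eq; rewrite setUC.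
Qed.

Lemma ecl_Sn s i j : Qmod_act s (ecl i j) = ecl (s i) (s j).
Proof.
have [->|ij] := eqVneq i j.
  have E k : ecl k k = 0 by rewrite /ecl; case: {-}_ / boolP => // h; case/eqP: (h).
  rewrite !E; have := qclB (0 : Div Mbar) 0; rewrite !subrr => Q0.
  by rewrite -Q0 Qmod_actE Sn_DivE zlift0 Q0.
have sij : s i != s j by rewrite (inj_eq perm_inj).
rewrite (eclE ij) (eclE sij) Qmod_actE Sn_DivU; congr (qcl << _ >>).
apply: same_sval => x; rewrite bzE -[sval (Sn_prime _ _) x]/(sval (bz ij) (Sn_act s^-1%g x)) bzE boundary_Sn.
by rewrite imsetU !imset_set1.
Qed.

Lemma phiQ_ecl i j a : i != j -> phiQ (ecl i j) a = ((a == i) + (a == j))%N%:Z.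
Proof.
move=> ij; rewrite (eclE ij) phiQE // /phiD zliftU (phiZE n_ge5 (d := deg2 i j)) ?ffunE //.
exists (brp K i j); split=> //; [exact: brp_pfactor|exact: brp_multihomog].
Qed.

Definition boundary_div (A : {set 'I_n}) : seq (prime_div Mbar) :=
  if pselect (prime_divisor Mbar (@boundary n K A)) is left h
  then [:: exist (fun Y : subpts K Q => prime_divisor Mbar Y) _ h] else [::].

(** A finite list with every D_A that is a prime divisor, so that divisors of cross-ratios can be
    written as sums over it. *)
Definition boundary_divs : seq (prime_div Mbar) :=
  undup (flatten [seq boundary_div A | A : {set 'I_n}]).

Lemma boundary_divsP Z I : (forall x, sval Z x <-> boundary I x) -> Z \in boundary_divs.
Proof.
move=> ZE; rewrite mem_undup; apply/flattenP; eexists; first by apply/imageP; exists I.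
have E : sval Z = @boundary n K I by apply/funext => x; apply/propext.
rewrite /boundary_div; case: pselect => [h|[]]; last by rewrite -E; apply: svalP.
by rewrite inE; apply/eqP; apply: same_sval => x /=; rewrite E.
Qed.

(** The zeros of the cross-ratio are the D_I with [l0 t], [l1 t] in I and [l2 t], [l3 t] outside;
    modulo N only those with |I| = 2 or |I^c| = 2 remain. *)
Lemma sum_v4 t : let v Z := `[< v4 (sval Z) (l0 t) (l1 t) (l2 t) (l3 t) >] in
  \sum_(Z <- boundary_divs | v Z) qcl << Z >> = ecl (l0 t) (l1 t) + ecl (l2 t) (l3 t).
Proof.
move=> v; have [[n1 n2 n3] [n4 n5 n6]] := quad_uniq t.
have m1 : bz n1 \in boundary_divs by apply: boundary_divsP => x; apply: bzE.
have m2 : bz n6 \in boundary_divs by apply: boundary_divsP => x; apply: bzE.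
have v1 : v (bz n1) by apply/asboolP; apply: v4_bz (lbl_self t).
have [|t' tl'] := @lbl_ex n (l2 t) (l3 t) (l0 t) (l1 t).
  have := lbl_uniq (lbl_self t).
  by rewrite (_ : [:: l2 t; l3 t; l0 t; l1 t] = rot 2 [:: l0 t; l1 t; l2 t; l3 t]) // rot_uniq.
have v2 : v (bz n6).
  by apply/asboolP; have [_ ZM _ _] := svalP (bz n6); apply: v4_half => //; apply: v4_bz tl'.
have ne : bz n6 != bz n1.
  apply/eqP => E; have /setP/(_ (l2 t)) : [set l2 t; l3 t] = [set l0 t; l1 t].
    apply: (prime_brp_uniq n6 n1 (brp_prime K n6)); first exact: divides_refl.
    apply: (Zf_inj n_ge5 (brp_pfactor n6) (brp_pfactor n1)) => x.
    by rewrite -[Zf _ _]/(sval (bz n6) x) E.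
  by rewrite !inE eqxx ![l2 t == _]eq_sym (negPf n2) (negPf n4).
have us : uniq boundary_divs := undup_uniq _.
rewrite -big_filter (bigD1_seq (bz n1)) ?filter_uniq ?mem_filter ?v1 //=.
rewrite -big_filter (bigD1_seq (bz n6)) ?filter_uniq ?mem_filter ?ne ?v2 //=.
rewrite (eclE n1) (eclE n6); congr (_ + _).
rewrite big_seq_cond big1 ?addr0 // => Z /andP[]; rewrite !mem_filter => /andP[Z1 /andP[Zv Zin]] Z2.
have [m0 m1' m2' m3 ZE] := v4_boundary (asboolW Zv).
move: m0 m1' m2' m3 ZE; set S := side _ _ _ _ => m0 m1' m2' m3 ZE.
have [h1|h1] := leqP #|S| 2.
  case/eqP: Z1; apply: same_sval => x; rewrite ZE bzE (_ : S = [set l0 t; l1 t]) //.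
  apply/esym/eqP; rewrite eqEcard cards2 n1 h1 andbT; apply/subsetP => e.
  by rewrite in_set2 => /orP[]/eqP->.
have [h2|h2] := leqP #|~: S| 2; last exact: (qcl_boundary h1 h2 ZE).
case/eqP: Z2; apply: same_sval => x; rewrite bzE (_ : [set l2 t; l3 t] = ~: S).
  by rewrite ZE; split=> [/boundaryC//|/boundaryC]; rewrite setCK.
apply/eqP; rewrite eqEcard cards2 n6 h2 andbT; apply/subsetP => e.
by rewrite in_set2 inE => /orP[]/eqP->.
Qed.

(** The divisor of a cross-ratio: the D_I separating [l0 t], [l1 t] from [l2 t], [l3 t], minus those
    separating [l0 t], [l2 t] from [l1 t], [l3 t], each with multiplicity 1 by the transverse
    curves. *)
Lemma ecl_rel (Gam : groupType) (act : Gam -> Qmod n K -> Qmod n K) t :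
  is_stably_permutation_module act ->
  ecl (l0 t) (l1 t) + ecl (l2 t) (l3 t) = ecl (l0 t) (l2 t) + ecl (l1 t) (l3 t).
Proof.
move=> /principal_exists[D0 [p0 [q0 [_ _ _ ord0']]]].
have unif Z : exists (a b : mpol K Q), uniformizer Mbar (sval Z) a b.
  by have [a [b [c [e [i [j [u _ _ _]]]]]]] := ord0' Z; exists a, b.
have [[n1 n2 n3] [n4 n5 n6]] := quad_uniq t.
have [|t' tl'] := @lbl_ex n (l0 t) (l2 t) (l1 t) (l3 t).
  by rewrite /= !inE !negb_or n1 n2 n3 n5 n6 eq_sym n4.
have tl := lbl_self t.
pose v1 Z := `[< v4 (sval Z) (l0 t) (l1 t) (l2 t) (l3 t) >].
pose v2 Z := `[< v4 (sval Z) (l0 t) (l2 t) (l1 t) (l3 t) >].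
pose D : Div Mbar := \sum_(Z <- boundary_divs | v1 Z) << Z >> - \sum_(Z <- boundary_divs | v2 Z) << Z >>.
have cD (v : pred (prime_div Mbar)) Z : (v Z -> Z \in boundary_divs) ->
    coeff Z (\sum_(Z <- boundary_divs | v Z) << Z >>) = (v Z)%:Z.
  move=> vZ; rewrite raddf_sum /=; under eq_bigr do rewrite coeffU mul1r.
  have us : uniq boundary_divs := undup_uniq _.
  have [vz|nvz] := boolP (v Z).
    rewrite -big_filter (bigD1_seq Z) ?filter_uniq ?mem_filter ?vz ?vZ //= eqxx big1 ?addr0 // => Y /negPf-> //.
  by rewrite big1 // => Y vY; case: eqP => // E; rewrite E (negPf nvz) in vY.
have m1 Z : v1 Z -> Z \in boundary_divs.
  by move/asboolP/v4_boundary => [_ _ _ _ ZE]; apply: boundary_divsP ZE.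
have m2 Z : v2 Z -> Z \in boundary_divs.
  by move/asboolP/v4_boundary => [_ _ _ _ ZE]; apply: boundary_divsP ZE.
have pD : principal D.
  exists (@var K Q (t, false)), (@var K Q (t, true)); split.
  - by exists (fun u : mfac Q => (u == t) : nat); split; apply: (@multihomog_var K Q (t, _)).
  - by move/vanish_Mbar_pull/eqP; rewrite (negPf (pull_var_neq0 _ _)).
  - by move/vanish_Mbar_pull/eqP; rewrite (negPf (pull_var_neq0 _ _)).
  move=> Z; rewrite raddfB /= (cD _ _ (m1 Z)) (cD _ _ (m2 Z)).
  have [[_ irrZ] ZM _ _] := svalP Z; have [[z Zz] _] := irrZ.
  have Zp x : sval Z x -> is_point x by move/ZM/Mbar_point.
  have [a [b u]] := unif Z.
  have hf := @multihomog_var K Q (t, false); have ht := @multihomog_var K Q (t, true).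
  have [z1|/asboolPn z1] := boolP (v1 Z).
    have z1' := asboolW z1.
    have /negPf -> : ~~ v2 Z by apply/asboolPn => /(v4_excl irrZ ZM z1').
    have [m0 m1' m2' m3 ZE] := v4_boundary z1'.
    rewrite subr0; apply: (order_one n_ge5 m0 m2' ZE u hf ht).
    - by move=> x Zx; rewrite pevalV; apply: (v4P _ tl).1 z1' x Zx.
    - by move=> /(_ z Zz); rewrite pevalV; apply/eqP/(f0_t (Zp z Zz))/((v4P _ tl).1 z1').
    - by move=> w gw; apply: gam_br.
  have [z2|/asboolPn z2] := boolP (v2 Z).
    have z2' := asboolW z2.
    have [m0 m1' m2' m3 ZE] := v4_boundary z2'.
    have tt0 x : sval Z x -> x (t, true) = 0.
      move=> Zx; have x0 := (v4P _ tl').1 z2' x Zx.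
      have := rel_swap (ZM x Zx) tl tl'; rewrite x0 mulr0 => /esym/eqP.
      by rewrite mulf_eq0 (negPf (f0_t (Zp x Zx) x0)) orbF => /eqP.
    rewrite sub0r; apply: order_opp; apply: (order_one n_ge5 m0 m2' ZE u ht hf).
    - by move=> x Zx; rewrite pevalV; apply: tt0.
    - move=> /(_ z Zz); rewrite pevalV => z0.
      by have [] := pointQ t (Zp z Zz); rewrite ?z0 ?tt0 ?eqxx.
    - by move=> w gw; apply: gam_br.
  rewrite subrr; apply: (order_zero u hf ht).
    by move=> v; apply: z1; exists t.
  move=> v; apply: z2; apply/(v4P _ tl') => x Zx.
  have xt : x (t, true) = 0 by have := v x Zx; rewrite pevalV.
  have := rel_swap (ZM x Zx) tl tl'; rewrite xt mul0r => /eqP; rewrite mulf_eq0.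
  by have [|] := pointQ t (Zp x Zx); rewrite ?xt ?eqxx // => /negPf-> /eqP.
have := qcl_principal pD; rewrite qclB.
have qsum (v : pred (prime_div Mbar)) : qcl (\sum_(Z <- boundary_divs | v Z) << Z >>) =
    \sum_(Z <- boundary_divs | v Z) qcl << Z >>.
  by apply: big_morph; [exact: qclD | have := qclB (0 : Div Mbar) 0; rewrite !subrr].
rewrite !qsum (sum_v4 t); have := sum_v4 t'; case: tl' => -> -> -> -> /= ->.
by move/eqP; rewrite subr_eq0 => /eqP.
Qed.
End Relation.

(* A cocycle which becomes a coboundary after multiplication by N is one: divide the
   coordinates by N with remainder, the remainders forming an invariant vector. *)
Lemma permutation_module_coboundary (Gam : groupType) (W : zmodType) (act : Gam -> W -> W)
    (N : nat) (B : W) (x : Gam -> W) : (0 < N)%N -> is_permutation_module act ->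
  (forall g, act g B - B = x g *+ N) -> exists B', forall g, act g B' - B' = x g.
Proof.
move=> N0 [[act1 actM actD] [m [e [eB eP]]]] H.
have act0 g : act g 0 = 0 by apply: (addrI (act g 0)); rewrite -actD !addr0.
have actN g u : act g (- u) = - act g u by apply: (addrI (act g u)); rewrite -actD !subrr act0.
have actn g u k : act g (u *+ k) = act g u *+ k.
  by elim: k => [|k IH]; rewrite ?act0 // !mulrS actD IH.
have actz g u z : act g (u *~ z) = act g u *~ z.
  by case: z => k; rewrite ?NegzE ?mulrNz ?actN -!pmulrn actn.
have act_sum g (f : 'I_m -> W) : act g (\sum_i f i) = \sum_i act g (f i).
  exact: (big_morph _ (actD g) (act0 g)).
have /choice[co coP] : forall z : W, exists c : {ffun 'I_m -> int}, z = \sum_i e i *~ c i.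
  by move=> z; have [c [zE _]] := eB z; exists c.
have indep (a b : 'I_m -> int) : \sum_i e i *~ a i = \sum_i e i *~ b i -> a =1 b.
  move=> E; have [c [_ cU]] := eB (\sum_i e i *~ a i).
  have ca : c = finfun a by apply: cU; apply: eq_bigr => i _; rewrite ffunE.
  have cb : c = finfun b by apply: cU; rewrite E; apply: eq_bigr => i _; rewrite ffunE.
  by move=> i; have := congr1 (fun f : {ffun 'I_m -> int} => f i) ca; rewrite cb !ffunE.
have torsion (z : W) : z *+ N = 0 -> z = 0.
  rewrite (coP z) -sumrMnl => zN.
  have E : \sum_i e i *~ (co z i * N%:Z) = \sum_i e i *~ 0.
    transitivity (0 : W); last by rewrite big1.
    by apply: etrans zN; apply: eq_bigr => i _; rewrite mulrzA pmulrn.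
  rewrite big1 // => i _; have /eqP := indep _ _ E i.
  by rewrite mulf_eq0 => /orP[/eqP->//|/eqP[]]; lia.
pose b := co B; pose B' := \sum_i e i *~ (b i %/ N)%Z; pose R := \sum_i e i *~ (b i %% N)%Z.
have BE : B = B' *+ N + R.
  rewrite {1}(coP B) -sumrMnl -big_split /=; apply: eq_bigr => i _.
  by rewrite {1}(divz_eq (co B i) N) mulrzDr mulrzA pmulrn.
exists B' => g.
have /choice[pi piP] := eP g.
have pi_inj : injective pi.
  move=> i j E; have eij : e i = e j.
    by rewrite -[LHS]act1 -[RHS]act1 -(mulgV g) !actM !piP E.
  have /indep/(_ i) : \sum_k e k *~ (k == i)%:Z = \sum_k e k *~ (k == j)%:Z.
    rewrite (bigD1 i) //= eqxx big1 => [|k /negPf->//]; rewrite [RHS](bigD1 j) //= eqxx big1 => [|k /negPf->//].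
    by rewrite eij.
  by rewrite eqxx; case: eqP.
pose s := perm pi_inj.
have actE (a : 'I_m -> int) : act g (\sum_i e i *~ a i) = \sum_i e i *~ a (s^-1%g i).
  rewrite act_sum [RHS](reindex_inj (@perm_inj _ s)) /=; apply: eq_bigr => i _.
  by rewrite actz piP permK permE.
have bE i : b (s^-1%g i) = b i + co (x g) i * N%:Z.
  apply: (indep (fun i => b (s^-1%g i)) (fun i => b i + co (x g) i * N%:Z)).
  rewrite -actE -(coP B); have /eqP := H g; rewrite subr_eq addrC => /eqP ->.
  rewrite {1}(coP B) {1}(coP (x g)) -sumrMnl -big_split; apply: eq_bigr => j _ /=.
  by rewrite mulrzDr mulrzA pmulrn.
have RE : act g R = R.
  rewrite actE; apply: eq_bigr => i _; congr (_ *~ _).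
  by rewrite bE addrC modzMDl.
apply/eqP; rewrite -subr_eq0; apply/eqP/torsion.
have -> : (act g B' - B' - x g) *+ N = (act g (B' *+ N + R) - (B' *+ N + R)) - x g *+ N.
  by rewrite actD actn RE opprD addrACA subrr addr0 !mulrnBl.
by rewrite -BE H subrr.
Qed.

(** * An odd stable set of labels *)

Section OddSet.
Variables (K : closedFieldType) (n : nat).
Hypothesis n_ge5 : (5 <= n)%N.
Implicit Types (i j k l a b c : 'I_n) (s : 'S_n) (q : Qmod n K).
Local Notation ecl := (@ecl K n n_ge5).

Lemma Qmod_actB s q1 q2 : Qmod_act s (q1 - q2) = Qmod_act s q1 - Qmod_act s q2.
Proof.
have [[D1 ->] [D2 ->]] := (qcl_surj q1, qcl_surj q2).
by rewrite -qclB !Qmod_actE Sn_DivB qclB.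
Qed.

Variables (Gam : groupType) (r : Gam -> 'S_n).
Hypothesis rM : forall g h, r (g * h)%g = (r g * r h)%g.
Hypothesis stab : is_stably_permutation_module (fun g => @Qmod_act n K (r g)).

Definition dcl a b : Qmod n K := if [pick k | k \notin [:: a; b]] is Some k then ecl a k - ecl b k else 0.

Lemma dclE a b k : k \notin [:: a; b] -> dcl a b = ecl a k - ecl b k.
Proof.
rewrite /dcl; case: pickP => [k'|/(_ k) -> //]; rewrite !inE !negb_or => /andP[k'a k'b] /andP[ka kb].
have [->|ab] := eqVneq a b; first by rewrite !subrr.
have [->//|k'k] := eqVneq k' k.
have [|t [h0 h1 h2 h3]] := @lbl_ex n a k k' b.
  by rewrite /= !inE !negb_or (eq_sym a k) ka (eq_sym a k') k'a ab (eq_sym k k') k'k kb k'b.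
have := ecl_rel n_ge5 t stab; rewrite h0 h1 h2 h3 (ecl_sym _ _ k' b) (ecl_sym _ _ k b) => E.
by apply/eqP; rewrite subr_eq addrAC E addrK.
Qed.

Lemma dcl_fresh a b c : exists k, [/\ k \notin [:: a; b], k \notin [:: b; c] & k \notin [:: a; c]].
Proof.
have [k] := @fresh n [:: a; b; c] (leq_trans (isT : 3 < 5)%N n_ge5).
by rewrite !inE !negb_or => /and3P[ka kb kc]; exists k; rewrite !inE !negb_or ka kb kc.
Qed.

Lemma dcl_trans a b c : dcl a b + dcl b c = dcl a c.
Proof.
have [k [k1 k2 k3]] := dcl_fresh a b c.
by rewrite (dclE k1) (dclE k2) (dclE k3) addrA subrK.
Qed.

Lemma dcl_act s a b : Qmod_act s (dcl a b) = dcl (s a) (s b).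
Proof.
have [k [k1 _ _]] := dcl_fresh a b b.
rewrite (dclE k1) (@dclE (s a) (s b) (s k)) ?Qmod_actB ?ecl_Sn //.
by move: k1; rewrite !inE !(inj_eq perm_inj).
Qed.

Lemma phiQ_dcl a b i : phiQ (dcl a b) i = (i == a)%:Z - (i == b)%:Z.
Proof.
have [k [k1 _ _]] := dcl_fresh a b b; move: (k1); rewrite !inE !negb_or => /andP[ka kb].
have [ak bk] : a != k /\ b != k by rewrite ![_ == k]eq_sym.
by rewrite (dclE k1) phiQB // !ffunE !phiQ_ecl // !PoszD opprD addrACA subrr addr0.
Qed.

Lemma odd_stable_set : exists O : {set 'I_n}, odd #|O| /\ forall g i, (r g i \in O) = (i \in O).
Proof.
have [o _] := @fresh n [::] (leq_trans (isT : 0 < 5)%N n_ge5).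
have [P [actP [permP permLP]]] := stab.
have [[_ _ actPD] _] := permP.
have actP0 g : actP g 0 = 0 by apply: (addrI (actP g 0)); rewrite -actPD !addr0.
(* The group may be infinite; the cocycle only depends on the permutation r g, so the sum is taken
   over this finite image. *)
pose im := [set s | `[< exists g, r g = s >]].
pose N := #|im|; have im_r g : r g \in im by rewrite inE; apply/asboolP; exists g.
have N0 : (0 < N)%N by apply/card_gt0P; exists (r 1%g).
pose L := Qmod n K.
(* Summing the cocycle relation over [im] shows that N times the cocycle is the coboundary of
   [S]. *)
pose S : L := - \sum_(s in im) dcl (s o) o.
have Qmod_act_sum g (f : 'S_n -> L) : Qmod_act (r g) (\sum_(s in im) f s) = \sum_(s in im) Qmod_act (r g) (f s).
  have Q0 : Qmod_act (r g) (0 : L) = 0 by have := Qmod_actB (r g) 0 0; rewrite !subrr.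
  have QN (u : L) : Qmod_act (r g) (- u) = - Qmod_act (r g) u by have := Qmod_actB (r g) 0 u; rewrite Q0 !sub0r.
  have QD (u v : L) : Qmod_act (r g) (u + v) = Qmod_act (r g) u + Qmod_act (r g) v.
    by have := Qmod_actB (r g) u (- v); rewrite QN !opprK.
  exact: (big_morph _ QD Q0).
have SE g : Qmod_act (r g) S - S = dcl (r g o) o *+ N.
  have -> : Qmod_act (r g) S = S + dcl (r g o) o *+ N.
    have := Qmod_actB (r g) 0 (\sum_(s in im) dcl (s o) o).
    have Q0 : Qmod_act (r g) (0 : L) = 0 by have := Qmod_actB (r g) 0 0; rewrite !subrr.
    rewrite Q0 !sub0r => ->; rewrite Qmod_act_sum /S -sumr_const.
    rewrite [X in - X + _](reindex_inj (mulIg (r g))) /=.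
    rewrite [X in - X + _](eq_bigl (fun s => s \in im)) => [|s]; last first.
      rewrite !inE; apply/asboolP/asboolP => -[h hE].
        by exists (h * g^-1)%g; apply: (mulIg (r g)); rewrite -rM mulgKV.
      by exists (h * g)%g; rewrite rM hE.
    rewrite -!sumrN -big_split /=; apply: eq_bigr => s _; rewrite dcl_act permM.
    by rewrite -(dcl_trans (r g (s o)) (r g o) o) opprD subrK.
  by rewrite addrAC subrr add0r.
(* The equation is solved in the permutation module Q + P, with right-hand side 0 in P; the first
   component of the solution solves it in Q. *)
have [[q p] qP] : exists B', forall g, dsum_act (fun g => Qmod_act (r g)) actP g B' - B' = (dcl (r g o) o, 0).
  apply: (@permutation_module_coboundary _ _ _ N (S, 0)) => // g.
  have pairM (u : L) (k : nat) : (u, 0 : P) *+ k = (u *+ k, 0).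
    by elim: k => [|k IH]; rewrite ?mulr0n // !mulrS IH; congr pair; rewrite addr0.
  by rewrite pairM /dsum_act /= actP0 -SE; congr pair; rewrite subrr.
pose f i : int := (i == o)%:Z - phiQ q i.
have fI g i : f (r g i) = f i.
  have := congr1 (fun u : L * P => phiQ u.1 (r g i)) (qP g).
  rewrite /= phiQB // phiQ_dcl ffunE ffunE phiQ_Sn // permK (inj_eq perm_inj) => E.
  rewrite /f; have -> : phiQ q (r g i) = phiQ q i - ((i == o)%:Z - (r g i == o)%:Z) by rewrite -E; ring.
  by ring.
exists [set i | odd `|f i|%N]; split; last by move=> g i; rewrite !inE fI.
have : (2 %| \sum_i f i - 1)%Z.
  rewrite sumrB (bigD1 o) //= eqxx big1 ?addr0 => [|i /negPf->//].
  by rewrite addrAC subrr add0r rpredN; apply: phiQ_even.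
have par (z : int) : (2 %| z - (odd `|z|%N)%:Z)%Z.
  by apply/dvdzP; exists ((z - (odd `|z|%N)%:Z) %/ 2)%Z; lia.
have E : (2 %| \sum_i f i - #|[set i | odd `|f i|%N]|%:Z)%Z.
  have -> : #|[set i | odd `|f i|%N]|%:Z = \sum_i (odd `|f i|%N)%:Z.
    rewrite -sum1_card (big_morph Posz PoszD (erefl : Posz 0 = 0)) big_mkcond.
    by apply: eq_bigr => i _; rewrite inE; case: odd.
  by rewrite -sumrB; apply: rpred_sum => i _; apply: par.
by move: E; move: (\sum_i f i) #|_| => u m /dvdzP[x xE] /dvdzP[y yE]; lia.
Qed.
End OddSet.

(** * Coefficients in a subring, and interpolation *)

Section Subring.
Variable R : nzRingType.

Definition subring_pred (C : R -> Prop) := [/\ C 1, forall x y, C x -> C y -> C (x - y) &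
  forall x y, C x -> C y -> C (x * y)].

Variable C : R -> Prop.
Hypothesis subC : subring_pred C.

Lemma subring0 : C 0.
Proof. by have [C1 CB _] := subC; rewrite -(subrr 1); apply: CB. Qed.

Lemma subring1 : C 1.
Proof. by have [] := subC. Qed.

Lemma subringN x : C x -> C (- x).
Proof. by have [_ CB _] := subC; rewrite -sub0r; apply: CB; apply: subring0. Qed.

Lemma subringD x y : C x -> C y -> C (x + y).
Proof. by have [_ CB _] := subC => Cx Cy; rewrite -[y]opprK; apply: CB => //; apply: subringN. Qed.

Lemma subringM x y : C x -> C y -> C (x * y).
Proof. by have [_ _ CM] := subC; apply: CM. Qed.

Lemma subring_sum (I : Type) (r : seq I) (P : pred I) (F : I -> R) :
  (forall i, P i -> C (F i)) -> C (\sum_(i <- r | P i) F i).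
Proof. by move=> H; apply: (@big_ind _ C); [apply: subring0|apply: subringD|]. Qed.

Lemma subring_prod (I : Type) (r : seq I) (P : pred I) (F : I -> R) :
  (forall i, P i -> C (F i)) -> C (\prod_(i <- r | P i) F i).
Proof. by move=> H; apply: (@big_ind _ C); [apply: subring1|apply: subringM|]. Qed.

Lemma subringX x k : C x -> C (x ^+ k).
Proof. by move=> Cx; elim: k => [|k IH]; rewrite ?expr0 ?exprS; [apply: subring1|apply: subringM]. Qed.

End Subring.

Section Coefficients.
Variable K : closedFieldType.
Implicit Types (A B : mproj) (C : K -> Prop).

Section Closure.
Variable C : K -> Prop.
Hypothesis subC : subring_pred C.

Lemma coefs_cst A c : C c -> coefs_in C (cst A c).
Proof. by move=> Cc m; rewrite mcoeffC; case: (_ == _); rewrite ?mulr1 ?mulr0 //; apply: (subring0 subC). Qed.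

Lemma coefs1 A : coefs_in C (1 : mpol K A).
Proof. by apply: coefs_cst; apply: (subring1 subC). Qed.

Lemma coefs0 A : coefs_in C (0 : mpol K A).
Proof. by move=> m; rewrite mcoeff0; apply: (subring0 subC). Qed.

Lemma coefs_var A (v : mvar A) : coefs_in C (@var K A v).
Proof. by move=> m; rewrite mcoeffX; case: (_ == _); [apply: (subring1 subC)|apply: (subring0 subC)]. Qed.

Lemma coefsD A (p q : mpol K A) : coefs_in C p -> coefs_in C q -> coefs_in C (p + q).
Proof. by move=> hp hq m; rewrite mcoeffD; apply: (subringD subC). Qed.

Lemma coefsN A (p : mpol K A) : coefs_in C p -> coefs_in C (- p).
Proof. by move=> hp m; rewrite mcoeffN; apply: (subringN subC). Qed.

Lemma coefsB A (p q : mpol K A) : coefs_in C p -> coefs_in C q -> coefs_in C (p - q).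
Proof. by move=> hp hq; apply: coefsD => //; apply: coefsN. Qed.

Lemma coefsM A (p q : mpol K A) : coefs_in C p -> coefs_in C q -> coefs_in C (p * q).
Proof. by move=> hp hq m; rewrite mcoeffM; apply: (subring_sum subC) => k _; apply: (subringM subC). Qed.

Lemma coefsZ A c (p : mpol K A) : C c -> coefs_in C p -> coefs_in C (c *: p).
Proof. by move=> Cc hp m; rewrite mcoeffZ; apply: (subringM subC). Qed.

Lemma coefsX A (p : mpol K A) k : coefs_in C p -> coefs_in C (p ^+ k).
Proof. by move=> hp; elim: k => [|k IH]; rewrite ?expr0 ?exprS; [apply: coefs1|apply: coefsM]. Qed.

Lemma coefs_sum A (I : Type) (r : seq I) (P : pred I) (F : I -> mpol K A) :
  (forall i, P i -> coefs_in C (F i)) -> coefs_in C (\sum_(i <- r | P i) F i).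
Proof. by move=> H; apply: (@big_ind _ (coefs_in C (A := A))); [apply: coefs0|apply: coefsD|]. Qed.

Lemma coefs_prod A (I : Type) (r : seq I) (P : pred I) (F : I -> mpol K A) :
  (forall i, P i -> coefs_in C (F i)) -> coefs_in C (\prod_(i <- r | P i) F i).
Proof. by move=> H; apply: (@big_ind _ (coefs_in C (A := A))); [apply: coefs1|apply: coefsM|]. Qed.

Lemma coefs_subst A B (q : form_tuple K A B) (p : mpol K B) :
  (forall v, coefs_in C (q v)) -> coefs_in C p -> coefs_in C (subst q p).
Proof.
move=> hq hp; rewrite /subst comp_mpolyEX; apply: coefs_sum => m _; apply: coefsZ => //.
by rewrite comp_mpolyX; apply: coefs_prod => i _; apply: coefsX; rewrite tnth_mktuple.
Qed.
End Closure.

Lemma teval_rescale A B (q : form_tuple K A B) (D : mfac B -> mfac A -> nat) l x :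
  (forall v, multihomog (D (blk v)) (q v)) ->
  teval q (rescale l x) = rescale (fun j => \prod_i l i ^+ D j i) (teval q x).
Proof. by move=> hq; apply/funext => v; rewrite /teval hq. Qed.

Lemma multihomog_subst A B (q : form_tuple K A B) (D : mfac B -> mfac A -> nat) d (p : mpol K B) :
  (forall v, multihomog (D (blk v)) (q v)) -> multihomog d p ->
  multihomog (fun i => \sum_j d j * D j i)%N (subst q p).
Proof.
move=> hq hp l x; rewrite !peval_subst (teval_rescale _ _ hq) hp; congr (_ * _).
under eq_bigr do rewrite -prodrXl; rewrite exchange_big /=; apply: eq_bigr => i _.
by rewrite -prodrXr; apply: eq_bigr => j _; rewrite mulnC exprM.
Qed.

Lemma form_tuple_degree C A B (q : form_tuple K A B) : is_form_tuple C q ->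
  exists D : mfac B -> mfac A -> nat, forall v, multihomog (D (blk v)) (q v).
Proof.
move=> [_ H]; have /choice[D DP] := H.
by exists D => v; apply: DP.
Qed.

Lemma teval_same C A B (q : form_tuple K A B) x y : is_form_tuple C q -> same_pt x y ->
  same_pt (teval q x) (teval q y).
Proof.
move=> /form_tuple_degree[D hq] [l [l0 ->]]; rewrite (teval_rescale _ _ hq).
by exists (fun j => \prod_i l i ^+ D j i); split=> // j; apply: prodX_neq0.
Qed.

Definition comp_tuple A B A' (q' : form_tuple K B A') (q : form_tuple K A B) : form_tuple K A A' :=
  fun v => subst q (q' v).

Lemma teval_comp A B A' (q' : form_tuple K B A') (q : form_tuple K A B) x :
  teval (comp_tuple q' q) x = teval q' (teval q x).
Proof. by apply/funext => v; rewrite /teval peval_subst. Qed.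

Lemma is_form_comp C A B A' (q' : form_tuple K B A') (q : form_tuple K A B) : subring_pred C ->
  is_form_tuple C q' -> is_form_tuple C q -> is_form_tuple C (comp_tuple q' q).
Proof.
move=> sC fq' fq; split=> [v|j]; first by apply: coefs_subst => //; [case: fq|case: fq'].
have [D hq] := form_tuple_degree fq; have [_ /(_ j)[d hd]] := fq'.
by exists (fun i => \sum_k d k * D k i)%N => v vj; apply: multihomog_subst => //; apply: hd.
Qed.

(* A product of linear factors vanishing at P k for all k != k0, but not at P k0, expands into such monomials. *)
Lemma interpolation (T I : finType) (P : I -> T -> K) (c : I -> K) k0 : c k0 != 0 ->
  (forall k, k != k0 -> exists t, P k t != P k0 t) ->
  exists e : T -> nat, (forall t, (e t <= #|I|)%N) /\ \sum_k c k * \prod_t P k t ^+ e t != 0.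
Proof.
move=> c0 H; apply: contrapT => N.
have {N} van (e : T -> nat) : (forall t, (e t <= #|I|)%N) -> \sum_k c k * \prod_t P k t ^+ e t = 0.
  by move=> he; apply/eqP; apply: contraT => ne; case: N; exists e.
(* Each linear factor is expanded, raising one exponent by at most 1; the size of s bounds what is
   still to come. *)
have ind (s : seq (T * K)) (e : T -> nat) : (forall t, (e t + size s <= #|I|)%N) ->
    \sum_k c k * (\prod_t P k t ^+ e t * \prod_(u <- s) (P k u.1 - u.2)) = 0.
  elim: s e => [|[u b] s IH] e he.
    by under eq_bigr do rewrite big_nil mulr1; apply: van => t; have := he t; rewrite addn0.
  have E1 : \sum_k c k * (\prod_t P k t ^+ (e t + (t == u))%N * \prod_(u <- s) (P k u.1 - u.2)) = 0.
    by apply: IH => t; have := he t; rewrite /=; case: (t == u) => /=; lia.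
  have E2 : \sum_k c k * (\prod_t P k t ^+ e t * \prod_(u <- s) (P k u.1 - u.2)) = 0.
    by apply: IH => t; have := he t; rewrite /=; lia.
  transitivity ((\sum_k c k * (\prod_t P k t ^+ (e t + (t == u))%N * \prod_(u <- s) (P k u.1 - u.2))) -
     b * \sum_k c k * (\prod_t P k t ^+ e t * \prod_(u <- s) (P k u.1 - u.2))); last first.
    by rewrite E1 E2 mulr0 subrr.
  rewrite mulr_sumr -sumrB.
  apply: eq_bigr => k _; rewrite big_cons /=.
  have -> : \prod_t P k t ^+ (e t + (t == u))%N = (\prod_t P k t ^+ e t) * P k u.
    by under eq_bigr do rewrite exprD; rewrite big_split /= prod_delta.
  by ring.
(* At most one factor for each k other than [k0], which is why exponents up to #|I| suffice. *)
have /choice[w wP] : forall k, exists w : seq (T * K), [/\ (size w <= 1)%N,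
    forall u, u \in w -> P k0 u.1 != u.2 & k != k0 -> exists2 u, u \in w & P k u.1 = u.2].
  move=> k; have [->|ne] := eqVneq k k0; first by exists [::].
  have [t tP] := H k ne; exists [:: (t, P k t)]; split=> // [u|_].
    by rewrite inE => /eqP -> /=; rewrite eq_sym.
  by exists (t, P k t); rewrite ?mem_head.
pose s := flatten [seq w k | k <- enum I].
have ss : (size s <= #|I|)%N.
  rewrite size_flatten /shape -map_comp sumnE big_map big_enum -sum1_card.
  by apply: leq_sum => k _; have [] := wP k.
have s0 k : k != k0 -> \prod_(u <- s) (P k u.1 - u.2) = 0.
  move=> ne; have [_ _ /(_ ne)[u uw uE]] := wP k.
  have us : u \in s by apply/flattenP; exists (w k) => //; apply: map_f; rewrite mem_enum.
  by rewrite (big_rem u) //= uE subrr mul0r.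
have /eqP := ind s (fun=> 0%N) (fun=> ss).
rewrite (bigD1 k0) //= [X in _ + X]big1 => [|k /s0 ->]; last by rewrite !mulr0.
rewrite addr0 !mulf_eq0 (negPf c0) /= => /orP[/prodf_eq0[t _]|]; first by rewrite expr0 oner_eq0.
rewrite prodf_seq_eq0 => /hasP[u /flattenP[_ /mapP[k _ ->] uk]]; rewrite subr_eq0.
by have [_ /(_ u uk)/negPf -> _] := wP k.
Qed.
End Coefficients.

Lemma ratioX (F : fieldType) (u v : F) (e N : nat) : (e <= N)%N -> v != 0 ->
  v ^+ N * (u / v) ^+ e = u ^+ e * v ^+ (N - e).
Proof.
move=> eN v0; rewrite -{1}(subnKC eN) exprD expr_div_n.
by field; rewrite expf_neq0.
Qed.

Lemma pairing (T : Type) (l : seq T) : ~~ odd (size l) ->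
  exists p : seq (T * T), l = flatten [seq [:: u.1; u.2] | u <- p].
Proof.
have [m] := ubnP (size l); elim: m l => // m IH [|a [|b l]] //= ls; first by exists [::].
rewrite negbK => lo; have [|p ->] := IH l _ lo; first by rewrite ltnS in ls; apply: ltnW.
by exists ((a, b) :: p).
Qed.

(** * A covariant matrix attached to an odd set *)

Section Tau.
Variables (K : closedFieldType) (n : nat).
Hypothesis n_ge5 : (5 <= n)%N.
Local Notation P1n := (P1n n).
Local Notation Q := (quadP1 n).
Implicit Types (w : pts K P1n) (i j k a b : 'I_n) (s : 'S_n) (q : quad n).

(** No nontrivial permutation fixes the point of M_{0,n} represented by w; the cross-ratios are
    compared by cross-multiplication. *)
Definition free_orbit w := forall s, s != 1%g -> exists q,
  cr (relab s w) (q, false) * cr w (q, true) != cr (relab s w) (q, true) * cr w (q, false).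

Lemma cr_relabE s w q (e : bool) : cr (relab s w) (q, e) = cr w (quad_perm s q, e).
Proof. by rewrite cr_relab Sn_actE. Qed.

(** Take a moved by s, then b different from a and s a, then c with c and s c both outside {a, b}:
    [ab] divides the right-hand side and none of the four brackets on the left. *)
Lemma moved_quad s : s != 1%g -> exists q,
  crp K (quad_perm s q, false) * crp K (q, true) != crp K (quad_perm s q, true) * crp K (q, false).
Proof.
move=> s1; have [a sa] : exists a, s a != a.
  apply/existsP; apply: contraNT s1; rewrite negb_exists => /forallP H.
  by apply/eqP/permP => a; rewrite perm1; apply/eqP; have := H a; rewrite negbK.
have [b] := @fresh n [:: a; s a] (leq_trans (isT : 2 < 5)%N n_ge5).
have [c] := @fresh n [:: a; b; s^-1%g a; s^-1%g b] n_ge5.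
have [d] := @fresh n [:: a; b; c] (leq_trans (isT : 3 < 5)%N n_ge5).
rewrite !inE !negb_or => /and3P[da db dc] /and4P[ca cb csa csb] /andP[ba bsa].
have sca : s c != a by apply: contraNneq csa => <-; rewrite permK.
have scb : s c != b by apply: contraNneq csb => <-; rewrite permK.
have ab : a != b by rewrite eq_sym.
have [|q [q0 q1 q2 q3]] := @lbl_ex n a b c d.
  by rewrite /= !inE !negb_or ab ![_ == c]eq_sym ca cb ![_ == d]eq_sym da db dc.
exists q; apply/eqP => E; have fp := brp_prime K ab; have [_ _ fP] := fp.
have sq : [/\ l0 (quad_perm s q) = s a, l1 (quad_perm s q) = s b, l2 (quad_perm s q) = s c & l3 (quad_perm s q) = s d].
  by rewrite -q0 -q1 -q2 -q3 /l0 /l1 /l2 /l3 !lab_perm.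
have dv : divides (brp K a b) (crp K (quad_perm s q, false) * crp K (q, true)).
  rewrite E /crp /= q0 q1; exists ((brp K (l0 (quad_perm s q)) (l2 (quad_perm s q)) *
    brp K (l1 (quad_perm s q)) (l3 (quad_perm s q))) * brp K (l2 q) (l3 q)); ring.
have ne (u v : 'I_n) : u != v -> (u != a) && (u != b) || (v != a) && (v != b) -> ~ divides (brp K a b) (brp K u v).
  move=> uv H dd; have /setP E' := prime_brp_uniq ab uv fp (divides_refl _) dd.
  have := E' u; have := E' v; rewrite !inE !eqxx orbT => /orP[]/eqP Ev /orP[]/eqP Eu;
    by move: H; rewrite Ev Eu !eqxx ?andbF.
have [p0 p1 p2 p3] := sq; move: dv; rewrite /crp /= p0 p1 p2 p3 q0 q1 q2 q3.
have inj u v : u != v -> s u != s v by rewrite (inj_eq perm_inj).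
have csd : c != d by rewrite eq_sym.
case/fP => /fP[]; apply: ne; rewrite ?inj // ?ca ?cb ?da ?db ?orbT //.
- by rewrite sa eq_sym bsa.
- by rewrite sca scb.
- by rewrite eq_sym.
- by rewrite eq_sym.
Qed.

Lemma free_point : exists w, all_br w /\ free_orbit w.
Proof.
have /choice[q qP] : forall s : 'S_n, exists q, s != 1%g ->
    crp K (quad_perm s q, false) * crp K (q, true) != crp K (quad_perm s q, true) * crp K (q, false).
  move=> s; have [->|ne] := eqVneq s 1%g; last by have [q H] := moved_quad ne; exists q.
  have [i _] := @fresh n [::] (leq_trans (isT : 0 < 5)%N n_ge5).
  have [j] := @fresh n [:: i] (leq_trans (isT : 1 < 5)%N n_ge5); rewrite inE eq_sym => ij.
  by have [_ [_ [t _]]] := quad_through n_ge5 ij; exists t.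
pose P := discp K n * \prod_(s : 'S_n | s != 1%g) (crp K (quad_perm s (q s), false) * crp K (q s, true) -
   crp K (quad_perm s (q s), true) * crp K (q s, false)).
have P0 : P != 0.
  by rewrite mulf_neq0 ?discp_neq0 //; apply/prodf_neq0 => s s1; rewrite subr_eq0 qP.
have [w] := peval_nonroot P0; rewrite pevalM mulf_eq0 negb_or => /andP[/discE hw].
rewrite peval_prod => /prodf_neq0 H; exists w; split=> // s s1; exists (q s).
by have := H s s1; rewrite pevalB [X in X - _]pevalM [X in _ - X]pevalM !crpE subr_eq0 !cr_relabE.
Qed.

Definition vbr (u v : bool -> K) : K := u false * v true - u true * v false.

Section Forms.
Variables (O : {set 'I_n}) (i j k : 'I_n) (p : seq ('I_n * 'I_n)).
Hypotheses (ij : i != j) (ik : i != k) (jk : j != k).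
Hypothesis OE : enum O = i :: flatten [seq [:: u.1; u.2] | u <- p].
Variables (N : nat) (ex : bool -> quad n -> nat).
Hypothesis exN : forall c q, (ex c q <= N)%N.

Definition pairs : mpol K P1n := \prod_(u <- p) brp K u.1 u.2.
Definition disc_jk : mpol K P1n := \prod_(ab : 'I_n * 'I_n | (ab.1 != ab.2) && (ab != (j, k))) brp K ab.1 ab.2.

(** The two columns before averaging. In the first, the vector i and the brackets of the pairs of O
    use each label of O once, whence |O| odd. The factor [discp] is there so that in the second
    column, with the vector j, the bracket [jk] can be taken out of it and [ik] put in, which gives
    both columns the same weights. *)
Definition vec (c e : bool) : mpol K P1n :=
  if c then @var K P1n (j, e) * brp K i k * pairs * disc_jk
  else @var K P1n (i, e) * pairs * discp K n.

(** A monomial of degree N in the two coordinates of each cross-ratio, so that its behaviour under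
    GL_2 and scalings does not depend on the exponents; these are free to be chosen against
    cancellation in the average. *)
Definition weight (c : bool) : mpol K P1n :=
  \prod_q (crp K (q, false) ^+ ex c q * crp K (q, true) ^+ (N - ex c q)).

Definition stabp : pred 'S_n := fun s => [forall a, (s a \in O) == (a \in O)].

Definition tau (e c : bool) : mpol K P1n := \sum_(s | stabp s) relabp s (weight c * vec c e).

(** The common factor by which the columns of tau are multiplied. The stabiliser of O permutes the
    quadruples, the labels in O and the pairs of labels, so the factor is the same for all terms of
    the average. *)
Definition kap (g : bool -> bool -> K) (t : 'I_n -> K) : K :=
  (\prod_q (det2 g ^+ 2 * (t (l0 q) * t (l1 q) * t (l2 q) * t (l3 q)))) ^+ N *
  (det2 g ^+ size p * \prod_(a in O) t a) *
  \prod_(ab : 'I_n * 'I_n | ab.1 != ab.2) (t ab.1 * t ab.2 * det2 g).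

Lemma prodO (t : 'I_n -> K) : \prod_(a in O) t a = t i * \prod_(u <- p) (t u.1 * t u.2).
Proof.
rewrite -big_enum OE big_cons; congr (_ * _); elim: (p) => [|u l IH] /=; first by rewrite !big_nil.
by rewrite !big_cons IH mulrA.
Qed.

Lemma vec_lin g t w c e : peval (vec c e) (lin g t w) =
  (det2 g ^+ size p * \prod_(a in O) t a) *
  (\prod_(ab : 'I_n * 'I_n | ab.1 != ab.2) (t ab.1 * t ab.2 * det2 g)) *
  (g e false * peval (vec c false) w + g e true * peval (vec c true) w).
Proof.
have pE : peval pairs (lin g t w) = det2 g ^+ size p * \prod_(u <- p) (t u.1 * t u.2) * peval pairs w.
  rewrite /pairs !peval_prod; elim: (p) => [|u l IH]; first by rewrite !big_nil expr0 !mulr1.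
  by rewrite !big_cons IH !brpE br_lin exprS; ring.
have dE : peval (discp K n) (lin g t w) = (\prod_(ab : 'I_n * 'I_n | ab.1 != ab.2) (t ab.1 * t ab.2 * det2 g)) *
    peval (discp K n) w.
  by rewrite /discp !peval_prod -big_split; apply: eq_bigr => ab _; rewrite !brpE br_lin.
have d'E : peval disc_jk (lin g t w) =
    (\prod_(ab : 'I_n * 'I_n | (ab.1 != ab.2) && (ab != (j, k))) (t ab.1 * t ab.2 * det2 g)) * peval disc_jk w.
  by rewrite /disc_jk !peval_prod -big_split; apply: eq_bigr => ab _; rewrite !brpE br_lin.
rewrite prodO /vec; case: c.
  have -> : \prod_(ab : 'I_n * 'I_n | ab.1 != ab.2) (t ab.1 * t ab.2 * det2 g) = t j * t k * det2 g *
      \prod_(ab : 'I_n * 'I_n | (ab.1 != ab.2) && (ab != (j, k))) (t ab.1 * t ab.2 * det2 g).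
    by rewrite (bigD1 (j, k)).
  by rewrite !pevalM !pevalV !brpE pE d'E br_lin /lin /=; ring.
by rewrite !pevalM !pevalV pE dE /lin /=; ring.
Qed.

Lemma weight_lin g t w c : peval (weight c) (lin g t w) =
  (\prod_q (det2 g ^+ 2 * (t (l0 q) * t (l1 q) * t (l2 q) * t (l3 q)))) ^+ N * peval (weight c) w.
Proof.
rewrite /weight !peval_prod -prodrXl -big_split; apply: eq_bigr => q _ /=.
set m := det2 g ^+ 2 * _.
have E (b : bool) : cr (lin g t w) (q, b) = m * cr w (q, b) by rewrite cr_lin.
have -> : m ^+ N = m ^+ ex c q * m ^+ (N - ex c q) by rewrite -exprD subnKC.
by rewrite !pevalM !pevalX !crpE !E !exprMn; ring.
Qed.

Lemma kap_perm g t s : stabp s -> kap g (t \o s) = kap g t.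
Proof.
move=> /forallP sO; rewrite /kap; congr (_ ^+ _ * (_ * _) * _).
- rewrite [RHS](reindex_inj (can_inj (quad_permK s))) /=; apply: eq_bigr => q _.
  by rewrite /l0 /l1 /l2 /l3 !lab_perm.
- rewrite [RHS](reindex_inj (@perm_inj _ s)) /=; apply: eq_bigl => a.
  by rewrite (eqP (sO a)).
- have inj : injective (fun ab : 'I_n * 'I_n => (s ab.1, s ab.2)).
    by move=> [a b] [c d] [/perm_inj -> /perm_inj ->].
  by rewrite [RHS](reindex_inj inj) /=; apply: eq_bigl => -[a b] /=; rewrite (inj_eq perm_inj).
Qed.

Lemma tau_lin g t w e c : peval (tau e c) (lin g t w) =
  kap g t * (g e false * peval (tau false c) w + g e true * peval (tau true c) w).
Proof.
rewrite /tau !peval_sum !mulr_sumr -big_split mulr_sumr; apply: eq_bigr => s sO /=.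
rewrite !relabpE -[relab s (lin g t w)]/(lin g (t \o s) (relab s w)) !pevalM weight_lin vec_lin.
by rewrite -(kap_perm g t sO) /kap; ring.
Qed.

Lemma kap_neq0 g t : det2 g != 0 -> (forall a, t a != 0) -> kap g t != 0.
Proof.
move=> g0 t0; rewrite /kap; apply: mulf_neq0; first apply: mulf_neq0.
- apply: expf_neq0; apply/prodf_neq0 => q _.
  by rewrite mulf_neq0 ?expf_neq0 // !mulf_neq0.
- by rewrite mulf_neq0 ?expf_neq0 //; apply/prodf_neq0 => a _.
- by apply/prodf_neq0 => ab _; rewrite !mulf_neq0.
Qed.

Lemma relabp_relab s s' (f : mpol K P1n) w : peval (relabp s f) (relab s' w) = peval (relabp (s * s')%g f) w.
Proof. by rewrite !relabpE; congr peval; apply/funext => -[a e]; rewrite /relab /= permM. Qed.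

Lemma tau_relab s w e c : stabp s -> peval (tau e c) (relab s w) = peval (tau e c) w.
Proof.
move=> sO; rewrite /tau !peval_sum [RHS](reindex_inj (mulIg s)) /=.
rewrite [RHS](eq_bigl stabp) => [|s']; first by apply: eq_bigr => s' _; rewrite relabp_relab.
apply/forallP/forallP => H a; have := H a; rewrite permM ?(eqP (forallP sO _)) //.
Qed.

(** For g the identity, [kap] is a monomial in t, whose exponents are the degree. *)
Lemma tau_homog : exists D : mfac P1n -> nat, forall e c, multihomog D (tau e c).
Proof.
pose mono (f : ('I_n -> K) -> K) := exists D : 'I_n -> nat, forall t, f t = \prod_a t a ^+ D a.
have monoM f f' : mono f -> mono f' -> mono (fun t => f t * f' t).
  move=> [D hD] [D' hD']; exists (fun a => D a + D' a)%N => t; rewrite hD hD' -big_split.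
  by apply: eq_bigr => a _; rewrite exprD.
have mono1 : mono (fun=> 1) by exists (fun=> 0%N) => t; rewrite big1.
have monoV a : mono (fun t => t a) by exists (fun b => b == a) => t; rewrite prod_delta.
have mono_prod (I : finType) (P : pred I) (F : I -> ('I_n -> K) -> K) :
    (forall x, P x -> mono (F x)) -> mono (fun t => \prod_(x | P x) F x t).
  move=> H; have /choice[D hD] : forall x, exists D : 'I_n -> nat, P x -> forall t, F x t = \prod_a t a ^+ D a.
    move=> x; have [Px|_] := boolP (P x); last by exists (fun=> 0%N).
    by have [D hD] := H x Px; exists D.
  exists (fun a => \sum_(x | P x) D x a)%N => t.
  under eq_bigr => x Px do rewrite (hD x Px).
  by rewrite exchange_big; apply: eq_bigr => a _; rewrite prodrXr.
have monoX f m : mono f -> mono (fun t => f t ^+ m).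
  move=> [D hD]; exists (fun a => D a * m)%N => t; rewrite hD -prodrXl.
  by apply: eq_bigr => a _; rewrite exprM.
have d1 : det2 (@id2 K) = 1 by rewrite /det2 /id2 /=; ring.
have [D hD] : mono (kap (@id2 K)).
  rewrite /kap d1; apply: (monoM); first apply: (monoM).
  - apply: (monoX); apply: (mono_prod) => q _; rewrite expr1n.
    by apply: (monoM (fun=> 1)) => //; do !apply: (monoM); apply: (monoV).
  - by rewrite expr1n; apply: (monoM (fun=> 1)) => //; apply: (mono_prod) => a _; apply: (monoV).
  - apply: (mono_prod) => ab _; do !apply: (monoM); by [apply: (monoV)|].
exists D => e c l w; rewrite -lin_id tau_lin hD /id2 /=; congr (_ * _).
by case: e; rewrite ?mul1r ?mul0r ?addr0 ?add0r.
Qed.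

Lemma tau_coefs (C : K -> Prop) e c : subring_pred C -> coefs_in C (tau e c).
Proof.
move=> sC; have cb a b : coefs_in C (brp K a b).
  by apply: coefsB => //; apply: coefsM => //; apply: coefs_var.
have cc (v : mvar Q) : coefs_in C (crp K v).
  by rewrite /crp; case: (v.2); apply: coefsM.
apply: coefs_sum => // s _; apply: coefs_subst => // [v|]; first exact: coefs_var.
apply: coefsM => //.
  by apply: coefs_prod => // q _; apply: coefsM => //; apply: coefsX.
have cp : coefs_in C pairs by apply: coefs_prod.
have cd : coefs_in C (discp K n) by apply: coefs_prod.
have cd' : coefs_in C disc_jk by apply: coefs_prod.
by rewrite /vec; case: c; do !apply: coefsM => //; apply: coefs_var.
Qed.

Lemma vec_br w : all_br w -> vbr (fun e => peval (vec false e) w) (fun e => peval (vec true e) w) != 0.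
Proof.
move=> hw.
have p0 : peval pairs w != 0.
  rewrite /pairs peval_prod prodf_seq_neq0; apply/allP => u up /=; rewrite brpE; apply: hw.
  have : uniq (enum O) := enum_uniq _; rewrite OE /= => /andP[_].
  move: up; elim: (p) => //= v l IH; rewrite inE => /orP[/eqP->|ul].
    by rewrite inE negb_or => /andP[/andP[]].
  by case/and3P => _ _; apply: IH.
have d0 : peval (discp K n) w != 0 by apply/discE.
have d0' : peval disc_jk w != 0.
  by rewrite /disc_jk peval_prod; apply/prodf_neq0 => ab /andP[h _]; rewrite brpE hw.
have -> : vbr (fun e => peval (vec false e) w) (fun e => peval (vec true e) w) =
   br w i j * br w i k * (peval pairs w ^+ 2 * peval (discp K n) w * peval disc_jk w).
  by rewrite /vbr /vec !pevalM !pevalV !brpE [br w i j]/br; ring.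
by rewrite !mulf_neq0 ?expf_neq0 ?hw.
Qed.
End Forms.

(* tau is a matrix of integral forms in n vectors of K^2, covariant under GL_2, and invariant under
   the permutations preserving O; its existence needs |O| odd. *)
Definition tau_spec (O : {set 'I_n}) (T : bool -> bool -> mpol K P1n) (kp : (bool -> bool -> K) -> ('I_n -> K) -> K)
    (D : mfac P1n -> nat) w0 :=
  [/\ forall g t w e c, peval (T e c) (lin g t w) =
        kp g t * (g e false * peval (T false c) w + g e true * peval (T true c) w),
      forall g t, det2 g != 0 -> (forall a, t a != 0) -> kp g t != 0,
      forall s w e c, (forall a, (s a \in O) = (a \in O)) -> peval (T e c) (relab s w) = peval (T e c) w,
      (forall e c, multihomog D (T e c)) /\ (forall C e c, subring_pred C -> coefs_in C (T e c)) &
      [/\ all_br w0, free_orbit w0 & det2 (fun e c => peval (T e c) w0) != 0]].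

(** Every nontrivially relabelled [w0] differs from [w0] in some cross-ratio, so [interpolation] can
    single out the term of the identity: the exponents of the first column are chosen to make its
    average independent of the second column before averaging, then those of the second column to
    make the determinant nonzero. *)
Lemma tau_exists (O : {set 'I_n}) : odd #|O| -> exists T kp D w0, tau_spec O T kp D w0.
Proof.
move=> oO; have [i [r OE]] : exists i r, enum O = i :: r.
  by move: oO; rewrite cardE; case: (enum O) => // i r _; exists i, r.
have [|p rE] := @pairing _ r.
  by move: oO; rewrite cardE OE /=.
rewrite rE in OE.
have [j] := @fresh n [:: i] (leq_trans (isT : 1 < 5)%N n_ge5); rewrite inE eq_sym => ij.
have [k] := @fresh n [:: i; j] (leq_trans (isT : 2 < 5)%N n_ge5).
rewrite !inE negb_or ![k == _]eq_sym => /andP[ik jk].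
have [w0 [hw0 fw0]] := free_point.
pose N := #|{: 'S_n}|.
pose X s : quad n -> K := fun q => cr (relab s w0) (q, false) / cr (relab s w0) (q, true).
have hs s : all_br (relab s w0) by move=> a b ab; rewrite /br; apply: hw0; rewrite (inj_eq perm_inj).
have nz s q e : cr (relab s w0) (q, e) != 0 by exact: (cr_point (hs s)).
have Xne s : s != 1%g -> exists q, X s q != X 1%g q.
  move=> s1; have [q H] := fw0 s s1; exists q; apply: contraNneq H => E.
  have r1 : relab 1%g w0 = w0 by apply/funext => -[a e]; rewrite /relab /= perm1.
  rewrite /X r1 in E; have n0 e : cr w0 (q, e) != 0 by rewrite -r1.
  apply/eqP; have := congr1 (fun z => z * cr (relab s w0) (q, true) * cr w0 (q, true)) E.
  by rewrite divfK // => ->; field.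
pose U c s e := peval (vec i j k p c e) (relab s w0).
have stab1 : stabp O 1%g by apply/forallP => a; rewrite perm1.
have sel (f : 'S_n -> K) : f 1%g != 0 -> exists e : quad n -> nat, (forall q, (e q <= N)%N) /\
    \sum_(s | stabp O s) f s * \prod_q (cr (relab s w0) (q, false) ^+ e q * cr (relab s w0) (q, true) ^+ (N - e q)) != 0.
  move=> f1; pose c s := if stabp O s then f s * \prod_q cr (relab s w0) (q, true) ^+ N else 0.
  have [|e [eN eS]] := @interpolation K _ _ X c 1%g _ Xne.
    by rewrite /c stab1 mulf_neq0 //; apply/prodf_neq0 => q _; rewrite expf_neq0.
  exists e; split=> //; apply: contraNneq eS => eS; apply/eqP; rewrite -[RHS]eS [RHS]big_mkcond.
  apply: eq_bigr => s _; rewrite /c; case: ifP => _; last by rewrite mul0r.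
  rewrite -mulrA -big_split; congr (_ * _); apply: eq_bigr => q _.
  exact: ratioX.
have r1 : relab 1%g w0 = w0 by apply/funext => -[a e]; rewrite /relab /= perm1.
have [|e0 [e0N S0]] := sel (fun s => vbr (U false s) (U true 1%g)).
  by apply: (vec_br (O := O)) => //; apply: hs.
pose A e s := \prod_q (cr (relab s w0) (q, false) ^+ e q * cr (relab s w0) (q, true) ^+ (N - e q)).
pose col0 e := \sum_(s | stabp O s) A e0 s * U false s e.
have [|e1 [e1N S1]] := sel (fun s => vbr col0 (U true s)).
  apply: contraNneq S0 => E; apply/eqP; rewrite -[RHS]E /vbr /col0 !mulr_suml -sumrB.
  by apply: eq_bigr => s _; rewrite /A; ring.
pose ex (c : bool) := if c then e1 else e0.
have exN c q : (ex c q <= N)%N by case: c.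
have [D hD] := tau_homog jk OE exN.
exists (tau O i j k p N ex), (kap O p N), D, w0; split.
- by move=> g t w e c; apply: (tau_lin jk OE exN).
- by move=> g t; apply: kap_neq0.
- by move=> s w e c H; apply: tau_relab; apply/forallP => a; rewrite H.
- by split=> // C e c sC; apply: tau_coefs.
split=> //; apply: contraNneq S1 => E.
have tE e c : peval (tau O i j k p N ex e c) w0 = \sum_(s | stabp O s) A (ex c) s * U c s e.
  rewrite /tau peval_sum; apply: eq_bigr => s _; rewrite relabpE pevalM /U; congr (_ * _).
  by rewrite /weight peval_prod; apply: eq_bigr => q _; rewrite pevalM !pevalX !crpE.
have detE (f : bool -> bool -> K) : (forall e, f e false = col0 e) ->
    (forall e, f e true = \sum_(s | stabp O s) A e1 s * U true s e) ->
    det2 f = \sum_(s | stabp O s) vbr col0 (U true s) * A e1 s.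
  move=> h0 h1; rewrite /det2 !h0 !h1 mulr_sumr mulr_suml -sumrB.
  by apply: eq_bigr => s _; rewrite /vbr; ring.
by apply/eqP; rewrite -[RHS]E; apply/esym/detE => e; rewrite tE.
Qed.
End Tau.

(** * Birational maps *)

Section Birational.
Variable K : closedFieldType.
Implicit Types (A B : mproj) (C : K -> Prop).

(** The consequence of irreducibility that birational maps need, in a form that passes to products
    with a projective space. *)
Definition prime_set A (X : subpts K A) := forall d e (p q : mpol K A),
  multihomog d p -> multihomog e q -> ~ vanish X p -> ~ vanish X q -> ~ vanish X (p * q).

Lemma irreducible_prime A (X : subpts K A) : irreducible_set X -> (forall x, X x -> is_point x) -> prime_set X.
Proof. by move=> iX Xp d e p q hp hq np nq /(irreducible_vanishM iX Xp hp hq)[]. Qed.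

Lemma pspace_point r (p : mpol K (Pspace r.+1)) : p != 0 -> exists x, is_point x /\ peval p x != 0.
Proof.
move=> p0; have v0 : @var K (Pspace r.+1) ord0 != 0.
  by apply/eqP => /(congr1 (fun P => peval P (fun=> 1)))/eqP; rewrite pevalV peval0 oner_eq0.
have [x] := peval_nonroot (mulf_neq0 p0 v0); rewrite pevalM pevalV mulf_eq0 negb_or => /andP[px x0].
by exists x; split=> // -[]; exists ord0.
Qed.

Lemma prime_whole r : prime_set (@whole K r.+1).
Proof.
move=> d e p q _ _ np nq vpq.
have nz (f : mpol K (Pspace r.+1)) : ~ vanish (@whole K r.+1) f -> f != 0.
  by move=> nf; apply/eqP => f0; apply: nf => x _; rewrite f0 peval0.
have [x [xp]] := pspace_point (mulf_neq0 (nz p np) (nz q nq)).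
by rewrite vpq ?eqxx.
Qed.

Lemma not_vanish A (X : subpts K A) p : ~ vanish X p -> exists x, X x /\ peval p x != 0.
Proof.
move=> nv; apply: contrapT => H; apply: nv => x Xx; apply/eqP.
by apply: contraT => px; case: H; exists x.
Qed.

Definition pair_pt A B (x : pts K A) (y : pts K B) : pts K (prodamb A B) :=
  fun v => match v with inl u => x u | inr u => y u end.

Lemma pair_eta A B (z : pts K (prodamb A B)) : z = pair_pt (fun v => z (inl v)) (fun v => z (inr v)).
Proof. by apply/funext => -[]. Qed.

Definition inl_tuple (B A : mproj) : form_tuple K (prodamb A B) A := fun v => @var K (prodamb A B) (inl v).
Arguments inl_tuple : clear implicits.

Lemma inl_tupleE B A z : teval (inl_tuple B A) z = fun v => z (inl v).
Proof. by apply/funext => v; rewrite /teval pevalV. Qed.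

Lemma inl_tuple_form C B A : subring_pred C -> is_form_tuple C (inl_tuple B A).
Proof.
move=> sC; split=> [v|t]; first exact: coefs_var.
by exists (fun u : mfac (prodamb A B) => (u == inl t) : nat) => v /= <-; apply: (@multihomog_var K (prodamb A B) (inl v)).
Qed.

(** Choose g in the projective space at which both forms, each restricted to a suitable point of X,
    are nonzero; fixing g gives two forms not vanishing identically on X. *)
Lemma prime_prod A (X : subpts K A) r : prime_set X -> prime_set (prodset X (@whole K r.+1)).
Proof.
move=> pX d e p q hp hq np nq vpq.
have [z0 [[X0 _] pz0]] := not_vanish np; have [z1 [[X1 _] qz1]] := not_vanish nq.
pose B := Pspace r.+1.
pose atx (x : pts K A) : form_tuple K B (prodamb A B) := fun v =>
  match v with inl u => cst B (x u) | inr u => @var K B u end.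
pose atg (g : pts K B) : form_tuple K A (prodamb A B) := fun v =>
  match v with inl u => @var K A u | inr u => cst A (g u) end.
have atxE x g : teval (atx x) g = pair_pt x g.
  by apply/funext => -[u|u]; rewrite /teval /= pevalE.
have atgE x g : teval (atg g) x = pair_pt x g.
  by apply/funext => -[u|u]; rewrite /teval /= pevalE.
have p0 : subst (atx (fun v => z0 (inl v))) p != 0.
  by apply: contraNneq pz0 => E; rewrite {1}(pair_eta z0) -atxE -peval_subst E peval0.
have q0 : subst (atx (fun v => z1 (inl v))) q != 0.
  by apply: contraNneq qz1 => E; rewrite {1}(pair_eta z1) -atxE -peval_subst E peval0.
have [g [gp]] := pspace_point (mulf_neq0 p0 q0).
rewrite pevalM !peval_subst !atxE mulf_eq0 negb_or => /andP[pg qg].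
have hom f (d' : mfac (prodamb A B) -> nat) : multihomog d' f -> exists d'', multihomog d'' (subst (atg g) f).
  move=> hf; apply: (@subst_homog K A (prodamb A B) (atg g) (fun j => if j is inl u then Some u else None) _ _ _ hf).
  by move=> l x; rewrite !atgE; apply/funext => -[u|u]; rewrite /pair_pt /rescale /= ?mul1r.
have [dp hp'] := hom p d hp; have [dq hq'] := hom q e hq.
apply: (pX dp dq _ _ hp' hq').
- by move/(_ _ X0)/eqP; rewrite peval_subst atgE (negPf pg).
- by move/(_ _ X1)/eqP; rewrite peval_subst atgE (negPf qg).
- by move=> x Xx; rewrite pevalM !peval_subst !atgE -pevalM; apply: vpq.
Qed.

Definition generic_form C A (X : subpts K A) (h : mpol K A) :=
  [/\ coefs_in C h, exists d, multihomog d h & ~ vanish X h].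

(** N and N' only ensure that each map is undone by the other where they are nonzero; multiplying
    each by the pull-back of the other makes the two open sets correspond. *)
Lemma generic_birational C A B (X : subpts K A) (Y : subpts K B) q N q' N' : subring_pred C ->
  prime_set X -> prime_set Y -> is_form_tuple C q -> is_form_tuple C q' ->
  generic_form C X N -> generic_form C Y N' ->
  (forall x, X x -> peval N x != 0 -> Y (teval q x) /\ same_pt (teval q' (teval q x)) x) ->
  (forall y, Y y -> peval N' y != 0 -> X (teval q' y) /\ same_pt (teval q (teval q' y)) y) ->
  is_birational_map C X Y q (N * subst q N') q' (N' * subst q' N).
Proof.
move=> sC pX pY fq fq' [cN [dN hN] nN] [cN' [dN' hN'] nN'] F F'.
have [D hq] := form_tuple_degree fq; have [D' hq'] := form_tuple_degree fq'.
split=> //.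
- split.
  + by apply: coefsM => //; apply: coefs_subst => //; case: fq.
  + by eexists; apply: multihomogM hN (multihomog_subst hq hN').
  + apply: (pX _ _ _ _ hN (multihomog_subst hq hN')) => // v.
    have [y [Yy Ny]] := not_vanish nN'; have [Xq /(multihomog_same hN') E] := F' y Yy Ny.
    by have := v _ Xq; rewrite peval_subst => /eqP; rewrite -E (negPf Ny).
- split.
  + by apply: coefsM => //; apply: coefs_subst => //; case: fq'.
  + by eexists; apply: multihomogM hN' (multihomog_subst hq' hN).
  + apply: (pY _ _ _ _ hN' (multihomog_subst hq' hN)) => // v.
    have [x [Xx Nx]] := not_vanish nN; have [Yq /(multihomog_same hN) E] := F x Xx Nx.
    by have := v _ Yq; rewrite peval_subst => /eqP; rewrite -E (negPf Nx).
- move=> x Xx; rewrite pevalM peval_subst mulf_eq0 negb_or => /andP[Nx N'x].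
  have [Yq sq] := F x Xx Nx; split=> //.
  by rewrite pevalM peval_subst mulf_neq0 // -(multihomog_same hN sq).
- move=> y Yy; rewrite pevalM peval_subst mulf_eq0 negb_or => /andP[N'y Ny].
  have [Xq sq] := F' y Yy N'y; split=> //.
  by rewrite pevalM peval_subst mulf_neq0 // -(multihomog_same hN' sq).
Qed.
End Birational.
Arguments inl_tuple {K} B A.

(** * The birational map to P^n *)

Section MapToSpace.
Variables (K : closedFieldType) (n : nat).
Hypothesis n_ge5 : (5 <= n)%N.
Local Notation P1n := (P1n n).
Local Notation Q := (quadP1 n).
Local Notation P3 := (Pspace 4).
Local Notation PN := (Pspace n.+1).
Local Notation AB := (prodamb Q P3).
Implicit Types (w : pts K P1n) (i j k a b : 'I_n) (s : 'S_n) (x : pts K Q) (z : pts K AB) (y : pts K PN).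
Implicit Types (g h : bool -> bool -> K).

Variables (O : {set 'I_n}) (T : bool -> bool -> mpol K P1n)
  (kp : (bool -> bool -> K) -> ('I_n -> K) -> K) (D : mfac P1n -> nat) (w0 : pts K P1n).
Hypothesis tauP : tau_spec O T kp D w0.
Variables (a0 b0 c0 : 'I_n).
Hypotheses (ab : a0 != b0) (ac : a0 != c0) (bc : b0 != c0).

Definition mul2 g h : bool -> bool -> K := fun e c => g e false * h false c + g e true * h true c.
Definition adj2 g : bool -> bool -> K := fun e c => if e == c then g (~~ e) (~~ e) else - g e c.

Lemma lin_lin g t h t' w : lin g t (lin h t' w) = lin (mul2 g h) (fun k => t k * t' k) w.
Proof. by apply/funext => -[k e]; rewrite /lin /mul2 /=; ring. Qed.

Lemma det2M g h : det2 (mul2 g h) = det2 g * det2 h.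
Proof. by rewrite /det2 /mul2; ring. Qed.

Lemma det2_adj g : det2 (adj2 g) = det2 g.
Proof. by rewrite /det2 /adj2 /=; ring. Qed.

Definition Tw w : bool -> bool -> K := fun e c => peval (T e c) w.

Lemma Tw_lin g t w : Tw (lin g t w) = fun e c => kp g t * mul2 g (Tw w) e c.
Proof. by apply/funext => e; apply/funext => c; have [H _ _ _ _] := tauP; rewrite /Tw H. Qed.

(* Up to scalars, [normal w] depends on w only through the classes of its n points modulo GL_2. *)
Definition normal w : pts K P1n := lin (adj2 (Tw w)) (fun=> 1) w.

Lemma normal_lin g t w : normal (lin g t w) = @rescale K P1n (fun k => kp g t * det2 g * t k) (normal w).
Proof.
by apply/funext => -[k e]; rewrite /normal /rescale Tw_lin /lin /adj2 /mul2 /det2 /=; case: e => /=; ring.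
Qed.

(** The n points in the affine coordinate first / second, with denominators cleared by the product
    of all second coordinates, which is placed in coordinate 0. *)
Definition Y0 w : pts K PN := fun v : mvar PN =>
  if unlift (ord0 : 'I_n.+1) v is Some k then w (k, false) * \prod_(l | l != k) w (l, true) else \prod_l w (l, true).

Lemma Y0_rescale (r : 'I_n -> K) w : Y0 (@rescale K P1n r w) = fun v => (\prod_k r k) * Y0 w v.
Proof.
apply/funext => j; rewrite /Y0 /rescale /=; case: unlift => [k|]; last by rewrite -big_split.
by rewrite big_split /= [X in _ = X * _](bigD1 (k : 'I_n)) //=; ring.
Qed.

Definition mY : form_tuple K PN P1n := fun v => @var K PN (if v.2 then ord0 else fintype.lift ord0 v.1).

Lemma mYE y k (e : bool) : teval mY y (k, e) = y (if e then ord0 else fintype.lift ord0 k).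
Proof. by rewrite /teval pevalV. Qed.

Lemma mY_Y0 w : teval mY (Y0 w) = @rescale K P1n (fun k => \prod_(l | l != k) w (l, true)) w.
Proof.
apply/funext => -[k e]; rewrite mYE /Y0 /rescale /=; case: e; first by rewrite unlift_none (bigD1 k) //= mulrC.
by rewrite liftK mulrC.
Qed.

(** The coordinates of P^3 are the entries of a 2 x 2 matrix listed row by row. *)
Definition gx (e c : bool) : 'I_4 := inord (2 * e + c).
Definition row4 (v : 'I_4) : bool := (1 < v)%N.
Definition col4 (v : 'I_4) : bool := odd v.

Lemma gxK v : gx (row4 v) (col4 v) = v.
Proof. by apply: val_inj; rewrite /= /row4 /col4 inordK; case: v => [[|[|[|[|]]]]]. Qed.

Lemma row_gx e c : row4 (gx e c) = e.
Proof. by rewrite /row4 /gx inordK; case: e; case: c. Qed.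

Lemma col_gx e c : col4 (gx e c) = c.
Proof. by rewrite /col4 /gx inordK; case: e; case: c. Qed.

Definition gm z : bool -> bool -> K := fun e c => z (inr (gx e c)).

Definition normalp : form_tuple K P1n P1n := fun v =>
  if v.2 then - T true false * @var K P1n (v.1, false) + T false false * @var K P1n (v.1, true)
  else T true true * @var K P1n (v.1, false) - T false true * @var K P1n (v.1, true).

Lemma normalpE w : teval normalp w = normal w.
Proof.
apply/funext => -[k e]; rewrite /teval /normalp /normal /lin /adj2 /Tw /=.
by case: e; rewrite !pevalE /=; ring.
Qed.

Definition m0z : form_tuple K AB P1n := comp_tuple (m0p K a0 b0 c0) (inl_tuple P3 Q).

Lemma m0zE z : teval m0z z = m0 a0 b0 c0 (fun v => z (inl v)).
Proof. by rewrite teval_comp inl_tupleE m0E. Qed.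

(** This is g tau(m)^-1 m up to a scalar, the adjugate in [normal] replacing the inverse so as to
    have polynomials. *)
Definition config z : pts K P1n := lin (gm z) (fun=> 1) (normal (teval m0z z)).

Definition configp : form_tuple K AB P1n := fun v =>
  @var K AB (inr (gx v.2 false)) * subst m0z (normalp (v.1, false)) +
  @var K AB (inr (gx v.2 true)) * subst m0z (normalp (v.1, true)).

Lemma configpE z : teval configp z = config z.
Proof.
apply/funext => -[k e]; rewrite /teval /configp /config /lin /= mul1r !pevalE /gm !peval_subst -normalpE.
by [].
Qed.

Definition qA : form_tuple K AB PN := fun v : mvar PN =>
  if unlift (ord0 : 'I_n.+1) v is Some k then configp (k, false) * \prod_(l | l != k) configp (l, true)
  else \prod_l configp (l, true).

Lemma qAE z : teval qA z = Y0 (config z).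
Proof.
apply/funext => j; rewrite /teval /qA /Y0 -configpE.
by case: unlift => [k|]; rewrite ?pevalM peval_prod.
Qed.

Definition qB : form_tuple K PN AB := fun v =>
  match v with inl t => subst mY (crp K t) | inr i => subst mY (T (row4 i) (col4 i)) end.

Lemma qBE y : teval qB y = pair_pt (cr (teval mY y)) (fun v : mvar P3 => Tw (teval mY y) (row4 v) (col4 v)).
Proof.
by apply/funext => -[t|i]; rewrite /teval /qB /= peval_subst // crpE.
Qed.

Definition detp : mpol K P1n := T false false * T true true - T false true * T true false.

Lemma detpE w : peval detp w = det2 (Tw w).
Proof. by rewrite !pevalE. Qed.

Definition NA : mpol K AB :=
  subst m0z (discp K n * detp) *
  ((@var K AB (inr (gx false false)) * @var K AB (inr (gx true true)) -
    @var K AB (inr (gx false true)) * @var K AB (inr (gx true false))) * \prod_k configp (k, true)).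

Definition NB : mpol K PN := @var K PN ord0 * subst mY (discp K n * detp).

Lemma NA_neq0 z : (peval NA z != 0) = [&& peval (discp K n) (teval m0z z) != 0, det2 (Tw (teval m0z z)) != 0,
  det2 (gm z) != 0 & [forall k, config z (k, true) != 0]].
Proof.
rewrite /NA pevalM peval_subst (pevalM _ (discp K n)) detpE pevalM pevalB !(pevalM _ (var _ _)) !pevalV peval_prod.
rewrite !mulf_eq0 !negb_or -andbA -/(det2 (gm z)); congr [&& _, _, _ & _].
apply/prodf_neq0/forallP => H k; have := H k; rewrite -configpE //; exact.
Qed.

Lemma NB_neq0 y : (peval NB y != 0) = [&& y ord0 != 0, peval (discp K n) (teval mY y) != 0 & det2 (Tw (teval mY y)) != 0].
Proof. by rewrite /NB pevalM pevalV peval_subst (pevalM _ (discp K n)) detpE !mulf_eq0 !negb_or. Qed.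

Lemma kp_neq0 g t : det2 g != 0 -> (forall k, t k != 0) -> kp g t != 0.
Proof. by have [_ H _ _ _] := tauP; apply: H. Qed.

Lemma all_br_lin g t w : all_br w -> det2 g != 0 -> (forall k, t k != 0) -> all_br (lin g t w).
Proof. by move=> hw g0 t0 i j ij; rewrite br_lin !mulf_neq0 ?hw. Qed.

Lemma all_br_disc w : peval (discp K n) w != 0 <-> all_br w.
Proof. exact: discE. Qed.

Lemma cr_m0_same x : Mbar x -> all_br (m0 a0 b0 c0 x) -> same_pt x (cr (m0 a0 b0 c0 x)).
Proof.
move=> Mx hw; have [mu E] := cr_m0_rel ab ac bc Mx; exists mu; split=> // t.
have := cr_point hw (t, true); rewrite E /rescale /=; apply: contraNneq => ->.
by rewrite mul0r.
Qed.

Lemma mulTadj w : mul2 (adj2 (Tw w)) (Tw w) = fun e c => det2 (Tw w) * id2 K e c.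
Proof. by apply/funext => -[]; apply/funext => -[]; rewrite /mul2 /adj2 /det2 /id2 /=; ring. Qed.

(** By covariance tau(g adj(tau(m)) m) is a multiple of g adj(tau(m)) tau(m), that is of g; so tau
    recovers g, and the cross-ratios recover x. *)
Lemma forward z : Mbar (fun v => z (inl v)) -> peval NA z != 0 ->
  is_point (teval qA z) /\ same_pt (teval qB (teval qA z)) z.
Proof.
move=> Mz; rewrite NA_neq0 => /and4P[/all_br_disc hw dT dg /forallP V0].
set x := (fun v => z (inl v)) in Mz; set w := teval m0z z in hw dT.
rewrite qAE; split.
  by case; exists ord0; split=> //; rewrite /Y0 unlift_none; apply/prodf_neq0 => k _.
pose M := mul2 (gm z) (adj2 (Tw w)).
have VE : config z = lin M (fun=> 1) w.
  by rewrite /config /normal lin_lin; congr lin; apply/funext => k; rewrite mulr1.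
have dM : det2 M != 0 by rewrite det2M det2_adj mulf_neq0.
pose r k := \prod_(l | l != k) config z (l, true).
have r0 k : r k != 0 by apply/prodf_neq0 => l _.
have mE : teval mY (Y0 (config z)) = lin (@id2 K) r (config z) by rewrite mY_Y0 lin_id.
have d1 : det2 (@id2 K) != 0 by rewrite /det2 /id2 /= !mulr0 subr0 mulr1 oner_eq0.
rewrite qBE mE.
have TE : Tw (lin (@id2 K) r (config z)) = fun e c => (kp (@id2 K) r * kp M (fun=> 1) * det2 (Tw w)) * gm z e c.
  rewrite Tw_lin VE Tw_lin; apply/funext => e; apply/funext => c.
  have := mulTadj w => /(congr1 (fun f => f false c)) E0; have := mulTadj w => /(congr1 (fun f => f true c)) E1.
  transitivity (kp (@id2 K) r * kp M (fun=> 1) * (gm z e false * (mul2 (adj2 (Tw w)) (Tw w) false c) +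
     gm z e true * (mul2 (adj2 (Tw w)) (Tw w) true c))).
    by rewrite {1}/mul2 /M /id2 {1 2}/mul2; case: e => /=; rewrite /mul2; ring.
  by rewrite E0 E1 /id2; case: c {E0 E1} => /=; ring.
have sx : same_pt (cr (lin (@id2 K) r (config z))) x.
  rewrite VE lin_lin cr_lin; apply: same_pt_sym; apply: same_pt_trans (cr_m0_same Mz _) _.
    by rewrite -/w /w m0zE in hw *.
  rewrite -m0zE -/w; eexists; split; last by [].
  move=> t /=; have dd : det2 (mul2 (@id2 K) M) != 0 by rewrite det2M mulf_neq0.
  by rewrite !mulf_neq0 ?expf_neq0 ?r0 ?oner_eq0.
have [l [l0 xE]] := sx.
pose m := kp (@id2 K) r * kp M (fun=> 1) * det2 (Tw w).
have m0' : m != 0 by rewrite !mulf_neq0 ?kp_neq0 // => k; apply: oner_neq0.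
exists (fun v => match v with inl t => l t | inr _ => m^-1 end); split.
  by case=> [t|_]; rewrite ?invr_eq0.
apply/funext => -[t|i]; rewrite /rescale /pair_pt /=.
  by rewrite -[z (inl t)]/(x t) xE.
by rewrite TE -/m mulKf // /gm gxK.
Qed.

Lemma m0_cr_lin w : all_br w -> exists h t, [/\ det2 h != 0, forall k, t k != 0 & m0 a0 b0 c0 (cr w) = lin h t w].
Proof.
move=> hw; have N0 : N3 a0 b0 c0 w != 0 by rewrite !mulf_neq0 ?hw.
exists (gT a0 b0 c0 w), (tT a0 b0 c0 w); split; last exact: m0_cr.
  by rewrite gT_det oppr_eq0.
by move=> k; apply: tT_neq0.
Qed.

(** The matrix component of [teval qB y] is tau(m) for the configuration m of y. Normalising m to 0,
    1, oo changes it by GL_2 and scalings, which [normal] turns into scalars, and tau(m) adj(tau(m))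
    m is a multiple of m. *)
Lemma config_qB y : peval NB y != 0 -> exists r, (forall k, r k != 0) /\
  config (teval qB y) = @rescale K P1n r (teval mY y) /\ exists h t, [/\ det2 h != 0, forall k, t k != 0 &
    teval m0z (teval qB y) = lin h t (teval mY y)].
Proof.
rewrite NB_neq0 => /and3P[y0 /all_br_disc hw dT]; set w := teval mY y in hw dT *.
have [h [t [h0 t0 E]]] := m0_cr_lin hw.
have mE : teval m0z (teval qB y) = lin h t w by rewrite m0zE qBE.
exists (fun k => det2 (Tw w) * (kp h t * det2 h * t k)); split.
  by move=> k; rewrite !mulf_neq0 ?kp_neq0.
split; last by exists h, t.
have gE : gm (teval qB y) = Tw w.
  by apply/funext => e; apply/funext => c; rewrite /gm qBE /= row_gx col_gx.
rewrite /config mE gE normal_lin /normal; apply/funext => -[k e]; rewrite /lin /rescale /adj2 /det2 /=.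
by case: e => /=; ring.
Qed.

Lemma NA_qB y : peval NB y != 0 -> peval NA (teval qB y) != 0.
Proof.
move=> Ny; have [r [r0 [cE [h [t [h0 t0 mE]]]]]] := config_qB Ny.
move: Ny; rewrite NB_neq0 => /and3P[y0 /all_br_disc hw dT].
rewrite NA_neq0 mE cE; apply/and4P; split.
- by apply/all_br_disc; apply: all_br_lin.
- rewrite Tw_lin; have -> : det2 (fun e c => kp h t * mul2 h (Tw (teval mY y)) e c) =
    kp h t ^+ 2 * (det2 h * det2 (Tw (teval mY y))) by rewrite -det2M /det2; ring.
  by rewrite !mulf_neq0 ?expf_neq0 ?kp_neq0.
- rewrite (_ : gm _ = Tw (teval mY y)) //.
  by apply/funext => e; apply/funext => c; rewrite /gm qBE /= row_gx col_gx.
- by apply/forallP => k; rewrite /rescale /= mulf_neq0 // mYE.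
Qed.

Lemma backward y : peval NB y != 0 ->
  prodset (@Mbar n K) (@whole K 4) (teval qB y) /\ same_pt (teval qA (teval qB y)) y.
Proof.
move=> Ny; have [r [r0 [cE _]]] := config_qB Ny.
move: (Ny); rewrite NB_neq0 => /and3P[y0 /all_br_disc hw dT]; split.
  rewrite qBE; split; last first.
    case; apply: contrapT => H; case/eqP: dT; rewrite /det2.
    have Z e c : Tw (teval mY y) e c = 0.
      apply/eqP; apply: contraT => ne; case: H; exists (gx e c).
      by split=> //; rewrite /= row_gx col_gx.
    by rewrite !Z mul0r subrr.
  apply: cr_Mbar => t; exists (t, true); split=> //; exact: cr_point.
rewrite qAE cE Y0_rescale.
(* All second coordinates of [teval mY y] are [y ord0], so clearing denominators multiplies y by the
   (n - 1)-st power of it. *)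
apply: same_pt_sym; exists (fun=> (\prod_k r k) * y ord0 ^+ n.-1); split.
  by move=> _; rewrite mulf_neq0 ?expf_neq0 //; apply/prodf_neq0 => k _.
apply/funext => j; rewrite /rescale -mulrA; congr (_ * _).
have n0 : (0 < n)%N by apply: leq_trans n_ge5.
have pw k : \prod_(l | l != k) teval mY y (l, true) = y ord0 ^+ n.-1.
  under eq_bigr do rewrite mYE; rewrite prodr_const; congr (_ ^+ _).
  by rewrite (eq_card (B := predC1 k)) ?cardC1 ?card_ord.
rewrite /Y0; case: unliftP => [k|] -> ; first by rewrite mYE pw mulrC.
under eq_bigr do rewrite mYE; rewrite prodr_const card_ord -exprSr prednK //.
Qed.

Definition permY s y : pts K PN := fun v : mvar PN =>
  if unlift (ord0 : 'I_n.+1) v is Some k then y (fintype.lift ord0 (s^-1%g k)) else y ord0.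

Lemma Y0_relab s w : Y0 (relab s^-1%g w) = permY s (Y0 w).
Proof.
apply/funext => j; rewrite /permY {1}/Y0; case: (unlift ord0 j) => [k|].
  rewrite /Y0 liftK; congr (_ * _).
  rewrite [RHS](reindex_inj (@perm_inj _ s^-1%g)) /=; apply: eq_bigl => l.
  by rewrite (inj_eq perm_inj).
by rewrite /Y0 unlift_none [RHS](reindex_inj (@perm_inj _ s^-1%g)).
Qed.

Lemma m0_rescale mu x : (forall t, mu t != 0) -> exists r, (forall k, r k != 0) /\
  m0 a0 b0 c0 (@rescale K Q mu x) = @rescale K P1n r (m0 a0 b0 c0 x).
Proof.
move=> mu0; exists (fun k => if qd a0 b0 c0 k is Some t then mu t else 1); split.
  by move=> k; case: qd => // ; rewrite ?oner_eq0 // oner_neq0.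
by apply/funext => -[k e]; rewrite /m0 /rescale /=; case: qd => //; rewrite mul1r.
Qed.

(** The normalised configuration of s x and the relabelled one of x represent the same point, so
    they differ by GL_2 and scalings; [normal] turns these into scalars, and tau is not changed by
    the relabelling because s preserves O. *)
Lemma qA_equivariant s z z' : (forall i, (s i \in O) = (i \in O)) ->
  Mbar (fun v => z (inl v)) -> Mbar (fun v => z' (inl v)) ->
  peval NA z != 0 -> peval NA z' != 0 ->
  same_pt (Sn_act s (fun v => z (inl v))) (fun v => z' (inl v)) -> (forall v : mvar P3, z' (inr v) = z (inr v)) ->
  same_pt (permY s (teval qA z)) (teval qA z').
Proof.
move=> sO Mz Mz'; rewrite !NA_neq0 => /and4P[/all_br_disc hw dT dg _] /and4P[/all_br_disc hw' dT' _ _] sx gz.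
set w := teval m0z z in hw dT; set w' := teval m0z z' in hw' dT'.
have wE : w = m0 a0 b0 c0 (fun v => z (inl v)) by rewrite /w m0zE.
have w'E : w' = m0 a0 b0 c0 (fun v => z' (inl v)) by rewrite /w' m0zE.
have hr : all_br (relab s^-1%g w) by move=> i j ij; apply: hw; rewrite (inj_eq perm_inj).
have sc : same_pt (cr (relab s^-1%g w)) (cr w').
  have s1 : same_pt (cr w') (fun v => z' (inl v)).
    by apply: same_pt_sym; rewrite w'E; apply: cr_m0_same => //; rewrite -w'E.
  have s2 : same_pt (fun v => z (inl v)) (cr w) by rewrite wE; apply: cr_m0_same => //; rewrite -wE.
  apply: same_pt_trans (same_pt_sym s1); apply: same_pt_trans sx.
  rewrite cr_relab; apply: same_pt_sym; have [l [l0 lE]] := s2.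
  exists (fun t => l (quad_perm s^-1%g t)); split=> //.
  by rewrite lE Sn_act_rescale invgK.
have [mu [mu0 muE]] := sc.
have [h [t [h0 t0 hE]]] := m0_cr_lin hr; have [h' [t' [h0' t0' hE']]] := m0_cr_lin hw'.
have [r [r0 rE]] := m0_rescale (cr (relab s^-1%g w)) mu0.
have w'rel : w' = lin (mul2 (inv2 h') h) (fun k => (t' k)^-1 * (r k * t k)) (relab s^-1%g w).
  have E : lin h' t' w' = lin h (fun k => r k * t k) (relab s^-1%g w).
    rewrite -hE' muE rE hE; apply/funext => -[k e]; rewrite /rescale /lin /=; ring.
  by rewrite -[LHS](lin_inv w' h0' t0') E lin_lin.
rewrite !qAE; have -> : config z' = @rescale K P1n (fun k => kp (mul2 (inv2 h') h) (fun k => (t' k)^-1 * (r k * t k)) *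
    det2 (mul2 (inv2 h') h) * ((t' k)^-1 * (r k * t k))) (relab s^-1%g (config z)).
  have gE : gm z' = gm z by apply/funext => e; apply/funext => c; rewrite /gm gz.
  rewrite /config -/w -/w' gE {1}w'rel normal_lin.
  have -> : normal (relab s^-1%g w) = relab s^-1%g (normal w).
    have TE : Tw (relab s^-1%g w) = Tw w.
      have [_ _ H _ _] := tauP; apply/funext => e; apply/funext => c; rewrite /Tw H // => i.
      by rewrite -{2}(permKV s i) sO.
    by rewrite /normal TE.
  by apply/funext => -[k e]; rewrite /lin /rescale /relab /=; ring.
rewrite Y0_rescale Y0_relab; eexists (fun=> _); split; last by [].
move=> _; apply/prodf_neq0 => k _.
have dd : det2 (mul2 (inv2 h') h) != 0 by rewrite det2M mulf_neq0 ?det2_inv.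
have tt l : (t' l)^-1 * (r l * t l) != 0 by rewrite !mulf_neq0 ?invr_eq0.
by rewrite !mulf_neq0 ?kp_neq0 ?invr_eq0.
Qed.
End MapToSpace.

(** * Degrees, coefficients and genericity of the map *)

Section MapAForms.
Variables (K : closedFieldType) (n : nat).
Hypothesis n_ge5 : (5 <= n)%N.
Local Notation P1n := (P1n n).
Local Notation Q := (quadP1 n).
Local Notation P3 := (Pspace 4).
Local Notation PN := (Pspace n.+1).
Local Notation AB := (prodamb Q P3).
Variables (O : {set 'I_n}) (T : bool -> bool -> mpol K P1n)
  (kp : (bool -> bool -> K) -> ('I_n -> K) -> K) (D : mfac P1n -> nat) (w0 : pts K P1n).
Hypothesis tauP : tau_spec O T kp D w0.
Variables (a0 b0 c0 : 'I_n).
Hypotheses (ab : a0 != b0) (ac : a0 != c0) (bc : b0 != c0).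
Variable C : K -> Prop.
Hypothesis sC : subring_pred C.
Local Notation qA := (qA T a0 b0 c0).
Local Notation qB := (qB T).
Local Notation NA := (NA T a0 b0 c0).
Local Notation NB := (NB T).

Let TC e c : coefs_in C (T e c).
Proof. by have [_ _ _ [_ H] _] := tauP; apply: H. Qed.
Let TD e c : multihomog D (T e c).
Proof. by have [_ _ _ [H _] _] := tauP. Qed.

Lemma m0p_form : is_form_tuple C (m0p K a0 b0 c0).
Proof.
split=> [v|k]; first rewrite /m0p.
  case: qd => [t|]; first exact: coefs_var.
  apply: coefs_cst => //; have c1 := subring1 sC; have c2 := subring0 sC.
  by rewrite /m00; case: ifP => _; [|case: ifP => _ //]; case: (v.2).
case E: (qd a0 b0 c0 k) => [t|].
  by exists (fun u : mfac Q => (u == t) : nat) => v vk; rewrite /m0p -[v.1]/(blk v) vk E; apply: (@multihomog_var K Q (t, v.2)).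
by exists (fun=> 0%N) => v vk; rewrite /m0p -[v.1]/(blk v) vk E; apply: multihomog_cst.
Qed.

Lemma m0z_form : is_form_tuple C (m0z K a0 b0 c0).
Proof. by apply: is_form_comp => //; [exact: m0p_form|exact: inl_tuple_form]. Qed.

Lemma normalp_homog v : multihomog (fun k : mfac P1n => D k + (k == v.1))%N (normalp T v).
Proof.
rewrite /normalp; case: (v.2).
  rewrite mulNr addrC; apply: multihomogB; apply: multihomogM => //; exact: (@multihomog_var K P1n (v.1, _)).
by apply: multihomogB; apply: multihomogM => //; exact: (@multihomog_var K P1n (v.1, _)).
Qed.

Lemma normalp_coefs v : coefs_in C (normalp T v).
Proof.
have cv u : coefs_in C (@var K P1n u) by apply: coefs_var.
rewrite /normalp; case: (v.2).
  by rewrite mulNr addrC; apply: coefsB => //; apply: coefsM.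
by apply: coefsB => //; apply: coefsM.
Qed.

Lemma configp_homog : exists E : 'I_n -> mfac AB -> nat, forall v, multihomog (E v.1) (configp T a0 b0 c0 v).
Proof.
have [Dz hz] := form_tuple_degree m0z_form.
exists (fun k i => (i == inr tt) + \sum_j (D j + (j == k)) * Dz j i)%N => v.
rewrite /configp; apply: multihomogD; apply: multihomogM; try exact: (@multihomog_var K AB (inr _)).
  exact: (multihomog_subst hz (normalp_homog (v.1, false))).
exact: (multihomog_subst hz (normalp_homog (v.1, true))).
Qed.

Lemma configp_coefs v : coefs_in C (configp T a0 b0 c0 v).
Proof.
have [cz _] := m0z_form.
apply: coefsD => //; apply: coefsM => //; try exact: coefs_var.
  by apply: coefs_subst => //; apply: normalp_coefs.
by apply: coefs_subst => //; apply: normalp_coefs.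
Qed.

Lemma qA_form : is_form_tuple C qA.
Proof.
split=> [v|].
  rewrite /qA; case: unlift => [k|]; last by apply: coefs_prod => // l _; apply: configp_coefs.
  by apply: coefsM => //; [|apply: coefs_prod => // l _]; apply: configp_coefs.
case; have [E hE] := configp_homog; exists (fun i => \sum_k E k i)%N => v _.
rewrite /qA; case: unlift => [k|]; last first.
  by apply: multihomog_prod => l _; apply: hE.
have h : multihomog (fun i => E k i + \sum_(l <- [seq l <- index_enum 'I_n | l != k]) E l i)%N
    (configp T a0 b0 c0 (k, false) * \prod_(l <- [seq l <- index_enum 'I_n | l != k]) configp T a0 b0 c0 (l, true)).
  by apply: multihomogM; [exact: (hE (k, false))|apply: multihomog_prod => l _; exact: (hE (l, true))].
rewrite -big_filter; apply: multihomog_ext h => i.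
by rewrite big_filter [RHS](bigD1 (k : 'I_n)).
Qed.

Lemma mY_homog v : multihomog (fun=> 1%N) (@mY K n v).
Proof. by apply: multihomog_ext (@multihomog_var K PN _) => -[]. Qed.

Lemma mY_coefs v : coefs_in C (@mY K n v).
Proof. exact: coefs_var. Qed.

Lemma crp_coefs v : coefs_in C (@crp K n v).
Proof.
have cb a b : coefs_in C (brp K a b).
  by apply: coefsB => //; apply: coefsM => //; apply: coefs_var.
by rewrite /crp; case: (v.2); apply: coefsM.
Qed.

Lemma discp_coefs : coefs_in C (discp K n).
Proof.
by apply: coefs_prod => // u _; apply: coefsB => //; apply: coefsM => //; apply: coefs_var.
Qed.

Lemma qB_form : is_form_tuple C qB.
Proof.
split=> [[v|v]|[t|[]]].
- by apply: coefs_subst => //; [exact: mY_coefs|exact: crp_coefs].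
- by apply: coefs_subst => //; exact: mY_coefs.
- exists (fun i => \sum_j dq t j * 1)%N => -[[t' e] /= [<-]|v //].
  exact: (multihomog_subst (D := fun _ _ => 1%N) mY_homog (@crp_homog K n t' e)).
- exists (fun i => \sum_j D j * 1)%N => -[//|v _] /=.
  exact: (multihomog_subst (D := fun _ _ => 1%N) mY_homog (TD _ _)).
Qed.

Lemma detp_form : coefs_in C (detp T) /\ multihomog (fun k => D k + D k)%N (detp T).
Proof.
split; first by apply: coefsB => //; apply: coefsM.
by apply: multihomogB; apply: multihomogM.
Qed.

Lemma discp_homog : exists d : mfac P1n -> nat, multihomog d (discp K n).
Proof.
rewrite /discp -big_filter; eexists; apply: (@multihomog_prod K P1n _ _ (fun u => deg2 u.1 u.2)) => u _.
exact: brp_multihomog.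
Qed.

Lemma discdet_form : coefs_in C (discp K n * detp T) /\ exists d : mfac P1n -> nat, multihomog d (discp K n * detp T).
Proof.
have [cd hd] := detp_form; have [d hdisc] := discp_homog.
split; first by apply: coefsM => //; apply: discp_coefs.
by eexists; apply: multihomogM hdisc hd.
Qed.

Lemma good_y : exists y : pts K PN, peval NB y != 0.
Proof.
have det0 : detp T != 0.
  by have [_ _ _ _ [_ _]] := tauP; apply: contraNneq => E; rewrite -[det2 _]/(det2 (Tw T w0)) -detpE E peval0.
have v0 : \prod_k @var K P1n (k, true) != 0.
  apply/prodf_neq0 => k _; apply/eqP => /(congr1 (fun P => peval P (fun=> 1)))/eqP.
  by rewrite pevalV peval0 oner_eq0.
have [w] := peval_nonroot (mulf_neq0 (mulf_neq0 (discp_neq0 K n) det0) v0).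
rewrite pevalM mulf_eq0 negb_or pevalM mulf_eq0 negb_or detpE peval_prod => /andP[/andP[dw Dw] /prodf_neq0 nz].
have wt k : w (k, true) != 0 by have := nz k isT; rewrite pevalV.
pose y : pts K PN := fun v : mvar PN => if unlift (ord0 : 'I_n.+1) v is Some k then w (k, false) / w (k, true) else 1.
have mE : teval (@mY K n) y = lin (@id2 K) (fun k => (w (k, true))^-1) w.
  apply/funext => -[k e]; rewrite lin_id mYE /y /rescale /=.
  by case: e; rewrite ?unlift_none ?liftK ?mulVf // mulrC.
exists y; rewrite NB_neq0 mE; apply/and3P; split.
- by rewrite /y unlift_none oner_eq0.
- apply/all_br_disc => i j ij; rewrite br_lin !mulf_neq0 ?invr_eq0 //.
    by rewrite /det2 /id2 /= !mulr0 subr0 mulr1 oner_eq0.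
  by move/all_br_disc: dw; apply.
- have d1 : det2 (@id2 K) != 0 by rewrite /det2 /id2 /= !mulr0 subr0 mulr1 oner_eq0.
  rewrite (Tw_lin tauP); set m := kp _ _; have m0' : m != 0.
    by apply: (kp_neq0 tauP) => // k; rewrite invr_eq0.
  have -> : det2 (fun e c => m * mul2 (@id2 K) (Tw T w) e c) = m ^+ 2 * (det2 (@id2 K) * det2 (Tw T w)).
    by rewrite -det2M /det2; ring.
  by rewrite !mulf_neq0 ?expf_neq0.
Qed.

Lemma NB_generic : generic_form C (@whole K n.+1) NB.
Proof.
have [cd [d hd]] := discdet_form; split.
- by apply: coefsM => //; [exact: coefs_var|apply: coefs_subst => //; exact: mY_coefs].
- by eexists; apply: (multihomogM (@multihomog_var K PN _) (multihomog_subst (D := fun _ _ => 1%N) mY_homog hd)).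
- have [y Ny] := good_y; move=> v; move: (Ny); rewrite v ?eqxx //.
  by case; exists ord0; split=> //; move: Ny; rewrite NB_neq0 => /and3P[].
Qed.

Lemma NA_generic : generic_form C (prodset (@Mbar n K) (@whole K 4)) NA.
Proof.
have [cd [d hd]] := discdet_form; have [E hE] := configp_homog; split.
- apply: coefsM => //; first by apply: coefs_subst => //; case: m0z_form.
  have cv (u : mvar AB) : coefs_in C (@var K AB u) by apply: coefs_var.
  apply: coefsM => //; first by apply: coefsB => //; apply: coefsM.
  by apply: coefs_prod => // k _; apply: configp_coefs.
- have [Dz hz] := form_tuple_degree m0z_form.
  have hv (u : 'I_4) : multihomog (fun i : mfac AB => (i == inr tt) : nat) (@var K AB (inr u)).
    exact: (@multihomog_var K AB (inr u)).
  eexists; apply: multihomogM; first exact: (multihomog_subst hz hd).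
  apply: multihomogM; first by apply: multihomogB; apply: multihomogM.
  by apply: multihomog_prod => k _; apply: hE.
- have [y Ny] := good_y; move=> v.
  have := NA_qB tauP ab ac bc Ny; have [Xy _] := backward n_ge5 tauP ab ac bc Ny.
  by rewrite (v _ Xy) eqxx.
Qed.

Lemma Mbar_irreducible : irreducible_set (@Mbar n K).
Proof.
apply: vanish_prime_irreducible; last first.
- by move=> d e p q _ _ /vanish_M0n/eqP; rewrite pullM mulf_eq0 => /orP[]/eqP p0; [left|right]; apply/vanish_M0n.
- by move=> x; apply: M0n_point.
- have [w [hw _]] := free_point K n_ge5; exists (cr w); exists (fun i => w (i, false)), (fun i => w (i, true)).
  by split=> [i j /hw|]; last by apply/funext => -[t e].
Qed.

Lemma mapA_birational : is_birational_map C (prodset (@Mbar n K) (@whole K 4)) (@whole K n.+1)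
  qA (NA * subst qA NB) qB (NB * subst qB NA).
Proof.
apply: generic_birational => //.
- by apply: prime_prod; apply: irreducible_prime; [exact: Mbar_irreducible|move=> x; apply: Mbar_point].
- exact: prime_whole.
- exact: qA_form.
- exact: qB_form.
- exact: NA_generic.
- exact: NB_generic.
- by move=> z [Mz _] Nz; have := forward tauP ab ac bc Mz Nz.
- by move=> y _ Ny; apply: (backward n_ge5 tauP ab ac bc Ny).
Qed.
End MapAForms.

(** * Stable linearizability *)

Section PartA.
Variables (K : closedFieldType) (n : nat).
Hypothesis n_ge5 : (5 <= n)%N.

Lemma three_labels : exists a b c : 'I_n, [/\ a != b, a != c & b != c].
Proof.
have [i _] := @fresh n [::] (leq_trans (isT : 0 < 5)%N n_ge5).
have [j] := @fresh n [:: i] (leq_trans (isT : 1 < 5)%N n_ge5); rewrite inE eq_sym => ij.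
have [k] := @fresh n [:: i; j] (leq_trans (isT : 2 < 5)%N n_ge5).
by rewrite !inE negb_or ![k == _]eq_sym => /andP[ik jk]; exists i, j, k.
Qed.

(** The permutation representation with a trivial line added for coordinate 0. *)
Lemma perm_mx_repr (G : {group 'S_n}) :
  mx_repr G (fun g : 'S_n => @perm_mx K n.+1 (lift_perm ord0 ord0 g)).
Proof.
split=> [|g h _ _]; first by rewrite lift_perm1 perm_mx1.
by rewrite -perm_mxM lift_permM.
Qed.

Lemma rep_permY (G : {group 'S_n}) (g : 'S_n) (y : pts K (Pspace n.+1)) :
  rep_act (MxRepresentation (perm_mx_repr G)) g y = permY g y.
Proof.
apply/funext => j; rewrite /rep_act /= -[lift_perm _ _ _]invgK -col_permE !mxE lift_permV /permY.
by case: unliftP => [k ->|->]; rewrite ?lift_perm_lift ?lift_perm_id.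
Qed.

Lemma odd_linearizable (G : {group 'S_n}) (O : {set 'I_n}) : odd #|O| ->
  (forall g, g \in G -> forall i, (g i \in O) = (i \in O)) ->
  stably_linearizable G (@Mbar n K) (@Sn_act n K).
Proof.
move=> oO GO; have [T [kp [D [w0 tauP]]]] := tau_exists K n_ge5 oO.
have [a [b [c [ab ac bc]]]] := three_labels.
have sC : subring_pred (fun _ : K => True) by [].
(* [Pspace d] has d homogeneous coordinates: 3 stands for P^3, whose 4 coordinates are the entries
   of a matrix. *)
exists 3, n.+1, (MxRepresentation (perm_mx_repr G)); do 4 eexists.
split; first exact: (mapA_birational n_ge5 tauP ab ac bc sC).
move=> g z gG [Mz wz]; rewrite pevalM mulf_eq0 negb_or => /andP[Nz _].
rewrite pevalM mulf_eq0 negb_or => /andP[Nz' _].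
rewrite rep_permY; apply: same_pt_sym; apply: (qA_equivariant tauP ab ac bc (GO g gG)) Nz Nz' _ _ => //.
  exact: (Sn_act_Mbar g Mz).
exact: (same_ptxx (Sn_act g (fun v => z (inl v)))).
Qed.
End PartA.

(** * Automorphisms of an algebraic closure *)

Section PolyOver.
Variables (R : comNzRingType) (C : R -> Prop).
Hypothesis sC : subring_pred C.

Definition coef_pred (p : {poly R}) := forall i, C p`_i.

Lemma coef_predC a : C a -> coef_pred a%:P.
Proof. by move=> Ca i; rewrite coefC; case: ifP => // _; apply: subring0. Qed.

Lemma coef_predX : coef_pred 'X.
Proof. by move=> i; rewrite coefX; case: eqP => _; [apply: subring1|apply: subring0]. Qed.

Lemma coef_predB p q : coef_pred p -> coef_pred q -> coef_pred (p - q).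
Proof. by move=> hp hq i; rewrite coefB; have [_ CB _] := sC; apply: CB. Qed.

Lemma coef_predM p q : coef_pred p -> coef_pred q -> coef_pred (p * q).
Proof. by move=> hp hq i; rewrite coefM; apply: subring_sum => // j _; apply: subringM. Qed.

Lemma coef_pred1 : coef_pred 1.
Proof. by apply: coef_predC; apply: subring1. Qed.

Lemma subring_horner p z : coef_pred p -> C z -> C p.[z].
Proof.
move=> hp Cz; rewrite horner_coef; apply: subring_sum => // i _.
by apply: subringM => //; apply: subringX.
Qed.

(** Over an arbitrary commutative ring because it is also applied to K * K, whose elements are pairs
    of an element and its image. *)
Lemma monic_division f p : coef_pred f -> f \is monic -> coef_pred p ->
  exists u r, [/\ coef_pred u, coef_pred r, p = u * f + r & (size r < size f)%N].
Proof.
move=> hf mf; have f0 : (0 < size f)%N by rewrite size_poly_gt0 monic_neq0.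
elim/ltn_ind: {p}(size p) {-2}p (leqnn (size p)) => m IH p sp hp.
have [lt|ge] := ltnP (size p) (size f).
  by exists 0, p; rewrite mul0r add0r; split=> // i; rewrite coef0; apply: subring0.
pose w := (lead_coef p)%:P * 'X^(size p - size f).
have hw : coef_pred w.
  apply: coef_predM; first exact/coef_predC/hp.
  by elim: (_ - _)%N => [|k]; rewrite ?expr0 ?exprS; [exact: coef_pred1|apply: coef_predM coef_predX].
have p0 : (0 < size p)%N by apply: leq_trans ge.
have lt : (size (p - w * f)%R < size p)%N.
  rewrite -[X in (_ < X)%N](prednK p0) ltnS; apply/leq_sizeP => j; rewrite leq_eqVlt coefB /w -mulrA coefCM mulrC.
  rewrite coefXnM; case/predU1P => [<-|lj].
    have lej : (size p - size f <= (size p).-1)%N by lia.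
    rewrite ltnNge lej /= (_ : ((size p).-1 - (size p - size f))%N = (size f).-1); last by lia.
    by rewrite -/(lead_coef f) -/(lead_coef p) (monicP mf) mul1r subrr.
  have pj : (size p <= j)%N by rewrite -(prednK p0).
  rewrite [p`_j]nth_default //.
  case: ifP => [|H]; first by rewrite mul0r subr0.
  have fj : (size f <= j - (size p - size f))%N by rewrite leq_subRL ?subnK // leqNgt H.
  by rewrite [f`_ _]nth_default ?mul0r ?subr0.
have [|u [r [hu hr E sr]]] := IH _ (leq_trans lt sp) (p - w * f) (leqnn _).
  by apply: coef_predB => //; apply: coef_predM.
exists (w + u), r; split=> //.
  by move=> i; rewrite coefD; apply: subringD.
by rewrite mulrDl -addrA -E addrC subrK.
Qed.
End PolyOver.

Section Automorphisms.
Variables (F : fieldType) (K : closedFieldType) (iota : {rmorphism F -> K}).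
Hypothesis alg : is_algebraic_closure iota.
Implicit Types (C : K -> Prop) (R : K * K -> Prop) (x y a : K).

Lemma root_inverse (g : {poly F}) a : g != 0 -> root (map_poly iota g) a -> a != 0 ->
  exists k : {poly F}, a * (map_poly iota k).[a] = 1.
Proof.
move=> g0 ga a0; elim/poly_ind: g g0 ga => [|g c IH]; first by rewrite eqxx.
rewrite rmorphD rmorphM /= map_polyX map_polyC /root hornerMXaddC => g0 ga.
have [c0|c0] := eqVneq c 0.
  have ic : iota c = 0 by rewrite c0 rmorph0.
  have {}ga : (map_poly iota g).[a] * a + 0 == 0 by have E : (map_poly iota g).[a] * a + iota c == 0 by []; rewrite ic in E.
  move: ga; rewrite addr0 mulf_eq0 (negPf a0) orbF => ga; apply: IH => //.
  by apply: contraNneq g0 => ->; rewrite c0 mul0r polyC0 addr0.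
exists (- c^-1 *: g); rewrite map_polyZ hornerZ rmorphN fmorphV.
move: ga; rewrite addr_eq0 => /eqP E; rewrite mulrCA [a * _]mulrC E mulrNN mulVf // fmorph_eq0 //.
Qed.

Lemma inverse_poly a : a != 0 -> exists k : {poly F}, a * (map_poly iota k).[a] = 1.
Proof. by move=> a0; have [g g0 ga] := alg a; apply: root_inverse ga a0. Qed.

Definition subfield_pred C := subring_pred C /\ forall b, C (iota b).

Lemma coef_map_base C (k : {poly F}) : subfield_pred C -> coef_pred C (map_poly iota k).
Proof. by move=> [_ CF] i; rewrite coef_map; apply: CF. Qed.

Lemma subfieldV C a : subfield_pred C -> C a -> C a^-1.
Proof.
move=> sC Ca; have [->|a0] := eqVneq a 0; first by rewrite invr0; apply: subring0; case: sC.
have [k ak] := inverse_poly a0.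
suff -> : a^-1 = (map_poly iota k).[a] by apply: subring_horner Ca; [case: sC|apply: coef_map_base].
by apply: (mulfI a0); rewrite ak divff.
Qed.

(* The graph of an isomorphism of subfields of K over F: as K is algebraic over F, closure
   under inverses and injectivity follow. *)
Definition partial_iso R := [/\ subring_pred R, forall b, R (iota b, iota b) & forall b, R (0, b) -> b = 0].

Definition dg (p : {poly K}) : {poly K * K} := \poly_(i < size p) (p`_i, p`_i).

Lemma coef_dg p i : (dg p)`_i = (p`_i, p`_i).
Proof. by rewrite coef_poly; case: ltnP => // H; rewrite nth_default. Qed.

Lemma horner_pair (P : {poly K * K}) z : P.[z] = ((map_poly fst P).[z.1], (map_poly snd P).[z.2]).
Proof. by rewrite !horner_map -surjective_pairing. Qed.

Lemma horner_dg p z : (dg p).[z] = (p.[z.1], p.[z.2]).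
Proof.
rewrite horner_pair; congr pair; congr (_.[_]); apply/polyP => i; by rewrite coef_map coef_dg.
Qed.

Lemma dg_base R (k : {poly F}) : partial_iso R -> coef_pred R (dg (map_poly iota k)).
Proof. by move=> [_ RF _] i; rewrite coef_dg coef_map; apply: RF. Qed.

(** The inverse of [u.1] is a polynomial in [u.1] over F; the same polynomial at [u.2] gives the
    inverse of [u.2], because a pair in R with first component 0 is 0. *)
Lemma partial_isoV R u : partial_iso R -> R u -> u.1 != 0 -> R (u.1^-1, u.2^-1) /\ u.2 != 0.
Proof.
move=> pR Ru u0; have [sR RF R0] := pR; have [k uk] := inverse_poly u0.
pose v := (dg (map_poly iota k)).[u].
have Rv : R v by apply: subring_horner => //; apply: dg_base.
have v1 : u.1 * v.1 = 1 by rewrite /v horner_dg.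
have v2 : u.2 * v.2 = 1.
  apply/eqP; rewrite -subr_eq0; apply/eqP/R0.
  have [R1 RB RM] := sR; have := RB _ _ (RM _ _ Ru Rv) R1.
  by rewrite (_ : u * v - 1 = (u.1 * v.1 - 1, u.2 * v.2 - 1)) // v1 subrr.
have u2 : u.2 != 0 by apply: contra_eq_neq v2 => ->; rewrite mul0r eq_sym oner_eq0.
clearbody v; split=> //.
have -> : u.1^-1 = v.1 by apply: (mulfI u0); rewrite v1 divff.
have -> : u.2^-1 = v.2 by apply: (mulfI u2); rewrite v2 divff.
by rewrite -surjective_pairing.
Qed.

(** The minimal polynomial of x over the domain of R, each coefficient being paired with its
    image. *)
Definition min_pair R x (f : {poly K * K}) := [/\ coef_pred R f, f \is monic, (map_poly fst f).[x] = 0 &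
  forall g, coef_pred R g -> g \is monic -> (map_poly fst g).[x] = 0 -> (size f <= size g)%N].

Lemma min_pair_ex R x : partial_iso R -> exists f, min_pair R x f.
Proof.
move=> pR; pose P m := `[< exists f, [/\ coef_pred R f, f \is monic, (map_poly fst f).[x] = 0 & size f = m] >].
have exP : exists m, P m.
  have [g g0 gx] := alg x; pose f := dg (map_poly iota ((lead_coef g)^-1 *: g)).
  exists (size f); apply/asboolP; exists f; split=> //; first exact: dg_base.
    have mg : map_poly iota ((lead_coef g)^-1 *: g) \is monic.
      by rewrite map_monic monicE lead_coefZ mulVf // lead_coef_eq0.
    have sf : size f = size (map_poly iota ((lead_coef g)^-1 *: g)).
      by rewrite /f /dg size_poly_eq // -lead_coefE (monicP mg); apply: oner_neq0.
    by rewrite monicE lead_coefE sf coef_dg -lead_coefE (monicP mg).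
  have := congr1 fst (horner_pair f (x, x)); rewrite /= => <-; rewrite horner_dg /= map_polyZ hornerZ.
  by move: gx => /eqP ->; rewrite mulr0.
have := ex_minnP exP => -[m /asboolP[f [hf mf fx <-]] mmin]; exists f; split=> // g hg mg gx.
by apply: mmin; apply/asboolP; exists g.
Qed.

Lemma min_pair_kill R x f g : partial_iso R -> min_pair R x f -> coef_pred R g -> (size g < size f)%N ->
  (map_poly fst g).[x] = 0 -> g = 0.
Proof.
move=> pR [hf mf fx fmin] hg sg gx; have [sR RF R0] := pR; apply: contraTeq sg => g0; rewrite -leqNgt.
have Rl : R (lead_coef g) by apply: hg.
have l0 : (lead_coef g).1 != 0.
  apply: contraNneq g0 => l1; rewrite -lead_coef_eq0; have := Rl; rewrite [lead_coef g]surjective_pairing l1.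
  by move/R0 => ->.
have [Ri l2] := partial_isoV pR Rl l0; set v := (_, _) in Ri.
have vl : v * lead_coef g = 1 by apply/pair_eqP; rewrite /= !mulVf // !eqxx.
have sz : size (v *: g) = size g.
  have gp : (0 < size g)%N by rewrite size_poly_gt0.
  apply/eqP; rewrite eqn_leq size_scale_leq leqNgt; apply/negP => lt.
  have /leq_sizeP/(_ _ (leqnn _)) : (size (v *: g)%R <= (size g).-1)%N by rewrite -ltnS prednK.
  by rewrite coefZ -lead_coefE vl => /eqP; rewrite oner_eq0.
rewrite -sz; apply: fmin.
- by move=> i; rewrite coefZ; apply: subringM.
- by rewrite monicE lead_coefE sz coefZ -lead_coefE vl.
- by rewrite map_polyZ hornerZ gx mulr0.
Qed.

Definition adjoin1 (S : comNzRingType) (C : S -> Prop) (z w : S) := exists p, coef_pred C p /\ w = p.[z].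

Lemma adjoin1_subring (S : comNzRingType) (C : S -> Prop) z : subring_pred C -> subring_pred (adjoin1 C z).
Proof.
move=> sC; split.
- by exists 1; rewrite hornerC; split=> //; apply: coef_pred1.
- move=> _ _ [p [hp ->]] [q [hq ->]]; exists (p - q); rewrite hornerD hornerN; split=> //; exact: coef_predB.
- move=> _ _ [p [hp ->]] [q [hq ->]]; exists (p * q); rewrite hornerM; split=> //; exact: coef_predM.
Qed.

Lemma adjoin1_sub (S : comNzRingType) (C : S -> Prop) z w : subring_pred C -> C w -> adjoin1 C z w.
Proof. by move=> sC Cw; exists w%:P; rewrite hornerC; split=> //; apply: coef_predC. Qed.

Lemma adjoin1_id (S : comNzRingType) (C : S -> Prop) z : subring_pred C -> adjoin1 C z z.
Proof. by move=> sC; exists 'X; rewrite hornerX; split=> //; apply: coef_predX. Qed.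

(** A value p(x, y) with first component 0 is also the value of the remainder of p modulo f; that
    remainder has smaller degree and its first component kills x, so it is 0 and the second
    component of the value vanishes too. *)
Lemma partial_iso_adjoin R x y f : partial_iso R -> min_pair R x f -> (map_poly snd f).[y] = 0 ->
  partial_iso (adjoin1 R (x, y)).
Proof.
move=> pR mf fy; have [sR RF R0] := pR; split; first exact: adjoin1_subring.
  by move=> b; apply: adjoin1_sub.
move=> b [p [hp E]]; have [hf mon fx _] := mf.
have [u [r [hu hr pE sr]]] := monic_division sR hf mon hp.
have f0 : f.[(x, y)] = 0 by rewrite horner_pair /= fx fy.
have E' : r.[(x, y)] = (0, b) by rewrite E pE hornerD hornerM f0 mulr0 add0r.
have r0 : r = 0.
  by apply: min_pair_kill pR mf hr sr _; have := congr1 fst E'; rewrite horner_pair.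
by move: E'; rewrite r0 horner0 => -[].
Qed.

Definition swap_graph R : K * K -> Prop := fun u => R (u.2, u.1).

Lemma partial_iso_swap R : partial_iso R -> partial_iso (swap_graph R).
Proof.
move=> pR; have [sR RF R0] := pR; have [R1 RB RM] := sR; split=> //.
  by split=> // u v Ru Rv; [apply: (RB _ _ Ru Rv)|apply: (RM _ _ Ru Rv)].
move=> b Rb; apply/eqP; apply: contraT => b0.
by have [_] := partial_isoV pR Rb b0; rewrite eqxx.
Qed.

Lemma partial_iso_total R : partial_iso R -> (forall R', partial_iso R' -> (forall u, R u -> R' u) -> forall u, R' u -> R u) ->
  forall x, exists y, R (x, y).
Proof.
move=> pR Rmax x; have [f mf] := min_pair_ex x pR; have [sR RF R0] := pR; have [hf mon fx _] := mf.
have ms : map_poly snd f \is monic by rewrite monic_map.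
have [y /eqP fy] : exists y, root (map_poly snd f) y.
  apply/closed_rootP; apply/eqP => s1.
  have f1 : f = 1.
    have : size f = 1%N by rewrite -(size_map_poly_id0 (f := snd)) // (monicP mon) oner_neq0.
    by move/eqP/size_poly1P => [c _ fc]; move: mon; rewrite fc monicE lead_coefC => /eqP ->.
  by move: fx; rewrite f1 rmorph1 hornerC => /eqP; rewrite oner_eq0.
exists y; apply: (Rmax _ (partial_iso_adjoin pR mf fy)); last exact: adjoin1_id.
by move=> u Ru; apply: adjoin1_sub.
Qed.

Lemma partial_iso_max R0 : partial_iso R0 -> exists R, [/\ partial_iso R, forall u, R0 u -> R u &
  forall R', partial_iso R' -> (forall u, R u -> R' u) -> forall u, R' u -> R u].
Proof.
(* [R0] is built into the property, so that the union of the empty chain satisfies it as well. *)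
move=> p0; pose P (A : K * K -> Prop) := partial_iso (fun u => R0 u \/ A u).
have [Fm HF tF|A [PA maxA]] := @classical_sets.Zorn_bigcup (K * K)%type P.
  have [[R1 RB RM] RF RZ] := p0.
  pose U u := R0 u \/ classical_sets.bigcup Fm id u.
  have join u v : U u -> U v -> exists A, [/\ partial_iso A, A u, A v & forall w, A w -> U w].
    have one A : Fm A -> forall w, R0 w \/ A w -> U w by move=> FA w [Rw|Aw]; [left|right; exists A].
    case=> [Ru|[A FA Au]] [Rv|[B FB Bv]].
    - by exists R0; split=> // w; left.
    - exists (fun w => R0 w \/ B w); split; [exact: HF|by left|by right|exact: one].
    - exists (fun w => R0 w \/ A w); split; [exact: HF|by right|by left|exact: one].
    - have [AB|BA] := tF _ _ FA FB.
      + exists (fun w => R0 w \/ B w); split; [exact: HF|by right; apply: AB|by right|exact: one].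
      + exists (fun w => R0 w \/ A w); split; [exact: HF|by right|by right; apply: BA|exact: one].
  split.
  - split; first by left.
    + by move=> u v Uu Uv; have [A [[[_ AB _] _ _] Au Av sA]] := join u v Uu Uv; apply/sA/AB.
    + by move=> u v Uu Uv; have [A [[[_ _ AM] _ _] Au Av sA]] := join u v Uu Uv; apply/sA/AM.
  - by move=> b; left.
  - by move=> b Ub; have [A [[_ _ AZ] Au _ _]] := join _ _ Ub Ub; apply: AZ.
exists (fun u => R0 u \/ A u); split=> // [u|R' pR' sR' u R'u]; first by left.
apply: contrapT => nu; apply: (maxA R').
  split; first by move=> w Aw; apply: sR'; right.
  by move=> H; apply: nu; right; apply: H.
rewrite /P; suff -> : (fun u => R0 u \/ R' u) = R' by [].
by apply/funext => w; apply/propext; split=> [[Rw|//]|]; [apply: sR'; left|right].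
Qed.

(** A maximal partial isomorphism is defined on all of K, since a root of the conjugated minimal
    polynomial could otherwise be adjoined; the same applied to the swapped graph gives
    surjectivity. *)
Lemma galois_extension R0 : partial_iso R0 -> exists s : absGal iota, forall u, R0 u -> galact s u.1 = u.2.
Proof.
move=> /partial_iso_max[R [pR sR maxR]]; have [sub RF R0'] := pR; have [R1 RB RM] := sub.
have fun_R a b b' : R (a, b) -> R (a, b') -> b = b'.
  move=> Rb Rb'; apply/eqP; rewrite -subr_eq0; apply/eqP/R0'; have := RB _ _ Rb Rb'.
  by rewrite (_ : (a, b) - (a, b') = (a - a, b - b')) // subrr.
have pS := partial_iso_swap pR; have [_ _ S0] := pS.
have inj_R a a' b : R (a, b) -> R (a', b) -> a = a'.
  move=> Rb Rb'; apply/eqP; rewrite -subr_eq0; apply/eqP/S0; have := RB _ _ Rb Rb'.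
  by rewrite (_ : (a, b) - (a', b) = (a - a', b - b)) // subrr.
have /choice[f fP] := partial_iso_total pR maxR.
have /choice[g gP] : forall y, exists x, swap_graph R (y, x).
  apply: partial_iso_total pS _ => R' pR' sR' u R'u.
  apply: (maxR _ (partial_iso_swap pR')); last by rewrite /swap_graph -surjective_pairing.
  by move=> v Rv; apply: sR'; rewrite /swap_graph -surjective_pairing.
have gal : `[< is_galois iota (f, g) >].
  apply/asboolP; split=> /= [a b|a b|b|a|b].
  - apply: (fun_R (a + b)); first exact: fP.
    by apply: (subringD sub (x := (a, f a)) (y := (b, f b))).
  - by apply: (fun_R (a * b)); [apply: fP|apply: (RM (a, f a) (b, f b))].
  - by apply: (fun_R (iota b)).
  - by apply: (inj_R _ _ (f a)); [apply: (gP (f a))|].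
  - by apply: (fun_R (g b)); [|apply: (gP b)].
exists (mk_gal gal) => u /sR Ru; rewrite /galact /=.
by apply: (fun_R u.1); rewrite -?surjective_pairing.
Qed.
End Automorphisms.

(** * Fixed elements of the Galois group *)

Section GaloisAction.
Variables (F : fieldType) (K : closedFieldType) (iota : {rmorphism F -> K}).
Implicit Types (C : K -> Prop) (x y a : K) (s t : absGal iota) (S : seq K).

Lemma galact_zmod s : zmod_morphism (galact s).
Proof.
have [sD _ _ _ _] := galoisP s => a b; apply/eqP; rewrite eq_sym subr_eq; apply/eqP.
by rewrite -[LHS]/((val s).1 a) -[RHS]sD subrK.
Qed.

Lemma galact_monoid s : monoid_morphism (galact s).
Proof.
have [_ sM sF _ _] := galoisP s; split; last exact: sM.
by have := sF 1; rewrite rmorph1.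
Qed.

HB.instance Definition _ s := GRing.isZmodMorphism.Build K K (galact s) (galact_zmod s).
HB.instance Definition _ s := GRing.isMonoidMorphism.Build K K (galact s) (galact_monoid s).

Lemma gal0 s : galact s 0 = 0.
Proof. exact: rmorph0. Qed.

Lemma gal1 s : galact s 1 = 1.
Proof. exact: rmorph1. Qed.

Lemma galB s x y : galact s (x - y) = galact s x - galact s y.
Proof. exact: rmorphB. Qed.

Lemma galMr s x y : galact s (x * y) = galact s x * galact s y.
Proof. exact: rmorphM. Qed.

Lemma gal_sum s (I : Type) (r : seq I) (P : pred I) (f : I -> K) :
  galact s (\sum_(i <- r | P i) f i) = \sum_(i <- r | P i) galact s (f i).
Proof. exact: rmorph_sum. Qed.

Lemma gal_prod s (I : Type) (r : seq I) (P : pred I) (f : I -> K) :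
  galact s (\prod_(i <- r | P i) f i) = \prod_(i <- r | P i) galact s (f i).
Proof. exact: rmorph_prod. Qed.

Lemma galX s x k : galact s (x ^+ k) = galact s x ^+ k.
Proof. exact: rmorphXn. Qed.

Lemma gal_eq0 s x : (galact s x == 0) = (x == 0).
Proof. exact: fmorph_eq0. Qed.

Lemma gal_horner s (p : {poly K}) x : galact s p.[x] = (map_poly (galact s) p).[galact s x].
Proof. by rewrite horner_map. Qed.

Lemma galactM s t a : galact (s * t)%g a = galact t (galact s a).
Proof. by []. Qed.

Lemma galact1 a : galact (1%g : absGal iota) a = a.
Proof. by []. Qed.

Lemma galactK s : cancel (galact s) (galact s^-1%g).
Proof. by move=> a; rewrite -galactM mulgV. Qed.

Lemma galactVK s : cancel (galact s^-1%g) (galact s).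
Proof. by move=> a; rewrite -galactM mulVg. Qed.

Lemma galact_base s b : galact s (iota b) = iota b.
Proof. by have [_ _ sF _ _] := galoisP s; apply: sF. Qed.

(** The subfield generated by S over F: when K is algebraic over F, subrings containing F are
    subfields ([subfieldV]). *)
Definition gen S a := forall C, subfield_pred iota C -> (forall x, x \in S -> C x) -> C a.

Lemma gen_subfield S : subfield_pred iota (gen S).
Proof.
split=> [|b C [_ CF] _]; last exact: CF.
split=> [C [sC _] _|a b Ga Gb C sC SC|a b Ga Gb C sC SC]; first exact: subring1.
- by have [[_ CB _] _] := sC; apply: CB; [apply: Ga|apply: Gb].
- by have [[_ _ CM] _] := sC; apply: CM; [apply: Ga|apply: Gb].
Qed.

Lemma gen_subring S : subring_pred (gen S).
Proof. by have [] := gen_subfield S. Qed.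

Lemma gen_mem S x : x \in S -> gen S x.
Proof. by move=> Sx C _; apply. Qed.

Lemma subfield_gal C s : subfield_pred iota C -> subfield_pred iota (fun a => C (galact s a)).
Proof.
move=> [sC CF]; split=> [|b]; last by rewrite galact_base.
split=> [|a b Ca Cb|a b Ca Cb]; first by rewrite rmorph1; apply: subring1.
- by rewrite rmorphB; have [_ CB _] := sC; apply: CB.
- by rewrite rmorphM; apply: subringM.
Qed.

Lemma gen_stable S s a : (forall x, x \in S -> galact s x \in S) -> gen S a -> gen S (galact s a).
Proof.
move=> sS Ga; apply: (Ga (fun b => gen S (galact s b))); first exact: (subfield_gal s (gen_subfield S)).
by move=> x /sS; apply: gen_mem.
Qed.

Lemma gen_eq S s t a : {in S, galact s =1 galact t} -> gen S a -> galact s a = galact t a.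
Proof.
move=> st Ga; apply: (Ga (fun b => galact s b = galact t b)) => //.
split=> [|b]; last by rewrite !galact_base.
split=> [|b c E E'|b c E E']; first by rewrite !rmorph1.
- by rewrite !galB E E'.
- by rewrite !galMr E E'.
Qed.

Lemma in_base_subfield : subfield_pred iota (in_base iota).
Proof.
split=> [|b]; last by exists b.
split; first by exists 1; rewrite rmorph1.
- by move=> _ _ [a ->] [b ->]; exists (a - b); rewrite rmorphB.
- by move=> _ _ [a ->] [b ->]; exists (a * b); rewrite rmorphM.
Qed.

Lemma subfield_adjoin1 C x : subfield_pred iota C -> subfield_pred iota (adjoin1 C x).
Proof. by move=> [sC CF]; split=> [|b]; [apply: adjoin1_subring|apply: adjoin1_sub]. Qed.

(** Adjunction one element at a time, for the induction in [fixed_adjoin]. *)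
Fixpoint adjoin C S : K -> Prop := if S is x :: S' then adjoin (adjoin1 C x) S' else C.

Lemma adjoin_subfield C S : subfield_pred iota C -> subfield_pred iota (adjoin C S).
Proof. by elim: S C => //= x S IH C sC; apply: IH; apply: subfield_adjoin1. Qed.

Lemma adjoin_sub C S a : subfield_pred iota C -> C a -> adjoin C S a.
Proof.
elim: S C => //= x S IH C sC Ca; apply: IH; first exact: subfield_adjoin1.
by apply: adjoin1_sub => //; case: sC.
Qed.

Lemma adjoin_mem C S x : subfield_pred iota C -> x \in S -> adjoin C S x.
Proof.
elim: S C => //= y S IH C sC; rewrite inE => /predU1P[->|Sx]; last by apply: IH => //; apply: subfield_adjoin1.
by apply: adjoin_sub; [apply: subfield_adjoin1|apply: adjoin1_id; case: sC].
Qed.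

Lemma gen_adjoin S a : gen S a -> adjoin (in_base iota) S a.
Proof.
apply; first exact/adjoin_subfield/in_base_subfield.
by move=> x; apply: adjoin_mem in_base_subfield.
Qed.

Hypothesis alg : is_algebraic_closure iota.

(** Write a = r(x) with r of degree less than that of the minimal polynomial f of x over C. Every
    root b of f is the image of x under an automorphism fixing C, hence fixing a, so r(b) = a; f
    having distinct roots, r - a has too many of them and r is constant. *)
Lemma fixed_adjoin1 C x a : subfield_pred iota C -> separable_over_base iota x -> adjoin1 C x a ->
  (forall s, (forall c, C c -> galact s c = c) -> galact s a = a) -> C a.
Proof.
move=> sC [g sg gx] [p [hp aE]] fixa; have [sub CF] := sC.
pose R (u : K * K) := C u.1 /\ u.2 = u.1.
have pR : partial_iso iota R.
  split=> [|b|b [_ /= ->] //]; last by split=> //; apply: CF.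
  have [C1 CB CM] := sub.
  by split=> [|u v [Cu uE] [Cv vE]|u v [Cu uE] [Cv vE]]; split=> //=; rewrite ?uE ?vE //; [apply: CB|apply: CM].
have [f0 mf0] := min_pair_ex alg x pR; have [hf mon fx _] := mf0.
pose f := map_poly fst f0.
have fs : map_poly snd f0 = f by apply/polyP => i; rewrite !coef_map; have [_] := hf i.
have Cf : coef_pred C f by move=> i; rewrite coef_map; have [] := hf i.
have mf : f \is monic by rewrite monic_map.
have szf : size f = size f0 by rewrite size_map_poly_id0 // (monicP mon) oner_neq0.
have kill r : coef_pred C r -> (size r < size f)%N -> r.[x] = 0 -> r = 0.
  move=> hr sr rx; have dg0 : dg r = 0.
    apply: (min_pair_kill alg pR mf0); first by move=> i; rewrite coef_dg; split=> //; apply: hr.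
      by apply: leq_ltn_trans (size_poly _ _) _; rewrite -szf.
    by have := congr1 fst (horner_pair (dg r) (x, x)); rewrite /= => <-; rewrite horner_dg.
  by apply/polyP => i; have := congr1 (fun P : {poly K * K} => (P`_i).1) dg0; rewrite coef_dg !coef0.
have [u [r [hu hr pE sr]]] := monic_division sub Cf mf hp.
have ar : a = r.[x] by rewrite aE pE hornerD hornerM fx mulr0 add0r.
have [v [r' [hv hr' gE sr']]] := monic_division sub Cf mf (coef_map_base g sC).
have r'0 : r' = 0.
  by apply: kill => //; move: gx; rewrite /root gE hornerD hornerM fx mulr0 add0r => /eqP.
have sepf : separable_poly f.
  apply: (dvdp_separable (p := map_poly iota g)); last by rewrite separable_map.
  by rewrite gE r'0 addr0 dvdp_mull.
have [rs fE] := closed_field_poly_normal f.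
rewrite (monicP mf) scale1r in fE.
have urs : uniq rs by rewrite -separable_prod_XsubC -fE.
have srs : size f = (size rs).+1 by rewrite fE size_prod_XsubC.
have ra b : b \in rs -> r.[b] = a.
  move=> brs; have fb : (map_poly snd f0).[b] = 0.
    by apply/eqP; rewrite fs -/(root f b) fE root_prod_XsubC.
  have [s sP] := galois_extension alg (partial_iso_adjoin alg pR mf0 fb).
  have sx : galact s x = b by apply: (sP (x, b)); apply: adjoin1_id; case: pR.
  have sC' c : C c -> galact s c = c.
    by move=> Cc; apply: (sP (c, c)); apply: adjoin1_sub => //; case: pR.
  rewrite -(fixa s sC') ar gal_horner sx; congr (_.[b]).
  by apply/polyP => i; rewrite coef_map [RHS]sC'.
suff E : r = a%:P by have := hr 0%N; rewrite E coefC.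
apply/eqP; rewrite -subr_eq0; apply: contraT => ne.
have rs0 : (0 < size rs)%N.
  by move: fx; rewrite -/f fE; case: (rs) => // /eqP; rewrite big_nil hornerC oner_eq0.
have := max_poly_roots ne _ urs; rewrite ltnNge.
have -> : (size (r - a%:P)%R <= size rs)%N.
  apply: leq_trans (size_polyD _ _) _; rewrite geq_max size_polyN -ltnS -srs sr /=.
  by apply: leq_trans (size_polyC_leq1 _) _.
by move=> H; apply: H; apply/allP => b /ra; rewrite /root hornerD hornerN hornerC => ->; rewrite subrr.
Qed.

Lemma fixed_adjoin C S a : subfield_pred iota C -> (forall x, x \in S -> separable_over_base iota x) -> adjoin C S a ->
  (forall s, (forall c, C c -> galact s c = c) -> galact s a = a) -> C a.
Proof.
elim: S C => //= x S IH C sC sS aS fixa.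
have sx : separable_over_base iota x by apply: sS; rewrite inE eqxx.
apply: (fixed_adjoin1 sC sx _ fixa).
apply: IH aS _; first exact: subfield_adjoin1.
  by move=> y Sy; apply: sS; rewrite inE Sy orbT.
move=> s sP; apply: fixa => c Cc; apply: sP.
by apply: adjoin1_sub => //; case: sC.
Qed.

Definition separable_list S := forall x, x \in S -> separable_over_base iota x.
Definition galois_list S := forall s x, x \in S -> galact s x \in S.

Lemma gen_fixed S a : separable_list S -> gen S a -> (forall s, galact s a = a) -> in_base iota a.
Proof.
move=> sS /gen_adjoin aS fixa; apply: (fixed_adjoin in_base_subfield sS aS) => s _; exact: fixa.
Qed.

(** All roots of separable polynomials annihilating the elements of S are added. *)
Lemma stable_closure S : separable_list S -> exists S', [/\ separable_list S', galois_list S' & {subset S <= S'}].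
Proof.
elim: S => [|x S IH] sS; first by exists [::].
have [y Sy|S' [sS' gS' sub]] := IH; first by apply: sS; rewrite inE Sy orbT.
have [g sg gx] : separable_over_base iota x by apply: sS; rewrite inE eqxx.
have g0 : map_poly iota g != 0.
  by rewrite map_poly_eq0; apply: contraTneq sg => ->; rewrite separable_poly.unlock deriv0 coprimep0 -size_poly_eq1 size_poly0.
have [rs gE] := closed_field_poly_normal (map_poly iota g).
have rsP y : (y \in rs) = root (map_poly iota g) y.
  by rewrite gE rootZ ?lead_coef_eq0 // root_prod_XsubC.
exists (rs ++ S'); split=> [y|s y|y].
- rewrite mem_cat => /orP[|/sS' //]; rewrite rsP => gy; by exists g.
- rewrite !mem_cat => /orP[|/(gS' s) ->]; last by rewrite orbT.
  rewrite !rsP /root => /eqP gy; apply/orP; left.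
  have -> : map_poly iota g = map_poly (galact s) (map_poly iota g).
    by apply/polyP => i; rewrite !coef_map; have := galact_base s (g`_i).
  by rewrite horner_map gy rmorph0.
- by rewrite inE mem_cat => /predU1P[->|/sub ->]; rewrite ?rsP ?gx ?orbT.
Qed.

Lemma galois_reps S : galois_list S -> exists (I : finType) (u : I -> absGal iota),
  (forall t, exists i, {in S, galact t =1 galact (u i)}) /\
  (forall i j, {in S, galact (u i) =1 galact (u j)} -> i = j).
Proof.
move=> gS'; pose T := undup S; pose r := size T; have uT : uniq T := undup_uniq S.
have gS s x : x \in T -> galact s x \in T by rewrite !mem_undup; apply: gS'.
pose real (phi : {ffun 'I_r -> 'I_r}) := `[< exists t, forall i : 'I_r, galact t T`_i = T`_(phi i) >].
have /choice[u uP] : forall phi : {phi | real phi}, exists t, forall i : 'I_r, galact t T`_i = T`_(val phi i).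
  by case=> phi /= /asboolP.
exists {phi | real phi}, u; split=> [t|phi psi E].
  have lt (i : 'I_r) : (index (galact t T`_i) T < r)%N by rewrite index_mem gS // mem_nth.
  pose phi := [ffun i : 'I_r => Ordinal (lt i)].
  have rphi : real phi.
    by apply/asboolP; exists t => i; rewrite ffunE nth_index // gS // mem_nth.
  exists (Sub phi rphi) => x; rewrite -mem_undup => Sx; have ix : (index x T < r)%N by rewrite index_mem.
  have := uP (Sub phi rphi) (Ordinal ix); rewrite /= nth_index // => ->.
  by rewrite ffunE /= nth_index // nth_index // gS.
apply: val_inj; apply/ffunP => i; apply: val_inj; apply/eqP; rewrite -(nth_uniq 0 (ltn_ord _) (ltn_ord _) uT); apply/eqP.
by rewrite -!uP; apply: E; rewrite -mem_undup mem_nth.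
Qed.
End GaloisAction.

(** * Composition, products and local forms of birational maps *)

Section BirationalOperations.
Variable K : closedFieldType.
Implicit Types (A B : mproj) (C : K -> Prop).

Lemma birational_sym C A B (X : subpts K A) (Y : subpts K B) q h q' h' :
  is_birational_map C X Y q h q' h' -> is_birational_map C Y X q' h' q h.
Proof. by case=> [[? ?] ? ? ? ?]. Qed.

Lemma birational_pull C A B (X : subpts K A) (Y : subpts K B) q h q' h' d N :
  is_birational_map C X Y q h q' h' -> prime_set Y -> multihomog d N -> ~ vanish Y N -> ~ vanish X (subst q N).
Proof.
move=> [_ _ [_ [e hh'] nh'] _ G] pY hN nN v.
have [y [Yy]] := not_vanish (pY _ _ _ _ hN hh' nN nh'); rewrite pevalM mulf_eq0 negb_or => /andP[Ny h'y].
have [Xq _ sq] := G y Yy h'y.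
have := v _ Xq; rewrite peval_subst => /eqP.
by rewrite -(multihomog_same hN sq) (negPf Ny).
Qed.

Lemma birational_comp C A B A' (X : subpts K A) (Y : subpts K B) (Z : subpts K A') q1 h1 q1' h1' q2 h2 q2' h2' :
  subring_pred C -> prime_set X -> prime_set Y -> prime_set Z ->
  is_birational_map C X Y q1 h1 q1' h1' -> is_birational_map C Y Z q2 h2 q2' h2' ->
  exists h h', is_birational_map C X Z (comp_tuple q2 q1) h (comp_tuple q1' q2') h' /\
    forall x, peval h x != 0 -> peval h1 x != 0 /\ peval h2 (teval q1 x) != 0.
Proof.
move=> sC pX pY pZ b1 b2.
have [[f1 f1'] [ch1 [d1 hh1] nh1] [ch1' [d1' hh1'] nh1'] F1 G1] := b1.
have [[f2 f2'] [ch2 [d2 hh2] nh2] [ch2' [d2' hh2'] nh2'] F2 G2] := b2.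
have nz (p q : K) : (p * q != 0) -> p != 0 /\ q != 0 by rewrite mulf_eq0 negb_or => /andP.
exists (h1 * subst q1 h2 * subst (comp_tuple q2 q1) (h2' * subst q2' h1')).
exists (h2' * subst q2' h1' * subst (comp_tuple q1' q2') (h1 * subst q1 h2)).
split; last by move=> x; rewrite pevalM => /nz[+ _]; rewrite pevalM peval_subst => /nz.
have [D1 hq1] := form_tuple_degree f1; have [D2' hq2'] := form_tuple_degree f2'.
apply: generic_birational => //.
- exact: is_form_comp.
- exact: is_form_comp.
- split.
  + by apply: coefsM => //; apply: coefs_subst => //; case: f1.
  + by eexists; apply: multihomogM hh1 (multihomog_subst hq1 hh2).
  + by apply: (pX _ _ _ _ hh1 (multihomog_subst hq1 hh2)) => //; apply: birational_pull b1 _ hh2 nh2.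
- split.
  + by apply: coefsM => //; apply: coefs_subst => //; case: f2'.
  + by eexists; apply: multihomogM hh2' (multihomog_subst hq2' hh1').
  + apply: (pZ _ _ _ _ hh2' (multihomog_subst hq2' hh1')) => //.
    exact: birational_pull (birational_sym b2) _ hh1' nh1'.
- move=> x Xx; rewrite pevalM peval_subst => /nz[h1x h2x]; rewrite !teval_comp.
  have [Yx h1'x s1] := F1 x Xx h1x; have [Zx h2'x s2] := F2 _ Yx h2x; split=> //.
  exact: same_pt_trans (teval_same f1' s2) s1.
- move=> z Zz; rewrite pevalM peval_subst => /nz[h2z h1z]; rewrite !teval_comp.
  have [Yz h2'z s2] := G2 z Zz h2z; have [Xz h1'z s1] := G1 _ Yz h1z; split=> //.
  exact: same_pt_trans (teval_same f2 s1) s2.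
Qed.

Lemma same_pair A B (x x' : pts K A) (y y' : pts K B) : same_pt x x' -> same_pt y y' ->
  same_pt (pair_pt x y) (pair_pt x' y').
Proof.
move=> [l [l0 ->]] [m [m0 ->]].
exists (fun i : mfac (prodamb A B) => match i with inl i => l i | inr i => m i end).
by split=> [[i|i]|] //; apply/funext => -[u|u].
Qed.

Section Product.
Variable P : mproj.

Definition prod_tuple A B (q : form_tuple K A B) : form_tuple K (prodamb A P) (prodamb B P) :=
  fun v => match v with inl u => subst (inl_tuple P A) (q u) | inr u => @var K (prodamb A P) (inr u) end.

Lemma prod_tupleE A B (q : form_tuple K A B) z :
  teval (prod_tuple q) z = pair_pt (teval q (fun v => z (inl v))) (fun v => z (inr v)).
Proof.
apply/funext => -[u|u]; rewrite /teval /=; last by rewrite pevalV.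
by rewrite peval_subst inl_tupleE.
Qed.

Lemma prod_tuple_form C A B (q : form_tuple K A B) : subring_pred C -> is_form_tuple C q -> is_form_tuple C (prod_tuple q).
Proof.
move=> sC fq; have [ci hi] := inl_tuple_form P A sC; split.
  by case=> v; [apply: coefs_subst => //; case: fq|apply: coefs_var].
case=> j; last first.
  by exists (fun u : mfac (prodamb A P) => (u == inr j) : nat) => -[//|v] /= [<-]; apply: (@multihomog_var K (prodamb A P) (inr v)).
have [D hD] := form_tuple_degree (inl_tuple_form P A sC); have [_ /(_ j)[d hd]] := fq.
by exists (fun i => \sum_k d k * D k i)%N => -[v [vj]|//]; apply: multihomog_subst => //; apply: hd.
Qed.
End Product.

Lemma birational_prod C A B (X : subpts K A) (Y : subpts K B) q h q' h' r : subring_pred C ->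
  is_birational_map C X Y q h q' h' ->
  is_birational_map C (prodset X (@whole K r.+1)) (prodset Y (@whole K r.+1))
    (prod_tuple (P := Pspace r.+1) q) (subst (inl_tuple (Pspace r.+1) A) h)
    (prod_tuple (P := Pspace r.+1) q') (subst (inl_tuple (Pspace r.+1) B) h').
Proof.
move=> sC [[fq fq'] gh gh' FF GG].
have gen D (Z : subpts K D) p : generic_form C Z p ->
    generic_form C (prodset Z (@whole K r.+1)) (subst (inl_tuple (Pspace r.+1) D) p).
  move=> [cp [d hp] np]; have fi := inl_tuple_form (Pspace r.+1) D sC.
  have [E hE] := form_tuple_degree fi; split.
  - by apply: coefs_subst => //; case: fi.
  - by eexists; apply: multihomog_subst hp.
  - move=> v; apply: np => x Zx; have := v (pair_pt x (fun=> 1)).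
    rewrite peval_subst inl_tupleE; apply; split=> // -[]; exists ord0; split=> //.
    exact: oner_neq0.
split; [by split; apply: prod_tuple_form|exact: gen|exact: gen| |].
- move=> z [Xz wz]; rewrite !peval_subst !prod_tupleE !inl_tupleE /= => hz.
  have [Yq h'q s] := FF _ Xz hz; split=> //.
  by rewrite [X in same_pt _ X](pair_eta z); apply: same_pair => //; apply: same_ptxx.
- move=> z [Yz wz]; rewrite !peval_subst !prod_tupleE !inl_tupleE /= => hz.
  have [Yq h'q s] := GG _ Yz hz; split=> //.
  by rewrite [X in same_pt _ X](pair_eta z); apply: same_pair => //; apply: same_ptxx.
Qed.

Lemma point_form C A B (q : form_tuple K A B) x : subring_pred C -> is_form_tuple C q -> is_point (teval q x) ->
  exists h, [/\ coefs_in C h, exists d, multihomog d h, peval h x != 0 &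
    forall y, peval h y != 0 -> is_point (teval q y)].
Proof.
move=> sC fq /choice[v vP]; have [D hq] := form_tuple_degree fq.
exists (\prod_j q (v j)); split.
- by apply: coefs_prod => // j _; case: fq.
- by eexists; apply: (multihomog_prod (d := fun j => D (blk (v j)))) => j _; apply: hq.
- by rewrite peval_prod; apply/prodf_neq0 => j _; have [] := vP j.
- move=> y; rewrite peval_prod => /prodf_neq0 H j; exists (v j); split; last exact: H.
  by have [] := vP j.
Qed.

Lemma morphism_same C A B (X : subpts K A) (Y : subpts K B) f x x' : is_morphism C X Y f ->
  X x -> X x' -> same_pt x x' -> same_pt (f x) (f x').
Proof.
move=> [_ H] Xx Xx' s; have [q [fq qx qf]] := H x Xx.
have s' := teval_same fq s.
apply: same_pt_trans (same_pt_sym (qf x Xx qx)) _; apply: same_pt_trans (s') _.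
by apply: qf => //; apply: same_pt_is_point s' qx.
Qed.

(** The formulas valid near [y0] and near its preimage already form a birational map. The subring C'
    is quantified separately because it will be the subfield generated by a finite list containing
    the coefficients of these formulas. *)
Lemma isomorphism_local C A B (X : subpts K A) (Y : subpts K B) f y0 :
  closed_set X -> closed_set Y -> is_isomorphism C X Y f -> Y y0 ->
  exists (q : form_tuple K A B) (q' : form_tuple K B A) x0,
    [/\ is_form_tuple C q, is_form_tuple C q', X x0, is_point (teval q x0) & same_pt (teval q x0) y0] /\
    (forall x, X x -> is_point (teval q x) -> same_pt (teval q x) (f x)) /\
    forall C', subring_pred C' -> is_form_tuple C' q -> is_form_tuple C' q' ->
      exists h h', is_birational_map C' X Y q h q' h' /\ forall x, peval h x != 0 -> is_point (teval q x).
Proof.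
move=> cX cY [mf [g [mg gf fg]]] Yy0.
have [fX floc] := mf; have [gY gloc] := mg; pose x0 := g y0; have Xx0 : X x0 by apply: gY.
have [q [fq qx0 qf]] := floc _ Xx0; have [q' [fq' q'y0 q'g]] := gloc _ Yy0.
have s0 : same_pt (teval q x0) y0 by apply: same_pt_trans (qf _ Xx0 qx0) (fg _ Yy0).
exists q, q', x0; split=> //; split=> // C' sC fq1 fq1'.
have [h [ch [d hh] h0 hP]] := point_form sC fq1 qx0.
have [h' [ch' [d' hh'] h'0 h'P]] := point_form sC fq1' q'y0.
have [D hq] := form_tuple_degree fq; have [D' hq'] := form_tuple_degree fq'.
have F x : X x -> is_point (teval q x) -> Y (teval q x).
  by move=> Xx qx; apply: (closed_same cY (same_pt_sym (qf x Xx qx))); apply: fX.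
have G y : Y y -> is_point (teval q' y) -> X (teval q' y).
  by move=> Yy qy; apply: (closed_same cX (same_pt_sym (q'g y Yy qy))); apply: gY.
have s0' : same_pt (teval q' y0) x0 := q'g _ Yy0 q'y0.
have nz (u v : K) : (u * v != 0) -> u != 0 /\ v != 0 by rewrite mulf_eq0 negb_or => /andP.
exists (h * subst q h'), (h' * subst q' h); split; last by move=> x; rewrite pevalM => /nz[/hP].
split=> //.
- split.
  + by apply: coefsM => //; apply: coefs_subst => //; case: fq1.
  + by eexists; apply: multihomogM hh (multihomog_subst hq hh').
  + move/(_ _ Xx0)/eqP; rewrite pevalM peval_subst mulf_eq0 (negPf h0) /=.
    by rewrite -(multihomog_same hh' s0) (negPf h'0).
- split.
  + by apply: coefsM => //; apply: coefs_subst => //; case: fq1'.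
  + by eexists; apply: multihomogM hh' (multihomog_subst hq' hh).
  + move/(_ _ Yy0)/eqP; rewrite pevalM peval_subst mulf_eq0 (negPf h'0) /=.
    by rewrite -(multihomog_same hh s0') (negPf h0).
- move=> x Xx; rewrite pevalM peval_subst => /nz[hx h'q].
  have qx := hP x hx; have Yq := F x Xx qx.
  have s : same_pt (teval q' (teval q x)) x.
    apply: same_pt_trans (q'g _ Yq (h'P _ h'q)) _; apply: same_pt_trans (gf _ Xx).
    by apply: morphism_same mg _ _ (qf x Xx qx) => //; apply: fX.
  by split=> //; rewrite pevalM peval_subst mulf_neq0 // -(multihomog_same hh s).
- move=> y Yy; rewrite pevalM peval_subst => /nz[h'y hq'y].
  have qy := h'P y h'y; have Xq := G y Yy qy.
  have s : same_pt (teval q (teval q' y)) y.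
    apply: same_pt_trans (qf _ Xq (hP _ hq'y)) _; apply: same_pt_trans (fg _ Yy).
    by apply: morphism_same mf _ _ (q'g y Yy qy) => //; apply: gY.
  by split=> //; rewrite pevalM peval_subst mulf_neq0 // -(multihomog_same hh' s).
Qed.
End BirationalOperations.

(** * Galois descent of birational maps *)

Section Descent.
Variables (F : fieldType) (K : closedFieldType) (iota : {rmorphism F -> K}).
Hypothesis alg : is_algebraic_closure iota.
Implicit Types (A B : mproj) (s t : absGal iota).

Definition galp A s (p : mpol K A) : mpol K A := map_mpoly (galact s) p.

Lemma galp_coef A s (p : mpol K A) m : (galp s p)@_m = galact s p@_m.
Proof. exact: mcoeff_map_mpoly. Qed.

Lemma peval_gal A s (p : mpol K A) x : peval (galp s p) (gal_pt s x) = galact s (peval p x).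
Proof.
have -> : galp s p = \sum_(m <- msupp p) galact s p@_m *: 'X_[m].
  apply/mpolyP => m; rewrite galp_coef {1}[p]mpolyE (raddf_sum (mcoeff m)) gal_sum (raddf_sum (mcoeff m)) /=.
  apply: eq_bigr => k _.
  by rewrite !mcoeffZ !mcoeffX galMr; case: eqP; rewrite ?gal0 ?gal1.
rewrite peval_sum /peval mevalE gal_sum; apply: eq_bigr => m _.
rewrite galMr mevalZ mevalX gal_prod; congr (_ * _); apply: eq_bigr => i _.
by rewrite galX.
Qed.

Lemma gal_ptVK A s (x : pts K A) : gal_pt s (gal_pt s^-1%g x) = x.
Proof. by apply/funext => v; rewrite /gal_pt galactVK. Qed.

Lemma peval_galp A s (p : mpol K A) x : peval (galp s p) x = galact s (peval p (gal_pt s^-1%g x)).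
Proof. by rewrite -peval_gal gal_ptVK. Qed.

Lemma gal_pt_same A s (x y : pts K A) : same_pt x y -> same_pt (gal_pt s x) (gal_pt s y).
Proof.
move=> [l [l0 ->]]; exists (fun i => galact s (l i)); split=> [i|]; first by rewrite gal_eq0.
by apply/funext => v; rewrite /gal_pt /rescale galMr.
Qed.

Lemma gal_pt_point A s (x : pts K A) : is_point x -> is_point (gal_pt s x).
Proof. by move=> xp i; have [v [vi xv]] := xp i; exists v; rewrite /gal_pt gal_eq0. Qed.

Lemma galpM A s (p q : mpol K A) : galp s (p * q) = galp s p * galp s q.
Proof. by apply: peval_inj => x; rewrite pevalM !peval_galp pevalM galMr. Qed.

Lemma galp_prod A s (I : Type) (r : seq I) (P : pred I) (f : I -> mpol K A) :
  galp s (\prod_(i <- r | P i) f i) = \prod_(i <- r | P i) galp s (f i).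
Proof.
apply: peval_inj => x; rewrite peval_galp !peval_prod gal_prod.
by apply: eq_bigr => i _; rewrite peval_galp.
Qed.

Lemma galp_sum A s (I : Type) (r : seq I) (P : pred I) (f : I -> mpol K A) :
  galp s (\sum_(i <- r | P i) f i) = \sum_(i <- r | P i) galp s (f i).
Proof.
apply: peval_inj => x; rewrite peval_galp !peval_sum gal_sum.
by apply: eq_bigr => i _; rewrite peval_galp.
Qed.

Lemma galp_comp A s t (p : mpol K A) : galp t (galp s p) = galp (s * t)%g p.
Proof. by apply/mpolyP => m; rewrite !galp_coef. Qed.

Lemma galp_homog A s d (p : mpol K A) : multihomog d p -> multihomog d (galp s p).
Proof.
move=> hp l x; rewrite !peval_galp.
have -> : gal_pt s^-1%g (rescale l x) = rescale (fun i => galact s^-1%g (l i)) (gal_pt s^-1%g x).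
  by apply/funext => v; rewrite /gal_pt /rescale galMr.
rewrite hp galMr gal_prod; congr (_ * _); apply: eq_bigr => i _.
by rewrite galX galactVK.
Qed.

Lemma galp_base A s (p : mpol K A) : coefs_in (in_base iota) p -> galp s p = p.
Proof. by move=> hp; apply/mpolyP => m; rewrite galp_coef; have [b ->] := hp m; apply: galact_base. Qed.

Definition gal_stable A (W : subpts K A) := forall s x, W x -> W (gal_pt s x).

Lemma vanish_galp A (W : subpts K A) s p : gal_stable W -> vanish W (galp s p) -> vanish W p.
Proof.
by move=> gW v x Wx; have := v _ (gW s x Wx); rewrite peval_gal => /eqP; rewrite gal_eq0 => /eqP.
Qed.

Lemma prime_bigprod A (W : subpts K A) (I : eqType) (r : seq I) (f : I -> mpol K A) : prime_set W -> (exists x, W x) ->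
  (forall i, i \in r -> exists d, multihomog d (f i)) -> (forall i, i \in r -> ~ vanish W (f i)) ->
  (exists d, multihomog d (\prod_(i <- r) f i)) /\ ~ vanish W (\prod_(i <- r) f i).
Proof.
move=> pW [x Wx]; elim: r => [|i r IH] hf nf.
  rewrite big_nil; split; first by exists (fun=> 0%N); apply: multihomog1.
  by move/(_ x Wx)/eqP; rewrite peval1 oner_eq0.
rewrite big_cons; have [[d hd] nr] : (exists d, multihomog d (\prod_(i <- r) f i)) /\ ~ vanish W (\prod_(i <- r) f i).
  by apply: IH => j jr; [apply: hf|apply: nf]; rewrite inE jr orbT.
have [e he] := hf i (mem_head _ _); split; first by eexists; apply: multihomogM he hd.
by apply: (pW _ _ _ _ he hd) => //; apply: nf; apply: mem_head.
Qed.

Variables (S : seq K) (I : finType) (u : I -> absGal iota).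
Hypotheses (sepS : separable_list iota S) (galS : galois_list iota S).
Hypothesis u_all : forall t, exists i, {in S, galact t =1 galact (u i)}.
Hypothesis u_inj : forall i j, {in S, galact (u i) =1 galact (u j)} -> i = j.
Local Notation C := (gen iota S).
Let sC : subring_pred C := gen_subring iota S.

Lemma galp_eq A s t (p : mpol K A) : coefs_in C p -> {in S, galact s =1 galact t} -> galp s p = galp t p.
Proof. by move=> hp st; apply/mpolyP => m; rewrite !galp_coef; apply: gen_eq st (hp m). Qed.

Lemma galp_coefs A s (p : mpol K A) : coefs_in C p -> coefs_in C (galp s p).
Proof. by move=> hp m; rewrite galp_coef; apply: gen_stable (hp m) => x; apply: galS. Qed.

Lemma fixed_coefs A (p : mpol K A) : coefs_in C p -> (forall s, galp s p = p) -> coefs_in (in_base iota) p.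
Proof.
move=> hp fp m; apply: (gen_fixed alg sepS (hp m)) => s.
by rewrite -galp_coef fp.
Qed.

(** Multiplication by t permutes the classes of automorphisms with the same restriction to S. *)
Lemma translate t : exists2 pi : I -> I, injective pi & forall i, {in S, galact (u i * t)%g =1 galact (u (pi i))}.
Proof.
have /choice[pi piP] : forall i, exists j, {in S, galact (u i * t)%g =1 galact (u j)} by move=> i; apply: u_all.
exists pi => // i j E.
apply: u_inj => x Sx; apply: (can_inj (galactK t)); rewrite -!galactM.
by rewrite piP // E -piP.
Qed.

Lemma galp_translate t : exists2 pi : I -> I, injective pi &
  forall A i (p : mpol K A), coefs_in C p -> galp t (galp (u i) p) = galp (u (pi i)) p.
Proof.
have [pi ipi piP] := translate t; exists pi => // A i p hp.
by rewrite galp_comp; apply: galp_eq.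
Qed.

Definition normp A (p : mpol K A) := \prod_i galp (u i) p.
Definition tracep A (p : mpol K A) := \sum_i galp (u i) p.

Lemma normp_base A (p : mpol K A) : coefs_in C p -> coefs_in (in_base iota) (normp p).
Proof.
move=> hp; apply: fixed_coefs => [|t]; first by apply: coefs_prod => // i _; apply: galp_coefs.
have [pi ipi piP] := galp_translate t; rewrite /normp galp_prod [RHS](reindex_inj ipi).
by apply: eq_bigr => i _; rewrite piP.
Qed.

Lemma tracep_base A (p : mpol K A) : coefs_in C p -> coefs_in (in_base iota) (tracep p).
Proof.
move=> hp; apply: fixed_coefs => [|t]; first by apply: coefs_sum => // i _; apply: galp_coefs.
have [pi ipi piP] := galp_translate t; rewrite /tracep galp_sum [RHS](reindex_inj ipi).
by apply: eq_bigr => i _; rewrite piP.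
Qed.

Lemma normp_neq0 A (p : mpol K A) x : coefs_in C p -> peval (normp p) x != 0 -> forall s, peval p (gal_pt s x) != 0.
Proof.
move=> hp; rewrite peval_prod => /prodf_neq0 H s; have [i iP] := u_all s^-1%g.
have := H i isT; rewrite -(galp_eq hp iP) peval_galp gal_eq0.
by rewrite (_ : gal_pt _ x = gal_pt s x) //; apply/funext => v; rewrite /gal_pt invgK.
Qed.

Lemma normp_generic A (W : subpts K A) (p : mpol K A) : prime_set W -> (exists x, W x) -> gal_stable W ->
  generic_form C W p -> generic_form (in_base iota) W (normp p).
Proof.
move=> pW neW gW [cp [d hp] np].
have [|i _|hd nn] := @prime_bigprod A W I (index_enum I) (fun i => galp (u i) p) pW neW.
- by move=> i _; exists d; apply: galp_homog.
- by move/(vanish_galp gW).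
- by split=> //; apply: normp_base.
Qed.

Definition mon (e : {ffun 'I_(size S) -> 'I_#|I|.+1}) : K := \prod_(k < size S) S`_k ^+ e k.

Lemma mon_gen e : C (mon e).
Proof. by apply: subring_prod => // k _; apply: (subringX sC); apply: gen_mem; apply: mem_nth. Qed.

(* Dedekind's independence of characters. *)
Lemma galois_interpolation (c : I -> K) i0 : c i0 != 0 -> exists e, \sum_i c i * galact (u i) (mon e) != 0.
Proof.
move=> c0; have [|e [le e0]] := @interpolation K 'I_(size S) I (fun i k => galact (u i) S`_k) c i0 c0.
  move=> k; apply: contra_neqP => H; apply: u_inj => x Sx.
  have ix : (index x S < size S)%N by rewrite index_mem.
  apply/eqP; apply: contraT => ne; case: H; exists (Ordinal ix).
  by rewrite nth_index.
exists [ffun k => inord (e k)].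
suff -> : \sum_i c i * galact (u i) (mon [ffun k => inord (e k)]) =
    \sum_i c i * \prod_(k < size S) galact (u i) S`_k ^+ e k by [].
apply: eq_bigr => i _; rewrite gal_prod; congr (_ * _); apply: eq_bigr => k _.
by rewrite galX ffunE inordK // ltnS.
Qed.

Lemma trace_neq0 : exists2 th, C th & \sum_i galact (u i) th != 0.
Proof.
have [i0 _] := u_all (1%g : absGal iota); have [e e0] := @galois_interpolation (fun=> 1) i0 (oner_neq0 _).
exists (mon e); first exact: mon_gen.
by move: e0; under eq_bigr do rewrite mul1r.
Qed.

Section Tuple.
Variables (A B : mproj) (W : subpts K A) (q : form_tuple K A B) (N : mpol K A) (dN : mfac A -> nat).
Hypotheses (pW : prime_set W) (gW : gal_stable W) (fq : is_form_tuple C q).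
Hypotheses (hN : multihomog dN N) (nN : ~ vanish W N).
Hypothesis q_pt : forall x, W x -> peval N x != 0 -> is_point (teval q x).
Hypothesis q_gal : forall s x, W x -> peval N x != 0 -> peval N (gal_pt s x) != 0 ->
  same_pt (teval q (gal_pt s x)) (gal_pt s (teval q x)).

(** As q commutes with s up to rescaling, q and its conjugate are proportional on W within each
    factor of B. *)
Lemma cross_vanish s v w : blk v = blk w -> vanish W (galp s (q v) * q w - galp s (q w) * q v).
Proof.
move=> vw; apply: contrapT => nv; have [D hq] := form_tuple_degree fq.
have hP : multihomog (fun i => D (blk v) i + D (blk v) i)%N (galp s (q v) * q w - galp s (q w) * q v).
  apply: multihomogB; apply: multihomogM; try apply: galp_homog; try exact: hq; rewrite vw; exact: hq.
have nNs : ~ vanish W (galp s N) by move/(vanish_galp gW).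
have := pW (multihomogM hN (galp_homog s hN)) hP (pW hN (galp_homog s hN) nN nNs) nv.
move=> /not_vanish[y [Wy]]; rewrite pevalM mulf_eq0 negb_or pevalM mulf_eq0 negb_or => /andP[/andP[Ny Nsy]].
pose x := gal_pt s^-1%g y; have yE : gal_pt s x = y by rewrite /x gal_ptVK.
have Wx : W x by apply: gW.
have Nx : peval N x != 0 by move: Nsy; rewrite peval_galp gal_eq0.
have := @q_gal s x Wx Nx; rewrite yE => /(_ Ny)[l [l0 lE]].
have E w' : peval (galp s (q w')) y = l (blk w') * peval (q w') y.
  by rewrite peval_galp; have := congr1 (fun f => f w') lE.
by rewrite pevalB !pevalM !E vw [X in _ - X]mulrAC mulrAC subrr eqxx.
Qed.

(** Within a factor, the quotients of q by a coordinate not vanishing on W are Galois invariant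
    functions on W. Multiplying by the norm of that coordinate clears the denominator. The resulting
    forms [M v] are invariant only modulo forms vanishing on W, so they are replaced by the traces
    of [th *: M v], which have coefficients in F and equal, on W, the trace of [th] times [M v]. *)
Lemma descend_tuple : exists (q1 : form_tuple K A B) N1, [/\ is_form_tuple (in_base iota) q1,
  generic_form (in_base iota) W N1 &
  forall x, W x -> peval N1 x != 0 -> same_pt (teval q1 x) (teval q x)].
Proof.
have [D hq] := form_tuple_degree fq; have [cq _] := fq.
have [z [Wz Nz]] := not_vanish nN; have neW : exists x, W x by exists z.
have /choice[v0 v0P] := q_pt Wz Nz.
have bv j : blk (v0 j) = j by have [] := v0P j.
have nv j : ~ vanish W (q (v0 j)) by move/(_ z Wz)/eqP; have [_ /negPf ->] := v0P j.
have [i0 i0P] := u_all 1%g.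
have u0 p : coefs_in C p -> galp (u i0) p = p :> mpol K A.
  by move=> hp; rewrite -(galp_eq hp i0P); apply/mpolyP => m; rewrite galp_coef galact1.
pose P j := \prod_(i <- [seq i <- index_enum I | i != i0]) galp (u i) (q (v0 j)).
have /choice[E hE] : forall j, exists e, multihomog e (P j).
  move=> j; have [||//] := @prime_bigprod A W I [seq i <- index_enum I | i != i0] (fun i => galp (u i) (q (v0 j))) pW neW.
    by move=> i _; eexists; apply: galp_homog.
  by move=> i _ /(vanish_galp gW)/nv.
have cP j : coefs_in C (P j) by apply: coefs_prod => // i _; apply: galp_coefs.
have nE j : normp (q (v0 j)) = q (v0 j) * P j.
  by rewrite /normp (bigD1 i0) //= u0 // /P big_filter.
have gen j : generic_form (in_base iota) W (normp (q (v0 j))).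
  by apply: normp_generic => //; split=> //; eexists; apply: hq.
pose M v := q v * P (blk v).
have hM v : multihomog (fun i => D (blk v) i + E (blk v) i)%N (M v) by apply: multihomogM.
have cM v : coefs_in C (M v) by apply: coefsM.
have Mfix t v : vanish W (galp t (M v) - M v).
  apply: contrapT => nM; have [cn [d hn] nn] := gen (blk v).
  have := pW (multihomogB (galp_homog t (hM v)) (hM v)) hn nM nn.
  apply=> y Wy; rewrite pevalM pevalB mulrBl.
  rewrite -[X in _ - _ * peval X _](galp_base t cn) !nE !galpM !pevalM.
  have := cross_vanish t (bv (blk v)) Wy; rewrite pevalB !pevalM => /eqP; rewrite subr_eq0 => /eqP Ec.
  have -> : forall a b c d e f : K, a * b * (c * d) - e * d * (f * b) = (a * c - f * e) * (b * d).
    by move=> *; ring.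
  by rewrite -Ec subrr mul0r.
have [th Cth th0] := trace_neq0; set tr := \sum_i _ in th0.
exists (fun v => tracep (th *: M v)), (\prod_(j <- index_enum (mfac B)) normp (q (v0 j))); split.
- split=> [v|j]; first by apply: tracep_base; apply: coefsZ.
  exists (fun i => D j i + E j i)%N => v <-.
  by apply: multihomog_sum => i _; apply: galp_homog; apply: multihomogZ.
- have [||hd nd] := @prime_bigprod A W _ (index_enum (mfac B)) (fun j => normp (q (v0 j))) pW neW.
  + by move=> j _; have [] := gen j.
  + by move=> j _; have [] := gen j.
  + split=> //; apply: coefs_prod => [|j _]; last by have [] := gen j.
    by have [] := in_base_subfield iota.
- move=> y Wy; rewrite peval_prod => /prodf_neq0 Hy; apply: same_pt_sym.
  exists (fun j => tr * peval (P j) y); split.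
    by move=> j; have := Hy j isT; rewrite nE pevalM mulf_eq0 negb_or => /andP[_ Pj]; rewrite mulf_neq0.
  apply/funext => v; rewrite /teval /rescale /tracep peval_sum.
  have Ei i : peval (galp (u i) (th *: M v)) y = galact (u i) th * peval (M v) y.
    have /eqP := Mfix (u i) v y Wy; rewrite pevalB subr_eq0 => /eqP <-.
    by rewrite !peval_galp pevalZ galMr.
  by under eq_bigr do rewrite Ei; rewrite -mulr_suml -/tr /M pevalM; ring.
Qed.
End Tuple.

(** Both directions are descended separately. The equivariance of the inverse follows from that of q
    at points whose conjugates all lie in the domain of q, which the norm of h guarantees. *)
Lemma descend_birational A B (W : subpts K A) (Y : subpts K B) q h q' h' :
  prime_set W -> prime_set Y -> gal_stable W -> gal_stable Y ->
  (forall x, W x -> is_point x) -> (forall y, Y y -> is_point y) ->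
  (forall x x', W x -> same_pt x x' -> W x') -> (forall y y', Y y -> same_pt y y' -> Y y') ->
  is_birational_map C W Y q h q' h' ->
  (forall s x, W x -> peval h x != 0 -> peval h (gal_pt s x) != 0 ->
    same_pt (teval q (gal_pt s x)) (gal_pt s (teval q x))) ->
  is_birational (in_base iota) W Y.
Proof.
move=> pW pY gW gY Wp Yp sW sY bir q_gal.
have [[fq fq'] gh gh' FF GG] := bir; have [ch [d hh] nh] := gh; have [ch' [d' hh'] nh'] := gh'.
have nz (a b : K) : (a * b != 0) -> a != 0 /\ b != 0 by rewrite mulf_eq0 negb_or => /andP.
have [x0 [Wx0 _]] := not_vanish nh; have [y0 [Yy0 _]] := not_vanish nh'.
have neW : exists x, W x by exists x0.
have neY : exists y, Y y by exists y0.
have [cn [e hn] nn] := normp_generic pW neW gW gh.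
have [cn' [e' hn'] nn'] := normp_generic pY neY gY gh'.
have h1 x : peval (normp h) x != 0 -> peval h x != 0 by move=> H; apply: (normp_neq0 ch H 1%g).
have h1' y : peval (normp h') y != 0 -> peval h' y != 0 by move=> H; apply: (normp_neq0 ch' H 1%g).
have [q1 [N1 [fq1 g1 s1]]] : exists (q1 : form_tuple K A B) N1, [/\ is_form_tuple (in_base iota) q1,
    generic_form (in_base iota) W N1 & forall x, W x -> peval N1 x != 0 -> same_pt (teval q1 x) (teval q x)].
  apply: (descend_tuple pW gW fq hh nh) q_gal => x Wx hx.
  by apply: Yp; have [] := FF x Wx hx.
have [q2 [N2 [fq2 g2 s2]]] : exists (q2 : form_tuple K B A) N2, [/\ is_form_tuple (in_base iota) q2,
    generic_form (in_base iota) Y N2 & forall y, Y y -> peval N2 y != 0 -> same_pt (teval q2 y) (teval q' y)].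
  have [D' hq'] := form_tuple_degree fq'.
  have hN := multihomogM hh' (multihomog_subst hq' hn).
  apply: (descend_tuple pY gY fq' hN).
  - apply: (pY _ _ _ _ hh' (multihomog_subst hq' hn)) => //.
    exact: (birational_pull (birational_sym bir) pW hn nn).
  - by move=> y Yy; rewrite pevalM => /nz[hy _]; apply: Wp; have [] := GG y Yy hy.
  - move=> s y Yy; rewrite pevalM peval_subst => /nz[hy nx] _.
    have [Wx hx sy] := GG y Yy hy; set x := teval q' y in nx Wx hx sy *.
    have hsx := normp_neq0 ch nx s.
    have [_ _ ss] := FF _ (gW s x Wx) hsx.
    have E : same_pt (teval q (gal_pt s x)) (gal_pt s y).
      by apply: same_pt_trans (q_gal s x Wx hx hsx) _; apply: gal_pt_same.
    exact: same_pt_trans (same_pt_sym (teval_same fq' E)) ss.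
have [c1 [d1 hN1] nN1] := g1; have [c2 [d2 hN2] nN2] := g2.
have sB : subring_pred (in_base iota) by have [] := in_base_subfield iota.
have [D1 hq1] := form_tuple_degree fq1; have [D2 hq2] := form_tuple_degree fq2.
exists q1; eexists; exists q2; eexists.
apply: (@generic_birational K (in_base iota) A B W Y q1 (N1 * normp h * subst q1 N2) q2 (N2 * normp h' * subst q2 N1)) => //.
- split.
  + by apply: coefsM => //; [apply: coefsM|apply: coefs_subst => //; case: fq1].
  + by eexists; apply: multihomogM (multihomogM hN1 hn) (multihomog_subst hq1 hN2).
  + apply: (pW _ _ _ _ (multihomogM hN1 hn) (multihomog_subst hq1 hN2)); first exact: (pW _ _ _ _ hN1 hn).
    have np := birational_pull bir pY hN2 nN2; have [D hq] := form_tuple_degree fq.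
    have [x [Wx]] := not_vanish (pW _ _ _ _ hN1 (multihomog_subst hq hN2) nN1 np).
    rewrite pevalM peval_subst => /nz[N1x N2x] /(_ x Wx)/eqP.
    by rewrite peval_subst -(multihomog_same hN2 (s1 x Wx N1x)) (negPf N2x).
- split.
  + by apply: coefsM => //; [apply: coefsM|apply: coefs_subst => //; case: fq2].
  + by eexists; apply: multihomogM (multihomogM hN2 hn') (multihomog_subst hq2 hN1).
  + apply: (pY _ _ _ _ (multihomogM hN2 hn') (multihomog_subst hq2 hN1)); first exact: (pY _ _ _ _ hN2 hn').
    have np := birational_pull (birational_sym bir) pW hN1 nN1; have [D hq] := form_tuple_degree fq'.
    have [x [Wx]] := not_vanish (pY _ _ _ _ hN2 (multihomog_subst hq hN1) nN2 np).
    rewrite pevalM peval_subst => /nz[N1x N2x] /(_ x Wx)/eqP.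
    by rewrite peval_subst -(multihomog_same hN1 (s2 x Wx N1x)) (negPf N2x).
- move=> x Wx; rewrite pevalM pevalM peval_subst => /nz[/nz[N1x /h1 hx] N2x].
  have [Yx h'x sx] := FF x Wx hx; have sq := s1 x Wx N1x.
  have Y1 : Y (teval q1 x) by apply: sY Yx (same_pt_sym sq).
  split=> //; apply: same_pt_trans (s2 _ Y1 N2x) _.
  exact: same_pt_trans (teval_same fq' sq) sx.
- move=> x Wx; rewrite pevalM pevalM peval_subst => /nz[/nz[N1x /h1' hx] N2x].
  have [Yx h'x sx] := GG x Wx hx; have sq := s2 x Wx N1x.
  have Y1 : W (teval q2 x) by apply: sW Yx (same_pt_sym sq).
  split=> //; apply: same_pt_trans (s1 _ Y1 N2x) _.
  exact: same_pt_trans (teval_same fq sq) sx.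
Qed.
End Descent.

(** * Linear changes of the affine coordinates *)

Section LinearChange.
Variables (K : closedFieldType) (n : nat).
Local Notation PN := (Pspace n.+1).
Implicit Types (B : 'M[K]_n) (y : pts K PN).

Definition linear_change B : form_tuple K PN PN := fun v : mvar PN =>
  if unlift (ord0 : 'I_n.+1) v is Some k then \sum_i B k i *: @var K PN (fintype.lift ord0 i) else @var K PN ord0.

Lemma linear_changeE B y (v : 'I_n.+1) : teval (linear_change B) y v =
  if unlift ord0 v is Some k then \sum_i B k i * y (fintype.lift ord0 i) else y ord0.
Proof.
rewrite /teval /linear_change; case: unlift => [k|]; last by rewrite pevalV.
by rewrite peval_sum; apply: eq_bigr => i _; rewrite pevalZ pevalV.
Qed.

Lemma linear_change_form (C : K -> Prop) B : subring_pred C -> (forall i j, C (B i j)) ->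
  is_form_tuple C (linear_change B).
Proof.
move=> sC CB; split=> [v|t].
  rewrite /linear_change; case: unlift => [k|]; last exact: coefs_var.
  by apply: coefs_sum => // i _; apply: coefsZ => //; apply: coefs_var.
exists (fun=> 1%N) => v _.
have hv (w : mvar PN) : multihomog (fun=> 1%N) (@var K PN w).
  by apply: multihomog_ext (@multihomog_var K PN _) => -[].
rewrite /linear_change; case: unlift => [k|//].
by apply: multihomog_sum => i _; apply: multihomogZ.
Qed.

Lemma linear_changeM B B' y : teval (linear_change B) (teval (linear_change B') y) = teval (linear_change (B *m B')) y.
Proof.
apply/funext => v; rewrite !linear_changeE; case: unlift => [k|]; last by rewrite unlift_none.
under eq_bigr do rewrite linear_changeE liftK mulr_sumr.
rewrite exchange_big; apply: eq_bigr => i _; rewrite mxE mulr_suml; apply: eq_bigr => j _.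
by rewrite mulrA.
Qed.

Lemma linear_change1 y : teval (linear_change 1%:M) y = y.
Proof.
apply/funext => v; rewrite linear_changeE; case: unliftP => [k ->|-> //].
rewrite (bigD1 k) //= mxE eqxx mul1r big1 ?addr0 // => i ik.
by rewrite mxE eq_sym (negPf ik) mul0r.
Qed.

Lemma linear_change_whole B y : B \in unitmx -> whole y -> whole (teval (linear_change B) y).
Proof.
move=> uB yp [] ; have [v [_ yv]] := yp tt; apply: contrapT => H; move/eqP: yv; apply.
have z0 w : teval (linear_change B) y w = 0 by apply/eqP; apply: contraT => ne; case: H; exists w.
rewrite -[y]linear_change1 -(mulVmx uB) -linear_changeM linear_changeE.
by case: unlift => [k|]; rewrite ?z0 // big1 // => i _; rewrite z0 mulr0.
Qed.

Lemma linear_birational (C : K -> Prop) B : subring_pred C -> B \in unitmx -> (forall i j, C (B i j)) ->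
  (forall i j, C (invmx B i j)) ->
  is_birational_map C (@whole K n.+1) (@whole K n.+1) (linear_change B) 1 (linear_change (invmx B)) 1.
Proof.
move=> sC uB CB CV.
have g1 : generic_form C (@whole K n.+1) 1.
  split; [exact: coefs1|by exists (fun=> 0%N); apply: multihomog1|].
  move/(_ (fun=> 1)); rewrite peval1 => H; have /eqP := oner_neq0 K; apply; apply: H.
  by case; exists ord0; split=> //; apply: oner_neq0.
split=> //; first by split; apply: linear_change_form.
- move=> y yp _; rewrite peval1 oner_neq0; split=> //; first exact: linear_change_whole.
  by rewrite linear_changeM mulVmx // linear_change1; apply: same_ptxx.
- move=> y yp _; rewrite peval1 oner_neq0; split=> //; first by apply: linear_change_whole; rewrite ?unitmx_inv.
  by rewrite linear_changeM mulmxV // linear_change1; apply: same_ptxx.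
Qed.
End LinearChange.

(** * Trivialization of a twisted permutation module *)

Section TwistedBasis.
Variables (F : fieldType) (K : closedFieldType) (iota : {rmorphism F -> K}).
Hypothesis alg : is_algebraic_closure iota.
Variables (S : seq K) (I : finType) (u : I -> absGal iota).
Hypothesis galS : galois_list iota S.
Hypothesis u_all : forall t : absGal iota, exists i, {in S, galact t =1 galact (u i)}.
Hypothesis u_inj : forall i j, {in S, galact (u i) =1 galact (u j)} -> i = j.
Local Notation C := (gen iota S).
Variables (n : nat) (rho : absGal iota -> 'S_n).
Hypothesis rhoM : {morph rho : s t / (s * t)%g >-> (s * t)%g}.
Hypothesis rho_triv : forall s, {in S, galact s =1 id} -> rho s = 1%g.
Let sC : subring_pred C := gen_subring iota S.

Lemma subfield_invmx (D : K -> Prop) m (B : 'M[K]_m) : subfield_pred iota D -> (forall i j, D (B i j)) ->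
  forall i j, D (invmx B i j).
Proof.
move=> sD DB; have [rD _] := sD.
have det_in k (M : 'M[K]_k) : (forall i j, D (M i j)) -> D (\det M).
  move=> DM; apply: subring_sum => // s _; apply: subringM => //.
    by apply: subringX => //; apply: subringN => //; apply: subring1.
  by apply: subring_prod.
move=> i j; rewrite /invmx; case: ifP => // _; rewrite !mxE.
apply: subringM => //; first by apply: (subfieldV alg sD); apply: det_in.
apply: subringM => //; first by apply: subringX => //; apply: subringN => //; apply: subring1.
by apply: det_in => i' j'; rewrite !mxE.
Qed.

Lemma rho_eq s t : {in S, galact s =1 galact t} -> rho s = rho t.
Proof.
move=> st; have E : rho (s * t^-1)%g = 1%g.
  by apply: rho_triv => x Sx; rewrite galactM st // galactK.
by rewrite -[s](mulgKV t) rhoM E mul1g.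
Qed.

Lemma rho1 : rho 1%g = 1%g.
Proof. by apply: rho_triv => x _; rewrite galact1. Qed.

(** The i-th coordinate of the trace of a times the basis vector [i0], for the Galois action on
    n-tuples that also permutes the basis vectors by rho. *)
Definition twisted_row (i0 : 'I_n) (a : K) (i : 'I_n) : K := \sum_(f | rho (u f) i0 == i) galact (u f) a.

Lemma twisted_row_gal t i0 a i : C a -> galact t (twisted_row i0 a i) = twisted_row i0 a (rho t i).
Proof.
move=> Ca; have [pi ipi piP] := translate u_all u_inj t.
rewrite /twisted_row gal_sum [RHS](reindex_inj ipi) /=; apply: eq_big => f.
  by rewrite -(rho_eq (piP f)) rhoM permM (inj_eq perm_inj).
by move=> _; rewrite -galactM; apply: gen_eq (piP f) Ca.
Qed.

(** A linear form c vanishing on these vectors gives, for each basis vector, a relation between the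
    automorphisms [u f] at all monomials. By independence its coefficients [c (rho (u f) i1)] are 0,
    and the representative of the identity gives [c i1 = 0]. *)
Lemma twisted_row_span (c : 'I_n -> K) : (forall i0 e, \sum_i c i * twisted_row i0 (mon (S := S) (I := I) e) i = 0) ->
  forall i, c i = 0.
Proof.
move=> H i1; apply/eqP; apply: contraT => ne; have [f1 f1P] := u_all 1%g.
have E : c (rho (u f1) i1) != 0 by rewrite -(rho_eq f1P) rho1 perm1.
have [e] := galois_interpolation u_inj (c := fun f => c (rho (u f) i1)) E.
case/eqP; rewrite -[RHS](H i1 e) (partition_big (fun f => rho (u f) i1) xpredT) //=.
apply: eq_bigr => i _; rewrite /twisted_row mulr_sumr.
by apply: eq_bigr => f /eqP ->.
Qed.

Lemma twisted_basis : exists B : 'M[K]_n, [/\ B \in unitmx, forall i j, C (B i j) &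
  forall s j i, galact s (B j i) = B j (rho s i)].
Proof.
pose J := ('I_n * {ffun 'I_(size S) -> 'I_#|I|.+1})%type.
pose M : 'M[K]_(#|{: J}|, n) := \matrix_(k, i) twisted_row (enum_val k).1 (mon (enum_val k).2) i.
have fullM : row_full M.
  rewrite /row_full -mxrank_tr -/(row_free M^T) -kermx_eq0; apply/eqP/row_matrixP => k.
  have /sub_kermxP kM : (row k (kermx M^T) <= kermx M^T)%MS by apply: row_sub.
  rewrite row0; apply/rowP => i; rewrite [RHS]mxE.
  apply: (twisted_row_span (c := fun i => row k (kermx M^T) 0 i)) => i0 e.
  have := congr1 (fun N : 'M[K]_(1, _) => N 0 (enum_rank (i0, e))) kM; rewrite [RHS]mxE => E.
  rewrite -[RHS]E [RHS]mxE; apply: eq_bigr => j _; congr (_ * _).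
  by rewrite !mxE enum_rankK.
exists (rowsub (fullrankfun fullM) M); split.
- exact: fullrowsub_unit.
- move=> i j; rewrite !mxE; apply: subring_sum => // f _.
  by apply: gen_stable; [move=> x; apply: galS|apply: mon_gen].
- by move=> s j i; rewrite !mxE; apply: twisted_row_gal; apply: mon_gen.
Qed.
End TwistedBasis.

(** * Stable rationality of forms *)

Section PartB.
Variables (F : fieldType) (K : closedFieldType) (iota : {rmorphism F -> K}).
Hypothesis alg : is_algebraic_closure iota.
Variable n : nat.
Hypothesis n_ge5 : (5 <= n)%N.
Implicit Types (A B : mproj) (s : absGal iota).

Lemma teval_gal A B (q : form_tuple K A B) s x : (forall v, galp s (q v) = q v) ->
  teval q (gal_pt s x) = gal_pt s (teval q x).
Proof. by move=> fq; apply/funext => v; rewrite /teval -{1}fq peval_gal. Qed.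

Lemma teval_gal_base A B (q : form_tuple K A B) s x : is_form_tuple (in_base iota) q ->
  teval q (gal_pt s x) = gal_pt s (teval q x).
Proof. by move=> [cq _]; apply: teval_gal => v; apply: galp_base. Qed.

Lemma cr_gal s (w : pts K (P1n n)) : cr (gal_pt s w) = gal_pt s (cr w).
Proof.
apply/funext => -[t e]; rewrite /gal_pt !crE /br.
by case: e; rewrite galMr !galB !galMr.
Qed.

Lemma Sn_act_same (g : 'S_n) (x y : pts K (quadP1 n)) : same_pt x y -> same_pt (Sn_act g x) (Sn_act g y).
Proof.
by move=> [l [l0 ->]]; exists (fun t => l (quad_perm g^-1%g t)).
Qed.

Lemma free_orbit_same (g : 'S_n) (w : pts K (P1n n)) : free_orbit w -> same_pt (cr w) (Sn_act g (cr w)) -> g = 1%g.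
Proof.
move=> fw [l [_ E]]; apply/eqP; apply: contraT => g1.
have [|q] := fw g^-1%g; first by rewrite eq_invg1.
rewrite cr_relab invgK E /rescale /= => /eqP[].
by ring.
Qed.

Lemma free_orbit_gal s (w : pts K (P1n n)) : free_orbit w -> free_orbit (gal_pt s w).
Proof.
move=> fw g g1; have [q qP] := fw g g1; exists q.
rewrite (_ : relab g (gal_pt s w) = gal_pt s (relab g w)) // !cr_gal /gal_pt -!galMr.
by rewrite (inj_eq (can_inj (galactK s))).
Qed.

(** The polynomials cutting out X are combinations of polynomials over F vanishing on X, and those
    vanish at conjugate points. *)
Lemma defined_stable A (X : subpts K A) : closed_set X -> defined_over_base iota X -> gal_stable iota X.
Proof.
move=> [E [hE XE]] dX s x Xx; have /XE[xp xE] := Xx; apply/XE; split; first exact: gal_pt_point.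
move=> p Ep; have [|k [c [g [gP ->]]]] := dX p; first by move=> y /XE[_]; apply.
rewrite peval_sum big1 // => i _; have [ci vi] := gP i.
by rewrite pevalZ -(galp_base s ci) peval_gal vi // gal0 mulr0.
Qed.

Lemma form_tuple_coefs (C : K -> Prop) A B (q : form_tuple K A B) : is_form_tuple C q ->
  exists L : seq K, (forall x, x \in L -> C x) /\ forall v m, (q v)@_m != 0 -> (q v)@_m \in L.
Proof.
move=> [cq _]; exists (flatten [seq [seq (q v)@_m | m <- msupp (q v)] | v <- enum (mvar B)]); split.
  by move=> x /flattenP[_ /mapP[v _ ->] /mapP[m _ ->]]; apply: cq.
move=> v m ne; apply/flattenP; exists [seq (q v)@_m | m <- msupp (q v)].
  by apply/mapP; exists v => //; rewrite mem_enum.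
by apply/mapP; exists m => //; rewrite mcoeff_msupp.
Qed.

(** The composite X x P^3 -> Mbar x P^3 -> P^n -> P^n has coefficients in the finite extension
    generated by S, the last map being given by the matrix of [twisted_basis]; it commutes with the
    Galois action and so descends. *)
Lemma odd_stably_rational A (X : subpts K A) (rho : absGal iota -> 'S_n) (O : {set 'I_n}) :
  projective_variety_over_base iota X -> {morph rho : s t / (s * t)%g >-> (s * t)%g} -> is_twist rho X ->
  odd #|O| -> (forall s i, (rho s i \in O) = (i \in O)) -> stably_rational iota X.
Proof.
move=> [[cX iX] dX] rhoM [psi iso psi_gal] oO rhoO.
have [T [kp [D [w0 tauP]]]] := tau_exists K n_ge5 oO; have [_ _ _ _ [hw0 fw0 _]] := tauP.
have [a [b [c [ab ac bc]]]] := three_labels n_ge5.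
have cM := @closed_Mbar K n; have My0 : Mbar (cr w0).
  by apply: cr_Mbar => t; exists (t, true); split=> //; apply: cr_point hw0 _.
have [q [q' [x0 [[fq0 fq0' Xx0 qx0 s0] [q_psi bir]]]]] := isomorphism_local cX cM iso My0.
have [L [sL cL]] := form_tuple_coefs fq0; have [L' [sL' cL']] := form_tuple_coefs fq0'.
have [S [sepS galS sub]] : exists S, [/\ separable_list iota S, galois_list iota S & {subset L ++ L' <= S}].
  by apply: stable_closure => x; rewrite mem_cat => /orP[/sL|/sL'].
have sC := gen_subring iota S.
have genS (p : K) : (p != 0 -> p \in L ++ L') -> gen iota S p.
  by have [-> _|p0 H] := eqVneq p 0; [exact: subring0|apply: gen_mem; apply: sub; apply: H].
have fq : is_form_tuple (gen iota S) q.
  by have [_ hq] := fq0; split=> // v m; apply: genS => /cL; rewrite mem_cat => ->.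
have fq' : is_form_tuple (gen iota S) q'.
  by have [_ hq] := fq0'; split=> // v m; apply: genS => /cL'; rewrite mem_cat orbC => ->.
have [h [h' [b1 h_pt]]] := bir _ sC fq fq'.
have gX : gal_stable iota X by apply: defined_stable.
have [I [u [u_all u_inj]]] := galois_reps galS.
have q_gal s x : X x -> is_point (teval q x) -> is_point (teval q (gal_pt s x)) ->
    same_pt (teval q (gal_pt s x)) (Sn_act (rho s) (gal_pt s (teval q x))).
  move=> Xx qx qsx; apply: same_pt_trans (q_psi _ (gX s x Xx) qsx) _.
  apply: same_pt_trans (psi_gal s x Xx) _; apply: Sn_act_same; apply: gal_pt_same.
  exact/same_pt_sym/q_psi.
(* The formula q has coefficients in the field generated by S, so an automorphism trivial on S
   commutes with it at [x0]; as [x0] goes to a point with free orbit, its permutation is trivial. *)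
have rho_triv s : {in S, galact s =1 id} -> rho s = 1%g.
  move=> sS; apply: (free_orbit_same (free_orbit_gal s fw0)); rewrite cr_gal.
  have E : teval q (gal_pt s x0) = gal_pt s (teval q x0).
    apply: teval_gal => v; have [cq _] := fq; apply/mpolyP => m; rewrite galp_coef.
    by rewrite (gen_eq (t := 1%g) _ (cq v m)).
  have qsx : is_point (teval q (gal_pt s x0)) by rewrite E; apply: gal_pt_point.
  apply: same_pt_trans (same_pt_sym (gal_pt_same s s0)) _; rewrite -E.
  apply: same_pt_trans (q_gal s x0 Xx0 qx0 qsx) _.
  by apply: Sn_act_same; apply: gal_pt_same.
have [M [uM CM Mgal]] := twisted_basis galS u_all u_inj rhoM rho_triv.
have sB := in_base_subfield iota; have [rB _] := sB.
have b2 := birational_prod 3 sC b1.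
have b3 := mapA_birational n_ge5 tauP ab ac bc sC.
have b4 := linear_birational sC uM CM (subfield_invmx alg (gen_subfield iota S) CM).
have pX : prime_set X by apply: irreducible_prime => // x; apply: closed_point cX.
have pM : prime_set (@Mbar n K) by apply: irreducible_prime; [exact: Mbar_irreducible|move=> x; apply: Mbar_point].
have pXP := prime_prod (r := 3) pX; have pMP := prime_prod (r := 3) pM.
have [h23 [h23' [b23 h23P]]] := birational_comp sC pXP pMP (prime_whole (r := n)) b2 b3.
have [hh [hh' [b234 hhP]]] := birational_comp sC pXP (prime_whole (r := n)) (prime_whole (r := n)) b23 b4.
(* Both numbers are dimensions; the spaces have 4 and n + 1 homogeneous coordinates. *)
exists 3, n.
apply: (descend_birational alg sepS galS u_all u_inj pXP (prime_whole (r := n)) _ _ _ _ _ _ b234).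
- by move=> s z [Xz wz]; split; [apply: (gX s _ Xz)|apply: (gal_pt_point s wz)].
- by move=> s y yp; apply: gal_pt_point.
- move=> z [Xz wz] [i|i].
    by have [v [vi zv]] := closed_point cX Xz i; exists (inl v); split=> //=; rewrite vi.
  by case: i; have [v [_ zv]] := wz tt; exists (inr v).
- by [].
- move=> z z' [Xz wz] [l [l0 ->]]; split.
    by apply: (closed_same cX _ Xz); exists (fun i => l (inl i)).
  by apply: (same_pt_is_point _ wz); exists (fun i => l (inr i)).
- by move=> y y' yp yy'; apply: same_pt_is_point yy' yp.
move=> s z [Xz wz] hz hsz; rewrite !teval_comp.
have [h2z _] := hhP _ hz; have [h2sz _] := hhP _ hsz.
have [h1z Nz] := h23P _ h2z; have [h1sz Nsz] := h23P _ h2sz.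
have qz : is_point (teval q (fun v => z (inl v))).
  by apply: h_pt; move: h1z; rewrite peval_subst inl_tupleE.
have qsz : is_point (teval q (gal_pt s (fun v => z (inl v)))).
  by apply: h_pt; move: h1sz; rewrite peval_subst inl_tupleE.
pose x := fun v => z (inl v); have Xx : X x := Xz.
have hx : peval h x != 0 by move: h1z; rewrite peval_subst inl_tupleE.
have hsx : peval h (gal_pt s x) != 0 by move: h1sz; rewrite peval_subst inl_tupleE.
have [_ _ _ FF _] := b1.
have [Mq _ _] := FF _ Xx hx; have [Msq _ _] := FF _ (gX s x Xx) hsx.
have sq := q_gal s x Xx qz qsz.
have Mqs : Mbar (gal_pt s (teval q x)).
  by rewrite -(Sn_actK (rho s) (gal_pt s _)); apply: Sn_act_Mbar; apply: closed_same cM sq Msq.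
set Z := teval (prod_tuple q) z in Nz *; set Z' := teval (prod_tuple q) (gal_pt s z) in Nsz *.
have ZE : Z = pair_pt (teval q x) (fun v => z (inr v)) by rewrite /Z prod_tupleE.
have ZE' : Z' = pair_pt (teval q (gal_pt s x)) (fun v => galact s (z (inr v))) by rewrite /Z' prod_tupleE.
have NZ : peval (NA T a b c) Z != 0 by move: Nz; rewrite pevalM mulf_eq0 negb_or => /andP[].
have NZ' : peval (NA T a b c) Z' != 0 by move: Nsz; rewrite pevalM mulf_eq0 negb_or => /andP[].
(* The form [NA] has coefficients in F, so its nonvanishing is preserved by conjugation. *)
have NsZ : peval (NA T a b c) (gal_pt s Z) != 0.
  have [cN _ _] := NA_generic n_ge5 tauP ab ac bc rB.
  by rewrite -(galp_base s cN) peval_gal gal_eq0.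
have E : same_pt (permY (rho s) (teval (qA T a b c) (gal_pt s Z))) (teval (qA T a b c) Z').
  apply: (qA_equivariant tauP ab ac bc (rhoO s)) NsZ NZ' _ _.
  - by rewrite ZE.
  - by rewrite ZE'.
  - by rewrite ZE ZE'; apply: same_pt_sym.
  - by move=> v; rewrite ZE ZE'.
have fM : is_form_tuple (gen iota S) (linear_change M) by apply: linear_change_form.
apply: same_pt_trans (same_pt_sym (teval_same fM E)) _.
rewrite (teval_gal_base s Z (qA_form tauP a b c rB)).
move: (teval (qA T a b c) Z) => y.
(* Applying s to an entry of M moves its column by [rho s], which undoes the permutation of
   coordinates. *)
suff -> : teval (linear_change M) (permY (rho s) (gal_pt s y)) = gal_pt s (teval (linear_change M) y) by apply: same_ptxx.
apply/funext => v; rewrite /gal_pt !linear_changeE /permY; case: unlift => [k|]; last by rewrite unlift_none.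
rewrite gal_sum [LHS](reindex_inj (@perm_inj _ (rho s))); apply: eq_bigr => i _.
by rewrite galMr Mgal liftK permK.
Qed.
End PartB.

Theorem theorem23 (n : nat) (hn : (5 <= n)%N) :
  (forall (K : closedFieldType) (G : {group 'S_n}),
     @is_stably_permutation_module (subg_of G) (@Qmod n K)
       (fun g => @Qmod_act n K (sgval g)) ->
     stably_linearizable G (@Mbar n K) (@Sn_act n K))
  /\
  (forall (F : fieldType) (K : closedFieldType) (iota : {rmorphism F -> K}),
     is_algebraic_closure iota ->
     forall (A : mproj) (X : subpts K A) (rho : absGal iota -> 'S_n),
       projective_variety_over_base iota X ->
       {morph rho : s t / (s * t)%g >-> (s * t)%g} ->
       is_twist rho X ->
       @is_stably_permutation_module (absGal iota) (@Qmod n K)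
         (fun s => @Qmod_act n K (rho s)) ->
       stably_rational iota X).
Proof.
split=> [K G stab|F K iota alg A X rho varX rhoM twX stab].
  have [|O [oO GO]] := odd_stable_set hn (r := fun g : subg_of G => sgval g) _ stab.
    by move=> g h.
  apply: (odd_linearizable K hn oO) => g gG i.
  by have := GO (subg G g) i; rewrite subgK.
have [O [oO rhoO]] := odd_stable_set hn rhoM stab.
exact: (odd_stably_rational alg hn varX rhoM twX oO rhoO).
Qed.
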